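(* Let $M\in\mathbb N$. Let $\varepsilon\neq0$ and let $\mathbf u\in H^2(\mathbb R)\oplus H^2_{\rm per}(0,T)$ be a primary pulse solution (as described in the context) of $A_\varepsilon\mathbf u+\mathcal N_\varepsilon(\mathbf u,\cdot)=0$. Then there exists $N\in\mathbb N$ such that for any $n\in\mathbb N$ with $n\ge N$ there exists a nondegenerate solution $\tilde{\mathbf u}_n$ of $A_\varepsilon\mathbf u+\mathcal N_\varepsilon(\mathbf u,\cdot)=0$ of the form $$\tilde{\mathbf u}_n=\mathbf a_n+\sum_{j=1}^M\chi_{j,n}\,\mathbf u(\cdot-jnT),$$ where $\{\mathbf a_n\}_n$ is a sequence in $H^2(\mathbb R)$ converging to $0$ as $n\to\infty$. If $\mathbf u$ is strongly spectrally stable, then so is $\tilde{\mathbf u}_n$. Moreover, if $\mathbf u$ is spectrally unstable, then so is $\tilde{\mathbf u}_n$.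
   Context: Let $T,d,a,m>0$, $f\in C^1(\mathbb R)$ real-valued, $T$-periodic and odd, $g\in C^1(\mathbb R)$ real-valued, $T$-periodic and even. Klausmeier system for $\mathbf u=(w,p)^\top\in\mathbb R^2$: $\partial_t\mathbf u=A_\varepsilon\mathbf u+\mathcal N_\varepsilon(\mathbf u,x)$ with $$A_\varepsilon=\begin{pmatrix}\partial_x^2+\varepsilon f\partial_x&0\\0&d^2\partial_x^2\end{pmatrix},\qquad\mathcal N_\varepsilon\Big(\begin{pmatrix}w\\ p\end{pmatrix},x\Big)=\begin{pmatrix}\varepsilon g(x)w-w-wp^2+a\\-mp+wp^2\end{pmatrix}.$$ For $\underline{\mathbf u}\in L^\infty(\mathbb R,\mathbb R^2)$, $L_\varepsilon(\underline{\mathbf u})=A_\varepsilon+\partial_{\mathbf u}\mathcal N_\varepsilon(\underline{\mathbf u},\cdot)$ on (complex $2$-vector-valued) $L^2(\mathbb R)$ with domain $H^2(\mathbb R)$. $\underline{\mathbf u}$ is: nondegenerate if $L_\varepsilon(\underline{\mathbf u})$ is invertible; strongly spectrally stable if $\sigma(L_\varepsilon(\underline{\mathbf u}))\subset\{\operatorname{Re}\lambda\le-\varrho\}$ for some $\varrho>0$; spectrally unstable if some $\lambda\in\sigma(L_\varepsilon(\underline{\mathbf u}))$ has $\operatorname{Re}\lambda>0$; spectrally stable with simple eigenvalue $0$ if $\sigma(L_\varepsilon(\underline{\mathbf u}))\subset\{\operatorname{Re}\lambda\le-\varrho\}\cup\{0\}$ for some $\varrho>0$ and $0$ is an eigenvalue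 of algebraic multiplicity one. $H^2_{\rm per}(0,T)$: $T$-periodic, locally $H^2$ functions. Primary pulses. Let $\mathbf u_0=\mathbf z_0+\mathbf v_0\in H^2(\mathbb R)\oplus\mathbb R^2$ be an even solution of $A_0\mathbf u+\mathcal N_0(\mathbf u,\cdot)=0$, spectrally stable with simple eigenvalue $0$, such that $\mathcal M=\int_{\mathbb R}(f'\partial_x\mathbf u_{01}+g'\mathbf u_{01})\Psi_{{\rm ad}1}\,dx\ne0$, where $\Psi_{\rm ad}\in H^2(\mathbb R)$ spans $\ker L_0(\mathbf u_0)^*$ with $\langle\partial_x\mathbf u_0,\Psi_{\rm ad}\rangle_{L^2}=1$ (subscript $1$: first component). Then there are $C,\varepsilon_0,\eta>0$ such that for $0<|\varepsilon|<\varepsilon_0$ there is a nondegenerate even solution $\mathbf u(\varepsilon)=\mathbf z(\varepsilon)+\mathbf v(\varepsilon)\in H^2(\mathbb R)\oplus H^2_{\rm per}(0,T)$ of $A_\varepsilon\mathbf u+\mathcal N_\varepsilon(\mathbf u,\cdot)=0$ with $\|\mathbf u(\varepsilon)-\mathbf u_0\|_{L^\infty}\le C|\varepsilon|$, $\|\mathbf v(\varepsilon)-\mathbf v_0\|_{H^2_{\rm per}(0,T)}\le C|\varepsilon|$ and $\sigma(L_\varepsilon(\mathbf u(\varepsilon)))\subset\{\operatorname{Re}\lambda\le-\eta\}\cup\{\lambda_0(\varepsilon)\}$, $\lambda_0(\varepsilon)=-\varepsilon\mathcal M+\mathcal O(\varepsilon^2)$ being a real simple eigenvalue. A primary pulse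 is such a $\mathbf u(\varepsilon)$. For $M\ge2$ and (sufficiently large) $n$, $\chi_{j,n}:\mathbb R\to[0,1]$, $j=1,\dots,M$, is a smooth partition of unity with $\|\chi_{j,n}\|_{W^{2,\infty}}$ bounded by an $n$-independent constant, $\chi_{1,n}$ supported on $(-\infty,\frac32nT+1)$, $\chi_{M,n}$ on $((M-\frac12)nT-1,\infty)$, and $\chi_{j,n}$ on $((j-\frac12)nT-1,(j+\frac12)nT+1)$ for $2\le j\le M-1$; for $M=1$, $\chi_{1,n}\equiv1$. *)

(* Defs.v *)
From HB Require Import structures.
From mathcomp Require Export all_boot all_order all_algebra.
From mathcomp Require Export all_classical all_reals all_analysis.
From mathcomp Require Export complex.
Set Implicit Arguments.
Unset Strict Implicit.
Unset Printing Implicit Defensive.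
Import Order.TTheory GRing.Theory Num.Theory.
Export numFieldNormedType.Exports.
Local Open Scope classical_set_scope.
Local Open Scope ring_scope.

(* Elements of Lebesgue and Sobolev spaces are represented by functions, and
   identities between them are required almost everywhere. *)

Section Sobolev.
Context {R : realType}.
Local Notation mu := (@lebesgue_measure R).
Implicit Types (phi f v : R -> R).

Definition smooth phi : Prop := forall k x, derivable (derive1n k phi) x 1.

Definition test_function phi : Prop :=
  smooth phi /\ exists a b : R, forall x, x \notin `[a, b] -> phi x = 0.

Definition is_wderiv f v : Prop :=
  [/\ locally_integrable setT f, locally_integrable setT v &
      forall phi, test_function phi ->
        \int[mu]_x (f x * derive1 phi x) = - \int[mu]_x (v x * phi x)].

Definition wderivable f : Prop := exists v, is_wderiv f v.

(* A representative of the weak derivative of [f], which is unique up to a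
   null set when it exists; it is the zero function otherwise. *)
Definition wderiv f : R -> R := xget (fun=> 0) [set v | is_wderiv f v].

Definition L2 f : Prop := f \in Lfun mu 2%:E.

Definition L2loc f : Prop :=
  measurable_fun setT f /\ locally_integrable setT (fun x => f x ^+ 2).

Definition H2 f : Prop :=
  [/\ L2 f, wderivable f, L2 (wderiv f), wderivable (wderiv f) &
      L2 (wderiv (wderiv f))].

Definition H2loc f : Prop :=
  [/\ L2loc f, wderivable f, L2loc (wderiv f), wderivable (wderiv f) &
      L2loc (wderiv (wderiv f))].

End Sobolev.

Section VectorSpaces.
Context {R : realType}.
Local Notation mu := (@lebesgue_measure R).
Implicit Types (u : R -> R * R) (h : R -> R[i]) (z y : R -> R[i] * R[i]).

Definition fst_fun {S : Type} (u : R -> S * S) : R -> S := fun x => (u x).1.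
Definition snd_fun {S : Type} (u : R -> S * S) : R -> S := fun x => (u x).2.

Definition enorm2 (q : R * R) : R := Num.sqrt (q.1 ^+ 2 + q.2 ^+ 2).

Definition vwderiv u : R -> R * R :=
  fun x => (wderiv (fst_fun u) x, wderiv (snd_fun u) x).

Definition H2v u : Prop := H2 (fst_fun u) /\ H2 (snd_fun u).
Definition H2vloc u : Prop := H2loc (fst_fun u) /\ H2loc (snd_fun u).
Definition H2per (T : R) u : Prop := periodic u T /\ H2vloc u.

Definition H2density u : R -> R := fun x => Num.sqrt (enorm2 (u x) ^+ 2 +
  enorm2 (vwderiv u x) ^+ 2 + enorm2 (vwderiv (vwderiv u) x) ^+ 2).

Definition H2norm u : \bar R := 'N[mu]_2%:E[EFin \o H2density u]%E.

Definition H2per_norm (T : R) u : \bar R :=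
  let D : set R := [set` `[0, T]] in
  'N[mu]_2%:E[EFin \o (H2density u \_ D)]%E.

Definition Linfnorm u : \bar R := 'N[mu]_+oo[EFin \o (enorm2 \o u)]%E.

Definition re_fun h : R -> R := fun x => complex.Re (h x).
Definition im_fun h : R -> R := fun x => complex.Im (h x).

Definition cwderiv h : R -> R[i] :=
  fun x => (wderiv (re_fun h) x +i* wderiv (im_fun h) x)%C.

Definition cintegral h : R[i] :=
  ((\int[mu]_x re_fun h x) +i* (\int[mu]_x im_fun h x))%C.

Definition L2c z : Prop :=
  [/\ L2 (re_fun (fst_fun z)), L2 (im_fun (fst_fun z)),
      L2 (re_fun (snd_fun z)) & L2 (im_fun (snd_fun z))].

Definition H2c z : Prop :=
  [/\ H2 (re_fun (fst_fun z)), H2 (im_fun (fst_fun z)),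
      H2 (re_fun (snd_fun z)) & H2 (im_fun (snd_fun z))].

Definition L2norm z : \bar R :=
  'N[mu]_2%:E[EFin \o (fun x => Num.sqrt (
    complex.Re (z x).1 ^+ 2 + complex.Im (z x).1 ^+ 2 +
    complex.Re (z x).2 ^+ 2 + complex.Im (z x).2 ^+ 2))]%E.

Definition inner z y : R[i] :=
  cintegral (fun x => (z x).1 * conjc (y x).1 + (z x).2 * conjc (y x).2).

Definition complexify u : R -> R[i] * R[i] :=
  fun x => (((u x).1)%:C%C, ((u x).2)%:C%C).

End VectorSpaces.

(* Spectral theory of an operator [L] on L^2(R, C^2) with domain H^2(R, C^2). *)
Section Spectrum.
Context {R : realType}.
Local Notation mu := (@lebesgue_measure R).
Local Notation V := (R -> R[i] * R[i]).
Implicit Types (L : V -> V) (lam : R[i]).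

Definition scalev (c : R[i]) (z : V) : V := fun x => (c * (z x).1, c * (z x).2).

Definition shift_op L lam : V -> V := fun z x => L z x - scalev lam z x.

Definition ae_zero (z : V) : Prop := {ae mu, forall x, z x = 0}.

Definition resolvent_set L : set R[i] := [set lam |
  [/\ forall h, L2c h ->
        exists2 z, H2c z & {ae mu, forall x, shift_op L lam z x = h x},
      forall z, H2c z -> ae_zero (shift_op L lam z) -> ae_zero z &
      exists K : R, forall z, H2c z ->
        (L2norm z <= K%:E * L2norm (shift_op L lam z))%E]].

Definition spectrum L : set R[i] := ~` resolvent_set L.

(* [gen_ker L lam k] is the kernel of (L - lam)^k, with the natural domain. *)
Fixpoint gen_ker L lam (k : nat) (z : V) : Prop :=
  if k is k'.+1 then H2c z /\ gen_ker L lam k' (shift_op L lam z)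
  else ae_zero z.

(* Algebraic multiplicity one: the generalized eigenspace, which is the union
   of the kernels of the powers of L - lam, is a line spanned by an
   eigenfunction. *)
Definition simple_eigenvalue L lam : Prop :=
  exists z : V, [/\ H2c z, ~ ae_zero z, ae_zero (shift_op L lam z) &
    forall k y, gen_ker L lam k y ->
      exists c : R[i], {ae mu, forall x, y x = scalev c z x}].

(* [adjoint_graph L z y]: z lies in the domain of L^* and L^* z = y. *)
Definition adjoint_graph L (z y : V) : Prop :=
  [/\ L2c z, L2c y & forall q, H2c q -> inner (L q) z = inner q y].

Definition ker_adjoint L (z : V) : Prop := adjoint_graph L z (fun=> 0).

End Spectrum.

Section Klausmeier.
Context {R : realType}.
Variables (T d a m : R) (f g : R -> R).
Local Notation mu := (@lebesgue_measure R).
Implicit Types (eps : R) (u : R -> R * R).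

Definition C1 (h : R -> R) : Prop :=
  (forall x, derivable h x 1) /\ continuous (derive1 h).

Definition A_op eps u : R -> R * R := fun x =>
  (wderiv (wderiv (fst_fun u)) x + eps * f x * wderiv (fst_fun u) x,
   d ^+ 2 * wderiv (wderiv (snd_fun u)) x).

Definition A_opC eps (z : R -> R[i] * R[i]) : R -> R[i] * R[i] := fun x =>
  (cwderiv (cwderiv (fst_fun z)) x
     + (eps * f x)%:C%C * cwderiv (fst_fun z) x,
   (d ^+ 2)%:C%C * cwderiv (cwderiv (snd_fun z)) x).

Definition N1 eps (x w p : R) : R := eps * g x * w - w - w * p ^+ 2 + a.
Definition N2 (w p : R) : R := - m * p + w * p ^+ 2.

Definition N_op eps u : R -> R * R := fun x =>
  (N1 eps x (u x).1 (u x).2, N2 (u x).1 (u x).2).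

Definition jacobian_op eps u (z : R -> R[i] * R[i]) : R -> R[i] * R[i] :=
  fun x => let w := (u x).1 in let p := (u x).2 in
  ((derive1 (fun s => N1 eps x s p) w)%:C%C * (z x).1
     + (derive1 (fun s => N1 eps x w s) p)%:C%C * (z x).2,
   (derive1 (fun s => N2 s p) w)%:C%C * (z x).1
     + (derive1 (fun s => N2 w s) p)%:C%C * (z x).2).

Definition L_op eps u (z : R -> R[i] * R[i]) : R -> R[i] * R[i] :=
  fun x => A_opC eps z x + jacobian_op eps u z x.

Definition solution eps u : Prop :=
  H2vloc u /\ {ae mu, forall x, A_op eps u x + N_op eps u x = 0}.

Definition nondegenerate eps u : Prop := resolvent_set (L_op eps u) 0.

Definition strongly_stable eps u : Prop :=
  exists2 rho : R, 0 < rho &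
    forall lam, spectrum (L_op eps u) lam -> complex.Re lam <= - rho.

Definition unstable eps u : Prop :=
  exists2 lam, spectrum (L_op eps u) lam & 0 < complex.Re lam.

Definition stable_simple0 eps u : Prop :=
  (exists2 rho : R, 0 < rho & forall lam, spectrum (L_op eps u) lam ->
     complex.Re lam <= - rho \/ lam = 0)
  /\ simple_eigenvalue (L_op eps u) 0.

Definition even_ae u : Prop := {ae mu, forall x, u (- x) = u x}.

Definition melnikov (u0 Psi : R -> R * R) : R :=
  \int[mu]_x ((derive1 f x * wderiv (fst_fun u0) x + derive1 g x * (u0 x).1)
              * (Psi x).1).

(* The adjoint eigenfunction is taken real-valued: the kernel of L_0(u0)^* is
   invariant under conjugation, so the normalisation forces this anyway. *)
Definition adjoint_eigenfunction u0 (Psi : R -> R * R) : Prop :=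
  [/\ H2v Psi, ker_adjoint (L_op 0 u0) (complexify Psi),
      forall y, ker_adjoint (L_op 0 u0) y ->
        exists c : R[i], {ae mu, forall x, y x = scalev c (complexify Psi) x} &
      inner (complexify (vwderiv u0)) (complexify Psi) = 1].

Definition seed_pulse (u0 z0 : R -> R * R) (v0 : R * R)
    (Psi : R -> R * R) : Prop :=
  [/\ H2v z0 /\ (forall x, u0 x = z0 x + v0),
      even_ae u0 /\ solution 0 u0,
      stable_simple0 0 u0,
      adjoint_eigenfunction u0 Psi &
      melnikov u0 Psi != 0].

(* [U eps = Z eps + V eps] is the family of pulses bifurcating from [u0], with
   critical eigenvalue [lam0 eps]. *)
Definition pulse_family (u0 : R -> R * R) (v0 : R * R) (Psi : R -> R * R)
    (C eps0 eta : R) (U Z V : R -> R -> R * R) (lam0 : R -> R) : Prop :=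
  [/\ 0 < C, 0 < eps0 & 0 < eta] /\
  (forall eps, 0 < `|eps| < eps0 ->
    [/\ [/\ H2v (Z eps), H2per T (V eps) &
            forall x, U eps x = Z eps x + V eps x],
        [/\ solution eps (U eps), even_ae (U eps) &
            nondegenerate eps (U eps)],
        (Linfnorm (fun x => U eps x - u0 x)%R <= (C * `|eps|)%:E)%E /\
        (H2per_norm T (fun x => V eps x - v0)%R <= (C * `|eps|)%:E)%E,
        forall lam, spectrum (L_op eps (U eps)) lam ->
          complex.Re lam <= - eta \/ lam = (lam0 eps)%:C%C &
        simple_eigenvalue (L_op eps (U eps)) (lam0 eps)%:C%C]) /\
  (exists K : R, \forall eps \near (0 : R)^',
    `|lam0 eps + eps * melnikov u0 Psi| <= K * eps ^+ 2).

Definition primary_pulse eps u : Prop :=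
  exists (u0 z0 : R -> R * R) (v0 : R * R) (Psi : R -> R * R)
         (C eps0 eta : R) (U Z V : R -> R -> R * R) (lam0 : R -> R),
  [/\ seed_pulse u0 z0 v0 Psi,
      pulse_family u0 v0 Psi C eps0 eta U Z V lam0,
      0 < `|eps| < eps0 &
      u = U eps].

End Klausmeier.

(* [chi j n] is chi_{j,n}, for 1 <= j <= M.  "Supported on" an open interval
   means vanishing outside it; the case j = 1 only has the right end point and
   the case j = M only the left one. *)
Definition cutoff_family (R : realType) (T : R) (M : nat)
    (chi : nat -> nat -> R -> R) : Prop :=
  (M = 1%N -> forall n x, chi 1%N n x = 1) /\
  ((2 <= M)%N -> exists (n0 : nat) (K : R), forall n, (n0 <= n)%N ->
    (forall x, \sum_(1 <= j < M.+1) chi j n x = 1) /\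
    forall j, (1 <= j <= M)%N ->
      [/\ smooth (chi j n),
          forall x, 0 <= chi j n x <= 1,
          forall x, [/\ `|chi j n x| <= K, `|derive1 (chi j n) x| <= K &
                        `|derive1n 2 (chi j n) x| <= K],
          (j < M)%N -> forall x : R,
            (j%:R + 1 / 2) * n%:R * T + 1 <= x -> chi j n x = 0 &
          (1 < j)%N -> forall x : R,
            x <= (j%:R - 1 / 2) * n%:R * T - 1 -> chi j n x = 0]).

(* Main.v *)
(* Write u = z + v with z localised and v periodic.  The background v solves the
   equation by itself, since its residual is both periodic and square integrable,
   and the train W_n = v + sum_j z(. - jnT) solves it up to a residual that tends
   to 0 in L^2, because at every point all translates of z but one are small.
   Invertibility of L(u) - l, with a bound on the inverse, passes to L(W_n) - l:
   inverses for neighbouring groups of pulses are glued with slowly varying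
   cutoffs, whose commutators with the operator are small.  A contraction argument
   then corrects W_n to an exact solution W_n + c_n with c_n -> 0 in H^2, and
   W_n differs from sum_j chi_j u(. - jnT) by the tails (1 - chi_j) z(. - jnT).

   Stability: in a half-plane the resolvent exists for large |l| by an energy
   estimate, and for l in a compact set by the gluing, uniformly in n.

   Instability: the unstable spectrum of L(u) is a simple eigenvalue l0 > 0.  On
   the boundary of a square around l0 the gluing bounds the resolvent of the
   multipulse uniformly in n.  Were there no spectrum inside the square, this bound
   would hold at l0 too, by a maximum principle on fine grids that rests on a
   four-point mean value property of the resolvent; but a translated eigenfunction
   of L(u) is an approximate eigenfunction for the multipulse. *)

Require Import Defs.
From mathcomp Require Import ring lra measurable_realfun.
Set Implicit Arguments.
Unset Strict Implicit.
Unset Printing Implicit Defensive.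
Import Order.TTheory GRing.Theory Num.Theory.
Local Open Scope classical_set_scope.
Local Open Scope ring_scope.

(** * Integration on the line *)

(** Complex problems are treated as real ones: the equation (L - l) z = h becomes an elliptic system
    with four real components, indexed by [bool * bool], so that only real weak derivatives and real
    integrals occur. Invertibility is carried by one predicate, [good P K]: solvability for every
    square integrable right-hand side together with a bound K on solutions. Gluing has to transport
    both halves: the bound, by applying it to cut-off functions; solvability, by a contraction that
    corrects an approximate right inverse. The thresholds of the gluing depend on K, on a bound for
    the potential and on the fixed coefficients, never on n; each further pulse only replaces the
    constant by a larger one, and the number of pulses is fixed. The obstacle in the instability
    part is that bounds uniform in n are available only on the boundary of the square. Inside it,
    the assumed absence of spectrum gives bounds that may depend on n. They enter only through the
    error O(s^4) of the mean value property on a grid of mesh s; the maximum principle multiplies it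
    by O(s^-2), so it disappears as s tends to 0. *)

Section Integration.
Context {R : realType}.
Local Notation mu := (@lebesgue_measure R).
Local Notation L1 f := (mu.-integrable [set: R] (EFin \o f)).
Implicit Types (f g h : R -> R) (c : R).

Lemma ae_all (P : R -> Prop) : (forall x, P x) -> {ae mu, forall x, P x}.
Proof. by move=> h; apply: aeW. Qed.

Lemma aeS (P Q : R -> Prop) : (forall x, P x -> Q x) ->
  {ae mu, forall x, P x} -> {ae mu, forall x, Q x}.
Proof.
move=> PQ; apply: (@filterS _ _ (ae_filter_ringOfSetsType mu)) => x; exact: PQ.
Qed.

Lemma aeS2 (P Q S : R -> Prop) : (forall x, P x -> Q x -> S x) ->
  {ae mu, forall x, P x} -> {ae mu, forall x, Q x} -> {ae mu, forall x, S x}.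
Proof.
by move=> h; apply: (@filterS2 _ _ (ae_filter_ringOfSetsType mu)) => x; exact: h.
Qed.

Lemma aeS3 (P Q S T : R -> Prop) : (forall x, P x -> Q x -> S x -> T x) ->
  {ae mu, forall x, P x} -> {ae mu, forall x, Q x} -> {ae mu, forall x, S x} ->
  {ae mu, forall x, T x}.
Proof.
by move=> h; apply: (@filterS3 _ _ (ae_filter_ringOfSetsType mu)) => x; exact: h.
Qed.

Lemma mfun_EFin f : measurable_fun [set: R] f ->
  measurable_fun [set: R] (EFin \o f).
Proof. by move=> mf; apply/measurable_EFinP. Qed.

Lemma mfun_norm f : measurable_fun [set: R] f ->
  measurable_fun [set: R] (fun x => `|f x|).
Proof. by move=> mf; exact: measurableT_comp. Qed.

Lemma L1_mfun f : L1 f -> measurable_fun [set: R] f.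
Proof. by move=> /integrableP[/measurable_EFinP]. Qed.

Lemma L1_le f g : measurable_fun [set: R] f -> L1 g ->
  {ae mu, forall x, `|f x| <= g x} -> L1 f.
Proof.
move=> mf /integrableP[mg ig] fg; apply/integrableP; split.
  exact/measurable_EFinP.
apply: le_lt_trans ig; apply: ae_ge0_le_integral => //=.
- exact: (mfun_EFin (mfun_norm mf)).
- by apply: (mfun_EFin (mfun_norm _)); exact/measurable_EFinP.
- by apply: aeS fg => x fgx _; rewrite lee_fin (le_trans fgx)// ler_norm.
Qed.

Lemma L1D f g : L1 f -> L1 g -> L1 (fun x => f x + g x).
Proof. by move=> lf lg; exact: (integrableD _ lf lg). Qed.

Lemma L1B f g : L1 f -> L1 g -> L1 (fun x => f x - g x).
Proof. by move=> lf lg; exact: (integrableB _ lf lg). Qed.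

Lemma L1Z c f : L1 f -> L1 (fun x => c * f x).
Proof. by move=> lf; exact: (integrableZl _ c lf). Qed.

Lemma L1_norm f : L1 f -> L1 (fun x => `|f x|).
Proof. exact: integrable_norm. Qed.

Lemma L1_ae f g : L1 f -> measurable_fun [set: R] g ->
  {ae mu, forall x, f x = g x} -> L1 g.
Proof.
move=> lf mg fg; apply: (L1_le mg (L1_norm lf)).
by apply: aeS fg => x ->.
Qed.

Lemma L1_mulbd c f g : measurable_fun [set: R] g ->
  {ae mu, forall x, `|g x| <= c} -> L1 f -> L1 (fun x => g x * f x).
Proof.
move=> mg gc lf; apply: (L1_le _ (L1Z c (L1_norm lf))).
  by apply: measurable_funM => //; exact: L1_mfun.
by apply: aeS gc => x gx; rewrite normrM ler_wpM2r.
Qed.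

Lemma IntD f g : L1 f -> L1 g ->
  \int[mu]_x (f x + g x) = \int[mu]_x f x + \int[mu]_x g x.
Proof. by move=> lf lg; rewrite RintegralD. Qed.

Lemma IntB f g : L1 f -> L1 g ->
  \int[mu]_x (f x - g x) = \int[mu]_x f x - \int[mu]_x g x.
Proof. by move=> lf lg; rewrite RintegralB. Qed.

Lemma IntZ c f : L1 f -> \int[mu]_x (c * f x) = c * \int[mu]_x f x.
Proof. by move=> lf; rewrite RintegralZl. Qed.

Lemma Int_ae f g : L1 f -> measurable_fun [set: R] g ->
  {ae mu, forall x, f x = g x} -> \int[mu]_x f x = \int[mu]_x g x.
Proof.
move=> lf mg fg; congr fine; apply: ae_eq_integral => //.
- exact: measurable_int lf.
- exact: mfun_EFin.
- by apply: aeS fg => x -> _.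
Qed.

Lemma Int_ge0 f : (forall x, 0 <= f x) -> 0 <= \int[mu]_x f x.
Proof. by move=> f0; apply: Rintegral_ge0. Qed.

Lemma Int_le f g : L1 f -> L1 g -> {ae mu, forall x, f x <= g x} ->
  \int[mu]_x f x <= \int[mu]_x g x.
Proof.
move=> lf lg fg.
have mfg := measurable_funB (L1_mfun lg) (L1_mfun lf).
have mabs : measurable_fun [set: R] (fun x => `|g x - f x|).
  exact: measurableT_comp.
(* The order holds almost everywhere, whereas [Int_ge0] asks for it pointwise; [|g - f|] is a
   representative of the difference that is nonnegative everywhere. *)
rewrite -subr_ge0 -IntB// (@Int_ae _ (fun x => `|g x - f x|)) ?Int_ge0//.
  exact: L1B.
by apply: aeS fg => x h; rewrite ger0_norm// subr_ge0.
Qed.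

Lemma Int_norm f : L1 f -> `|\int[mu]_x f x| <= \int[mu]_x `|f x|.
Proof. by move=> lf; apply: le_normr_Rintegral. Qed.

Lemma Int_eq0 f : L1 f -> (forall x, 0 <= f x) -> \int[mu]_x f x = 0 ->
  {ae mu, forall x, f x = 0}.
Proof.
move=> lf f0 i0.
have [+ _] := ae_eq_integral_abs mu measurableT (mfun_EFin (L1_mfun lf)).
have -> : (\int[mu]_(x in [set: R]) `|(EFin \o f) x| = 0)%E.
  under eq_integral do rewrite /= ger0_norm//.
  move: i0; rewrite /Rintegral => /eqP.
  rewrite fine_eq0 ?(integrable_fin_num _ lf)//.
  by move=> /eqP.
by move=> /(_ erefl); apply: aeS => x /= /(_ I) [].
Qed.

Lemma Int_dominated (F : nat -> R -> R) f g :
  (forall n, measurable_fun [set: R] (F n)) -> measurable_fun [set: R] f ->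
  L1 g -> (forall n, {ae mu, forall x, `|F n x| <= g x}) ->
  {ae mu, forall x, F n x @[n --> \oo] --> f x} ->
  \int[mu]_x F n x @[n --> \oo] --> \int[mu]_x f x.
Proof.
move=> mF mf lg Fg Ff.
have [] := @dominated_convergence _ _ _ mu setT measurableT
  (fun n => EFin \o F n) (EFin \o f) (EFin \o g).
- by move=> n; exact: mfun_EFin.
- exact: mfun_EFin.
- by apply: aeS Ff => x Fx _; apply: cvg_EFin => //; exact: nearW.
- exact: lg.
- have /ae_foralln : forall n, {ae mu, forall x, `|F n x| <= g x} by [].
  by apply: aeS => x Fgx n _; rewrite lee_fin.
move=> lf _; rewrite -[X in _ --> X -> _]fineK; last first.
  exact: (integrable_fin_num _ lf).
by move=> /fine_cvgP[_].
Qed.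

(** * Translation invariance of Lebesgue measure *)

Let shiftR c : measurableTypeR R -> measurableTypeR R := fun x => x + c.

Let mshift c : measurable_fun [set: measurableTypeR R] (shiftR c).
Proof. by apply: measurable_funD => //; exact: measurable_cst. Qed.

Let preimage_shift_itv c (a b : R) :
  shiftR c @^-1` `]a, b]%classic = `]a - c, b - c]%classic.
Proof.
apply/seteqP; split => x; rewrite /= /shiftR !in_itv/=.
  by move=> /andP[? ?]; apply/andP; split; lra.
by move=> /andP[? ?]; apply/andP; split; lra.
Qed.

(** Lebesgue measure is determined by its values on half-open intervals, and its pushforward under a
    translation takes the same values there. *)
Lemma lebesgue_measure_shift c (A : set (measurableTypeR R)) : measurable A ->
  mu ((fun x => x + c) @^-1` A) = mu A.
Proof.
move=> mA; apply/esym.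
apply: (@lebesgue_measure_unique R (pushforward mu (shiftR c))) => //.
move=> X [[a b] _ <-]/=; rewrite /pushforward preimage_shift_itv.
rewrite !lebesgue_measure_itv/= !lte_fin ltrD2r.
by case: ifPn => // _; rewrite -!EFinD; congr EFin; ring.
Qed.

Lemma ae_shift (P : R -> Prop) c : {ae mu, forall x, P x} ->
  {ae mu, forall x, P (x + c)}.
Proof.
move=> [N [mN N0 PN]]; exists ((fun x => x + c) @^-1` N); split.
- by rewrite -[X in measurable X]setTI; exact: mshift.
- by rewrite lebesgue_measure_shift.
- by move=> x /= nPx; apply: PN.
Qed.

Lemma L1_shift f c : L1 f -> L1 (fun x => f (x + c)).
Proof.
move=> lf; have mf := L1_mfun lf; apply/integrableP; split.
  by apply/measurable_EFinP; exact: (measurableT_comp mf (mshift c)).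
move/integrableP: lf => [_].
have -> : (\int[mu]_x `|(EFin \o f) x|)%E
    = (\int[pushforward mu (shiftR c)]_x `|(EFin \o f) x|)%E.
  apply: eq_measure_integral => A mA _.
  exact/esym/lebesgue_measure_shift.
rewrite ge0_integral_pushforward//=.
exact: (mfun_EFin (mfun_norm mf)).
Qed.

Lemma Int_shift f c : L1 f -> \int[mu]_x f (x + c) = \int[mu]_x f x.
Proof.
move=> lf; have mf := L1_mfun lf; congr fine; apply/esym.
have -> : (\int[mu]_x (f x)%:E)%E
    = (\int[pushforward mu (shiftR c)]_x (f x)%:E)%E.
  apply: eq_measure_integral => A mA _.
  exact/esym/lebesgue_measure_shift.
rewrite integral_pushforward//=; first exact/measurable_EFinP.
by rewrite preimage_setT; exact: (L1_shift c lf).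
Qed.

End Integration.

(** * Square integrable functions *)

Section SquareIntegrable.
Context {R : realType}.
Local Notation mu := (@lebesgue_measure R).
Local Notation L1 f := (mu.-integrable [set: R] (EFin \o f)).
Implicit Types (f g h : R -> R) (c : R).

Lemma L2P f : L2 f <-> measurable_fun [set: R] f /\ L1 (fun x => f x ^+ 2).
Proof.
split=> [l2f|[mf i2]].
  split; last exact: Lfun2_integrable_sqr.
  by move: l2f; rewrite /L2 inE => /andP[/[!inE]].
rewrite /L2 inE; apply/andP; split; rewrite inE//=.
rewrite /finite_norm unlock /Lnorm poweR_lty//.
move: i2 => /integrableP[_]; congr (_ < _)%E; apply: eq_integral => x _ /=.
by rewrite normrX powR_mulrn.
Qed.

(** The real-valued counterpart of the extended-real norm. It is meaningful together with [L2 f]: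
    the integral of a function that is not integrable has a default value. *)
Definition nu f : R := Num.sqrt (\int[mu]_x (f x ^+ 2)).

Lemma nu_ge0 f : 0 <= nu f. Proof. exact: sqrtr_ge0. Qed.

Lemma nu_sqr f : nu f ^+ 2 = \int[mu]_x (f x ^+ 2).
Proof. by rewrite sqr_sqrtr// Int_ge0// => x; exact: sqr_ge0. Qed.

Lemma LnormE f : L2 f -> ('N[mu]_2%:E[EFin \o f] = (nu f)%:E)%E.
Proof.
move=> /L2P[mf i2]; rewrite unlock /Lnorm.
have -> : (\int[mu]_x `|(EFin \o f) x| `^ 2 = (nu f ^+ 2)%:E)%E.
  rewrite nu_sqr /Rintegral fineK ?(integrable_fin_num _ i2)//.
  by apply: eq_integral => x _ /=; rewrite powR_mulrn// -normrX ger0_norm ?sqr_ge0.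
rewrite poweR_EFin; congr EFin.
by rewrite -powR_mulrn ?nu_ge0// -powRrM mulfV// powRr1// nu_ge0.
Qed.

Lemma L2_mfun f : L2 f -> measurable_fun [set: R] f.
Proof. by move=> /L2P[]. Qed.

Lemma L2_sqr f : L2 f -> L1 (fun x => f x ^+ 2).
Proof. by move=> /L2P[]. Qed.

Lemma L2M f g : L2 f -> L2 g -> L1 (fun x => f x * g x).
Proof. by move=> lf lg; apply/Lfun1_integrable; exact: Lfun2_mul_Lfun1. Qed.

Lemma L2_le f g : measurable_fun [set: R] f -> L2 g ->
  {ae mu, forall x, `|f x| <= g x} -> L2 f.
Proof.
move=> mf lg fg; apply/L2P; split => //; apply: L1_le (L2_sqr lg) _.
  exact: measurable_funX.
by apply: aeS fg => x h; rewrite normrX ler_sqr ?nnegrE// (le_trans _ h).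
Qed.

Lemma nu_le f g : measurable_fun [set: R] f -> L2 g ->
  {ae mu, forall x, `|f x| <= g x} -> nu f <= nu g.
Proof.
move=> mf lg fg; have lf := L2_le mf lg fg.
rewrite ler_sqrt ?Int_ge0//; last by move=> x; exact: sqr_ge0.
apply: Int_le; [exact: L2_sqr|exact: L2_sqr|].
apply: aeS fg => x h.
by rewrite -(real_normK (num_real (f x))) ler_sqr ?nnegrE// (le_trans _ h).
Qed.

Lemma L2D f g : L2 f -> L2 g -> L2 (fun x => f x + g x).
Proof.
move=> lf lg; apply/L2P; split.
  by apply: measurable_funD; exact: L2_mfun.
apply: (@L1_le _ _ (fun x => 2 * f x ^+ 2 + 2 * g x ^+ 2)).
- by apply: measurable_funX; apply: measurable_funD; exact: L2_mfun.
- by apply: L1D; apply: L1Z; exact: L2_sqr.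
- apply: ae_all => x; rewrite ger0_norm ?sqr_ge0//.
  by have := sqr_ge0 (f x - g x); nra.
Qed.

Lemma L2Z c f : L2 f -> L2 (fun x => c * f x).
Proof.
move=> lf; apply/L2P; split.
  by apply: measurable_funM => //; exact: L2_mfun.
by under [X in integrable _ _ X]eq_fun do rewrite /= exprMn;
  apply: L1Z; exact: L2_sqr.
Qed.

Lemma L2N f : L2 f -> L2 (fun x => - f x).
Proof. by move=> /(L2Z (-1)); under eq_fun do rewrite mulN1r. Qed.

Lemma L2B f g : L2 f -> L2 g -> L2 (fun x => f x - g x).
Proof. by move=> lf /L2N; exact: L2D. Qed.

Lemma L20 : L2 (fun=> 0 : R).
Proof.
apply/L2P; split => //; under [X in integrable _ _ X]eq_fun do rewrite /= expr0n/=.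
exact: integrable0.
Qed.

Lemma L2_norm f : L2 f -> L2 (fun x => `|f x|).
Proof.
move=> lf; apply/L2P; split; first by apply: mfun_norm; exact: L2_mfun.
by under [X in integrable _ _ X]eq_fun do rewrite /= real_normK ?num_real//;
  exact: L2_sqr.
Qed.

Lemma nu_norm f : nu (fun x => `|f x|) = nu f.
Proof.
by rewrite /nu; under eq_Rintegral do rewrite real_normK ?num_real//.
Qed.

Lemma nuZ c f : L2 f -> nu (fun x => c * f x) = `|c| * nu f.
Proof.
move=> lf; rewrite /nu; under eq_Rintegral do rewrite exprMn.
by rewrite (IntZ _ (L2_sqr lf)) sqrtrM ?sqr_ge0 ?sqrtr_sqr.
Qed.

Lemma nu0 : nu (fun=> 0 : R) = 0.
Proof.
transitivity (nu (fun x : R => 0 * (fun=> 0 : R) x)).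
  by congr nu; apply/funext => x; rewrite mul0r.
by rewrite nuZ ?normr0 ?mul0r//; exact: L20.
Qed.

Lemma nuD f g : L2 f -> L2 g -> nu (fun x => f x + g x) <= nu f + nu g.
Proof.
move=> lf lg; rewrite -lee_fin EFinD -!LnormE//; last exact: L2D.
by apply: minkowski_EFin; [exact: L2_mfun|exact: L2_mfun|rewrite ler1n].
Qed.

Lemma nuN f : nu (fun x => - f x) = nu f.
Proof. by rewrite /nu; under eq_Rintegral do rewrite sqrrN. Qed.

Lemma nuB f g : L2 f -> L2 g -> nu (fun x => f x - g x) <= nu f + nu g.
Proof. by move=> lf lg; rewrite -[in leRHS](nuN g); apply: nuD => //; exact: L2N. Qed.

Lemma cauchy_schwarz f g : L2 f -> L2 g ->
  `|\int[mu]_x (f x * g x)| <= nu f * nu g.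
Proof.
move=> lf lg; apply: (le_trans (Int_norm (L2M lf lg))).
have := @hoelder _ _ R mu f g 2 2 (L2_mfun lf) (L2_mfun lg).
rewrite ltr0n => /(_ isT isT).
rewrite !LnormE// Lnorm1 => H.
rewrite -lee_fin EFinM (le_trans _ (H _))//; last by rewrite -div1r -splitr.
rewrite /Rintegral fineK; last first.
  by apply: integrable_fin_num => //; exact/L1_norm/L2M.
by [].
Qed.

Lemma nu_eq0 f : L2 f -> nu f = 0 -> {ae mu, forall x, f x = 0}.
Proof.
move=> lf f0; have := Int_eq0 (L2_sqr lf) (fun x => sqr_ge0 _).
rewrite -nu_sqr f0 expr0n/= => /(_ erefl); apply: aeS => x /eqP.
by rewrite sqrf_eq0 => /eqP.
Qed.

Lemma L2_ae f g : L2 f -> measurable_fun [set: R] g ->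
  {ae mu, forall x, f x = g x} -> L2 g.
Proof.
move=> lf mg fg; apply: (L2_le mg (L2_norm lf)).
by apply: aeS fg => x ->.
Qed.

Lemma nu_ae f g : L2 f -> measurable_fun [set: R] g ->
  {ae mu, forall x, f x = g x} -> nu f = nu g.
Proof.
move=> lf mg fg; congr Num.sqrt; apply: Int_ae; first exact: L2_sqr.
  exact: measurable_funX.
by apply: aeS fg => x ->.
Qed.

Lemma L2_shift f c : L2 f -> L2 (fun x => f (x + c)).
Proof.
move=> lf; have lf2 := L2_sqr lf.
apply/L2P; split; last exact: (L1_shift c lf2).
by apply: (measurableT_comp (L2_mfun lf)); exact: measurable_funD.
Qed.

Lemma nu_shift f c : L2 f -> nu (fun x => f (x + c)) = nu f.
Proof. by move=> lf; rewrite /nu (Int_shift c (L2_sqr lf)). Qed.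

Lemma L2_mulbd c f g : measurable_fun [set: R] g ->
  {ae mu, forall x, `|g x| <= c} -> L2 f -> L2 (fun x => g x * f x).
Proof.
move=> mg gc lf; apply: (L2_le _ (L2Z c (L2_norm lf))).
  by apply: measurable_funM => //; exact: L2_mfun.
by apply: aeS gc => x gx; rewrite normrM ler_wpM2r.
Qed.

Lemma nu_mulbd c f g : measurable_fun [set: R] g ->
  {ae mu, forall x, `|g x| <= c} -> L2 f -> 0 <= c ->
  nu (fun x => g x * f x) <= c * nu f.
Proof.
move=> mg gc lf c0; rewrite -(nu_norm f) -[c in leRHS]ger0_norm//.
rewrite -nuZ; last exact: L2_norm.
apply: (nu_le _ (L2Z c (L2_norm lf))).
  by apply: measurable_funM => //; exact: L2_mfun.
by apply: aeS gc => x gx; rewrite normrM ler_wpM2r.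
Qed.

(** * Tails, monotone limits and completeness *)

Definition tail (r : R) f : R -> R := fun x => f x * (r <= `|x|)%R%:R.

Lemma mfun_ball (r : R) :
  measurable_fun [set: R] (fun x : R => (r <= `|x|)%R%:R : R).
Proof.
have -> : (fun x : R => (r <= `|x|)%R%:R : R)
    = (fun x => if (r <= `|x|)%R then 1 else 0).
  by apply/funext => x; case: (r <= _).
apply: measurable_fun_ifT => //; apply: measurable_fun_ler => //.
Qed.

Lemma L2_tail r f : L2 f -> L2 (tail r f).
Proof.
move=> lf; apply: (L2_le _ (L2_norm lf)).
  by apply: measurable_funM; [exact: L2_mfun|exact: mfun_ball].
apply: ae_all => x; rewrite normrM ler_piMr// normr_nat.
by case: (r <= _).
Qed.

(** Dominated convergence with majorant f^2 along integer radii; tails decrease in the radius, which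
    covers every real [r]. *)
Lemma tail_cvg0 f (e : R) : L2 f -> 0 < e ->
  exists2 r0 : R, 0 < r0 & forall r, r0 <= r -> nu (tail r f) <= e.
Proof.
move=> lf e0.
have : \int[mu]_x (tail n.+1%:R f x ^+ 2) @[n --> \oo] --> \int[mu]_x (0 : R).
  apply: (@Int_dominated _ _ _ (fun x => f x ^+ 2)) => //.
  - by move=> n; apply: measurable_funX; apply: L2_mfun; exact: L2_tail.
  - exact: L2_sqr.
  - move=> n; apply: ae_all => x; rewrite ger0_norm ?sqr_ge0// /tail exprMn.
    by rewrite ler_piMr ?sqr_ge0//; case: (_ <= `|x|); rewrite ?expr1n ?expr0n/= ?ler01.
  - apply: ae_all => x; apply: cvg_near_cst.
    near=> n; rewrite /tail; case: leP; rewrite ?mulr0 ?expr0n// => nx.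
    exfalso; move: nx; apply/negP; rewrite -ltNge.
    apply: (lt_le_trans (truncnS_gt `|x|)); rewrite ler_nat ltnS.
    by near: n; exact: nbhs_infty_ge.
rewrite Rintegral_cst// mul0r => /cvgr0Pnorm_lt /(_ (e ^+ 2)).
rewrite exprn_gt0// => /(_ isT) [N _ HN].
exists N.+1%:R => // r Nr; apply: (@le_trans _ _ (nu (tail N.+1%:R f))).
  rewrite -(nu_norm (tail N.+1%:R f)); apply: nu_le.
  - by apply: L2_mfun; exact: L2_tail.
  - by apply: L2_norm; exact: L2_tail.
  - apply: ae_all => x; rewrite /tail !normrM ler_wpM2l// !normr_nat ler_nat.
    case: (leP r) => // rx; rewrite (le_trans Nr rx)//.
rewrite -ler_sqr ?nnegrE ?nu_ge0 ?ltW// nu_sqr.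
have := HN N (leqnn N); rewrite /= ger0_norm => [/ltW//|].
by apply: Int_ge0 => x; exact: sqr_ge0.
Unshelve. all: by end_near. Qed.

(** The pointwise supremum has integral at most [c] by monotone convergence, so it is finite almost
    everywhere and its finite part serves as majorant. *)
Lemma beppo_levi (H : nat -> R -> R) c : (forall n, L1 (H n)) ->
  (forall n x, 0 <= H n x) ->
  (forall x, {homo (fun n => H n x) : m n / (m <= n)%N >-> m <= n}) ->
  (forall n, \int[mu]_x H n x <= c) ->
  exists2 g, L1 g & {ae mu, forall x, forall n, H n x <= g x}.
Proof.
move=> lH H0 Hnd Hc.
pose G2 x := ereal_sup (range (fun n => (H n x)%:E)).
have eHnd x : {homo (fun n => (H n x)%:E) : m n / (m <= n)%N >-> (m <= n)%E}.
  by move=> m n mn; rewrite lee_fin Hnd.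
have cG2 x : (H n x)%:E @[n --> \oo] --> G2 x.
  exact: ereal_nondecreasing_cvgn.
have meH n : measurable_fun [set: R] (fun x => (H n x)%:E).
  by apply: mfun_EFin; exact: L1_mfun.
have mG2 : measurable_fun [set: R] G2.
  exact: (emeasurable_fun_cvg (fun n x => (H n x)%:E)).
have HG2 n x : ((H n x)%:E <= G2 x)%E by apply: ereal_sup_ubound; exists n.
have G20 x : (0 <= G2 x)%E by apply: le_trans (HG2 0%N x); rewrite lee_fin.
have iG2 : (\int[mu]_x (G2 x) <= c%:E)%E.
  have := @cvg_monotone_convergence _ _ _ mu _ measurableT
    (fun n x => (H n x)%:E) meH.
  have A1 n x : [set: R] x -> (0 <= (H n x)%:E)%E by rewrite lee_fin.
  move=> /(_ A1 (fun x _ => eHnd x)).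
  under eq_integral => x _ do rewrite (cvg_lim _ (cG2 x))//.
  move=> cv; rewrite -(cvg_lim _ cv)//; apply: lime_le; first exact: cvgP cv.
  apply: nearW => n; have fin := integrable_fin_num measurableT (lH n).
  by rewrite -(fineK fin) lee_fin; exact: Hc.
have l1G2 : mu.-integrable [set: R] G2.
  apply/integrableP; split => //; under eq_integral do rewrite gee0_abs//.
  by rewrite (le_lt_trans iG2)// ltry.
have aefin : {ae mu, forall x, G2 x \is a fin_num}.
  by apply: aeS (integrable_ae measurableT l1G2) => x; exact.
exists (fun x => fine (G2 x)).
  apply/integrableP; split.
    by apply: mfun_EFin; exact: (measurableT_comp _ mG2).
  move/integrableP: l1G2 => [_]; apply: le_lt_trans.
  apply: ge0_le_integral => //=.
  - by apply: mfun_EFin; apply: mfun_norm; exact: (measurableT_comp _ mG2).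
  - exact: measurableT_comp.
  - by move=> x _; case: (G2 x) => //=; rewrite leey.
by apply: aeS aefin => x fx n; rewrite -lee_fin fineK.
Qed.

(** The Riesz-Fischer argument. The partial sums [G] of the absolute increments are bounded in L^2,
    so their squares have a common integrable majorant [g]. It forces the telescoping series to
    converge almost everywhere, and it dominates all (F m - F n)^2. The geometric rate is that of an
    iteration with contraction factor 1/2. *)
Lemma L2_complete (F : nat -> R -> R) c : (forall n, L2 (F n)) ->
  (forall n, nu (fun x => F n.+1 x - F n x) <= c * 2^-1 ^+ n) ->
  exists2 f, L2 f & nu (fun x => F n x - f x) @[n --> \oo] --> (0 : R).
Proof.
move=> lF Fc.
pose d n x := `|F n.+1 x - F n x|; pose G N x := \sum_(0 <= k < N) d k x.
have ld n : L2 (d n) by apply: L2_norm; exact: L2B.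
have lG N : L2 (G N).
  elim: N => [|N IH].
    by rewrite /G; under eq_fun do rewrite big_nil; exact: L20.
  by rewrite /G; under eq_fun do rewrite big_nat_recr//=; exact: L2D.
have geo n : c * 2^-1 ^+ n + 2 * c * 2^-1 ^+ n.+1 = 2 * c * 2^-1 ^+ n.
  by rewrite exprS; field.
have nuG N : nu (G N) <= 2 * c - 2 * c * 2^-1 ^+ N.
  elim: N => [|N IH].
    rewrite /G; under eq_fun do rewrite big_nil.
    by rewrite nu0 expr0 mulr1 subrr.
  rewrite /G; under eq_fun do rewrite big_nat_recr//=.
  apply: (le_trans (nuD (lG N) (ld N))); rewrite [nu (d N)]nu_norm.
  by have := Fc N; have := geo N; lra.
have c0 : 0 <= c.
  by have := Fc 0%N; rewrite expr0 mulr1; exact/le_trans/nu_ge0.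
have Gnd x : {homo (fun N => G N x) : m n / (m <= n)%N >-> m <= n}.
  apply/nondecreasing_seqP => n; rewrite /G big_nat_recr//= lerDl.
  exact: normr_ge0.
have G0 N x : 0 <= G N x by apply: sumr_ge0 => k _; exact: normr_ge0.
have [g lg Gg] : exists2 g, L1 g & {ae mu, forall x, forall N, G N x ^+ 2 <= g x}.
  apply: (@beppo_levi _ (4 * c ^+ 2)) => [N|N x|x m n mn|N].
  - exact: L2_sqr.
  - exact: sqr_ge0.
  - by rewrite ler_sqr ?nnegrE// Gnd.
  - have -> : 4 * c ^+ 2 = (2 * c) ^+ 2 by ring.
    rewrite -nu_sqr ler_sqr ?nnegrE ?nu_ge0 ?mulr_ge0//.
    apply: (le_trans (nuG N)); rewrite lerBlDr lerDl.
    by rewrite !mulr_ge0// exprn_ge0.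
have cF : {ae mu, forall x, cvgn (fun n => F n x)}.
  apply: aeS Gg => x Gx.
  have cd : cvgn (series (d ^~ x)).
    apply: nondecreasing_is_cvgn; first exact: Gnd.
    exists (1 + g x) => _ [N _ <-].
    have := Gx N; have := G0 N x; rewrite /series/= -/(G N x).
    by have := sqr_ge0 (G N x - 1); nra.
  have : cvgn (series (fun n => F n.+1 x - F n x)) by exact: normed_cvg.
  move=> cs; have : cvgn (fun n => F 0%N x + series (fun n => F n.+1 x - F n x) n).
    by apply: is_cvgD => //; exact: is_cvg_cst.
  have -> // : (fun n => F 0%N x + series (fun n => F n.+1 x - F n x) n) = F^~ x.
  apply/funext => n; rewrite /series/= telescope_sumr//.
  by rewrite addrC subrK.
have dG x m n : (m <= n)%N -> `|F m x - F n x| <= G n x.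
  move=> mn; rewrite distrC -(telescope_sumr (fun k => F k x) mn).
  apply: (le_trans (ler_norm_sum _ _ _)).
  have -> : G n x = G m x + \sum_(m <= k < n) d k x by rewrite /G -big_cat_nat.
  by rewrite lerDr G0.
have nuF m n : (m <= n)%N -> nu (fun x => F m x - F n x) <= 2 * c * 2^-1 ^+ m - 2 * c * 2^-1 ^+ n.
  move=> /subnK <-; elim: (n - m)%N => [|k IH].
    rewrite add0n subrr; under [X in nu X]eq_fun do rewrite subrr.
    by rewrite nu0.
  have -> : (fun x => F m x - F (k.+1 + m)%N x) =
      (fun x => (F m x - F (k + m)%N x) - (F (k.+1 + m)%N x - F (k + m)%N x)).
    by apply/funext => x; ring.
  apply: (le_trans (nuB (L2B _ _) (L2B _ _))) => //.
  by have := Fc (k + m)%N; have := geo (k + m)%N; rewrite -addSn; lra.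
(* Replacing the sequence by zero on a measurable null set makes it converge everywhere, so that the
   limit is measurable. *)
have [B [mB B0 FB]] := cF.
pose F' n (x : R) : R := if x \in B then 0 else F n x.
pose f (x : R) : R := limn (fun n => F' n x).
have cF' x : F' n x @[n --> \oo] --> f x.
  have [xB|xB] := boolP (x \in B).
    by rewrite /f; under eq_fun do rewrite /F' xB; exact: is_cvg_cst.
  rewrite /f; under [X in cvgn X]eq_fun do rewrite /F' (negbTE xB).
  by apply: contrapT => nc; move/negP: xB; apply; rewrite inE; exact: FB.
have mF' n : measurable_fun [set: R] (F' n).
  apply: measurable_fun_ifT => //; last exact: L2_mfun.
  by apply: (measurable_fun_bool true); rewrite setTI preimage_mem_true.
have mf : measurable_fun [set: R] f by apply: (@measurable_fun_cvg _ _ _ setT F') => // x _; exact: cF'.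
have F'F : {ae mu, forall x, forall n, F' n x = F n x}.
  exists B; split => // x /= h; apply: contrapT => xB; apply: h => n.
  by rewrite /F' ifN// notin_setE.
have mdiff m n : measurable_fun [set: R] (fun x => (F m x - F n x) ^+ 2).
  by apply: measurable_funX; apply: L2_mfun; exact: L2B.
have mdf m : measurable_fun [set: R] (fun x => (F m x - f x) ^+ 2).
  by apply: measurable_funX; apply: measurable_funB => //; exact: L2_mfun.
have cFx : {ae mu, forall x, F n x @[n --> \oo] --> f x}.
  by apply: aeS F'F => x /funext <-.
have cFm m : {ae mu, forall x, (F m x - F n x) ^+ 2 @[n --> \oo] --> (F m x - f x) ^+ 2}.
  apply: aeS cFx => x cx.
  apply: (@continuous_cvg _ _ _ _ _ _ (fun y => (F m x - y) ^+ 2)); last exact: cx.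
  move=> ?; apply: cvgM; apply: cvgB => //; exact: cvg_cst.
have bdm m : {ae mu, forall x, forall n, (F m x - F n x) ^+ 2 <= g x}.
  apply: aeS Gg => x Gx n; apply: le_trans (Gx (maxn m n)).
  rewrite -real_normK ?num_real// ler_sqr ?nnegrE//.
  have [mn|/ltnW nm] := leqP m n; first by rewrite (le_trans (dG _ _ _ mn))// Gnd.
  by rewrite distrC (le_trans (dG _ _ _ nm)).
have mFf m : L2 (fun x => F m x - f x).
  apply/L2P; split; first by apply: measurable_funB => //; exact: L2_mfun.
  apply: (L1_le _ lg) => //; apply: aeS2 (bdm m) (cFm m) => x bx cx.
  rewrite ger0_norm ?sqr_ge0// -(cvg_lim _ cx)//.
  by apply: limr_le; [exact: cvgP cx|exact: nearW].
have cFf m : nu (fun x => F m x - F n x) @[n --> \oo] --> nu (fun x => F m x - f x).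
  apply: (@continuous_cvg _ _ _ _ _ _ (fun y : R => Num.sqrt y)).
    exact: sqrt_continuous.
  apply: (@Int_dominated _ _ _ g) => // n.
  by apply: aeS (bdm m) => x bx; rewrite ger0_norm ?sqr_ge0.
exists f.
  have := L2B (lF 0%N) (mFf 0%N).
  by under eq_fun do rewrite subKr.
have bnd m : nu (fun x => F m x - f x) <= 2 * c * 2^-1 ^+ m.
  rewrite -(cvg_lim _ (cFf m))//; apply: limr_le; first exact: cvgP (cFf m).
  near=> n; have mn : (m <= n)%N by near: n; exact: nbhs_infty_ge.
  apply: (le_trans (nuF m n mn)); rewrite lerBlDr lerDl.
  by rewrite !mulr_ge0// exprn_ge0.
apply: (@squeeze_cvgr _ _ _ _ (fun=> 0) (fun m => 2 * c * 2^-1 ^+ m)).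
- by apply: nearW => m; rewrite nu_ge0 bnd.
- exact: cvg_cst.
- rewrite -[X in _ --> X](mulr0 (2 * c)); apply: cvgMr.
  by apply: cvg_expr; rewrite ger0_norm// invf_lt1// ltr1n.
Unshelve. all: by end_near. Qed.

End SquareIntegrable.

(** * Smooth functions and bumps *)

Section SmoothFunctions.
Context {R : realType}.
Local Notation mu := (@lebesgue_measure R).
Local Notation L1 f := (mu.-integrable [set: R] (EFin \o f)).
Implicit Types (f g h phi psi : R -> R) (a b c x : R).

Lemma smoothP phi : smooth phi <->
  (forall x, derivable phi x 1) /\ smooth (derive1 phi).
Proof.
split=> [sm|[d sm] [|k] x]; last by rewrite derive1Sn; exact: sm.
  split=> [x|k x]; first exact: (sm 0%N).
  by rewrite -derive1Sn; exact: sm.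
exact: d.
Qed.

Lemma smooth_derivable phi x : smooth phi -> derivable phi x 1.
Proof. by move=> /smoothP[]. Qed.

Lemma smooth_derive phi : smooth phi -> smooth (derive1 phi).
Proof. by move=> /smoothP[]. Qed.

Lemma smooth_is_derive phi x : smooth phi -> is_derive x 1 phi (derive1 phi x).
Proof.
by move=> s; rewrite derive1E; exact/derivableP/smooth_derivable.
Qed.

Lemma derive1_val f x l : is_derive x 1 f l -> derive1 f x = l.
Proof. by move=> d; rewrite derive1E; exact: derive_val. Qed.

Lemma smooth_continuous phi : smooth phi -> continuous phi.
Proof.
move=> s x; apply: differentiable_continuous; apply/derivable1_diffP.
exact: smooth_derivable.
Qed.

Lemma smooth_mfun phi : smooth phi -> measurable_fun [set: R] phi.
Proof.
by move=> s; apply: continuous_measurable_fun; exact: smooth_continuous.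
Qed.

(** Induction on the order, for all members of the class at once. Proving smoothness then amounts to
    naming a class closed under differentiation; no formula for higher derivatives of products or
    compositions has to be written. *)
Lemma smooth_coind (S : (R -> R) -> Prop) :
  (forall f, S f -> exists2 g, S g & forall x, is_derive x 1 f (g x)) ->
  forall f, S f -> smooth f.
Proof.
move=> HS f Sf k; elim: k f Sf => [|k IH] f Sf x.
  by have [g _ /(_ x) d] := HS f Sf; exact: ex_derive.
rewrite derive1Sn; have [g Sg d] := HS f Sf.
have -> : (derive1 f) = g by apply/funext => y; exact: derive1_val.
exact: IH.
Qed.

Lemma smooth_cst c : smooth (fun=> c).
Proof.
apply: (@smooth_coind (fun f => exists c, f = fun=> c)); last by exists c.
move=> _ [e ->]; exists (fun=> 0); first by exists 0.
by move=> x; exact: is_derive_cst.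
Qed.

Lemma smoothD f g : smooth f -> smooth g -> smooth (fun x => f x + g x).
Proof.
move=> sf sg; apply: (@smooth_coind (fun h => exists f g,
  [/\ smooth f, smooth g & h = (fun x => f x + g x)])); last by exists f, g.
move=> _ [p [q [sp sq ->]]]; exists (fun x => derive1 p x + derive1 q x).
  by exists (derive1 p), (derive1 q); split; [exact: smooth_derive..|].
move=> x; have := smooth_is_derive x sp; have := smooth_is_derive x sq.
by move=> ? ?; exact: is_deriveD.
Qed.

(** The derivative of a product is a sum of two products, so single products do not form a class
    closed under differentiation, but their finite sums do. *)
Inductive prod_span : (R -> R) -> Prop :=
| prod_spanM f g : smooth f -> smooth g -> prod_span (fun x => f x * g x)
| prod_spanD f g : prod_span f -> prod_span g -> prod_span (fun x => f x + g x).

Lemma is_deriveMx f g x a b : is_derive x 1 f a -> is_derive x 1 g b ->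
  is_derive x 1 (fun y => f y * g y) (a * g x + f x * b).
Proof.
move=> df dg; have dM := is_deriveM df dg; apply: (is_derive_eq dM).
by rewrite /GRing.scale/=; ring.
Qed.

Lemma smoothM f g : smooth f -> smooth g -> smooth (fun x => f x * g x).
Proof.
move=> sf sg; apply: (@smooth_coind prod_span); last exact: prod_spanM.
move=> h; elim=> {h} [p q sp sq|p q _ [p' Sp dp] _ [q' Sq dq]].
  exists (fun x => derive1 p x * q x + p x * derive1 q x).
    by apply: prod_spanD; apply: prod_spanM; [exact: smooth_derive|by []|by []|exact: smooth_derive].
  by move=> x; apply: is_deriveMx; exact: smooth_is_derive.
exists (fun x => p' x + q' x); first exact: prod_spanD.
by move=> x; have := dp x; have := dq x => ? ?; exact: is_deriveD.
Qed.

Lemma smoothZ c f : smooth f -> smooth (fun x => c * f x).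
Proof. by move=> sf; apply: smoothM; [exact: smooth_cst|exact: sf]. Qed.

Lemma smoothB f g : smooth f -> smooth g -> smooth (fun x => f x - g x).
Proof.
move=> sf sg; under eq_fun do rewrite -mulN1r.
by apply: smoothD; [|exact: smoothZ].
Qed.

Lemma is_derive_affine f a b x l : is_derive (a * x + b) 1 f l ->
  is_derive x 1 (fun y => f (a * y + b)) (a * l).
Proof.
move=> df; rewrite mulrC; apply: (@is_derive1_comp _ f (fun y => a * y + b)) => //.
have dD := is_deriveD (is_deriveZ a (is_derive_id x 1)) (is_derive_cst b x 1).
apply: (is_derive_eq dD).
by rewrite addr0 /GRing.scale/= mulr1.
Qed.

Lemma smooth_affine f a b : smooth f -> smooth (fun x => f (a * x + b)).
Proof.
move=> sf; apply: (@smooth_coind (fun h => exists c f, smooth f /\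
  h = (fun x => c * f (a * x + b)))); last first.
  by exists 1, f; split => //; apply/funext => x; rewrite mul1r.
move=> _ [c [p [sp ->]]]; exists (fun x => c * a * derive1 p (a * x + b)).
  by exists (c * a), (derive1 p); split; [exact: smooth_derive|].
move=> x; have d := is_derive_affine (smooth_is_derive (a * x + b) sp).
have dZ := is_deriveZ c d; apply: (is_derive_eq dZ).
by rewrite /GRing.scale/= mulrA.
Qed.

(** The functions x^-k exp(-1/x), extended by zero. All k are needed together, because the
    derivative of [flat k] combines [flat k.+2] and [flat k.+1]. *)
Definition flat (k : nat) (x : R) : R :=
  if 0 < x then x^-1 ^+ k * expR (- x^-1) else 0.

Lemma flat_ge0 k x : 0 <= flat k x.
Proof.
rewrite /flat; case: ifP => // x0.
by rewrite mulr_ge0 ?expR_ge0// exprn_ge0// invr_ge0 ltW.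
Qed.

(** With t = 1/x one has exp t = (exp (t/k))^k >= (t/k)^k; for k = 0 the bound reads 0^0 = 1. *)
Lemma flat_le k x : flat k x <= k%:R ^+ k.
Proof.
rewrite /flat; case: ifP => x0; last by rewrite exprn_ge0.
case: k => [|k].
  by rewrite !expr0 mul1r -expR0 ler_expR lerNl oppr0 invr_ge0 ltW.
rewrite expRN ler_pdivrMr ?expR_gt0//.
have -> : x^-1 = k.+1%:R * (x^-1 / k.+1%:R).
  by rewrite mulrCA mulfV ?mulr1 ?pnatr_eq0.
rewrite expRM_natl !exprMn ler_wpM2l ?exprn_ge0//.
rewrite -exprMn; apply: lerXn2r; rewrite ?nnegrE ?expR_ge0 ?divr_ge0 ?invr_ge0 ?(ltW x0)//.
by apply: le_trans (expR_ge1Dx _); rewrite lerDr.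
Qed.

Lemma flat_pos k x : 0 < x -> flat k x = x^-1 ^+ k * expR (- x^-1).
Proof. by move=> x0; rewrite /flat x0. Qed.

Lemma flat_neg k x : x <= 0 -> flat k x = 0.
Proof. by move=> x0; rewrite /flat ltNge x0. Qed.

Lemma flatS k x : 0 < x -> flat k x = x * flat k.+1 x.
Proof. by move=> x0; rewrite !flat_pos// exprS !mulrA mulfV ?gt_eqF// mul1r. Qed.

Lemma is_derive_near f g x l : (\forall y \near x, f y = g y) ->
  is_derive x 1 f l -> is_derive x 1 g l.
Proof.
move=> fg df; have fg' : {near x, f =1 g} by [].
apply: DeriveDef; first exact: (near_eq_derivable fg').
by rewrite -(near_eq_derive _ fg') derive_val.
Qed.

Lemma flat_derive k x :
  is_derive x 1 (flat k) (flat k.+2 x - k%:R * flat k.+1 x).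
Proof.
have [x0|x0|->] := ltgtP x 0.
- rewrite !flat_neg ?ltW// mulr0 subr0.
  apply: (@is_derive_near (fun=> 0)).
    near=> y; rewrite flat_neg// ltW//; near: y; exact: lt_nbhsl.
- apply: (@is_derive_near (fun y => y^-1 ^+ k * expR (- y^-1))).
    near=> y; rewrite flat_pos//; near: y; exact: lt_nbhsr.
  have dV : is_derive x 1 (fun y : R => y^-1) (- x ^- 2 *: 1).
    by apply: is_deriveV; rewrite gt_eqF.
  have dE : is_derive x 1 (fun y => expR (- y^-1)) (expR (- x^-1) * - (- x ^- 2 *: 1)).
    by apply: is_derive1_comp.
  have := is_deriveX k dV; rewrite exprfctE => dX.
  have dM := is_deriveMx dX dE; apply: (is_derive_eq dM).
  rewrite !flat_pos// /GRing.scale/= mulr1 -exprVn.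
  case: k {dX dM} => [|k]; first by rewrite /= !mul0r; ring.
  by rewrite /= -mulr_natr !exprS; ring.
(* At the origin, two applications of [flatS] turn the difference quotient for h > 0 into h times
   [flat k.+2 h], and the uniform bound on [flat k.+2] sends it to 0. *)
- rewrite !flat_neg// mulr0 subr0.
  have cv : h^-1 *: ((flat k \o shift (0:R)) (h *: 1) - flat k 0) @[h --> (0:R)^'] --> (0 : R).
    apply/cvgr0Pnorm_le => e e0.
    have C0 : 0 < k.+2%:R ^+ k.+2 :> R by rewrite exprn_gt0.
    near=> h.
    rewrite /= (flat_neg _ (lexx 0)) subr0 addr0 /GRing.scale/= mulr1.
    have [h0|h0] := leP h 0; first by rewrite flat_neg// mulr0 normr0 ltW.
    rewrite flatS// mulKf ?gt_eqF// flatS// ger0_norm; last first.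
      by rewrite mulr_ge0 ?flat_ge0// ltW.
    apply: (@le_trans _ _ (h * k.+2%:R ^+ k.+2)).
      by rewrite ler_wpM2l ?flat_le// ltW.
    rewrite -ler_pdivlMr// ltW// (le_lt_trans (ler_norm h))//.
    by near: h; apply: dnbhs0_lt; rewrite divr_gt0.
  by apply: DeriveDef; [exact: cvgP cv|exact: cvg_lim cv].
Unshelve. all: by end_near. Qed.

Inductive flat_span : (R -> R) -> Prop :=
| flat_span1 k : flat_span (flat k)
| flat_spanZ c f : flat_span f -> flat_span (fun x => c * f x)
| flat_spanD f g : flat_span f -> flat_span g -> flat_span (fun x => f x + g x).

Lemma smooth_flat k : smooth (flat k).
Proof.
apply: (@smooth_coind flat_span); last exact: flat_span1.
move=> h; elim=> {h} [n|c f _ [f' Sf df]|f g _ [f' Sf df] _ [g' Sg dg]].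
- exists (fun x => flat n.+2 x + (- n%:R) * flat n.+1 x).
    by apply: flat_spanD; [|apply: flat_spanZ]; exact: flat_span1.
  by move=> x; rewrite mulNr; exact: flat_derive.
- exists (fun x => c * f' x); first exact: flat_spanZ.
  by move=> x; have := df x => ?; exact: is_deriveZ.
- exists (fun x => f' x + g' x); first exact: flat_spanD.
  by move=> x; have := df x; have := dg x => ? ?; exact: is_deriveD.
Qed.

Definition bump x := flat 0 x * flat 0 (1 - x).

Lemma smooth_bump : smooth bump.
Proof.
apply: smoothM; first exact: smooth_flat.
under eq_fun do rewrite -mulN1r addrC.
by apply: smooth_affine; exact: smooth_flat.
Qed.

Lemma bump_ge0 x : 0 <= bump x.
Proof. by rewrite mulr_ge0// flat_ge0. Qed.

Lemma bump_out x : x \notin `[0, 1] -> bump x = 0.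
Proof.
rewrite in_itv/= negb_and -!ltNge /bump => /orP[x0|x1].
  by rewrite flat_neg ?mul0r// ltW.
by rewrite mulrC flat_neg ?mul0r// subr_le0 ltW.
Qed.

(** [flat 0] is at most 1 and its derivative [flat 2] at most 2^2, so the two terms of the Leibniz
    rule give 8 = 4 + 4. *)
Lemma bump_bound x : `|bump x| <= 1 /\ `|derive1 bump x| <= 8.
Proof.
have F0 y : `|flat 0 y| <= 1.
  by rewrite ger0_norm ?flat_ge0//; have := flat_le 0 y; rewrite expr0.
have F2 y : `|flat 2 y| <= 4.
  by rewrite ger0_norm ?flat_ge0// (le_trans (flat_le 2 y))// -natrX ler_nat.
split; first by rewrite /bump normrM mulr_ile1.
have d1 := flat_derive 0 x.
have := is_derive_affine (a := -1) (b := 1) (x := x) (flat_derive 0 (-1 * x + 1)).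
have -> : (fun y => flat 0 (-1 * y + 1)) = (fun y => flat 0 (1 - y)).
  by apply/funext => y; rewrite mulN1r addrC.
move=> d2.
rewrite (derive1_val (is_deriveMx d1 d2)) !mul0r !subr0 mulN1r addrC.
rewrite (le_trans (ler_normD _ _))// (_ : 8 = 4 + 4); last by ring.
rewrite mulN1r mulrN normrN !normrM lerD//.
  by rewrite -[4]mul1r ler_pM.
by rewrite -[4]mulr1 ler_pM.
Qed.

Lemma L1_supp f a b C : measurable_fun [set: R] f ->
  (forall x, `|f x| <= C) -> (forall x, x \notin `[a, b] -> f x = 0) -> L1 f.
Proof.
move=> mf fC f0; apply: (@L1_le _ _ (fun x => C * \1_`[a, b] x)) => //.
  by apply: L1Z; exact: integrable_indic_itv.
apply: ae_all => x; have [xab|xab] := boolP (x \in `[a, b]).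
  by rewrite indicE mem_set// mulr1.
by rewrite f0// normr0 indicE memNset ?mulr0//; exact/negP.
Qed.

Lemma L1_bump : L1 bump.
Proof.
apply: (@L1_supp _ 0 1 1); last exact: bump_out.
  by apply: smooth_mfun; exact: smooth_bump.
by move=> x; have [] := bump_bound x.
Qed.

Definition bump_prim x := \int[mu]_(t in `]-oo, x]) bump t.

Lemma bump_prim_derive x : is_derive x 1 bump_prim (bump x).
Proof.
have [] := @continuous_FTC1 R bump -oo%O x (x + 1).
- by rewrite ltrDl.
- by apply: integrableS L1_bump.
- exact: ltNyr.
- exact: smooth_continuous smooth_bump x.
by move=> d e; apply: DeriveDef; [exact: d|rewrite -derive1E].
Qed.

Lemma bump_prim_le0 x : x <= 0 -> bump_prim x = 0.
Proof.
move=> x0; rewrite /bump_prim -[RHS](Rintegral_set0 mu bump) Rintegral_mkcond.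
rewrite [RHS]Rintegral_mkcond; apply: eq_Rintegral => y _.
rewrite !patchE in_set0; case: ifP => //; rewrite inE/= in_itv/= => yx.
by rewrite /bump flat_neg ?mul0r// (le_trans yx).
Qed.

Lemma bump_prim_ge1 x : 1 <= x -> bump_prim x = \int[mu]_t bump t.
Proof.
move=> x1; rewrite /bump_prim Rintegral_mkcond; apply: eq_Rintegral => y _.
rewrite patchE; case: ifPn => //; rewrite notin_setE/= in_itv/= => /negP.
rewrite -ltNge => xy; rewrite bump_out// in_itv/= negb_and -!ltNge.
by rewrite (le_lt_trans x1 xy) orbT.
Qed.

Lemma bump_prim_itv x : 0 <= bump_prim x <= \int[mu]_t bump t.
Proof.
rewrite /bump_prim Rintegral_ge0/=; last by move=> y _; exact: bump_ge0.
rewrite Rintegral_mkcond; apply: Int_le; last 2 first.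
- exact: L1_bump.
- by apply: ae_all => y; rewrite patchE; case: ifP => // _; exact: bump_ge0.
have := (integrable_mkcond (mu := mu) (EFin \o bump) (measurable_itv `]-oo, x])).1.
rewrite restrict_EFin; apply.
exact: integrableS L1_bump.
Qed.

(** Were the integral zero, the primitive would vanish identically, and so would its derivative
    [bump], which is positive at 1/2. *)
Lemma int_bump_gt0 : 0 < \int[mu]_t bump t.
Proof.
rewrite lt_neqAle Int_ge0 ?andbT; last exact: bump_ge0.
apply/eqP => c0.
have F0 x : bump_prim x = 0.
  by have := bump_prim_itv x; rewrite -c0 -eq_le eq_sym => /eqP.
have := derive1_val (bump_prim_derive 2^-1).
rewrite (_ : bump_prim = fun=> 0); last exact/funext.
rewrite derive1_cst => /esym/eqP; rewrite /bump mulf_eq0 !flat_pos ?expr0 ?mul1r.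
- by rewrite !gt_eqF ?expR_gt0.
- by rewrite subr_gt0 invf_lt1// ltr1n.
- by rewrite invr_gt0.
Qed.

(** The primitive of [bump], divided by the total mass of [bump]. *)
Lemma smooth_step_exists : exists s : R -> R,
  [/\ smooth s, forall x, x <= 0 -> s x = 0, forall x, 1 <= x -> s x = 1,
      forall x, 0 <= s x <= 1 &
      exists2 C, 0 < C & forall x, `|derive1 s x| <= C /\
                                   `|derive1 (derive1 s) x| <= C].
Proof.
have c0 := int_bump_gt0; set c := \int[mu]_t bump t in c0.
have d1 x : is_derive x 1 (fun x => c^-1 * bump_prim x) (c^-1 * bump x).
  by have := bump_prim_derive x => ?; exact: is_deriveZ.
have e1 : derive1 (fun x => c^-1 * bump_prim x) = fun x => c^-1 * bump x.
  by apply/funext => x; exact: derive1_val.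
have d2 x : derive1 (fun x => c^-1 * bump x) x = c^-1 * derive1 bump x.
  by apply: derive1_val; have := smooth_is_derive x smooth_bump => ?; exact: is_deriveZ.
exists (fun x => c^-1 * bump_prim x); split.
- apply/smoothP; split=> [x|]; first exact: ex_derive.
  by rewrite e1; apply: smoothZ; exact: smooth_bump.
- by move=> x x0; rewrite bump_prim_le0// mulr0.
- by move=> x x1; rewrite bump_prim_ge1// mulVf// gt_eqF.
- move=> x; have /andP[? ?] := bump_prim_itv x.
  rewrite mulr_ge0 ?invr_ge0 ?(ltW c0)//= mulrC ler_pdivrMr// mul1r.
  by [].
- exists (c^-1 * 8); first by rewrite mulr_gt0// invr_gt0.
  move=> x; have [b1 b2] := bump_bound x.
  have ci : 0 <= c^-1 by rewrite invr_ge0 ltW.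
  rewrite e1 d2 ![`|c^-1 * _|]normrM (ger0_norm ci); split; apply: ler_wpM2l => //.
  by rewrite (le_trans b1)// ler1n.
Qed.

End SmoothFunctions.

(** * Weak derivatives *)

(* Unfolding smooth makes conversion diverge. *)
Opaque smooth.

Section WeakDerivatives.
Context {R : realType}.
Local Notation mu := (@lebesgue_measure R).
Local Notation L1 f := (mu.-integrable [set: R] (EFin \o f)).
Local Notation loc f := (locally_integrable [set: R] f).
Implicit Types (f g h v w F G phi : R -> R) (a b c x y : R).

Lemma squeeze_dist (u w : nat -> R) (l : R) : (forall n, `|u n - l| <= w n) ->
  w n @[n --> \oo] --> (0 : R) -> u n @[n --> \oo] --> l.
Proof.
move=> uw /cvgr0Pnorm_le w0; apply/cvgrPdist_le => e e0.
apply: filterS (w0 e e0) => n wn.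
by rewrite distrC (le_trans (uw n))// (le_trans (ler_norm _)).
Qed.

Lemma loc_mfun f : loc f -> measurable_fun [set: R] f.
Proof. by case. Qed.

Lemma loc_itv f a b : loc f -> mu.-integrable `[a, b] (EFin \o f).
Proof.
move=> [mf _ H]; apply/integrableP; split.
  by apply: measurable_funTS; exact: mfun_EFin.
by apply: H => //; exact: segment_compact.
Qed.

Lemma loc_restr f a b : loc f -> L1 (f \_ `[a, b]).
Proof.
move=> lf; have := (integrable_mkcond (mu := mu) (EFin \o f) (measurable_itv `[a, b])).1.
by rewrite restrict_EFin; apply; exact: loc_itv.
Qed.

Lemma L1_loc f : L1 f -> loc f.
Proof. by move=> lf; apply: open_integrable_locally => //; exact: openT. Qed.

Lemma loc_le f g : measurable_fun [set: R] f -> loc g ->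
  {ae mu, forall x, `|f x| <= g x} -> loc f.
Proof.
move=> mf [mg _ lg] fg; split => //; first exact: openT.
move=> K KT cK; apply: le_lt_trans (lg K KT cK).
have mK := compact_measurable cK.
apply: ae_ge0_le_integral => //.
- by apply: measurable_funTS; exact: (mfun_EFin (mfun_norm mf)).
- by apply: measurable_funTS; exact: (mfun_EFin (mfun_norm mg)).
- by apply: aeS fg => x fgx _; rewrite lee_fin (le_trans fgx)// ler_norm.
Qed.

Lemma continuous_loc f : continuous f -> loc f.
Proof.
move=> cf; split; [exact: continuous_measurable_fun|exact: openT|].
move=> K _ cK.
have /integrableP[_] // : mu.-integrable K (EFin \o f).
by apply: continuous_compact_integrable => //; exact: continuous_subspaceT.
Qed.

Lemma locM_L1 f (k : R -> R) a b (C : R) : loc f -> measurable_fun [set: R] k ->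
  (forall x, `|k x| <= C) -> (forall x, x \notin `[a, b] -> k x = 0) ->
  L1 (fun x => f x * k x).
Proof.
move=> lf mk kC k0.
have -> : (fun x => f x * k x) = (fun x => k x * (f \_ `[a, b]) x).
  apply/funext => x; rewrite mulrC patchE; case: ifPn => //.
  by rewrite notin_setE => /negP xab; rewrite k0 ?mul0r.
by apply: (L1_mulbd mk _ (loc_restr _ _ lf)); exact: ae_all kC.
Qed.

Lemma test_bound phi : test_function phi -> exists a b (C : R),
  [/\ forall x, x \notin `[a, b] -> phi x = 0 & forall x, `|phi x| <= C].
Proof.
move=> [sp [a [b p0]]]; have cp := smooth_continuous sp.
have : compact (phi @` `[a, b]).
  apply: continuous_compact; last exact: segment_compact.
  exact: continuous_subspaceT.
move=> /compact_bounded [M [_ HM]].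
exists a, b, (`|M| + 1); split => // x.
have [xab|xab] := boolP (x \in `[a, b]).
  apply: (HM (`|M| + 1)); last by exists x.
  by rewrite (le_lt_trans (ler_norm M))// ltrDl.
by rewrite p0// normr0 addr_ge0.
Qed.

Lemma test_derive phi : test_function phi -> test_function (derive1 phi).
Proof.
move=> [sp [a [b p0]]]; split; first exact: smooth_derive.
exists a, b => x xab; apply: derive1_val.
apply: (@is_derive_near _ (fun=> 0)).
have : nbhs x (~` `[a, b]%classic).
  apply: open_nbhs_nbhs; split; last exact/negP.
  by apply: closed_openC; exact: itv_closed.
by apply: filterS => y /negP yab; rewrite p0.
Qed.

Lemma testM phi f : test_function phi -> smooth f ->
  test_function (fun x => f x * phi x).
Proof.
move=> [sp [a [b p0]]] sf; split; first exact: smoothM.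
by exists a, b => x xab; rewrite p0// mulr0.
Qed.

Lemma test_L1 f phi : loc f -> test_function phi -> L1 (fun x => f x * phi x).
Proof.
move=> lf tp; have [a [b [C [p0 pC]]]] := test_bound tp.
apply: (locM_L1 lf _ pC p0); case: tp => sp _; exact: smooth_mfun.
Qed.

Lemma int_derive phi a b : smooth phi -> a < b ->
  \int[mu]_(x in `[a, b]) derive1 phi x = phi b - phi a.
Proof.
move=> sp ab; rewrite /Rintegral (@continuous_FTC2 _ _ phi)//.
- exact: continuous_subspaceT (smooth_continuous (smooth_derive sp)).
- split.
  + by move=> x _; exact: smooth_derivable.
  + by apply: cvg_at_right_filter; exact: smooth_continuous.
  + by apply: cvg_at_left_filter; exact: smooth_continuous.
Qed.

(** * Steep steps, Lebesgue points and the fundamental theorem of calculus *)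

Definition step : R -> R := projT1 (cid (@smooth_step_exists R)).

Lemma stepP : [/\ smooth step, forall x, x <= 0 -> step x = 0,
  forall x, 1 <= x -> step x = 1, forall x, 0 <= step x <= 1 &
  exists2 C, 0 < C & forall x, `|derive1 step x| <= C /\
                               `|derive1 (derive1 step) x| <= C].
Proof. exact: (projT2 (cid (@smooth_step_exists R))). Qed.

(** It climbs from 0 to 1 on [a, a + 1/n]. Its derivative has integral 1, support in that interval
    and size O(n): a one-sided approximate identity at [a]. *)
Definition nstep n a x := step (n * (x - a)).

Lemma smooth_nstep n a : smooth (nstep n a).
Proof.
have [ss _ _ _ _] := stepP.
rewrite /nstep; under eq_fun do rewrite mulrBr.
exact: (smooth_affine (a := n) (b := - (n * a)) ss).
Qed.

Lemma derive_nstep n a x : derive1 (nstep n a) x = n * derive1 step (n * (x - a)).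
Proof.
have [ss _ _ _ _] := stepP.
apply: derive1_val.
have := is_derive_affine (a := n) (b := - (n * a)) (smooth_is_derive (n * x - n * a) ss).
by rewrite -mulrBr /nstep; under eq_fun do rewrite -mulrBr.
Qed.

Lemma nstep_le n a x : 0 < n -> x <= a -> nstep n a x = 0.
Proof.
have [_ s0 _ _ _] := stepP => n0 xa.
by rewrite /nstep s0// pmulr_rle0// subr_le0.
Qed.

Lemma nstep_ge n a x : 0 < n -> a + n^-1 <= x -> nstep n a x = 1.
Proof.
have [_ _ s1 _ _] := stepP => n0 xa.
by rewrite /nstep s1// mulrC -ler_pdivrMr// div1r lerBrDl.
Qed.

Lemma nstep_itv n a x : 0 <= nstep n a x <= 1.
Proof. by have [_ _ _ H _] := stepP; exact: H. Qed.

Lemma nstep_test n a b : 0 < n -> a <= b ->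
  test_function (fun x => nstep n a x - nstep n b x).
Proof.
move=> n0 ab; split; first by apply: smoothB; exact: smooth_nstep.
exists a, (b + n^-1) => x; rewrite in_itv/= negb_and -!ltNge => /orP[xa|xb].
  by rewrite !nstep_le ?subrr// ltW// (lt_le_trans xa).
rewrite !nstep_ge ?subrr ?ltW//.
by apply: le_lt_trans xb; rewrite lerD2r.
Qed.

Lemma dnstep_out n a x : 0 < n -> x \notin `[a, a + n^-1] ->
  derive1 (nstep n a) x = 0.
Proof.
move=> n0; rewrite in_itv/= negb_and -!ltNge => /orP[xa|ax].
  apply: derive1_val; apply: (@is_derive_near _ (fun=> 0)).
  by near=> y; rewrite nstep_le// ltW//; near: y; exact: lt_nbhsl.
apply: derive1_val; apply: (@is_derive_near _ (fun=> 1)).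
by near=> y; rewrite nstep_ge// ltW//; near: y; exact: lt_nbhsr.
Unshelve. all: by end_near. Qed.

Lemma dnstep_test n a : 0 < n -> test_function (derive1 (nstep n a)).
Proof.
move=> n0; split; first by apply: smooth_derive; exact: smooth_nstep.
by exists a, (a + n^-1) => x; exact: dnstep_out.
Qed.

Lemma dnstep_bound : exists2 C, 0 < C &
  forall n a x, 0 <= n -> `|derive1 (nstep n a) x| <= n * C.
Proof.
have [_ _ _ _ [C C0 HC]] := stepP; exists C => // n a x n0.
by rewrite derive_nstep normrM ger0_norm// ler_wpM2l//; have [] := HC (n * (x - a)).
Qed.

Lemma L1_test phi : test_function phi -> L1 phi.
Proof.
move=> tp; have [a [b [C [p0 pC]]]] := test_bound tp.
by apply: (L1_supp _ pC p0); case: tp => sp _; exact: smooth_mfun.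
Qed.

Lemma int_dnstep n a : 0 < n -> \int[mu]_x derive1 (nstep n a) x = 1.
Proof.
move=> n0.
have -> : \int[mu]_x derive1 (nstep n a) x =
    \int[mu]_(x in `[a, a + n^-1]) derive1 (nstep n a) x.
  rewrite [RHS]Rintegral_mkcond; apply: eq_Rintegral => x _.
  by rewrite patchE; case: ifPn => //; rewrite notin_setE => /negP /dnstep_out ->.
rewrite int_derive ?ltrDl ?invr_gt0//; last exact: smooth_nstep.
by rewrite nstep_ge// nstep_le// subr0.
Qed.

Lemma lebesgue_ptP f a : loc f -> lebesgue_pt f a ->
  n.+1%:R * \int[mu]_(y in `[a, a + n.+1%:R^-1]) `|f y - f a| @[n --> \oo] --> (0 : R).
Proof.
move=> lf; rewrite /lebesgue_pt => la.
have lfa : loc (fun x => f x - f a).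
  apply: locally_integrableB => //; apply: continuous_loc; exact: cst_continuous.
have davgE r : 0 < r -> davg f a r =
    ((r *+ 2)^-1 * \int[mu]_(y in ball a r) `|f y - f a|)%:E.
  move=> r0; rewrite /davg /iavg lebesgue_measure_ball ?ltW// inver.
  rewrite mulrn_eq0/= gt_eqF// EFinM; congr (_ * _)%E.
  rewrite /Rintegral fineK//.
  have ib : mu.-integrable (ball a r) (EFin \o (fun y => `|f y - f a|)); last first.
    by apply: integrable_fin_num ib; exact: measurable_ball.
  apply: (@integrableS _ _ _ mu `[a - r, a + r] (ball a r)).
  - exact: measurable_itv.
  - exact: measurable_ball.
  - by rewrite ball_itv => x; exact: subset_itv_oo_cc.
  - by apply: integrable_norm => //; exact: loc_itv.
(* Lebesgue points are defined through centred balls. The open ball with twice the length of the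
   one-sided interval as radius contains that closed interval; its length is four times as large,
   whence the factor 4. *)
pose r n : R := 2 * n.+1%:R^-1.
have r0 n : 0 < r n by rewrite mulr_gt0.
have cr : davg f a (r n) @[n --> \oo] --> (0 : \bar R)%E.
  apply: cvg_comp la => A h.
  have c0 : r n @[n --> \oo] --> (0 : R).
    by rewrite -(mulr0 2); apply: cvgMr; exact: cvg_harmonic.
  by apply: (@filterS _ \oo _ (fun n => 0 < r n -> A (r n)) (fun n => A (r n)) _ (c0 _ h)) => n; apply; exact: r0.
have {cr} : (r n *+ 2)^-1 * \int[mu]_(y in ball a (r n)) `|f y - f a| @[n --> \oo] --> (0 : R).
  by move: cr; under eq_fun do rewrite davgE//; move=> /fine_cvgP[].
move=> cr.
have i0 (A : set R) : 0 <= \int[mu]_(y in A) `|f y - f a| by apply: Rintegral_ge0.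
apply: (@squeeze_dist _ (fun n => 4 * ((r n *+ 2)^-1 * \int[mu]_(y in ball a (r n)) `|f y - f a|))).
  move=> n; rewrite subr0 ger0_norm ?mulr_ge0// mulrA.
  have -> : 4 * (r n *+ 2)^-1 = n.+1%:R.
    have N0 : n.+1%:R != 0 :> R by rewrite pnatr_eq0.
    by rewrite /r -mulr_natr; move: N0; set N := n.+1%:R => N0; field.
  rewrite ler_wpM2l// Rintegral_mkcond [leRHS]Rintegral_mkcond.
  have bi : ball a (r n) `<=` `[a - r n, a + r n].
    by rewrite ball_itv => x; exact: subset_itv_oo_cc.
  have L A b c : measurable A -> A `<=` `[b, c] -> L1 ((fun y => `|f y - f a|) \_ A).
    move=> mA Ab.
    have := (integrable_mkcond (mu := mu) (EFin \o (fun y => `|f y - f a|)) mA).1.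
    rewrite restrict_EFin; apply; apply: (@integrableS _ _ _ mu `[b, c] A) => //.
    by apply: integrable_norm => //; exact: loc_itv.
  apply: Int_le; [exact: (L _ a (a + n.+1%:R^-1))|exact: (L _ _ _ (measurable_ball _ _) bi)|apply: ae_all => x].
  rewrite !patchE; case: ifPn => [|_]; last by case: ifP => _; [exact: normr_ge0|exact: lexx].
  rewrite inE/= in_itv/= => /andP[ax xn]; rewrite mem_set//.
  rewrite ball_itv/= in_itv/= (lt_le_trans _ ax) ?gtrBl//=.
  by rewrite (le_lt_trans xn)// ltrD2l /r ltr_pMl// ltr1n.
by rewrite -[X in _ --> X](mulr0 4); apply: cvgMr.
Qed.

(** The kernel has mass 1 and size at most C n on an interval of length 1/n, so the error is at most
    C times the mean of |f - f a| over that interval, which vanishes at a Lebesgue point. *)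
Lemma dnstep_cvg f a : loc f -> lebesgue_pt f a ->
  \int[mu]_x (f x * derive1 (nstep n.+1%:R a) x) @[n --> \oo] --> f a.
Proof.
move=> lf la; have [C C0 HC] := dnstep_bound.
apply: (@squeeze_dist _
  (fun n => C * (n.+1%:R * \int[mu]_(y in `[a, a + n.+1%:R^-1]) `|f y - f a|))); last first.
  by rewrite -[X in _ --> X](mulr0 C); apply: cvgMr; exact: lebesgue_ptP.
move=> n; set N := n.+1%:R; have N0 : 0 < N by rewrite ltr0n.
have tp := dnstep_test a N0.
have lfa : loc (fun x => f x - f a).
  apply: locally_integrableB => //; apply: continuous_loc; exact: cst_continuous.
have lK := test_L1 lfa tp.
have -> : \int[mu]_x (f x * derive1 (nstep N a) x) - f a =
    \int[mu]_x ((f x - f a) * derive1 (nstep N a) x).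
  under [RHS]eq_Rintegral do rewrite mulrBl.
  rewrite IntB; [|exact: test_L1|exact/L1Z/L1_test].
  by rewrite IntZ ?int_dnstep ?mulr1//; exact: L1_test.
apply: (le_trans (Int_norm lK)).
have lr : L1 (fun x => `|((fun x => f x - f a) \_ `[a, a + N^-1]) x|).
  by apply: L1_norm; exact: loc_restr.
rewrite mulrA [C * N]mulrC [X in _ * X]Rintegral_mkcond.
have -> : (fun y => `|f y - f a|) \_ `[a, a + N^-1] =
    (fun x => `|((fun x => f x - f a) \_ `[a, a + N^-1]) x|).
  by rewrite restrict_normr.
rewrite -IntZ//; apply: Int_le; [exact: L1_norm|exact: L1Z|].
apply: ae_all => x; rewrite normrM patchE.
case: ifPn => [_|].
  rewrite [leLHS]mulrC; apply: ler_pM => //; apply: HC; exact: ltW.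
by rewrite notin_setE => /negP/(dnstep_out N0) ->; rewrite normr0 mulr0 mulr_ge0// mulr_ge0// ltW.
Qed.

(** Tested with the approximate identities at x, the difference v - w integrates to zero; at a
    Lebesgue point these integrals converge to v x - w x. *)
Lemma wderiv_uniq f v w : is_wderiv f v -> is_wderiv f w ->
  {ae mu, forall x, v x = w x}.
Proof.
move=> [lf lv fv] [_ lw fw]; have lvw := locally_integrableB lv lw.
apply: aeS (lebesgue_differentiation lvw) => x xl.
have cv := dnstep_cvg lvw xl.
apply/eqP; rewrite -subr_eq0; apply/eqP.
have E n : \int[mu]_y ((v \- w)%R y * derive1 (nstep n.+1%:R x) y) = 0.
  have tp := @dnstep_test n.+1%:R x (ltr0Sn _ _).
  under eq_Rintegral do rewrite mulrBl.
  rewrite IntB; [|exact: test_L1|exact: test_L1].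
  have := fv _ tp; have := fw _ tp => -> /oppr_inj ->.
  by rewrite subrr.
have c0 : \int[mu]_y ((v \- w)%R y * derive1 (nstep n.+1%:R x) y) @[n --> \oo] --> (0 : R).
  by under eq_fun do rewrite E; exact: cvg_cst.
exact: (cvg_unique _ cv c0).
Qed.

(** The test functions [nstep n a - nstep n b] converge to the indicator of ]a, b], while their
    derivatives pick out f a - f b at Lebesgue points; the definition of the weak derivative passes
    to the limit. *)
Lemma wderiv_ftc f v a b : is_wderiv f v -> a < b -> lebesgue_pt f a ->
  lebesgue_pt f b -> f b - f a = \int[mu]_(x in `[a, b]) v x.
Proof.
move=> [lf lv fv] ab la lb.
pose phi n x := nstep n.+1%:R a x - nstep n.+1%:R b x.
have tphi n : test_function (phi n) by apply: nstep_test => //; exact: ltW.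
have dphi n x : derive1 (phi n) x =
    derive1 (nstep n.+1%:R a) x - derive1 (nstep n.+1%:R b) x.
  apply: derive1_val.
  have da := smooth_is_derive x (@smooth_nstep n.+1%:R a).
  have db := smooth_is_derive x (@smooth_nstep n.+1%:R b).
  exact: is_deriveB.
have ta n c := @dnstep_test n.+1%:R c (ltr0Sn _ _).
have c1 : \int[mu]_x (f x * derive1 (phi n) x) @[n --> \oo] --> f a - f b.
  have -> : (fun n => \int[mu]_x (f x * derive1 (phi n) x)) =
      (fun n => \int[mu]_x (f x * derive1 (nstep n.+1%:R a) x) -
                \int[mu]_x (f x * derive1 (nstep n.+1%:R b) x)).
    apply/funext => n; rewrite -IntB; [|exact: test_L1|exact: test_L1].
    by apply: eq_Rintegral => x _; rewrite dphi mulrBr.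
  by apply: cvgB; exact: dnstep_cvg.
have c2 : \int[mu]_x (v x * phi n x) @[n --> \oo] -->
    \int[mu]_x (v x * \1_`]a, b] x).
  have lvr := loc_restr a (b + 1) lv.
  apply: (@Int_dominated _ _ _ (fun x => `|(v \_ `[a, b + 1]) x|)).
  - by move=> n; apply: measurable_funM; [exact: loc_mfun|apply: smooth_mfun; case: (tphi n)].
  - by apply: measurable_funM; [exact: loc_mfun|].
  - exact: L1_norm.
  - move=> n; apply: ae_all => x; rewrite normrM patchE.
    case: ifPn => [_|].
      rewrite ler_piMr// ler_norml.
      have /andP[? ?] := nstep_itv n.+1%:R a x.
      have /andP[? ?] := nstep_itv n.+1%:R b x.
      by rewrite /phi; apply/andP; split; lra.
    rewrite notin_setE/= in_itv/= normr0 => /negP; rewrite negb_and -!ltNge => /orP[xa|xb].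
      by rewrite /phi !nstep_le ?subrr ?normr0 ?mulr0// ltW// (lt_trans xa).
    rewrite /phi !nstep_ge ?subrr ?normr0 ?mulr0//.
      apply: le_trans (ltW xb); rewrite lerD2l invf_le1//.
      by rewrite ler1n.
    apply: le_trans (ltW xb); rewrite lerD ?(ltW ab)// invf_le1//.
    by rewrite ler1n.
  - apply: ae_all => x; apply: cvgMr.
    have cs c : nstep n.+1%:R c x @[n --> \oo] --> ((c < x)%R%:R : R).
      have [cx|xc] := ltP c x.
        apply: cvg_near_cst; near=> n; rewrite nstep_ge//.
        rewrite -lerBrDl -[leRHS]invrK lef_pV2 ?posrE ?invr_gt0 ?subr_gt0//.
        apply: (@le_trans _ _ n%:R); last by rewrite ler_nat.
        by near: n; exact: nbhs_infty_ger.
      by apply: cvg_near_cst; apply: nearW => n; rewrite nstep_le.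
    have : phi n x @[n --> \oo] --> ((a < x)%R%:R - (b < x)%R%:R : R).
      by apply: cvgB; exact: cs.
    rewrite indicE mem_setE in_itv/=.
    have -> : ((a < x)%R%:R - (b < x)%R%:R : R) = ((a < x) && (x <= b))%:R.
      rewrite leNgt; case: ltP => ax; case: ltP => bx /=; rewrite ?subr0 ?subrr//.
      by move: (lt_trans ab bx); rewrite ltNge ax.
    by [].
have E : f a - f b = - \int[mu]_x (v x * \1_`]a, b] x).
  rewrite -(cvg_lim _ c1)// -(cvg_lim _ (cvgN c2))//.
  by congr (limn _); apply/funext => n; rewrite fctE fv.
rewrite -opprB E opprK.
have ivab := loc_itv a b lv.
rewrite -[RHS]Rintegral_itv_obnd_cbnd; last by apply: integrableS ivab => //; exact: subset_itv_oc_cc.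
rewrite [RHS]Rintegral_mkcond; apply: eq_Rintegral => x _.
by rewrite patchE indicE; case: ifP => _; rewrite ?mulr1 ?mulr0.
Unshelve. all: by end_near. Qed.

Definition sint v a b : R := if a <= b then \int[mu]_(x in `[a, b]) v x
  else - \int[mu]_(x in `[b, a]) v x.

Lemma sint_le v a b : a <= b -> sint v a b = \int[mu]_(x in `[a, b]) v x.
Proof. by rewrite /sint => ->. Qed.

Lemma int_cat v a b c : loc v -> a <= b -> b <= c ->
  \int[mu]_(x in `[a, b]) v x + \int[mu]_(x in `[b, c]) v x =
  \int[mu]_(x in `[a, c]) v x.
Proof.
move=> lv ab bc; have := @Rintegral_itvB _ v (BLeft a) (BRight c) b.
rewrite !bnd_simp => /(_ (loc_itv a c lv) ab bc).
rewrite Rintegral_itv_obnd_cbnd; last first.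
  by apply: integrableS (loc_itv b c lv) => //; exact: subset_itv_oc_cc.
by move=> <-; rewrite addrC subrK.
Qed.

Lemma sint_cat v a b c : loc v -> sint v a b + sint v b c = sint v a c.
Proof.
move=> lv; have H a' b' c' := @int_cat v a' b' c' lv.
have Z y : \int[mu]_(x in `[y, y]) v x = 0 by rewrite set_itv1 Rintegral_set1.
rewrite /sint; case: (leP a b) => ab; case: (leP b c) => bc; case: (leP a c) => ac.
- exact: H.
- by move: (le_trans ab bc); rewrite leNgt ac.
- by have := H a c b ac (ltW bc); lra.
- by have := H c a b (ltW ac) ab; lra.
- by have := H b a c (ltW ab) ac; lra.
- by have := H b c a bc (ltW ac); lra.
- by move: (lt_trans bc ab); rewrite ltNge ac.
- by have := H c b a (ltW bc) (ltW ab); lra.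
Qed.

Lemma lebesgue_pt_exists f : loc f -> exists x, lebesgue_pt f x.
Proof.
move=> /lebesgue_differentiation lf; apply: contrapT => /forallNP nf.
case: lf => [N [mN N0 sN]].
have : (mu [set: R] <= mu N)%E.
  by apply: le_measure; rewrite ?inE// => x _; apply: sN; exact: nf.
rewrite N0 => h.
have : (mu (`[0%R, 1%R]%classic : set R) <= 0)%E.
  by apply: le_trans h; apply: le_measure; rewrite ?inE.
by rewrite lebesgue_measure_itv/= lte_fin ltr01 oppr0 adde0 lee_fin ler10.
Qed.

(** The integrated form of F' = v, suited to v that are merely locally integrable: no pointwise
    derivative of F is involved. *)
Definition primitive F v := forall a b, a <= b ->
  F b - F a = \int[mu]_(x in `[a, b]) v x.

Lemma primitive_continuous F v : loc v -> primitive F v -> continuous F.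
Proof.
move=> lv Fv x.
have x1 : x - 1 < x + 1 by lra.
have := parameterized_integral_continuous (ltW x1) (loc_itv _ _ lv).
move=> /(continuous_within_itvP _ x1)[+ _ _].
have xi : x \in `](x - 1), (x + 1)[ by rewrite in_itv/= ltrBlDr !ltrDl ltr01.
move=> /(_ x xi) cx.
have {cx} cF : {for x, continuous (fun y => F (x - 1) + parameterized_integral mu (x - 1) y v)}.
  by apply: cvgD => //; exact: cvg_cst.
have E y : x - 1 <= y -> F (x - 1) + parameterized_integral mu (x - 1) y v = F y.
  by move=> xy; rewrite /parameterized_integral -Fv// addrC subrK.
rewrite /prop_for /continuous_at -(E x); last by lra.
apply: cvg_trans cF; apply: near_eq_cvg; near=> y; apply: E.
by apply: ltW; near: y; apply: lt_nbhsr; lra.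
Unshelve. all: by end_near. Qed.

(** Integrate v starting from a Lebesgue point c of f and add f c; by [wderiv_ftc] the result agrees
    with f at every Lebesgue point. *)
Lemma wderiv_rep f v : is_wderiv f v -> exists F,
  [/\ {ae mu, forall x, f x = F x}, continuous F & primitive F v].
Proof.
move=> fv; have [lf lv _] := fv.
have [c fc] := lebesgue_pt_exists lf.
pose F x := f c + sint v c x.
have pF : primitive F v.
  move=> a b ab; rewrite -(sint_le _ ab) -(sint_cat a c b lv) /F.
  have := sint_cat c a c lv; rewrite {3}/sint lexx set_itv1 Rintegral_set1.
  by lra.
exists F; split => //; last exact: (primitive_continuous lv).
apply: aeS (lebesgue_differentiation lf) => x fx; rewrite /F /sint.
case: ltgtP => cx.
- by rewrite -(wderiv_ftc fv)// addrC subrK.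
- by rewrite -(wderiv_ftc fv)//; ring.
- by rewrite cx set_itv1 Rintegral_set1 addr0.
Qed.

End WeakDerivatives.

(** * Sobolev estimates *)

Section SobolevSpaces.
Context {R : realType}.
Local Notation mu := (@lebesgue_measure R).
Local Notation L1 f := (mu.-integrable [set: R] (EFin \o f)).
Local Notation loc f := (locally_integrable [set: R] f).
Implicit Types (f g h v w p q F G phi : R -> R) (a b c x y : R).

Lemma locD f g : loc f -> loc g -> loc (fun x => f x + g x).
Proof. exact: locally_integrableD. Qed.

Lemma locM_cont f g : loc f -> continuous g -> loc (fun x => f x * g x).
Proof.
move=> [mf _ lf] cg; have mg := continuous_measurable_fun cg.
split; [exact: measurable_funM|exact: openT|] => K KT cK.
have mK : measurable (K : set (measurableTypeR R)) by exact: compact_measurable.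
have iK : mu.-integrable K (EFin \o f).
  apply/integrableP; split; last exact: lf.
  by apply: measurable_funTS; exact: mfun_EFin.
have [C HC] : exists C : R, forall x, K x -> `|g x| <= C.
  have : compact (g @` K) by apply: continuous_compact => //; exact: continuous_subspaceT.
  move=> /compact_bounded [M [_ HM]]; exists (`|M| + 1) => x Kx.
  apply: (HM (`|M| + 1)); last by exists x.
  by rewrite (le_lt_trans (ler_norm M))// ltrDl.
have /integrableP[_] // : mu.-integrable K (EFin \o (fun x => f x * g x)).
apply: (le_integrable mK _ _ (integrableZl mK C iK)).
  by apply: measurable_funTS; apply: mfun_EFin; exact: measurable_funM.
move=> x Kx; rewrite /= lee_fin !normrM mulrC ler_wpM2r//.
by rewrite (le_trans (HC x Kx))// ler_norm.
Qed.

Lemma locZr f c : loc f -> loc (fun x => f x * c).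
Proof. by move=> lf; apply: locM_cont => // x; exact: cvg_cst. Qed.

Lemma loc_norm f : loc f -> loc (fun x => `|f x|).
Proof.
move=> [mf oT lf]; split => //; first exact: mfun_norm.
by move=> K KT cK; under eq_integral do rewrite normr_id; exact: lf.
Qed.

Lemma int_le_itv f g a b : loc f -> loc g -> (forall x, x \in `[a, b] -> f x <= g x) ->
  \int[mu]_(x in `[a, b]) f x <= \int[mu]_(x in `[a, b]) g x.
Proof.
move=> lf lg fg; apply: le_Rintegral => //; exact: loc_itv.
Qed.

Lemma int_norm_itv f a b : loc f ->
  `|\int[mu]_(x in `[a, b]) f x| <= \int[mu]_(x in `[a, b]) `|f x|.
Proof. by move=> lf; apply: le_normr_Rintegral => //; exact: loc_itv. Qed.

Lemma intD_itv f g a b : loc f -> loc g ->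
  \int[mu]_(x in `[a, b]) (f x + g x) =
  \int[mu]_(x in `[a, b]) f x + \int[mu]_(x in `[a, b]) g x.
Proof. by move=> lf lg; rewrite RintegralD//; exact: loc_itv. Qed.

Lemma intZr_itv f c a b : loc f ->
  \int[mu]_(x in `[a, b]) (f x * c) = (\int[mu]_(x in `[a, b]) f x) * c.
Proof. by move=> lf; rewrite RintegralZr//; exact: loc_itv. Qed.

Lemma int_ge0_itv f a b : (forall x, 0 <= f x) ->
  0 <= \int[mu]_(x in `[a, b]) f x.
Proof. by move=> f0; apply: Rintegral_ge0. Qed.

Lemma int_sub_itv f a b c d : loc f -> (forall x, 0 <= f x) ->
  a <= c -> c <= d -> d <= b ->
  \int[mu]_(x in `[c, d]) f x <= \int[mu]_(x in `[a, b]) f x.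
Proof.
move=> lf f0 ac cd db.
have H1 := int_cat lf ac (le_trans cd db); have H2 := int_cat lf cd db.
have H3 := int_ge0_itv a c f0; have H4 := int_ge0_itv d b f0.
lra.
Qed.

Section IntegrationByParts.
Variables (F G p q : R -> R).
Hypotheses (lp : loc p) (lq : loc q) (Fp : primitive F p) (Gq : primitive G q).

Let cF : continuous F. Proof. exact: primitive_continuous Fp. Qed.
Let cG : continuous G. Proof. exact: primitive_continuous Gq. Qed.
Let lpq : loc (fun x => `|p x| + `|q x|).
Proof. by apply: locD; exact: loc_norm. Qed.
Let D a b := F b * G b - F a * G a - \int[mu]_(x in `[a, b]) (p x * G x + q x * F x).
Let m a b := \int[mu]_(x in `[a, b]) (`|p x| + `|q x|).

Let m0 a b : 0 <= m a b.
Proof. by apply: int_ge0_itv => x; rewrite addr_ge0. Qed.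

Let lpG : loc (fun x => p x * G x). Proof. exact: locM_cont. Qed.
Let lqF : loc (fun x => q x * F x). Proof. exact: locM_cont. Qed.

Let incr_bound g v a b s t : loc v -> primitive g v ->
  (forall x, `|v x| <= `|p x| + `|q x|) ->
  a <= s -> s <= t -> t <= b -> `|g t - g s| <= m a b.
Proof.
move=> lv gv vb as_ st tb; rewrite gv//.
apply: (le_trans (int_norm_itv _ _ lv)).
apply: (@le_trans _ _ (m s t)).
  by apply: int_le_itv => //; exact: loc_norm.
by apply: int_sub_itv => // x; rewrite addr_ge0.
Qed.

(** Integrating p G(b) + q F(a) gives exactly the boundary term, so the defect [D] involves only
    increments of F and G, each at most [m a b]. *)
Let D_bound a b : a <= b -> `|D a b| <= m a b ^+ 2.
Proof.
move=> ab.
have lG : loc (fun x => p x * (G b - G x)).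
  apply: locM_cont => // x; apply: cvgB; [exact: cvg_cst|exact: cG].
have lF : loc (fun x => q x * (F a - F x)).
  apply: locM_cont => // x; apply: cvgB; [exact: cvg_cst|exact: cF].
have -> : D a b = \int[mu]_(x in `[a, b]) (p x * (G b - G x) + q x * (F a - F x)).
  have E1 : \int[mu]_(x in `[a, b]) (p x * G b + q x * F a) =
      (F b - F a) * G b + (G b - G a) * F a.
    by rewrite intD_itv ?intZr_itv -?Fp -?Gq//; exact: locZr.
  have E2 : \int[mu]_(x in `[a, b]) (p x * G b + q x * F a) =
      \int[mu]_(x in `[a, b]) (p x * (G b - G x) + q x * (F a - F x)) +
      \int[mu]_(x in `[a, b]) (p x * G x + q x * F x).
    rewrite -intD_itv; [|exact: locD|exact: locD].
    by apply: eq_Rintegral => x _; ring.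
  by move: E2; rewrite E1 /D; lra.
apply: (le_trans (int_norm_itv _ _ (locD lG lF))).
rewrite expr2 {1}/m -intZr_itv//; apply: int_le_itv.
- by apply: loc_norm; exact: locD.
- exact: locZr.
move=> x; rewrite in_itv/= => /andP[ax xb].
rewrite (le_trans (ler_normD _ _))// !normrM mulrDl lerD// ler_wpM2l//.
- by apply: (@incr_bound _ q) => // y; rewrite lerDr.
- by rewrite distrC; apply: (@incr_bound _ p) => // y; rewrite lerDl.
Qed.

Let D_halve k a b : a <= b -> `|D a b| <= m a b ^+ 2 * 2^-1 ^+ k.
Proof.
elim: k a b => [|k IH] a b ab; first by rewrite expr0 mulr1; exact: D_bound.
(* The interval is cut where half of the mass [m] is reached, by the intermediate value theorem. The
   defect is additive and its bound quadratic in the mass, so the bound halves. *)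
pose M x := sint (fun x => `|p x| + `|q x|) a x.
have pM : primitive M (fun x => `|p x| + `|q x|).
  move=> x y xy; rewrite -(sint_le _ xy) /M; have H := sint_cat a x y lpq.
  by rewrite -H addrAC subrr add0r.
have cM := primitive_continuous lpq pM.
have Ma : M a = 0 by rewrite /M sint_le// set_itv1 Rintegral_set1.
have Mb : M b = m a b by rewrite /M sint_le.
have [] := @IVT R M a b (m a b / 2) ab.
- exact: continuous_subspaceT.
- rewrite Ma Mb; have := m0 a b => ?.
  by rewrite ge_min le_max; apply/andP; split; apply/orP; [left|right]; lra.
move=> c; rewrite in_itv/= => /andP[ac cb] Mc.
have mac : m a c = m a b / 2 by rewrite -Mc /M sint_le.
have mcb : m c b = m a b / 2.
  have := int_cat lpq ac cb; rewrite -!/(m _ _) mac; lra.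
have -> : D a b = D a c + D c b.
  rewrite /D -(int_cat (locD lpG lqF) ac cb); ring.
apply: (le_trans (ler_normD _ _)).
have H1 := IH a c ac; have H2 := IH c b cb.
rewrite mac in H1; rewrite mcb in H2; rewrite [2^-1 ^+ k.+1]exprS.
have -> : m a b ^+ 2 * (2^-1 * 2^-1 ^+ k) = (m a b / 2) ^+ 2 * 2^-1 ^+ k + (m a b / 2) ^+ 2 * 2^-1 ^+ k.
  by field.
exact: lerD.
Qed.

(** Repeated halving of the mass sends the bound on the defect to 0; this takes the place of
    Fubini's theorem. *)
Lemma primitive_by_parts a b : a <= b ->
  F b * G b - F a * G a = \int[mu]_(x in `[a, b]) (p x * G x + q x * F x).
Proof.
move=> ab; suff : D a b = 0 by move=> /eqP; rewrite subr_eq0 => /eqP.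
apply/eqP; rewrite -normr_le0.
have c0 : m a b ^+ 2 * 2^-1 ^+ k @[k --> \oo] --> (0 : R).
  rewrite -[X in _ --> X](mulr0 (m a b ^+ 2)); apply: cvgMr.
  by apply: cvg_expr; rewrite ger0_norm// invf_lt1// ltr1n.
rewrite -(cvg_lim _ c0)//; apply: limr_ge; first exact: cvgP c0.
by apply: nearW => k; exact: D_halve.
Qed.

End IntegrationByParts.

Lemma L2_loc f : L2 f -> loc f.
Proof.
move=> lf; apply: (@loc_le _ _ (fun x => 1 + f x ^+ 2)).
- exact: L2_mfun.
- apply: locD; first by apply: continuous_loc; exact: cst_continuous.
  by apply: L1_loc; exact: L2_sqr.
- apply: ae_all => x.
  have [x1|x1] := leP `|f x| 1; first by rewrite (le_trans x1)// lerDl sqr_ge0.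
  by rewrite -real_normK ?num_real// -[leLHS]add0r lerD// ler_eXnr// ltW.
Qed.

Lemma int_itv_ind f a b : \int[mu]_(x in `[a, b]) f x =
  \int[mu]_x (f x * \1_`[a, b] x).
Proof.
rewrite Rintegral_mkcond; apply: eq_Rintegral => x _.
by rewrite patchE indicE; case: ifP => _; rewrite ?mulr1 ?mulr0.
Qed.

Lemma int_cst_itv a b c : a <= b -> \int[mu]_(x in `[a, b]) c = c * (b - a).
Proof.
move=> ab; rewrite Rintegral_cst//= lebesgue_measure_itv/= lte_fin.
by move: ab; rewrite le_eqVlt => /predU1P[->|->]//; rewrite ltxx subrr.
Qed.

Lemma loc_cst c : loc (fun=> c).
Proof. by apply: continuous_loc; exact: cst_continuous. Qed.

(** Expand the nonnegative integral of (f L - J)^2, where J is the integral of f and L the length.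
    Cancelling L requires L > 0, so the degenerate interval is separate. *)
Lemma cauchy_schwarz_itv f a b : L2 f -> a <= b ->
  (\int[mu]_(x in `[a, b]) f x) ^+ 2 <= (b - a) * \int[mu]_(x in `[a, b]) (f x ^+ 2).
Proof.
move=> lf ab; have lf1 := L2_loc lf; have lf2 := L1_loc (L2_sqr lf).
set J := \int[mu]_(x in _) f x; set S := \int[mu]_(x in _) _; set L := b - a.
have L0 : 0 <= L by rewrite subr_ge0.
have : 0 <= \int[mu]_(x in `[a, b]) ((f x * L - J) ^+ 2).
  by apply: int_ge0_itv => x; exact: sqr_ge0.
have -> : \int[mu]_(x in `[a, b]) ((f x * L - J) ^+ 2) = S * L ^+ 2 + (J * (- 2 * L * J) + J ^+ 2 * L).
  rewrite -(int_cst_itv (J ^+ 2) ab) {2}/J -(intZr_itv _ _ _ lf1).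
  rewrite /S -(intZr_itv _ _ _ lf2).
  have c1 := locD (locZr (-2 * L * J) lf1) (loc_cst (J ^+ 2)).
  rewrite -[X in _ + X]intD_itv; [|exact: locZr|exact: loc_cst].
  rewrite -intD_itv//; last exact: locZr.
  by apply: eq_Rintegral => x _; ring.
have [L1|L1] := ltP 0 L; first by nra.
have ba : b = a by apply/eqP; rewrite eq_le ab andbT -subr_le0.
by move=> _; rewrite /J /S /L ba subrr mul0r set_itv1 Rintegral_set1 expr0n.
Qed.

(** For y in [x, x + 1], F(x)^2 <= 2 F(y)^2 + 2 (F(y) - F(x))^2, and Cauchy-Schwarz bounds the
    increment; average over y. *)
Lemma sobolev_local F f v x : L2 f -> L2 v -> {ae mu, forall x, f x = F x} ->
  continuous F -> primitive F v ->
  F x ^+ 2 <= 2 * \int[mu]_(y in `[x, x + 1]) (f y ^+ 2) +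
              2 * \int[mu]_(y in `[x, x + 1]) (v y ^+ 2).
Proof.
move=> lf lv fF cF Fv.
have x1 : x <= x + 1 by rewrite lerDl.
have lv2 := L1_loc (L2_sqr lv); have lf2 := L1_loc (L2_sqr lf).
have lF2 : loc (fun x => F x ^+ 2).
  by apply: continuous_loc => y; apply: cvgM; exact: cF.
set E := \int[mu]_(y in `[x, x + 1]) (v y ^+ 2).
have -> : \int[mu]_(y in `[x, x + 1]) (f y ^+ 2) = \int[mu]_(y in `[x, x + 1]) (F y ^+ 2).
  rewrite !int_itv_ind; apply: Int_ae.
  - have := loc_restr x (x + 1) lf2; congr (integrable _ _ _); apply/funext => y /=.
    by rewrite patchE indicE; case: ifP => _; rewrite ?mulr1 ?mulr0.
  - by apply: measurable_funM => //; exact: loc_mfun.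
  - by apply: aeS fF => y ->.
have H y : y \in `[x, x + 1] -> F x ^+ 2 <= F y ^+ 2 * 2 + 2 * E.
  rewrite in_itv/= => /andP[xy y1].
  have C := cauchy_schwarz_itv lv xy; rewrite -Fv// in C.
  have S : \int[mu]_(t in `[x, y]) (v t ^+ 2) <= E.
    by apply: int_sub_itv => // t; exact: sqr_ge0.
  have S0 : 0 <= \int[mu]_(t in `[x, y]) (v t ^+ 2).
    by apply: int_ge0_itv => t; exact: sqr_ge0.
  have : (F y - F x) ^+ 2 <= E.
    apply: (le_trans C); apply: le_trans S; rewrite ler_piMl//; lra.
  by have := sqr_ge0 (F y *+ 2 - F x); rewrite -mulr_natr; nra.
have c1 : loc (fun x => F x ^+ 2 * 2).
  by apply: locM_cont => // y; exact: cvg_cst.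
have := int_le_itv (loc_cst (F x ^+ 2)) (locD c1 (loc_cst (2 * E))) H.
rewrite intD_itv//; last exact: loc_cst.
rewrite !int_cst_itv// intZr_itv//.
by rewrite [x + 1 - x]addrAC subrr add0r !mulr1 [_ * 2]mulrC.
Qed.

(** The last bound is what makes the local estimate worthwhile: [x, x + 1] stays in the region |y|
    >= r once |x| >= r + 1, so the values of F far out are controlled by L^2 tails. *)
Lemma sobolev_rep f v : is_wderiv f v -> L2 f -> L2 v -> exists F,
  [/\ {ae mu, forall x, f x = F x}, continuous F, primitive F v,
      forall x, F x ^+ 2 <= 2 * nu f ^+ 2 + 2 * nu v ^+ 2 &
      forall r x, r + 1 <= `|x| ->
        F x ^+ 2 <= 2 * nu (tail r f) ^+ 2 + 2 * nu (tail r v) ^+ 2].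
Proof.
move=> fv lf lv; have [F [fF cF Fv]] := wderiv_rep fv.
have H h x : L2 h -> \int[mu]_(y in `[x, x + 1]) (h y ^+ 2) <= nu h ^+ 2.
  move=> lh; rewrite nu_sqr int_itv_ind; apply: Int_le.
  - have := loc_restr x (x + 1) (L1_loc (L2_sqr lh)); congr (integrable _ _ _).
    apply/funext => y /=.
    by rewrite patchE indicE; case: ifP => _; rewrite ?mulr1 ?mulr0.
  - exact: L2_sqr.
  - by apply: ae_all => y; rewrite ler_piMr ?sqr_ge0// indicE lern1 leq_b1.
have T h r x : L2 h -> r + 1 <= `|x| -> \int[mu]_(y in `[x, x + 1]) (h y ^+ 2) <= nu (tail r h) ^+ 2.
  move=> lh rx; apply: le_trans (H _ x (L2_tail r lh)).
  apply: int_le_itv; [exact/L1_loc/L2_sqr|apply/L1_loc/L2_sqr; exact: L2_tail|].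
  move=> y; rewrite in_itv/= => /andP[xy yx]; rewrite /tail.
  suff -> : r <= `|y| by rewrite mulr1.
  have : `|x| <= `|y| + 1.
    rewrite -(subrK y x) addrC (le_trans (ler_normD _ _))// lerD2l.
    by rewrite distrC ger0_norm; lra.
  by lra.
exists F; split => // [x|r x rx]; apply: (le_trans (sobolev_local x lf lv fF cF Fv));
  apply: lerD; rewrite ler_wpM2l//; [exact: H|exact: H|exact: T|exact: T].
Qed.

Lemma int_symm_cvg f : L1 f ->
  \int[mu]_(x in `[- n%:R, n%:R]) f x @[n --> \oo] --> \int[mu]_x f x.
Proof.
move=> lf; under eq_fun do rewrite int_itv_ind.
apply: (@Int_dominated _ _ _ (fun x => `|f x|)).
- by move=> n; apply: measurable_funM => //; exact: L1_mfun.
- exact: L1_mfun.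
- exact: L1_norm.
- by move=> n; apply: ae_all => x; rewrite normrM ler_piMr// normr_nat lern1 leq_b1.
- apply: ae_all => x; apply: cvg_near_cst; near=> n.
  rewrite indicE mem_set ?mulr1//= in_itv/= -ler_norml.
  by near: n; exact: nbhs_infty_ger.
Unshelve. all: by end_near. Qed.

Lemma sobolev_decay f v F e : L2 f -> L2 v -> (forall r x, r + 1 <= `|x| ->
    F x ^+ 2 <= 2 * nu (tail r f) ^+ 2 + 2 * nu (tail r v) ^+ 2) -> 0 < e ->
  exists2 r, 0 < r & forall x, r <= `|x| -> `|F x| <= e.
Proof.
move=> lf lv HF e0; have e2 : 0 < e / 2 by rewrite divr_gt0.
have [r1 r10 H1] := tail_cvg0 lf e2; have [r2 r20 H2] := tail_cvg0 lv e2.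
exists (Num.max r1 r2 + 1); first by rewrite addr_gt0// lt_max r10.
move=> x /HF; have := H1 (Num.max r1 r2); have := H2 (Num.max r1 r2).
rewrite !le_max !lexx orbT => /(_ isT) + /(_ isT).
set a := nu _; set b := nu _ => a1 b1 F2.
have a0 : 0 <= a by exact: nu_ge0.
have b0 : 0 <= b by exact: nu_ge0.
rewrite -ler_sqr ?nnegrE ?(ltW e0)// real_normK ?num_real//.
by apply: (le_trans F2); nra.
Qed.

(** Both continuous representatives tend to 0 at infinity, so the boundary terms on [-n, n] vanish
    in the limit. *)
Lemma wderiv_by_parts f v g w : is_wderiv f v -> is_wderiv g w ->
  L2 f -> L2 v -> L2 g -> L2 w ->
  \int[mu]_x (v x * g x) = - \int[mu]_x (f x * w x).
Proof.
move=> fv gw lf lv lg lw.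
have [F [fF cF Fv _ Ft]] := sobolev_rep fv lf lv.
have [G [gG cG Gw _ Gt]] := sobolev_rep gw lg lw.
have mF := continuous_measurable_fun cF; have mG := continuous_measurable_fun cG.
have lvg := L2M lv lg; have lfw := L2M lf lw.
have mvG : measurable_fun [set: R] (fun x => v x * G x).
  by apply: measurable_funM => //; exact: L2_mfun.
have mwF : measurable_fun [set: R] (fun x => w x * F x).
  by apply: measurable_funM => //; exact: L2_mfun.
have avG : {ae mu, forall x, v x * g x = v x * G x} by apply: aeS gG => x ->.
have awF : {ae mu, forall x, f x * w x = w x * F x}.
  by apply: aeS fF => x ->; rewrite mulrC.
have lvG := L1_ae lvg mvG avG; have lwF := L1_ae lfw mwF awF.
have cI := int_symm_cvg (L1D lvG lwF).
suff c0 : \int[mu]_(x in `[- n%:R, n%:R]) (v x * G x + w x * F x) @[n --> \oo] --> (0 : R).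
  have := cvg_unique _ cI c0.
  rewrite IntD// -(Int_ae lvg mvG avG) -(Int_ae lfw mwF awF) => /(_ (@Rhausdorff R)).
  by move=> /(_ _)/eqP; rewrite addr_eq0 => /eqP.
apply/cvgr0Pnorm_le => e e0.
have [r1 r10 H1] := sobolev_decay lf lv Ft (divr_gt0 e0 (ltr0Sn R 1)).
have [r2 r20 H2] := sobolev_decay lg lw Gt (@ltr01 R).
near=> n.
have nn : - n%:R <= n%:R :> R by rewrite lerNl (le_trans _ (ler0n _ _))// oppr_le0.
rewrite -(primitive_by_parts (L2_loc lv) (L2_loc lw) Fv Gw nn).
have B x : `|x| = n%:R -> `|F x * G x| <= e / 2.
  move=> xn; rewrite normrM -[e / 2]mulr1 ler_pM//.
    by apply: H1; rewrite xn; near: n; exact: nbhs_infty_ger.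
  by apply: H2; rewrite xn; near: n; exact: nbhs_infty_ger.
rewrite (le_trans (ler_normB _ _))// [e]splitr lerD// B//.
  by rewrite ger0_norm.
by rewrite normrN ger0_norm.
Unshelve. all: by end_near. Qed.

(** Integration by parts turns the squared norm of v into minus the pairing of f with w. This is
    what later lets advection and commutator terms of first order be absorbed. *)
Lemma nu_interpolation f v w : is_wderiv f v -> is_wderiv v w ->
  L2 f -> L2 v -> L2 w -> nu v ^+ 2 <= nu f * nu w.
Proof.
move=> fv vw lf lv lw; rewrite nu_sqr.
under eq_Rintegral do rewrite expr2.
rewrite (wderiv_by_parts fv vw)//.
by rewrite (le_trans (ler_norm _))// normrN cauchy_schwarz.
Qed.

End SobolevSpaces.

(** * Calculus in H^2 *)

Section SobolevCalculus.
Context {R : realType}.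
Local Notation mu := (@lebesgue_measure R).
Local Notation L1 f := (mu.-integrable [set: R] (EFin \o f)).
Local Notation loc f := (locally_integrable [set: R] f).
Implicit Types (f g h v w F G phi : R -> R) (a b c x y : R).

Lemma loc_itvP f : measurable_fun [set: R] f ->
  (forall a b, L1 (f \_ `[a, b])) -> loc f.
Proof.
move=> mf fab; split => //; first exact: openT.
move=> K _ cK; have [M [_ HM]] := compact_bounded cK.
have mK : measurable (K : set (measurableTypeR R)) by exact: compact_measurable.
pose N := `|M| + 1.
have H := (integrable_mkcond (mu := mu) (EFin \o f) (measurable_itv `[- N, N])).2.
rewrite restrict_EFin in H.
have /integrableP[_] // : mu.-integrable K (EFin \o f).
apply: integrableS (H (fab _ _)) => //.
move=> x Kx; rewrite /= in_itv/= -ler_norml.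
by apply: HM => //; rewrite /N (le_lt_trans (ler_norm M))// ltrDl.
Qed.

Lemma loc_shift f c : loc f -> loc (fun x => f (x + c)).
Proof.
move=> lf; apply: loc_itvP.
  by apply: (measurableT_comp (loc_mfun lf)); exact: measurable_funD.
move=> a b; have := L1_shift c (loc_restr (a + c) (b + c) lf).
congr (integrable _ _ _); apply/funext => x /=; rewrite !patchE.
by rewrite !mem_setE !in_itv/= !lerD2r.
Qed.

Lemma loc_ae f g : loc f -> measurable_fun [set: R] g ->
  {ae mu, forall x, f x = g x} -> loc g.
Proof.
move=> lf mg fg; apply: (loc_le mg (loc_norm lf)).
by apply: aeS fg => x ->.
Qed.

Lemma wderiv_loc f v : is_wderiv f v -> loc f /\ loc v.
Proof. by case. Qed.

Lemma wderiv_ae f g v w : is_wderiv f v -> measurable_fun [set: R] g ->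
  measurable_fun [set: R] w -> {ae mu, forall x, f x = g x} ->
  {ae mu, forall x, v x = w x} -> is_wderiv g w.
Proof.
move=> [lf lv fv] mg mw fg vw.
have lg := loc_ae lf mg fg; have lw := loc_ae lv mw vw.
split => // phi tp; have tp' := test_derive tp.
rewrite -(@Int_ae _ (fun x => f x * derive1 phi x)); last 3 first.
- exact: test_L1.
- by apply: measurable_funM => //; apply: smooth_mfun; case: tp'.
- by apply: aeS fg => x ->.
rewrite fv//; congr (- _); apply: Int_ae; first exact: test_L1.
  by apply: measurable_funM => //; apply: smooth_mfun; case: tp.
by apply: aeS vw => x ->.
Qed.

Lemma wderivD f g v w : is_wderiv f v -> is_wderiv g w ->
  is_wderiv (fun x => f x + g x) (fun x => v x + w x).
Proof.
move=> [lf lv fv] [lg lw gw]; split; [exact: locD|exact: locD|].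
move=> phi tp; have tp' := test_derive tp.
under eq_Rintegral do rewrite mulrDl.
under [in RHS]eq_Rintegral do rewrite mulrDl.
rewrite IntD; [|exact: test_L1|exact: test_L1].
rewrite IntD; [|exact: test_L1|exact: test_L1].
by rewrite fv// gw// opprD.
Qed.

Lemma locZ f c : loc f -> loc (fun x => c * f x).
Proof. by move=> lf; under eq_fun do rewrite mulrC; exact: locZr. Qed.

Lemma wderivZ c f v : is_wderiv f v ->
  is_wderiv (fun x => c * f x) (fun x => c * v x).
Proof.
move=> [lf lv fv]; split; [exact: locZ|exact: locZ|].
move=> phi tp; have tp' := test_derive tp.
under eq_Rintegral do rewrite -mulrA.
under [in RHS]eq_Rintegral do rewrite -mulrA.
by rewrite !IntZ ?fv ?mulrN//; exact: test_L1.
Qed.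

Lemma test_shift phi c : test_function phi -> test_function (fun x => phi (x + c)).
Proof.
move=> [sp [a [b p0]]]; split.
  have := smooth_affine (a := 1) (b := c) sp.
  by under eq_fun do rewrite mul1r.
exists (a - c), (b - c) => x xab; apply: p0; apply: contra xab.
by rewrite !in_itv/= lerBlDr lerBrDr.
Qed.

Lemma derive_shift phi c x : smooth phi ->
  derive1 (fun x => phi (x + c)) x = derive1 phi (x + c).
Proof.
move=> sp; apply: derive1_val.
have := is_derive_affine (a := 1) (b := c) (smooth_is_derive (1 * x + c) sp).
by rewrite !mul1r; under eq_fun do rewrite mul1r.
Qed.

Lemma wderiv_shift c f v : is_wderiv f v ->
  is_wderiv (fun x => f (x + c)) (fun x => v (x + c)).
Proof.
move=> [lf lv fv]; split; [exact: loc_shift|exact: loc_shift|].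
move=> phi tp; have tc := test_shift (- c) tp.
have [sp _] := tp.
have := fv _ tc.
rewrite -(Int_shift c (test_L1 lf (test_derive tc))) -(Int_shift c (test_L1 lv tc)).
under eq_Rintegral do rewrite derive_shift// addrK.
by move=> ->; congr (- _); apply: eq_Rintegral => x _; rewrite addrK.
Qed.

(** The product of g with a test function is again a test function, so the Leibniz rule is only
    applied to smooth functions. *)
Lemma wderivM f v g : is_wderiv f v -> smooth g ->
  is_wderiv (fun x => g x * f x) (fun x => derive1 g x * f x + g x * v x).
Proof.
move=> [lf lv fv] sg.
have sg' := smooth_derive sg.
have cg := smooth_continuous sg; have cg' := smooth_continuous sg'.
have lM h k : loc h -> smooth k -> loc (fun x => k x * h x).
  move=> lh sk; under eq_fun do rewrite mulrC; apply: locM_cont => //.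
  exact: smooth_continuous.
split; [exact: lM|by apply: locD; exact: lM|].
move=> phi tp; have tp' := test_derive tp; have [sp _] := tp.
have tg := testM tp sg.
have E : derive1 (fun x => g x * phi x) = fun x => derive1 g x * phi x + g x * derive1 phi x.
  by apply/funext => x; apply: derive1_val; apply: is_deriveMx; exact: smooth_is_derive.
have := fv _ tg; rewrite E.
have t1 := test_L1 (lM _ _ lf sg') tp; have t2 := test_L1 (lM _ _ lf sg) tp'.
have t3 := test_L1 (lM _ _ lv sg) tp.
have -> : \int[mu]_x (f x * (derive1 g x * phi x + g x * derive1 phi x)) =
    \int[mu]_x (derive1 g x * f x * phi x) + \int[mu]_x (g x * f x * derive1 phi x).
  by rewrite -IntD//; apply: eq_Rintegral => x _; ring.
have -> : \int[mu]_x ((derive1 g x * f x + g x * v x) * phi x) =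
    \int[mu]_x (derive1 g x * f x * phi x) + \int[mu]_x (g x * v x * phi x).
  by rewrite -IntD//; apply: eq_Rintegral => x _; ring.
have -> : \int[mu]_x (v x * (g x * phi x)) = \int[mu]_x (g x * v x * phi x).
  by apply: eq_Rintegral => x _; ring.
lra.
Qed.

Lemma wderivP f : wderivable f -> is_wderiv f (wderiv f).
Proof. by move=> ex; exact: (@xgetPex _ (fun=> 0) [set v | is_wderiv f v] ex). Qed.

Lemma wderivE f v : is_wderiv f v -> {ae mu, forall x, wderiv f x = v x}.
Proof. by move=> fv; exact: (wderiv_uniq (wderivP (ex_intro _ v fv)) fv). Qed.

(** Almost everywhere equal functions have the same set of weak derivatives, and [xget] picks the
    same element of equal sets; hence a genuine equality of functions. *)
Lemma wderiv_congr f g : measurable_fun [set: R] f -> measurable_fun [set: R] g ->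
  {ae mu, forall x, f x = g x} -> wderiv f = wderiv g.
Proof.
move=> mf mg fg; congr xget; apply/seteqP; split => v /= fv.
  apply: (wderiv_ae fv mg _ fg (ae_all _)) => //; by have [_ /loc_mfun] := wderiv_loc fv.
apply: (wderiv_ae fv mf _ _ (ae_all _)) => //; last by apply: aeS fg => x ->.
by have [_ /loc_mfun] := wderiv_loc fv.
Qed.

Lemma wderivE2 f v w : is_wderiv f v -> is_wderiv v w ->
  [/\ is_wderiv f (wderiv f), is_wderiv (wderiv f) (wderiv (wderiv f)),
      {ae mu, forall x, wderiv f x = v x} &
      {ae mu, forall x, wderiv (wderiv f) x = w x}].
Proof.
move=> fv vw; have fw := wderivP (ex_intro _ v fv); have e1 := wderivE fv.
have [_ /loc_mfun m1] := wderiv_loc fw; have [_ /loc_mfun m2] := wderiv_loc fv.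
have E : wderiv (wderiv f) = wderiv v by exact: wderiv_congr.
have vw' := wderivP (ex_intro _ w vw).
split; [exact: fw| |exact: e1|by rewrite E; exact: wderivE].
rewrite E; apply: (wderiv_ae vw' m1).
- by have [_ /loc_mfun] := wderiv_loc vw'.
- by apply: aeS e1 => x ->.
- by apply: ae_all.
Qed.

(** Membership in H^2 with the derivatives as explicit data: the representative chosen by [wderiv]
    obeys algebraic rules only almost everywhere, whereas witnesses can be added, shifted and
    multiplied as formulas. *)
Definition H2d f f1 f2 := [/\ L2 f, L2 f1, L2 f2, is_wderiv f f1 & is_wderiv f1 f2].

Definition H2locd f f1 f2 :=
  [/\ L2loc f, L2loc f1, L2loc f2, is_wderiv f f1 & is_wderiv f1 f2].

Lemma H2dP f : H2 f -> H2d f (wderiv f) (wderiv (wderiv f)).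
Proof. by move=> [l w l1 w1 l2]; split => //; exact: wderivP. Qed.

Lemma H2locdP f : H2loc f -> H2locd f (wderiv f) (wderiv (wderiv f)).
Proof. by move=> [l w l1 w1 l2]; split => //; exact: wderivP. Qed.

Lemma H2d_H2 f f1 f2 : H2d f f1 f2 -> H2 f.
Proof.
move=> [l l1 l2 w1 w2]; have [u1 u2 e1 e2] := wderivE2 w1 w2.
split => //.
- by exists f1.
- apply: (L2_ae l1); first by have [_ /loc_mfun] := wderiv_loc u1.
  by apply: aeS e1 => x ->.
- by exists (wderiv (wderiv f)).
- apply: (L2_ae l2); first by have [_ /loc_mfun] := wderiv_loc u2.
  by apply: aeS e2 => x ->.
Qed.

Lemma L2loc_ae f g : L2loc f -> measurable_fun [set: R] g ->
  {ae mu, forall x, f x = g x} -> L2loc g.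
Proof.
move=> [mf lf] mg fg; split => //; apply: (loc_ae lf); first exact: measurable_funX.
by apply: aeS fg => x ->.
Qed.

Lemma H2locd_H2loc f f1 f2 : H2locd f f1 f2 -> H2loc f.
Proof.
move=> [l l1 l2 w1 w2]; have [u1 u2 e1 e2] := wderivE2 w1 w2.
split => //.
- by exists f1.
- apply: (L2loc_ae l1); first by have [_ /loc_mfun] := wderiv_loc u1.
  by apply: aeS e1 => x ->.
- by exists (wderiv (wderiv f)).
- apply: (L2loc_ae l2); first by have [_ /loc_mfun] := wderiv_loc u2.
  by apply: aeS e2 => x ->.
Qed.

Lemma L2_L2loc f : L2 f -> L2loc f.
Proof. by move=> lf; split; [exact: L2_mfun|apply: L1_loc; exact: L2_sqr]. Qed.

Lemma H2d_loc f f1 f2 : H2d f f1 f2 -> H2locd f f1 f2.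
Proof. by move=> [? ? ? ? ?]; split => //; exact: L2_L2loc. Qed.

Lemma L2locD f g : L2loc f -> L2loc g -> L2loc (fun x => f x + g x).
Proof.
move=> [mf lf] [mg lg]; split; first exact: measurable_funD.
apply: (loc_le _ (locD (locZ 2 lf) (locZ 2 lg))).
  by apply: measurable_funX; exact: measurable_funD.
apply: ae_all => x; rewrite ger0_norm ?sqr_ge0//.
by have := sqr_ge0 (f x - g x); nra.
Qed.

Lemma H2dD f f1 f2 g g1 g2 : H2d f f1 f2 -> H2d g g1 g2 ->
  H2d (fun x => f x + g x) (fun x => f1 x + g1 x) (fun x => f2 x + g2 x).
Proof.
by move=> [? ? ? ? ?] [? ? ? ? ?]; split; try exact: L2D; exact: wderivD.
Qed.

Lemma H2locdD f f1 f2 g g1 g2 : H2locd f f1 f2 -> H2locd g g1 g2 ->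
  H2locd (fun x => f x + g x) (fun x => f1 x + g1 x) (fun x => f2 x + g2 x).
Proof.
by move=> [? ? ? ? ?] [? ? ? ? ?]; split; try exact: L2locD; exact: wderivD.
Qed.

Lemma H2dZ c f f1 f2 : H2d f f1 f2 ->
  H2d (fun x => c * f x) (fun x => c * f1 x) (fun x => c * f2 x).
Proof. by move=> [? ? ? ? ?]; split; try exact: L2Z; exact: wderivZ. Qed.

Lemma H2dB f f1 f2 g g1 g2 : H2d f f1 f2 -> H2d g g1 g2 ->
  H2d (fun x => f x - g x) (fun x => f1 x - g1 x) (fun x => f2 x - g2 x).
Proof.
move=> hf /(H2dZ (-1)) hg; have := H2dD hf hg.
by congr H2d; apply/funext => x; rewrite mulN1r.
Qed.

Lemma H2d0 : H2d (fun=> 0) (fun=> 0) (fun=> 0).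
Proof.
have w0 : is_wderiv (fun=> 0) (fun=> 0 : R).
  split; [exact: loc_cst|exact: loc_cst|move=> phi _].
  have Z h : \int[mu]_x (0 * h x) = 0.
    by under eq_Rintegral do rewrite mul0r; rewrite Rintegral_cst// mul0r.
  by rewrite !Z oppr0.
by split; try exact: L20; exact: w0.
Qed.

Lemma H2d_shift c f f1 f2 : H2d f f1 f2 ->
  H2d (fun x => f (x + c)) (fun x => f1 (x + c)) (fun x => f2 (x + c)).
Proof. by move=> [? ? ? ? ?]; split; try exact: L2_shift; exact: wderiv_shift. Qed.

Lemma H2d_smoothM (K : R) g f f1 f2 : smooth g ->
  (forall x, [/\ `|g x| <= K, `|derive1 g x| <= K & `|derive1 (derive1 g) x| <= K]) ->
  H2d f f1 f2 ->
  H2d (fun x => g x * f x) (fun x => derive1 g x * f x + g x * f1 x)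
    (fun x => derive1 (derive1 g) x * f x + 2 * (derive1 g x * f1 x) + g x * f2 x).
Proof.
move=> sg gK [l l1 l2 w1 w2].
have sg' := smooth_derive sg; have sg2 := smooth_derive sg'.
have B k h : smooth k -> (forall x, `|k x| <= K) -> L2 h -> L2 (fun x => k x * h x).
  by move=> sk kK lh; apply: (@L2_mulbd _ K) => //; [exact: smooth_mfun|exact: ae_all].
have b0 x : `|g x| <= K by have [] := gK x.
have b1 x : `|derive1 g x| <= K by have [] := gK x.
have b2 x : `|derive1 (derive1 g) x| <= K by have [] := gK x.
split.
- exact: B.
- by apply: L2D; exact: B.
- by apply: L2D; [apply: L2D; [|apply: L2Z]|]; exact: B.
- exact: wderivM.
- have := wderivD (wderivM w1 sg') (wderivM w2 sg).
  by congr is_wderiv; apply/funext => x; ring.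
Qed.

End SobolevCalculus.

(** * Elliptic systems and gluing of resolvents *)

Section EllipticSystems.
Context {R : realType} {I : finType}.
Local Notation mu := (@lebesgue_measure R).
Local Notation vf := (I -> R -> R).
Implicit Types (g h z y : vf) (i k : I) (P Q : I -> I -> R -> R).

Definition L2f h := forall i, L2 (h i).

Definition N h : R := \sum_i nu (h i).

Definition aeq g h := forall i, {ae mu, forall x, g i x = h i x}.

Lemma N_ge0 h : 0 <= N h.
Proof. by apply: sumr_ge0 => i _; exact: nu_ge0. Qed.

Lemma nu_leN h i : nu (h i) <= N h.
Proof. by rewrite /N (bigD1 i)//= lerDl sumr_ge0// => k _; exact: nu_ge0. Qed.

Lemma ND g h : L2f g -> L2f h -> N (fun i x => g i x + h i x) <= N g + N h.
Proof. by move=> lg lh; rewrite /N -big_split/=; apply: ler_sum => i _; exact: nuD. Qed.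

Lemma NB g h : L2f g -> L2f h -> N (fun i x => g i x - h i x) <= N g + N h.
Proof. by move=> lg lh; rewrite /N -big_split/=; apply: ler_sum => i _; exact: nuB. Qed.

Lemma NZ c h : L2f h -> N (fun i x => c * h i x) = `|c| * N h.
Proof. by move=> lh; rewrite /N mulr_sumr; apply: eq_bigr => i _; exact: nuZ. Qed.

Lemma L2fD g h : L2f g -> L2f h -> L2f (fun i x => g i x + h i x).
Proof. by move=> lg lh i; exact: L2D. Qed.

Lemma L2fB g h : L2f g -> L2f h -> L2f (fun i x => g i x - h i x).
Proof. by move=> lg lh i; exact: L2B. Qed.

Lemma N_ae g h : L2f g -> L2f h -> aeq g h -> N g = N h.
Proof. by move=> lg lh gh; apply: eq_bigr => i _; apply: nu_ae => //; exact: L2_mfun. Qed.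

Lemma N_eq0 h : L2f h -> N h = 0 -> aeq h (fun _ _ => 0).
Proof.
move=> lh h0 i; apply: nu_eq0 => //; apply/eqP; rewrite eq_le nu_ge0 andbT.
by rewrite -h0 nu_leN.
Qed.

Lemma N0 : N (fun _ _ => 0) = 0.
Proof. by rewrite /N big1// => i _; exact: nu0. Qed.

Lemma N_mulbd c g (t : R -> R) : measurable_fun [set: R] t ->
  {ae mu, forall x, `|t x| <= c} -> 0 <= c -> L2f g ->
  L2f (fun i x => t x * g i x) /\ N (fun i x => t x * g i x) <= c * N g.
Proof.
move=> mt tc c0 lg; split=> [i|]; first exact: (L2_mulbd mt tc).
by rewrite /N mulr_sumr; apply: ler_sum => i _; exact: nu_mulbd.
Qed.

(** Banach's iteration from 0. The factor 1/2 and the bound on Phi 0 keep the iterates in the ball,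
    and completeness is used in each component. The fixed point equation holds almost everywhere
    because elements of L^2 are represented by functions. *)
Lemma fixpoint (Phi : vf -> vf) (r : R) :
  (forall g, L2f g -> N g <= r -> L2f (Phi g)) ->
  (forall g h, L2f g -> L2f h -> N g <= r -> N h <= r ->
    N (fun i x => Phi g i x - Phi h i x) <= 2^-1 * N (fun i x => g i x - h i x)) ->
  2 * N (Phi (fun _ _ => 0)) <= r ->
  exists g, [/\ L2f g, N g <= r & aeq (Phi g) g].
Proof.
move=> LPhi cPhi P0.
pose G n := iter n Phi (fun _ _ => 0).
have r0 : 0 <= r by apply: le_trans P0; rewrite mulr_ge0// N_ge0.
have L0 : L2f (fun _ _ => 0) by move=> i; exact: L20.
have N0r : N (fun _ _ => 0) <= r by rewrite N0.
have inv g : L2f g -> N g <= r -> L2f (Phi g) /\ N (Phi g) <= r.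
  move=> lg gr; have lP := LPhi _ lg gr; have lP0 := LPhi _ L0 N0r; split => //.
  have c := cPhi _ _ lg L0 gr N0r.
  have -> : N (Phi g) = N (fun i x => (Phi g i x - Phi (fun _ _ => 0) i x) + Phi (fun _ _ => 0) i x).
    by congr N; apply/funext => i; apply/funext => x; rewrite subrK.
  apply: (le_trans (ND (L2fB lP lP0) lP0)).
  have E : N (fun i x => g i x - 0) = N g.
    by congr N; apply/funext => i; apply/funext => x; rewrite subr0.
  by move: c; rewrite E; lra.
have HG n : L2f (G n) /\ N (G n) <= r.
  by elim: n => [|n [l b]]; [split|exact: inv].
have step n : N (fun i x => G n.+1 i x - G n i x) <= r * 2^-1 ^+ n.
  elim: n => [|n IH].
    rewrite expr0 mulr1; have [_ b] := HG 1%N.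
    suff -> : N (fun i x => G 1%N i x - G 0%N i x) = N (G 1%N) by [].
    by congr N; apply/funext => i; apply/funext => x; rewrite subr0.
  have [l b] := HG n; have [l' b'] := HG n.+1.
  apply: (le_trans (cPhi _ _ l' l b' b)).
  by rewrite exprS mulrCA ler_wpM2l.
have ex i : exists f, L2 f /\ nu (fun x => G n i x - f x) @[n --> \oo] --> (0 : R).
  have [||f lf cf] := @L2_complete R (fun n => G n i) r.
  - by move=> n; have [l _] := HG n; exact: l.
  - by move=> n; apply: le_trans (step n); exact: (nu_leN (fun i x => G n.+1 i x - G n i x)).
  - by exists f.
have [g Hg] := choice ex.
have lg : L2f g by move=> i; have [] := Hg i.
have cN : N (fun i x => G n i x - g i x) @[n --> \oo] --> (0 : R).
  have -> : (0 : R) = \sum_(i : I) 0 by rewrite big1.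
  rewrite /N; apply: cvg_big => [|i _]; last by have [] := Hg i.
  exact: add_continuous.
have gr : N g <= r.
  have c : r + N (fun i x => G n i x - g i x) @[n --> \oo] --> r + 0.
    by apply: cvgD => //; exact: cvg_cst.
  rewrite -[leRHS]addr0 -(cvg_lim _ c)//; apply: limr_ge; first exact: cvgP c.
  apply: nearW => n; have [l b] := HG n.
  have -> : N g = N (fun i x => G n i x - (G n i x - g i x)).
    by congr N; apply/funext => i; apply/funext => x; rewrite subKr.
  by apply: (le_trans (NB l (L2fB l lg))); rewrite lerD2r.
exists g; split => //.
have [lPg _] := inv _ lg gr.
suff N00 : N (fun i x => Phi g i x - g i x) = 0.
  move=> i; have := N_eq0 (L2fB lPg lg) N00 i.
  by apply: aeS => x /eqP; rewrite subr_eq0 => /eqP.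
apply/eqP; rewrite eq_le N_ge0 andbT.
have c : 2^-1 * N (fun i x => G n i x - g i x) + N (fun i x => G n.+1 i x - g i x)
    @[n --> \oo] --> 2^-1 * 0 + (0 : R).
  apply: cvgD; first exact: cvgMr.
  by move: cN; rewrite -(cvg_shiftS (fun m => N (fun i x => G m i x - g i x))).
have -> : 0 = 2^-1 * 0 + 0 :> R by rewrite mulr0 addr0.
rewrite -(cvg_lim _ c)//; apply: limr_ge; first exact: cvgP c.
apply: nearW => n; have [l b] := HG n; have [l' b'] := HG n.+1.
have -> : N (fun i x => Phi g i x - g i x) = N (fun i x => (G n.+1 i x - g i x) - (G n.+1 i x - Phi g i x)).
  by congr N; apply/funext => i; apply/funext => x; ring.
apply: (le_trans (NB (L2fB l' lg) (L2fB l' lPg))).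
by rewrite addrC lerD2r; exact: cPhi.
Qed.

Variables (kap : I -> R) (c : I -> R -> R) (k0 k1 c0 : R).
Hypotheses (k00 : 0 < k0) (k0k : forall i, k0 <= kap i) (kk1 : forall i, kap i <= k1).
Hypotheses (mc : forall i, measurable_fun [set: R] (c i)).
Hypotheses (cc0 : forall i x, `|c i x| <= c0) (c00 : 0 <= c0).

Let n : R := #|I|%:R.

Definition H2f z z1 z2 := forall i, H2d (z i) (z1 i) (z2 i).

Definition pot P z : vf := fun i x => \sum_k P i k x * z k x.

Definition op P z z1 z2 : vf :=
  fun i x => kap i * z2 i x + c i x * z1 i x + pot P z i x.

Definition bounded (p : R) P := forall i k, measurable_fun [set: R] (P i k) /\
  {ae mu, forall x, `|P i k x| <= p}.

(** Bounded invertibility. Uniqueness is contained in the bound; only the L^2 norm of z appears,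
    since [elliptic] recovers the derivatives. *)
Definition good P (K : R) :=
  (forall h, L2f h -> exists z z1 z2, H2f z z1 z2 /\ aeq (op P z z1 z2) h) /\
  (forall z z1 z2, H2f z z1 z2 -> N z <= K * N (op P z z1 z2)).

Let L2_sum_seq (F : I -> R -> R) (s : seq I) : (forall k, L2 (F k)) ->
  L2 (fun x => \sum_(k <- s) F k x) /\
  nu (fun x => \sum_(k <- s) F k x) <= \sum_(k <- s) nu (F k).
Proof.
move=> lF; elim: s => [|k s [l b]].
  by rewrite big_nil; under eq_fun do rewrite big_nil; split; [exact: L20|rewrite nu0].
rewrite big_cons; under eq_fun do rewrite big_cons.
split; first exact: L2D.
by apply: (le_trans (nuD (lF k) l)); rewrite lerD2l.
Qed.

Lemma L2_sum (F : I -> R -> R) : (forall k, L2 (F k)) ->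
  L2 (fun x => \sum_k F k x) /\ nu (fun x => \sum_k F k x) <= \sum_k nu (F k).
Proof.
exact: L2_sum_seq.
Qed.

Lemma pot_bound (p : R) P z : 0 <= p -> bounded p P -> L2f z ->
  L2f (pot P z) /\ N (pot P z) <= n * p * N z.
Proof.
move=> p0 bP lz.
have H i : L2 (pot P z i) /\ nu (pot P z i) <= p * N z.
  have [|l b] := @L2_sum (fun k x => P i k x * z k x).
    by move=> k; have [mP Pp] := bP i k; exact: (L2_mulbd mP Pp).
  split => //; apply: (le_trans b); rewrite /N mulr_sumr; apply: ler_sum => k _.
  by have [mP Pp] := bP i k; exact: nu_mulbd.
split=> [i|]; first by have [] := H i.
rewrite /N; apply: (@le_trans _ _ (\sum_(i : I) p * N z)).
  by apply: ler_sum => i _; have [] := H i.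
by rewrite sumr_const -mulr_natl -/n mulrA.
Qed.

Lemma H2f_L2 z z1 z2 : H2f z z1 z2 -> [/\ L2f z, L2f z1 & L2f z2].
Proof. by move=> hz; split=> i; have [] := hz i. Qed.

Lemma H2fB z z1 z2 y y1 y2 : H2f z z1 z2 -> H2f y y1 y2 ->
  H2f (fun i x => z i x - y i x) (fun i x => z1 i x - y1 i x)
      (fun i x => z2 i x - y2 i x).
Proof. by move=> hz hy i; exact: H2dB. Qed.

Lemma opB P z z1 z2 y y1 y2 i x :
  op P (fun i x => z i x - y i x) (fun i x => z1 i x - y1 i x)
       (fun i x => z2 i x - y2 i x) i x =
  op P z z1 z2 i x - op P y y1 y2 i x.
Proof.
have -> : op P z z1 z2 i x - op P y y1 y2 i x =
  kap i * (z2 i x - y2 i x) + c i x * (z1 i x - y1 i x) + (pot P z i x - pot P y i x).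
  by rewrite /op; ring.
rewrite /op; congr (_ + _); rewrite /pot -sumrB.
by apply: eq_bigr => k _; rewrite mulrBr.
Qed.

Lemma L2_adv z1 i : L2 (z1 i) -> L2 (fun x => c i x * z1 i x) /\
  nu (fun x => c i x * z1 i x) <= c0 * nu (z1 i).
Proof.
move=> l; split; first exact: (L2_mulbd (mc i) (ae_all (cc0 i))).
exact: (nu_mulbd (mc i) (ae_all (cc0 i))).
Qed.

Lemma op_L2 (p : R) P z z1 z2 : 0 <= p -> bounded p P -> H2f z z1 z2 -> L2f (op P z z1 z2).
Proof.
move=> p0 bP hz i; have [lz lz1 lz2] := H2f_L2 hz.
have [lp _] := pot_bound p0 bP lz.
apply: L2D => //; apply: L2D; first exact: L2Z.
by have [] := L2_adv (lz1 i).
Qed.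

(** Here z, a and w stand for the norms of a function and of its first two derivatives. Inserting
    the equation for w into the interpolation inequality a^2 <= z w gives a quadratic inequality for
    a. *)
Lemma elliptic_scalar (a z w g kp : R) : 0 <= a -> 0 <= z -> 0 <= w -> 0 <= g ->
  k0 <= kp -> a ^+ 2 <= z * w -> kp * w <= g + c0 * a ->
  a <= (k0^-1 * c0 + 1) * z + k0^-1 * g /\ w <= k0^-1 * g + k0^-1 * c0 * a.
Proof.
move=> a0 z0 w0 g0 kp0 az wg.
have kw : w <= k0^-1 * g + k0^-1 * c0 * a.
  rewrite -mulrA -mulrDr -ler_pdivrMl ?invr_gt0// invrK.
  by apply: le_trans wg; exact: ler_wpM2r.
split => //; set q := k0^-1 * c0 in kw *; set t := k0^-1 * g in kw *.
have q0 : 0 <= q by rewrite mulr_ge0// invr_ge0 ltW.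
have t0 : 0 <= t by rewrite mulr_ge0// invr_ge0 ltW.
rewrite leNgt; apply/negP => h.
have h1 : a * ((q + 1) * z + t) < a * a.
  by rewrite ltr_pM2l//; apply: le_lt_trans h; rewrite addr_ge0// mulr_ge0// addr_ge0.
have h2 : t * z <= a * z.
  rewrite ler_wpM2r//; apply: le_trans (ltW h); rewrite lerDr.
  by rewrite mulr_ge0// addr_ge0.
have h3 : z * w <= z * (t + q * a) by rewrite ler_wpM2l.
have h4 : 0 <= a * t by rewrite mulr_ge0.
by rewrite expr2 in az; nra.
Qed.

(** Each row is solved for its second derivative, and [elliptic_scalar] removes the first-order
    term. The constant depends on the potential only through [p], which makes the gluing uniform. *)
Lemma elliptic (p : R) : 0 <= p -> exists2 C : R, 0 <= C & forall P z z1 z2,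
  bounded p P -> H2f z z1 z2 ->
  N z1 <= C * (N (op P z z1 z2) + N z) /\ N z2 <= C * (N (op P z z1 z2) + N z).
Proof.
move=> p0.
have ki0 : 0 <= k0^-1 by rewrite invr_ge0 ltW.
have n0 : 0 <= n by [].
pose A := (k0^-1 * c0 + 1) + k0^-1 * (1 + n * p).
have A0 : 0 <= A by rewrite !addr_ge0 ?mulr_ge0 ?addr_ge0 ?mulr_ge0.
pose B := k0^-1 * (1 + n * p) + k0^-1 * c0 * A.
have B0 : 0 <= B.
  apply: addr_ge0; apply: mulr_ge0 => //; last exact: mulr_ge0.
  by apply: addr_ge0 => //; exact: mulr_ge0.
exists (A + B); first exact: addr_ge0.
move=> P z z1 z2 bP hz; have [lz lz1 lz2] := H2f_L2 hz.
have lop := op_L2 p0 bP hz; have [lpot bpot] := pot_bound p0 bP lz.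
have H i : nu (z1 i) <= (k0^-1 * c0 + 1) * nu (z i) + k0^-1 * (nu (op P z z1 z2 i) + nu (pot P z i)) /\
    nu (z2 i) <= k0^-1 * (nu (op P z z1 z2 i) + nu (pot P z i)) + k0^-1 * c0 * nu (z1 i).
  have [_ _ _ w1 w2] := hz i; have [la ba] := L2_adv (lz1 i).
  apply: (@elliptic_scalar _ _ _ _ (kap i)); rewrite ?addr_ge0 ?nu_ge0//.
    exact: nu_interpolation.
  have -> : kap i * nu (z2 i) = nu (fun x => kap i * z2 i x).
    by rewrite nuZ// ger0_norm// (le_trans (ltW k00)).
  have -> : (fun x => kap i * z2 i x) =
      (fun x => (op P z z1 z2 i x - pot P z i x) - c i x * z1 i x).
    by apply/funext => x; rewrite /op; ring.
  apply: (le_trans (nuB (L2B (lop i) (lpot i)) la)); apply: lerD => //.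
  exact: nuB.
have H1 : N z1 <= (k0^-1 * c0 + 1) * N z + k0^-1 * (N (op P z z1 z2) + N (pot P z)).
  rewrite /N mulr_sumr -big_split/= mulr_sumr -big_split/=.
  by apply: ler_sum => i _; have [] := H i.
have H2 : N z2 <= k0^-1 * (N (op P z z1 z2) + N (pot P z)) + k0^-1 * c0 * N z1.
  rewrite /N -big_split/= !mulr_sumr -big_split/=.
  by apply: ler_sum => i _; have [] := H i.
set o := N (op P z z1 z2) in H1 H2 *; set w := N z in H1 H2 bpot *.
have o0 : 0 <= o by exact: N_ge0.
have w0 : 0 <= w by exact: N_ge0.
have E : k0^-1 * (o + N (pot P z)) <= k0^-1 * (1 + n * p) * (o + w).
  rewrite -mulrA ler_wpM2l//; have : 0 <= n * p * o by rewrite !mulr_ge0.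
  by lra.
have N1 : N z1 <= A * (o + w).
  apply: (le_trans H1); rewrite /A [leRHS]mulrDl; apply: lerD => //.
  by rewrite ler_wpM2l ?lerDr// addr_ge0// mulr_ge0.
have N2 : N z2 <= B * (o + w).
  apply: (le_trans H2); rewrite /B [leRHS]mulrDl; apply: lerD => //.
  by rewrite -[leRHS]mulrA ler_wpM2l// mulr_ge0.
rewrite mulrDl; split.
  by apply: (le_trans N1); rewrite lerDl mulr_ge0// addr_ge0.
by apply: (le_trans N2); rewrite lerDr mulr_ge0// addr_ge0.
Qed.

(** The solution operator comes from choice and is not known to be linear, nor to respect almost
    everywhere equality; [good_diff] supplies the Lipschitz estimate that replaces linearity. *)
Lemma good_solver P (K : R) : good P K -> exists S S1 S2 : vf -> vf,
  forall h, L2f h -> H2f (S h) (S1 h) (S2 h) /\ aeq (op P (S h) (S1 h) (S2 h)) h.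
Proof.
move=> [sP _].
have ex h : exists t : vf * vf * vf,
    L2f h -> H2f t.1.1 t.1.2 t.2 /\ aeq (op P t.1.1 t.1.2 t.2) h.
  have [lh|nlh] := pselect (L2f h); last by exists (h, h, h).
  by have [z [z1 [z2 hz]]] := sP h lh; exists (z, z1, z2).
have [F HF] := choice ex.
by exists (fun h => (F h).1.1), (fun h => (F h).1.2), (fun h => (F h).2).
Qed.

Lemma good_diff (p : R) P (K : R) z z1 z2 y y1 y2 g h : 0 <= p -> bounded p P ->
  good P K -> H2f z z1 z2 -> H2f y y1 y2 -> L2f g -> L2f h ->
  aeq (op P z z1 z2) g -> aeq (op P y y1 y2) h ->
  N (op P (fun i x => z i x - y i x) (fun i x => z1 i x - y1 i x)
       (fun i x => z2 i x - y2 i x)) = N (fun i x => g i x - h i x) /\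
  N (fun i x => z i x - y i x) <= K * N (fun i x => g i x - h i x).
Proof.
move=> p0 bP [_ lP] hz hy lg lh zg yh.
have hzy := H2fB hz hy.
have E : N (op P (fun i x => z i x - y i x) (fun i x => z1 i x - y1 i x)
       (fun i x => z2 i x - y2 i x)) = N (fun i x => g i x - h i x).
  apply: N_ae; [exact: op_L2 bP hzy|exact: L2fB|] => i.
  by apply: aeS2 (zg i) (yh i) => x; rewrite opB => -> ->.
by split => //; rewrite -E; exact: lP.
Qed.

(** For the bound, the difference of the potentials is absorbed. For solvability, with S the
    solution operator of P, one seeks a source g with g + (Q - P) S g = h by contraction; then S g
    solves the problem for Q. *)
Lemma good_perturb (p b : R) P Q (K : R) : 0 <= p -> bounded p P -> bounded p Q ->
  0 <= b -> bounded b (fun i k x => Q i k x - P i k x) -> 0 <= K ->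
  n * b * K <= 2^-1 -> good P K -> good Q (2 * K).
Proof.
move=> p0 bP bQ b0 bPQ K0 nbK gP; have [sP lP] := gP.
have potE z i x : pot Q z i x = pot P z i x + pot (fun i k x => Q i k x - P i k x) z i x.
  rewrite /pot -big_split/=; apply: eq_bigr => k _; ring.
have n0 : 0 <= n by [].
split; last first.
  move=> z z1 z2 hz; have [lz lz1 lz2] := H2f_L2 hz.
  have [lp bp] := pot_bound b0 bPQ lz.
  have := lP _ _ _ hz.
  have -> : N (op P z z1 z2) = N (fun i x => op Q z z1 z2 i x - pot (fun i k x => Q i k x - P i k x) z i x).
    by congr N; apply/funext => i; apply/funext => x; rewrite /op potE; ring.
  have := NB (op_L2 p0 bQ hz) lp.
  set u := N (fun _ _ => _ - _); set o := N (op Q _ _ _); move=> h1 h2.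
  have h3 : K * u <= K * (o + n * b * N z) by rewrite ler_wpM2l//; lra.
  have := N_ge0 z; nra.
move=> h lh; have [S [S1 [S2 HS]]] := good_solver gP.
pose D g := pot (fun i k x => Q i k x - P i k x) (S g).
have lD g : L2f g -> L2f (D g).
  move=> lg; have [hz _] := HS g lg; have [lz _ _] := H2f_L2 hz.
  by have [] := pot_bound b0 bPQ lz.
pose Phi g : vf := fun i x => h i x - D g i x.
have lPhi g : L2f g -> L2f (Phi g) by move=> lg; apply: L2fB => //; exact: lD.
have [| | |g [lg _ Hg]] := @fixpoint Phi (2 * N (Phi (fun _ _ => 0))).
- by move=> g lg _; exact: lPhi.
- move=> g g' lg lg' _ _.
  have [hz zg] := HS g lg; have [hz' zg'] := HS g' lg'.
  have [_ d] := good_diff p0 bP gP hz hz' lg lg' zg zg'.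
  have [lz _ _] := H2f_L2 (H2fB hz hz'); have [_ bz] := pot_bound b0 bPQ lz.
  have -> : N (fun i x => Phi g i x - Phi g' i x) =
      N (fun i x => - 1 * pot (fun i k x => Q i k x - P i k x) (fun i x => S g i x - S g' i x) i x).
    congr N; apply/funext => i; apply/funext => x.
    transitivity (D g' i x - D g i x); first by rewrite /Phi; ring.
    rewrite mulN1r /D /pot -sumrB -sumrN.
    by apply: eq_bigr => k _; ring.
  rewrite NZ; last by have [] := pot_bound b0 bPQ lz.
  rewrite normrN normr1 mul1r; apply: (le_trans bz).
  apply: (@le_trans _ _ (n * b * (K * N (fun i x => g i x - g' i x)))).
    by rewrite ler_wpM2l// mulr_ge0.
  by rewrite mulrA ler_wpM2r// N_ge0.
- by [].
have [hz zg] := HS g lg.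
exists (S g), (S1 g), (S2 g); split => // i.
apply: aeS2 (zg i) (Hg i) => x e1 e2.
have -> : op Q (S g) (S1 g) (S2 g) i x = op P (S g) (S1 g) (S2 g) i x + D g i x.
  by rewrite /op potE /D; ring.
by rewrite e1 -{1}e2 /Phi subrK.
Qed.

Lemma potB P z y i x :
  pot P (fun i x => z i x - y i x) i x = pot P z i x - pot P y i x.
Proof. by rewrite /pot -sumrB; apply: eq_bigr => k _; rewrite mulrBr. Qed.

Lemma good_shift (p : R) P (K s : R) : (forall i x, c i (x + s) = c i x) ->
  0 <= p -> bounded p P -> good P K -> good (fun i k x => P i k (x + s)) K.
Proof.
move=> cs p0 bP [sP lP].
have cs' i x : c i (x - s) = c i x by rewrite -cs subrK.
pose sh t h : vf := fun i x => h i (x + t).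
have Lsh t h : L2f h -> L2f (sh t h) by move=> lh i; exact: L2_shift.
have Nsh t h : L2f h -> N (sh t h) = N h.
  by move=> lh; apply: eq_bigr => i _; exact: nu_shift.
split=> [h lh|z z1 z2 hz].
  have [z [z1 [z2 [hz ez]]]] := sP (sh (- s) h) (Lsh _ _ lh).
  exists (sh s z), (sh s z1), (sh s z2); split=> i; first exact: H2d_shift.
  have := ae_shift s (ez i); apply: aeS => x; rewrite /sh addrK => <-.
  by rewrite /op cs.
have [lz _ _] := H2f_L2 hz.
have hz' : H2f (sh (- s) z) (sh (- s) z1) (sh (- s) z2).
  by move=> i; exact: H2d_shift.
have := lP _ _ _ hz'; rewrite Nsh//.
suff <- : sh s (op P (sh (- s) z) (sh (- s) z1) (sh (- s) z2)) =
    op (fun i k x => P i k (x + s)) z z1 z2 by rewrite Nsh//; exact: op_L2 bP hz'.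
apply/funext => i; apply/funext => x; rewrite /op /sh cs !addrK; congr (_ + _).
by rewrite /pot; under eq_bigr do rewrite addrK.
Qed.

(** * Cutoffs, commutators and gluing *)

Hypothesis k10 : 0 <= k1.

Definition cutoff (de : R) (t : R -> R) := smooth t /\ forall x,
  [/\ 0 <= t x <= 1, `|derive1 t x| <= de & `|derive1 (derive1 t) x| <= de].

Definition cut (t : R -> R) z : vf := fun i x => t x * z i x.
Definition cut1 (t : R -> R) z z1 : vf :=
  fun i x => derive1 t x * z i x + t x * z1 i x.
Definition cut2 (t : R -> R) z z1 z2 : vf := fun i x =>
  derive1 (derive1 t) x * z i x + 2 * (derive1 t x * z1 i x) + t x * z2 i x.

(** The operator with potential P applied to t z, minus t times the operator with potential Q
    applied to z: the commutator with t together with the error of exchanging the potentials. *)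
Definition com (t : R -> R) P Q z z1 : vf := fun i x =>
  kap i * (derive1 (derive1 t) x * z i x + 2 * (derive1 t x * z1 i x)) +
  c i x * (derive1 t x * z i x) + pot (fun i k x => t x * (P i k x - Q i k x)) z i x.

Lemma op_cut t P Q z z1 z2 i x :
  op P (cut t z) (cut1 t z z1) (cut2 t z z1 z2) i x =
  com t P Q z z1 i x + t x * op Q z z1 z2 i x.
Proof.
have E : pot P (cut t z) i x =
    pot (fun i k x => t x * (P i k x - Q i k x)) z i x + t x * pot Q z i x.
  rewrite /pot mulr_sumr -big_split/=; apply: eq_bigr => k _.
  by rewrite /cut; ring.
by rewrite /op E /com /cut1 /cut2; ring.
Qed.

Lemma comB t P Q z z1 y y1 i x :
  com t P Q (fun i x => z i x - y i x) (fun i x => z1 i x - y1 i x) i x =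
  com t P Q z z1 i x - com t P Q y y1 i x.
Proof. by rewrite /com potB; ring. Qed.

Lemma H2f_cut (de : R) t z z1 z2 : cutoff de t -> de <= 1 -> H2f z z1 z2 ->
  H2f (cut t z) (cut1 t z z1) (cut2 t z z1 z2).
Proof.
move=> [st ct] de1 hz i; apply: (@H2d_smoothM _ 1) => // x.
have [/andP[t0 t1] d1 d2] := ct x; split.
- by rewrite ger0_norm.
- exact: le_trans d1 _.
- exact: le_trans d2 _.
Qed.

Definition close (de : R) (t : R -> R) P Q := forall i k,
  {ae mu, forall x, `|t x * (P i k x - Q i k x)| <= de}.

Lemma com_bound (p de : R) t P Q z z1 : 0 <= de -> cutoff de t ->
  bounded p P -> bounded p Q -> close de t P Q -> L2f z -> L2f z1 ->
  L2f (com t P Q z z1) /\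
  N (com t P Q z z1) <= de * (2 * k1 + c0 + n) * (N z + N z1).
Proof.
move=> de0 [st ct] bP bQ cl lz lz1.
have st1 := smooth_derive st; have st2 := smooth_derive st1.
have b1 x : `|derive1 t x| <= de by have [] := ct x.
have b2 x : `|derive1 (derive1 t) x| <= de by have [] := ct x.
have m1 := smooth_mfun st1; have m2 := smooth_mfun st2.
have bW : bounded de (fun i k x => t x * (P i k x - Q i k x)).
  move=> i k; split; last exact: cl.
  have [mP _] := bP i k; have [mQ _] := bQ i k.
  by apply: measurable_funM; [exact: smooth_mfun|exact: measurable_funB].
have [lp bp] := pot_bound de0 bW lz.
have lA i : L2 (fun x => derive1 (derive1 t) x * z i x) by exact: (L2_mulbd m2 (ae_all b2)).
have lB i : L2 (fun x => derive1 t x * z1 i x) by exact: (L2_mulbd m1 (ae_all b1)).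
have lC i : L2 (fun x => derive1 t x * z i x) by exact: (L2_mulbd m1 (ae_all b1)).
have nA i : nu (fun x => derive1 (derive1 t) x * z i x) <= de * nu (z i).
  exact: (nu_mulbd m2 (ae_all b2)).
have nB i : nu (fun x => derive1 t x * z1 i x) <= de * nu (z1 i).
  exact: (nu_mulbd m1 (ae_all b1)).
have nC i : nu (fun x => derive1 t x * z i x) <= de * nu (z i).
  exact: (nu_mulbd m1 (ae_all b1)).
pose U : vf := fun i x => kap i * (derive1 (derive1 t) x * z i x + 2 * (derive1 t x * z1 i x)).
pose V : vf := fun i x => c i x * (derive1 t x * z i x).
have lU : L2f U by move=> i; apply: L2Z; apply: L2D => //; exact: L2Z.
have lV : L2f V by move=> i; have [] := L2_adv (z1 := fun i x => derive1 t x * z i x) (lC i).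
have nU : N U <= de * (k1 * N z + 2 * k1 * N z1).
  rewrite /N !mulr_sumr -big_split/= mulr_sumr; apply: ler_sum => i _.
  rewrite nuZ; last by apply: L2D => //; exact: L2Z.
  have := nuD (lA i) (L2Z 2 (lB i)); rewrite nuZ// (ger0_norm (ler0n _ 2)).
  rewrite (ger0_norm (le_trans (ltW k00) (k0k i))) => h.
  have h0 : 0 <= nu (z i) by exact: nu_ge0.
  have h1 : 0 <= nu (z1 i) by exact: nu_ge0.
  apply: (@le_trans _ _ (k1 * (de * nu (z i) + 2 * (de * nu (z1 i))))).
    apply: ler_pM => //; [exact: le_trans (ltW k00) (k0k i)|exact: nu_ge0|].
    by apply: (le_trans h); apply: lerD => //; rewrite ler_wpM2l.
  by rewrite le_eqVlt; apply/orP; left; apply/eqP; ring.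
have nV : N V <= de * (c0 * N z).
  rewrite /N !mulr_sumr; apply: ler_sum => i _.
  have [_ h] := L2_adv (z1 := fun i x => derive1 t x * z i x) (lC i).
  by apply: (le_trans h); rewrite mulrCA ler_wpM2l.
split; first by move=> i; apply: L2D => //; exact: (L2D (lU i) (lV i)).
apply: (le_trans (ND (L2fD lU lV) lp)).
have h := ND lU lV.
have z0 := N_ge0 z; have z10 := N_ge0 z1.
have e1 : 0 <= de * k1 * N z by rewrite !mulr_ge0.
have e2 : 0 <= de * c0 * N z1 by rewrite !mulr_ge0.
have e3 : 0 <= de * n * N z1 by rewrite !mulr_ge0.
have -> : de * (2 * k1 + c0 + n) * (N z + N z1) =
  de * k1 * N z + de * (k1 * N z + 2 * k1 * N z1) + (de * (c0 * N z) + de * c0 * N z1) + (n * de * N z + de * n * N z1).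
  by ring.
lra.
Qed.

(** The bound: apply the estimates for P1 and P2 to t1 z and t2 z, add up using t1 + t2 >= 1, and
    absorb the commutators by [elliptic]. Solvability: t1 S1 (h1 g) + t2 S2 (h2 g) solves the
    equation for g up to commutators, because t1 h1 + t2 h2 = h1 + h2 = 1; a contraction then
    adjusts the source g. Only t1 and t2 are differentiated, so h1 and h2 may jump. *)
Lemma good_glue (p K : R) : 0 <= p -> 0 <= K -> exists2 de : R, 0 < de <= 1 &
  forall P P1 P2 (t1 t2 h1 h2 : R -> R), bounded p P -> bounded p P1 -> bounded p P2 ->
  good P1 K -> good P2 K -> cutoff de t1 -> cutoff de t2 ->
  measurable_fun [set: R] h1 -> measurable_fun [set: R] h2 ->
  (forall x, `|h1 x| <= 1) -> (forall x, `|h2 x| <= 1) ->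
  (forall x, h1 x + h2 x = 1) -> (forall x, t1 x * h1 x = h1 x) ->
  (forall x, t2 x * h2 x = h2 x) -> (forall x, 1 <= t1 x + t2 x) ->
  close de t1 P P1 -> close de t2 P P2 -> good P (4 * K + 1).
Proof.
move=> p0 K0; have [Ce Ce0 HCe] := elliptic p0.
have n0 : 0 <= n by [].
pose A := 2 * k1 + c0 + n; have A0 : 0 <= A by rewrite !addr_ge0// mulr_ge0.
pose B := A * (K + Ce * (1 + K)) + K * A * (1 + Ce).
have B0 : 0 <= B.
  by rewrite /B; do ?[apply: addr_ge0 => // | apply: mulr_ge0 => //].
(* [B] collects the commutator constants of both halves, and de B <= 1/4. With w and o the norms of
   z and of its image, this gives w <= 2 K o + (w + o)/2, hence the constant 4 K + 1, and in the
   solvability half two errors of 1/4, hence the contraction factor 1/2. *)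
pose de := (4 * B + 1)^-1.
have b1 : 0 < 4 * B + 1 by rewrite ltr_wpDl// mulr_ge0.
have de0 : 0 < de by rewrite invr_gt0.
have deB : de * B <= 4^-1.
  by rewrite /de mulrC ler_pdivrMr// mulrDr mulrA mulVf// mul1r lerDl mulr1 invr_ge0.
exists de; first by rewrite de0/= invf_le1// lerDr mulr_ge0.
have de1 : de <= 1 by rewrite invf_le1// lerDr mulr_ge0.
move=> P P1 P2 t1 t2 h1 h2 bP bP1 bP2 g1 g2 ct1 ct2 mh1 mh2 h11 h21 h12 th1 th2 t12 cl1 cl2.
have lower t P' z z1 z2 : bounded p P' -> good P' K -> cutoff de t -> close de t P P' ->
    H2f z z1 z2 ->
    N (cut t z) <= K * (N (op P z z1 z2) + de * A * (N z + N z1)).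
  move=> bP' [_ lP'] ct cl hz; have [lz lz1 lz2] := H2f_L2 hz.
  have hc := H2f_cut ct de1 hz; apply: (le_trans (lP' _ _ _ hc)).
  rewrite ler_wpM2l//.
  have cl' : close de t P' P.
    by move=> i k; apply: aeS (cl i k) => x; rewrite -normrN -mulrN opprB.
  have [lc bc] := com_bound (ltW de0) ct bP' bP cl' lz lz1.
  have [st ct'] := ct.
  have tb x : `|t x| <= 1 by have [/andP[? ?] _ _] := ct' x; rewrite ger0_norm.
  have [lto bto] := N_mulbd (smooth_mfun st) (ae_all tb) ler01 (op_L2 p0 bP hz).
  have -> : op P' (cut t z) (cut1 t z z1) (cut2 t z z1 z2) =
      (fun i x => com t P' P z z1 i x + t x * op P z z1 z2 i x).
    by apply/funext => i; apply/funext => x; exact: op_cut.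
  by apply: (le_trans (ND lc lto)); rewrite addrC lerD//; rewrite mul1r in bto.
split; last first.
  move=> z z1 z2 hz; have [lz lz1 lz2] := H2f_L2 hz.
  have l1 := lower _ _ _ _ _ bP1 g1 ct1 cl1 hz.
  have l2 := lower _ _ _ _ _ bP2 g2 ct2 cl2 hz.
  have [e1 _] := HCe _ _ _ _ bP hz.
  have [lc1 _ _] := H2f_L2 (H2f_cut ct1 de1 hz).
  have [lc2 _ _] := H2f_L2 (H2f_cut ct2 de1 hz).
  have S : N z <= N (cut t1 z) + N (cut t2 z).
    rewrite /N -big_split/=; apply: ler_sum => i _.
    apply: (@le_trans _ _ (nu (fun x => `|cut t1 z i x| + `|cut t2 z i x|))).
      apply: nu_le; [exact: L2_mfun|by apply: L2D; exact: L2_norm|].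
      apply: ae_all => x; rewrite /cut !normrM -mulrDl -[leLHS]mul1r ler_wpM2r//.
      by apply: (le_trans (t12 x)); apply: lerD; exact: ler_norm.
    by apply: (le_trans (nuD (L2_norm (lc1 i)) (L2_norm (lc2 i)))); rewrite !nu_norm.
  set o := N (op _ _ _ _) in l1 l2 e1 *; set w := N z in l1 l2 e1 S *.
  have o0 : 0 <= o by exact: N_ge0.
  have w0 : 0 <= w by exact: N_ge0.
  have z10 : 0 <= N z1 by exact: N_ge0.
  have F : K * (de * A * (w + N z1)) <= 4^-1 * (w + o).
    apply: (@le_trans _ _ (de * B * (w + o))); last by rewrite ler_wpM2r// addr_ge0.
    apply: (@le_trans _ _ (de * (K * A * (1 + Ce)) * (w + o))); last first.
      rewrite ler_wpM2r ?addr_ge0// ler_wpM2l ?(ltW de0)// lerDr.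
      by do ?[apply: addr_ge0 => // | apply: mulr_ge0 => //].
    have -> : de * (K * A * (1 + Ce)) * (w + o) = K * (de * A * ((1 + Ce) * (w + o))) by ring.
    rewrite ler_wpM2l// ler_wpM2l ?mulr_ge0 ?(ltW de0)//.
    by lra.
  lra.
move=> h lh.
have [S1 [S11 [S12 HS1]]] := good_solver g1; have [S2 [S21 [S22 HS2]]] := good_solver g2.
pose E1 g := com t1 P P1 (S1 (cut h1 g)) (S11 (cut h1 g)).
pose E2 g := com t2 P P2 (S2 (cut h2 g)) (S21 (cut h2 g)).
have Lcut (hh : R -> R) g : measurable_fun [set: R] hh -> (forall x, `|hh x| <= 1) -> L2f g ->
    L2f (cut hh g) /\ N (cut hh g) <= N g.
  move=> mh hb lg; have := N_mulbd mh (ae_all hb) ler01 lg.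
  by rewrite mul1r.
have Ediff t (hh : R -> R) P' S S' S'' g g' : bounded p P' -> good P' K -> cutoff de t -> close de t P P' ->
    measurable_fun [set: R] hh -> (forall x, `|hh x| <= 1) ->
    (forall h, L2f h -> H2f (S h) (S' h) (S'' h) /\ aeq (op P' (S h) (S' h) (S'' h)) h) ->
    L2f g -> L2f g' ->
    L2f (com t P P' (S (cut hh g)) (S' (cut hh g))) /\
    N (fun i x => com t P P' (S (cut hh g)) (S' (cut hh g)) i x -
                  com t P P' (S (cut hh g')) (S' (cut hh g')) i x) <=
    4^-1 * N (fun i x => g i x - g' i x).
  move=> bP' gP' ct cl mh hb HS lg lg'.
  have [lc _] := Lcut _ _ mh hb lg; have [lc' _] := Lcut _ _ mh hb lg'.
  have [hz zg] := HS _ lc; have [hz' zg'] := HS _ lc'.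
  have [lz lz1 _] := H2f_L2 hz.
  have [lcom _] := com_bound (ltW de0) ct bP bP' cl lz lz1; split => //.
  have [eo bo] := good_diff p0 bP' gP' hz hz' lc lc' zg zg'.
  have hd := H2fB hz hz'; have [ld ld1 _] := H2f_L2 hd.
  have [el _] := HCe _ _ _ _ bP' hd.
  have [_ bc] := com_bound (ltW de0) ct bP bP' cl ld ld1.
  have -> : (fun i x => com t P P' (S (cut hh g)) (S' (cut hh g)) i x -
                  com t P P' (S (cut hh g')) (S' (cut hh g')) i x) =
    com t P P' (fun i x => S (cut hh g) i x - S (cut hh g') i x)
               (fun i x => S' (cut hh g) i x - S' (cut hh g') i x).
    by apply/funext => i; apply/funext => x; rewrite comB.
  apply: (le_trans bc); rewrite -/A.
  have cd : N (fun i x => cut hh g i x - cut hh g' i x) <= N (fun i x => g i x - g' i x).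
    have -> : (fun i x => cut hh g i x - cut hh g' i x) = cut hh (fun i x => g i x - g' i x).
      by apply/funext => i; apply/funext => x; rewrite /cut mulrBr.
    by have [] := Lcut _ _ mh hb (L2fB lg lg').
  rewrite eo in el.
  set q := N (fun _ _ => cut _ _ _ _ - _) in el bo cd.
  set d := N (fun _ _ => g _ _ - _) in cd *.
  set a := N (fun _ _ => S _ _ _ - _) in el bo *; set b := N (fun _ _ => S' _ _ _ - _) in el *.
  have q0 : 0 <= q by exact: N_ge0.
  have ab : a + b <= (K + Ce * (1 + K)) * d.
    apply: (@le_trans _ _ ((K + Ce * (1 + K)) * q)); last first.
      by rewrite ler_wpM2l// addr_ge0// mulr_ge0// addr_ge0.
    have : Ce * (q + a) <= Ce * (q + K * q) by rewrite ler_wpM2l// lerD2l.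
    by lra.
  apply: (@le_trans _ _ (de * A * ((K + Ce * (1 + K)) * d))).
    by rewrite ler_wpM2l// mulr_ge0// ltW.
  have d0 : 0 <= d by exact: N_ge0.
  apply: (@le_trans _ _ (de * B * d)); last by rewrite ler_wpM2r.
  rewrite -[de * A * _]mulrA -[leRHS]mulrA ler_wpM2l ?(ltW de0)// mulrA ler_wpM2r//.
  by rewrite lerDl; do ?[apply: addr_ge0 => // | apply: mulr_ge0 => //].
pose Phi g : vf := fun i x => h i x - (E1 g i x + E2 g i x).
have lE1 g : L2f g -> L2f (E1 g).
  by move=> lg; have [] := Ediff t1 h1 P1 S1 S11 S12 g g bP1 g1 ct1 cl1 mh1 h11 HS1 lg lg.
have lE2 g : L2f g -> L2f (E2 g).
  by move=> lg; have [] := Ediff t2 h2 P2 S2 S21 S22 g g bP2 g2 ct2 cl2 mh2 h21 HS2 lg lg.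
have lPhi g : L2f g -> L2f (Phi g).
  by move=> lg; apply: L2fB => //; apply: L2fD; [exact: lE1|exact: lE2].
have [| | |g [lg _ Hg]] := @fixpoint Phi (2 * N (Phi (fun _ _ => 0))).
- by move=> g lg _; exact: lPhi.
- move=> g g' lg lg' _ _.
  have [_ d1] := Ediff t1 h1 P1 S1 S11 S12 g' g bP1 g1 ct1 cl1 mh1 h11 HS1 lg' lg.
  have [_ d2] := Ediff t2 h2 P2 S2 S21 S22 g' g bP2 g2 ct2 cl2 mh2 h21 HS2 lg' lg.
  have -> : N (fun i x => Phi g i x - Phi g' i x) =
      N (fun i x => (E1 g' i x - E1 g i x) + (E2 g' i x - E2 g i x)).
    by congr N; apply/funext => i; apply/funext => x; rewrite /Phi; ring.
  have sym : N (fun i x => g' i x - g i x) = N (fun i x => g i x - g' i x).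
    apply: eq_bigr => i _; rewrite -[RHS]nuN; congr nu; apply/funext => x; ring.
  apply: (le_trans (ND (L2fB (lE1 _ lg') (lE1 _ lg)) (L2fB (lE2 _ lg') (lE2 _ lg)))).
  by rewrite sym in d1 d2; apply: (le_trans (lerD d1 d2)); lra.
- by [].
have [lc1 _] := Lcut _ _ mh1 h11 lg; have [lc2 _] := Lcut _ _ mh2 h21 lg.
have [hz1 zg1] := HS1 _ lc1; have [hz2 zg2] := HS2 _ lc2.
have H1 := H2f_cut ct1 de1 hz1; have H2 := H2f_cut ct2 de1 hz2.
eexists; eexists; eexists; split; first by move=> i; exact: (H2dD (H1 i) (H2 i)).
move=> i; apply: aeS3 (zg1 i) (zg2 i) (Hg i) => x e1 e2 e3.
set u1 := cut t1 _; set u2 := cut t2 _.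
transitivity (op P u1 (cut1 t1 (S1 (cut h1 g)) (S11 (cut h1 g)))
    (cut2 t1 (S1 (cut h1 g)) (S11 (cut h1 g)) (S12 (cut h1 g))) i x +
  op P u2 (cut1 t2 (S2 (cut h2 g)) (S21 (cut h2 g)))
    (cut2 t2 (S2 (cut h2 g)) (S21 (cut h2 g)) (S22 (cut h2 g))) i x).
  rewrite /op; have -> : pot P (fun i x => u1 i x + u2 i x) i x = pot P u1 i x + pot P u2 i x.
    by rewrite /pot -big_split/=; apply: eq_bigr => k _; rewrite mulrDr.
  by ring.
rewrite (op_cut t1 P P1) (op_cut t2 P P2) e1 e2 /cut !mulrA th1 th2.
have := h12 x; rewrite -/(E1 g i x) -/(E2 g i x); move: e3; rewrite /Phi.
set a := E1 g i x; set b := E2 g i x => e3 hh.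
have : h1 x * g i x + h2 x * g i x = g i x by rewrite -mulrDl hh mul1r.
lra.
Qed.

Lemma cutoff_step : exists2 C : R, 0 < C & forall de r b : R, `|r| <= 1 ->
  `|r| * C <= de -> cutoff de (fun x => step (r * x + b)).
Proof.
have [ss _ _ s1 [C C0 HC]] := @stepP R; exists C; [exact: C0|move=> de r b r1 rC].
have d1 x : derive1 (fun x => step (r * x + b)) x = r * derive1 step (r * x + b).
  by apply: derive1_val; apply: is_derive_affine; exact: smooth_is_derive.
have d2 x : derive1 (derive1 (fun x => step (r * x + b))) x =
    r * (r * derive1 (derive1 step) (r * x + b)).
  have -> : derive1 (fun x => step (r * x + b)) = (fun x => r * derive1 step (r * x + b)).
    by apply/funext => y; exact: d1.
  apply: derive1_val; apply: (is_deriveZ r).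
  by apply: is_derive_affine; apply: smooth_is_derive; exact: smooth_derive.
split=> [|x]; first exact: smooth_affine.
rewrite d1 d2 !normrM; have [h1 h2] := HC (r * x + b); split; first exact: s1.
  by apply: le_trans rC; exact: ler_wpM2l.
apply: le_trans rC; rewrite -[leRHS]mulrC; apply: (@le_trans _ _ (1 * (`|r| * C))).
  by apply: ler_pM => //; exact: ler_wpM2l.
by rewrite mul1r mulrC.
Qed.

(** The cutoffs are steps stretched to length l on either side of s, so P1 and P2 have to
    approximate P only on their own half-line enlarged by l; the sharp partition jumps at s. *)
Lemma good_glue_line (p K : R) : 0 <= p -> 0 <= K ->
  exists2 de : R, 0 < de & exists2 l : R, 0 < l &
  forall P P1 P2 (s : R), bounded p P -> bounded p P1 -> bounded p P2 ->
  good P1 K -> good P2 K ->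
  (forall i k, {ae mu, forall x, x <= s + l -> `|P i k x - P1 i k x| <= de}) ->
  (forall i k, {ae mu, forall x, s - l <= x -> `|P i k x - P2 i k x| <= de}) ->
  good P (4 * K + 1).
Proof.
move=> p0 K0; have [de /andP[de0 de1] glue] := good_glue p0 K0.
have [C C0 HC] := cutoff_step.
(* Then l >= 1 and C / l <= de, so a step stretched to length l is an admissible cutoff. *)
exists de => //; pose l := 1 + C * de^-1; exists l.
  by rewrite addr_gt0// divr_gt0.
have l1 : 1 <= l by rewrite lerDl divr_ge0// ltW.
have l0 : 0 < l := lt_le_trans ltr01 l1.
have li : `|l^-1| <= 1 by rewrite ger0_norm ?invr_ge0 ?(ltW l0)// invf_le1.
have lC : `|l^-1| * C <= de.
  rewrite ger0_norm ?invr_ge0 ?(ltW l0)// mulrC ler_pdivrMr// /l mulrDr mulr1.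
  by rewrite mulrCA divff ?gt_eqF// mulr1 lerDr ltW.
move=> P P1 P2 s bP bP1 bP2 g1 g2 c1 c2.
have [_ s0 s1 sb _] := @stepP R.
pose t1 (x : R) := step (- l^-1 * x + (l^-1 * s + 1)).
pose t2 (x : R) := step (l^-1 * x + (1 - l^-1 * s)).
have t1E x : - l^-1 * x + (l^-1 * s + 1) = 1 - l^-1 * (x - s) by ring.
have t2E x : l^-1 * x + (1 - l^-1 * s) = 1 + l^-1 * (x - s) by ring.
have t1l x : x <= s -> t1 x = 1.
  move=> xs; rewrite /t1 t1E s1// lerBrDl gerDr mulr_ge0_le0 ?invr_ge0 ?(ltW l0)//.
  by rewrite subr_le0.
have t1r x : s + l <= x -> t1 x = 0.
  by move=> xs; rewrite /t1 t1E s0// subr_le0 -(mulVf (lt0r_neq0 l0)) ler_pM2l ?invr_gt0// lerBrDl.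
have t2r x : s <= x -> t2 x = 1.
  by move=> xs; rewrite /t2 t2E s1// lerDl mulr_ge0 ?invr_ge0 ?(ltW l0)// subr_ge0.
have t2l x : x <= s - l -> t2 x = 0.
  move=> xs; rewrite /t2 t2E s0// -(mulVf (lt0r_neq0 l0)) -mulrDr pmulr_rle0 ?invr_gt0//.
  by rewrite -lerBrDl sub0r lerBlDl.
pose h1 (x : R) : R := if x <= s then 1 else 0.
pose h2 (x : R) : R := if x <= s then 0 else 1.
have tb (t : R -> R) (Q : I -> I -> R -> R) : (forall x, 0 <= t x <= 1) ->
    (forall i k, {ae mu, forall x, t x != 0 -> `|P i k x - Q i k x| <= de}) -> close de t P Q.
  move=> t01 H i k; apply: aeS (H i k) => x h.
  have [->|/h h'] := eqVneq (t x) 0; first by rewrite mul0r normr0 ltW.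
  have /andP[x0 x1] := t01 x; rewrite normrM ger0_norm//.
  by rewrite -[leRHS]mul1r ler_pM.
apply: (glue P P1 P2 t1 t2 h1 h2) => //.
- by apply: HC; rewrite normrN.
- by apply: HC.
- by apply: measurable_fun_ifT => //; exact: measurable_fun_ler.
- by apply: measurable_fun_ifT => //; exact: measurable_fun_ler.
- by move=> x; rewrite /h1; case: ifP; rewrite ?normr1 ?normr0.
- by move=> x; rewrite /h2; case: ifP; rewrite ?normr1 ?normr0.
- by move=> x; rewrite /h1 /h2; case: ifP; rewrite ?addr0 ?add0r.
- by move=> x; rewrite /h1; case: leP => xs; rewrite ?mulr0// t1l// mulr1.
- by move=> x; rewrite /h2; case: leP => xs; rewrite ?mulr0// t2r ?(ltW xs)// mulr1.
- move=> x; have /andP[a1 _] := sb (- l^-1 * x + (l^-1 * s + 1)).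
  have /andP[a2 _] := sb (l^-1 * x + (1 - l^-1 * s)).
  by case: (leP x s) => xs; [rewrite t1l// lerDl|rewrite t2r ?(ltW xs)// lerDr].
- apply: tb => [x|i k]; first exact: sb.
  apply: aeS (c1 i k) => x h t0; apply: h; rewrite leNgt; apply/negP => /ltW/t1r e.
  by rewrite e eqxx in t0.
- apply: tb => [x|i k]; first exact: sb.
  apply: aeS (c2 i k) => x h t0; apply: h; rewrite leNgt; apply/negP => /ltW/t2l e.
  by rewrite e eqxx in t0.
Qed.

End EllipticSystems.

(** * The Klausmeier linearization as a real system *)

Section KlausmeierSystem.
Context {R : realType}.
Variables (d a m eps : R) (f g : R -> R).
Local Notation mu := (@lebesgue_measure R).
Local Notation vf4 := (bool * bool -> R -> R).
Implicit Types (u : R -> R * R) (z : R -> R[i] * R[i]).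

Definition kap2 (i : bool) : R := if i then d ^+ 2 else 1.

Definition c2 (i : bool) (x : R) : R := if i then 0 else eps * f x.

Definition jac u (i k : bool) (x : R) : R :=
  let w := (u x).1 in let p := (u x).2 in
  if i then (if k then - m + 2 * w * p else p ^+ 2)
  else (if k then - (2 * w * p) else eps * g x - 1 - p ^+ 2).

(* The index (i, b) stands for the real (b = false) or imaginary (b = true)
   part of the component i. *)
Definition kap4 (i : bool * bool) := kap2 i.1.
Definition c4 (i : bool * bool) := c2 i.1.

(** The real form of J - (al + i be). Multiplication by -i be sends the imaginary part, times be, to
    the real row and the real part, times -be, to the imaginary row. *)
Definition lpot (J : bool -> bool -> R -> R) (al be : R) (i k : bool * bool) (x : R) : R :=
  if i.2 == k.2 then J i.1 k.1 x - (if i.1 == k.1 then al else 0)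
  else if i.1 == k.1 then (if i.2 then - be else be) else 0.

Definition tovf z : vf4 := fun i =>
  let zi := if i.1 then snd_fun z else fst_fun z in
  if i.2 then im_fun zi else re_fun zi.

Definition ofvf (h : vf4) : R -> R[i] * R[i] := fun x =>
  ((h (false, false) x +i* h (false, true) x)%C,
   (h (true, false) x +i* h (true, true) x)%C).

Lemma ofvfK h : tovf (ofvf h) = h.
Proof. by apply/funext => -[[] []]. Qed.

Lemma tovfK z : ofvf (tovf z) = z.
Proof.
apply/funext => x; rewrite /ofvf /tovf /re_fun /im_fun /fst_fun /snd_fun /=.
by case: (z x) => -[? ?] [? ?].
Qed.

Lemma tovf_eq z y x : (forall i, tovf z i x = tovf y i x) -> z x = y x.
Proof.
move=> H; rewrite -(tovfK z) -(tovfK y) /ofvf.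
by rewrite !H.
Qed.

Lemma tovf_congr z y x i : z x = y x -> tovf z i x = tovf y i x.
Proof. by move=> e; rewrite /tovf /re_fun /im_fun /fst_fun /snd_fun; case: i => -[] []/=; rewrite e. Qed.

Lemma big_bool2 (F : bool * bool -> R) : \sum_i F i =
  F (true, true) + F (true, false) + (F (false, true) + F (false, false)).
Proof.
rewrite -(eq_bigr _ (fun i _ => congr1 F (esym (surjective_pairing i)))).
by rewrite -(pair_bigA _ (fun i b => F (i, b)))/= !big_bool.
Qed.

Lemma jacobianE u x : let w := (u x).1 in let p := (u x).2 in
  [/\ derive1 (fun s => N1 a g eps x s p) w = jac u false false x,
      derive1 (fun s => N1 a g eps x w s) p = jac u false true x,
      derive1 (fun s => N2 m s p) w = jac u true false x &
      derive1 (fun s => N2 m w s) p = jac u true true x].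
Proof.
move=> w p; rewrite /jac -/w -/p /N1 /N2.
split; apply: derive1_val.
- have -> : (fun s => eps * g x * s - s - s * p ^+ 2 + a) =
    (fun s => (eps * g x - 1 - p ^+ 2) * s + a) by apply/funext => s; ring.
  have := is_derive_affine (f := id) (a := eps * g x - 1 - p ^+ 2) (b := a) (is_derive_id _ (1 : R)).
  by rewrite mulr1.
- have -> : (fun s => eps * g x * w - w - w * s ^+ 2 + a) =
    (fun s => - w * (s * s) + (eps * g x * w - w + a)) by apply/funext => s; ring.
  have h := is_deriveMx (is_derive_id p (1 : R)) (is_derive_id p (1 : R)).
  have h' := is_deriveD (is_deriveZ (- w) h) (is_derive_cst (eps * g x * w - w + a) p 1).
  by apply: (is_derive_eq h'); rewrite /GRing.scale/=; ring.
- have -> : (fun s => - m * p + s * p ^+ 2) = (fun s => p ^+ 2 * s + - m * p).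
    by apply/funext => s; ring.
  have := is_derive_affine (f := id) (a := p ^+ 2) (b := - m * p) (is_derive_id _ (1 : R)).
  by rewrite mulr1.
- have -> : (fun s => - m * s + w * s ^+ 2) = (fun s => - m * s + w * (s * s)).
    by apply/funext => s; ring.
  have h := is_deriveMx (is_derive_id p (1 : R)) (is_derive_id p (1 : R)).
  have h' := is_deriveD (is_deriveZ (- m) (is_derive_id p (1 : R))) (is_deriveZ w h).
  by apply: (is_derive_eq h'); rewrite /GRing.scale/=; ring.
Qed.

Lemma Re_row (z2 z1 y1 y2 y : R[i]) (c j1 j2 al be : R) :
  complex.Re (z2 + c%:C%C * z1 + (j1%:C%C * y1 + j2%:C%C * y2) - (al +i* be)%C * y) =
  complex.Re z2 + c * complex.Re z1 + (j1 * complex.Re y1 + j2 * complex.Re y2) -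
    (al * complex.Re y - be * complex.Im y).
Proof. by case: z2 z1 y1 y2 y => ? ? [? ?] [? ?] [? ?] [? ?] /=; ring. Qed.

Lemma Im_row (z2 z1 y1 y2 y : R[i]) (c j1 j2 al be : R) :
  complex.Im (z2 + c%:C%C * z1 + (j1%:C%C * y1 + j2%:C%C * y2) - (al +i* be)%C * y) =
  complex.Im z2 + c * complex.Im z1 + (j1 * complex.Im y1 + j2 * complex.Im y2) -
    (al * complex.Im y + be * complex.Re y).
Proof. by case: z2 z1 y1 y2 y => ? ? [? ?] [? ?] [? ?] [? ?] /=; ring. Qed.

Lemma Re_scale (k : R) (y : R[i]) : complex.Re (k%:C%C * y) = k * complex.Re y.
Proof. by case: y => ? ? /=; ring. Qed.

Lemma Im_scale (k : R) (y : R[i]) : complex.Im (k%:C%C * y) = k * complex.Im y.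
Proof. by case: y => ? ? /=; ring. Qed.

Lemma shift_opE u al be z i x :
  tovf (shift_op (L_op d a m f g eps u) (al +i* be)%C z) i x =
  op kap4 c4 (lpot (jac u) al be) (tovf z) (fun i => wderiv (tovf z i))
     (fun i => wderiv (wderiv (tovf z i))) i x.
Proof.
have [e1 e2 e3 e4] := jacobianE u x.
have E1 : (shift_op (L_op d a m f g eps u) (al +i* be)%C z x).1 =
    cwderiv (cwderiv (fst_fun z)) x + (eps * f x)%:C%C * cwderiv (fst_fun z) x +
    ((jac u false false x)%:C%C * (z x).1 + (jac u false true x)%:C%C * (z x).2) -
    (al +i* be)%C * (z x).1 by rewrite -e1 -e2.
(* A vanishing advection term is inserted so that the second row has the shape expected by [Re_row]
   and [Im_row]. *)
have E2 : (shift_op (L_op d a m f g eps u) (al +i* be)%C z x).2 =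
    (d ^+ 2)%:C%C * cwderiv (cwderiv (snd_fun z)) x + 0%:C%C * 0 +
    ((jac u true false x)%:C%C * (z x).1 + (jac u true true x)%:C%C * (z x).2) -
    (al +i* be)%C * (z x).2 by rewrite -e3 -e4 mul0r addr0.
rewrite /op /pot big_bool2.
case: i => -[] [].
- transitivity (complex.Im (shift_op (L_op d a m f g eps u) (al +i* be)%C z x).2); first by [].
  rewrite E2 Im_row Im_scale /lpot /kap4 /c4 /kap2 /c2/=.
  rewrite /tovf/= /im_fun /re_fun /fst_fun /snd_fun; ring.
- transitivity (complex.Re (shift_op (L_op d a m f g eps u) (al +i* be)%C z x).2); first by [].
  rewrite E2 Re_row Re_scale /lpot /kap4 /c4 /kap2 /c2/=.
  rewrite /tovf/= /im_fun /re_fun /fst_fun /snd_fun; ring.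
- transitivity (complex.Im (shift_op (L_op d a m f g eps u) (al +i* be)%C z x).1); first by [].
  rewrite E1 Im_row /lpot /kap4 /c4 /kap2 /c2/=.
  rewrite /tovf/= /im_fun /re_fun /fst_fun /snd_fun; ring.
- transitivity (complex.Re (shift_op (L_op d a m f g eps u) (al +i* be)%C z x).1); first by [].
  rewrite E1 Re_row /lpot /kap4 /c4 /kap2 /c2/=.
  rewrite /tovf/= /im_fun /re_fun /fst_fun /snd_fun; ring.
Qed.

Definition cnorm z : R -> R := fun x => Num.sqrt (
  complex.Re (z x).1 ^+ 2 + complex.Im (z x).1 ^+ 2 +
  complex.Re (z x).2 ^+ 2 + complex.Im (z x).2 ^+ 2).

Lemma cnormE z x : cnorm z x = Num.sqrt (\sum_i tovf z i x ^+ 2).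
Proof. by congr Num.sqrt; rewrite big_bool2/=; ring. Qed.

Lemma tovf_le z i x : `|tovf z i x| <= cnorm z x.
Proof.
rewrite -ler_sqr ?nnegrE ?sqrtr_ge0// cnormE sqr_sqrtr ?sumr_ge0//; last first.
  by move=> k _; exact: sqr_ge0.
rewrite -normrX ger0_norm ?sqr_ge0// (bigD1 i)//= lerDl sumr_ge0// => k _.
exact: sqr_ge0.
Qed.

Lemma cnorm_le z x : cnorm z x <= \sum_i `|tovf z i x|.
Proof.
have s0 : 0 <= \sum_i `|tovf z i x| by apply: sumr_ge0.
rewrite -ler_sqr ?nnegrE ?sqrtr_ge0// cnormE sqr_sqrtr ?sumr_ge0//; last first.
  by move=> k _; exact: sqr_ge0.
rewrite expr2 mulr_suml; apply: ler_sum => i _.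
rewrite -[_ ^+ 2]ger0_norm ?sqr_ge0// normrX expr2 ler_wpM2l//.
by rewrite (bigD1 i)//= lerDl sumr_ge0.
Qed.

Lemma L2cP z : L2c z <-> L2f (tovf z).
Proof.
split=> [[l1 l2 l3 l4] [[] []]//|l].
by split; [exact: (l (false, false))|exact: (l (false, true))|
  exact: (l (true, false))|exact: (l (true, true))].
Qed.

Lemma H2cP z : H2c z -> H2f (tovf z) (fun i => wderiv (tovf z i))
  (fun i => wderiv (wderiv (tovf z i))).
Proof.
move=> [h1 h2 h3 h4] [[] []].
- exact: (H2dP h4).
- exact: (H2dP h3).
- exact: (H2dP h2).
- exact: (H2dP h1).
Qed.

Lemma H2f_H2c (h h1 h2 : vf4) : H2f h h1 h2 -> H2c (ofvf h).
Proof.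
move=> l; split; apply: H2d_H2.
- exact: (l (false, false)).
- exact: (l (false, true)).
- exact: (l (true, false)).
- exact: (l (true, true)).
Qed.

Lemma L2norm_N z : L2c z -> exists2 r : R, L2norm z = r%:E &
  r <= N (tovf z) /\ N (tovf z) <= #|{: bool * bool}|%:R * r.
Proof.
move=> /L2cP lz.
have [lS bS] := L2_sum (fun i => L2_norm (lz i)).
have mc : measurable_fun [set: R] (cnorm z).
  rewrite (_ : cnorm z = fun x => Num.sqrt (\sum_i tovf z i x ^+ 2)); last first.
    by apply/funext => x; exact: cnormE.
  apply: (measurableT_comp (continuous_measurable_fun (@sqrt_continuous R))).
  rewrite (_ : (fun x => _) = (fun x => \sum_(i <- index_enum (bool * bool)%type) tovf z i x ^+ 2))//.
  apply: measurable_sum => i; apply: measurable_funX; exact: L2_mfun.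
have lc : L2 (cnorm z).
  apply: (L2_le mc lS); apply: ae_all => x.
  by rewrite ger0_norm ?sqrtr_ge0//; exact: cnorm_le.
exists (nu (cnorm z)); first exact: (LnormE lc).
split.
  apply: (@le_trans _ _ (nu (fun x => \sum_i `|tovf z i x|))).
    apply: nu_le => //; apply: ae_all => x.
    by rewrite ger0_norm ?sqrtr_ge0//; exact: cnorm_le.
  apply: (le_trans bS); apply: ler_sum => i _; rewrite nu_norm//.
rewrite mulr_natl -sumr_const; apply: ler_sum => i _.
apply: nu_le => //; first exact: L2_mfun.
by apply: ae_all => x; exact: tovf_le.
Qed.

Hypotheses (d0 : 0 < d) (mf : measurable_fun [set: R] f) (mg : measurable_fun [set: R] g).
Variable c0 : R.
Hypotheses (c00 : 0 <= c0) (fc0 : forall x, `|eps * f x| <= c0).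

Lemma mc2 i : measurable_fun [set: R] (c2 i).
Proof.
rewrite /c2; case: i; first exact: measurable_cst.
by apply: measurable_funM => //; exact: measurable_cst.
Qed.

Lemma c2_le i x : `|c2 i x| <= c0.
Proof. by rewrite /c2; case: i => //; rewrite normr0. Qed.

Definition kmin : R := Num.min 1 (d ^+ 2).
Definition kmax : R := Num.max 1 (d ^+ 2).

Lemma kmin_gt0 : 0 < kmin.
Proof. by rewrite lt_min ltr01 exprn_gt0. Qed.

Lemma kmin_le i : kmin <= kap2 i.
Proof. by rewrite /kmin /kap2; case: i; rewrite ge_min lexx ?orbT. Qed.

Lemma kmax_ge i : kap2 i <= kmax.
Proof. by rewrite /kmax /kap2; case: i; rewrite le_max lexx ?orbT. Qed.

Lemma kmax_ge0 : 0 <= kmax.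
Proof. by rewrite /kmax le_max ler01. Qed.

Let mc4 i : measurable_fun [set: R] (c4 i) := mc2 i.1.
Let c4_le i x : `|c4 i x| <= c0 := c2_le i.1 x.

Lemma bounded_lpot (p r al be : R) J : bounded p J -> `|al| + `|be| <= r ->
  bounded (p + r) (lpot J al be).
Proof.
move=> bJ abr i k; have [mJ Jp] := bJ i.1 k.1; rewrite /lpot.
have a0 := normr_ge0 al; have b0 := normr_ge0 be.
have ar : `|al| <= r by lra.
have br : `|be| <= r by lra.
split.
  case: (i.2 == k.2); case: (i.1 == k.1); try exact: measurable_cst.
    by apply: measurable_funB => //; exact: measurable_cst.
  by apply: measurable_funB => //; exact: measurable_cst.
apply: aeS Jp => x Jx; have p0 := le_trans (normr_ge0 _) Jx.
case: (i.2 == k.2); case: (i.1 == k.1); rewrite ?subr0 ?normr0; try lra.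
  by apply: (le_trans (ler_normB _ _)); lra.
by case: i.2; rewrite ?normrN; lra.
Qed.

(** The bridge between spectra and the real estimates. Solutions in [good] come with arbitrary weak
    derivatives while [L_op] uses the chosen ones; they agree almost everywhere by [wderivE2]. *)
Lemma resolventP u (p al be : R) : 0 <= p -> bounded p (jac u) ->
  resolvent_set (L_op d a m f g eps u) (al +i* be)%C <->
  exists2 K : R, 0 <= K & good kap4 c4 (lpot (jac u) al be) K.
Proof.
move=> p0 bJ; have bP := bounded_lpot bJ (lexx (`|al| + `|be|)).
set r := `|al| + `|be| in bP.
have r0 : 0 <= p + r by rewrite !addr_ge0.
set LL := shift_op (L_op d a m f g eps u) (al +i* be)%C.
have EL z : tovf (LL z) = op kap4 c4 (lpot (jac u) al be) (tovf z)
    (fun i => wderiv (tovf z i)) (fun i => wderiv (wderiv (tovf z i))).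
  by apply/funext => i; apply/funext => x; exact: shift_opE.
have LLc z : H2c z -> L2c (LL z).
  move=> hz; apply/L2cP; rewrite EL.
  exact: (op_L2 kap4 mc4 c4_le c00 r0 bP (H2cP hz)).
have ZZc z : H2c z -> L2c z by move=> /H2cP/H2f_L2[l _ _]; apply/L2cP.
set n : R := #|{: bool * bool}|%:R; have n0 : 0 <= n by [].
split=> [[sP _ [K HK]]|[K K0 [sP lP]]].
  (* The constant in the definition of the resolvent set carries no sign, hence the absolute value;
     n = 4 compares the sum of the component norms with the Euclidean norm. *)
  exists (n * `|K|); first exact: mulr_ge0.
  split=> [h lh|z z1 z2 hz].
    have [|z hz ez] := sP (ofvf h); first by apply/L2cP; rewrite ofvfK.
    exists (tovf z), (fun i => wderiv (tovf z i)), (fun i => wderiv (wderiv (tovf z i))).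
    split; first exact: H2cP.
    by rewrite -EL => i; apply: aeS ez => x e; rewrite -[in RHS](ofvfK h); exact: tovf_congr.
  have hc := H2f_H2c hz.
  have [r1 e1 [_ b1]] := L2norm_N (ZZc _ hc); have [r2 e2 [b2 _]] := L2norm_N (LLc _ hc).
  have := HK _ hc; rewrite -/LL e1 e2 -EFinM lee_fin => h.
  rewrite EL ofvfK in b2; rewrite ofvfK in b1.
  have E : N (op kap4 c4 (lpot (jac u) al be) z (fun i => wderiv (z i)) (fun i => wderiv (wderiv (z i)))) =
      N (op kap4 c4 (lpot (jac u) al be) z z1 z2).
    have hz' := H2cP hc; rewrite ofvfK in hz'.
    apply: N_ae; [exact: (op_L2 kap4 mc4 c4_le c00 r0 bP hz')|exact: (op_L2 kap4 mc4 c4_le c00 r0 bP hz)|].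
    move=> i; have [_ _ _ w1 w2] := hz i; have [_ _ a1 a2] := wderivE2 w1 w2.
    by apply: aeS2 a1 a2 => x; rewrite /op => -> ->.
  rewrite E in b2; apply: (le_trans b1); rewrite -mulrA ler_wpM2l//.
  have r20 : 0 <= r2.
    have := fine_ge0 (Lnorm_ge0 mu 2%:E (EFin \o cnorm (LL (ofvf z)))).
    by rewrite -/(L2norm (LL (ofvf z))) e2.
  apply: (le_trans h); apply: (@le_trans _ _ (`|K| * r2)); last by rewrite ler_wpM2l.
  by rewrite ler_wpM2r// ler_norm.
have lower z : H2c z -> N (tovf z) <= K * N (tovf (LL z)).
  by move=> hz; rewrite EL; exact: lP (H2cP hz).
split.
- move=> h /L2cP lh; have [z [z1 [z2 [hz ez]]]] := sP _ lh.
  have hc := H2f_H2c hz; exists (ofvf z) => //.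
  have E i : {ae mu, forall x, tovf (LL (ofvf z)) i x = tovf h i x}.
    rewrite EL ofvfK; have [_ _ _ w1 w2] := hz i; have [_ _ a1 a2] := wderivE2 w1 w2.
    by apply: aeS3 a1 a2 (ez i) => x e1 e2 <-; rewrite /op e1 e2.
  have E1 : {ae mu, forall x, tovf (LL (ofvf z)) (false, false) x = tovf h (false, false) x /\ tovf (LL (ofvf z)) (false, true) x = tovf h (false, true) x}.
    by apply: aeS2 (E (false, false)) (E (false, true)) => x.
  apply: aeS3 E1 (E (true, false)) (E (true, true)) => x [e1 e2] e3 e4.
  by apply: tovf_eq => -[[] []].
- move=> z hz zz; have := lower z hz.
  have -> : N (tovf (LL z)) = 0.
    rewrite -(@N0 R (bool * bool)%type); apply: N_ae.
    - exact/L2cP/LLc.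
    - by move=> i; exact: L20.
    - by move=> i; apply: aeS zz => x e; rewrite (tovf_congr i e); case: i => -[] [].
  rewrite mulr0 => z0; have lz : L2f (tovf z) by exact/L2cP/ZZc.
  have E := N_eq0 lz (le_anti (introT andP (conj z0 (N_ge0 _)))).
  have E1 : {ae mu, forall x, tovf z (false, false) x = 0 /\ tovf z (false, true) x = 0}.
    by apply: aeS2 (E (false, false)) (E (false, true)) => x.
  apply: aeS3 E1 (E (true, false)) (E (true, true)) => x [e1 e2] e3 e4.
  by apply: (@tovf_eq z (fun=> 0)) => -[[] []]; rewrite ?e1 ?e2 ?e3 ?e4.
- exists (K * n) => z hz; have [r1 e1 [b1 _]] := L2norm_N (ZZc _ hz).
  have [r2 e2 [_ b2]] := L2norm_N (LLc _ hz).
  rewrite -/LL e1 e2 -EFinM lee_fin; apply: (le_trans b1); apply: (le_trans (lower z hz)).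
  by rewrite -mulrA ler_wpM2l.
Qed.

(** At spectral parameter 0 real and imaginary parts decouple: take a source with zero imaginary
    part and keep the real part of the solution. The nonlinear correction needs this real
    version. *)
Lemma good_real J (K : R) : good kap4 c4 (lpot J 0 0) K -> good kap2 c2 J K.
Proof.
move=> [sP lP].
pose re (h : bool -> R -> R) : vf4 := fun i => if i.2 then fun=> 0 else h i.1.
have opre (z z1 z2 : bool -> R -> R) i x : op kap4 c4 (lpot J 0 0) (re z) (re z1) (re z2) i x = re (op kap2 c2 J z z1 z2) i x.
  by case: i => -[] []; rewrite /op /pot big_bool2 /re /lpot/= ?big_bool/= /kap4 /c4/=; ring.
have Nre (z : bool -> R -> R) : N (re z) = N z.
  by rewrite /N big_bool2 big_bool/= nu0; ring.
have lre (z : bool -> R -> R) : L2f z -> L2f (re z) by move=> l [i []]; [exact: L20|exact: l].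
split=> [h lh|z z1 z2 hz].
  have [z [z1 [z2 [hz ez]]]] := sP _ (lre _ lh).
  exists (fun i => z (i, false)), (fun i => z1 (i, false)), (fun i => z2 (i, false)).
  split=> i; first exact: hz.
  apply: aeS (ez (i, false)) => x; rewrite [RHS]/re/= => <-.
  by rewrite /op /pot big_bool2 /lpot/= big_bool/= /kap4 /c4; case: i => /=; ring.
have hre : H2f (re z) (re z1) (re z2) by move=> [i []]; [exact: H2d0|exact: hz].
have := lP _ _ _ hre; rewrite Nre.
have -> : op kap4 c4 (lpot J 0 0) (re z) (re z1) (re z2) = re (op kap2 c2 J z z1 z2).
  by apply/funext => i; apply/funext => x; exact: opre.
by rewrite Nre.
Qed.

End KlausmeierSystem.

(** * Resolvent estimates *)

Section ResolventEstimates.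
Context {R : realType}.
Variables (d eps c0 : R) (f : R -> R).
Hypotheses (d0 : 0 < d) (mf : measurable_fun [set: R] f).
Hypotheses (c00 : 0 <= c0) (fc0 : forall x, `|eps * f x| <= c0).
Local Notation mu := (@lebesgue_measure R).
Local Notation vf := (bool * bool -> R -> R).
Implicit Types (J : bool -> bool -> R -> R) (z h : vf) (al be K p r : R).

Let k4 := @kap4 R d.
Let cc := c4 eps f.
Let mcc i : measurable_fun [set: R] (cc i) := mc2 eps mf i.1.
Let cc_le i x : `|cc i x| <= c0 := c2_le c00 fc0 i.1 x.

Definition lgood J al be K := good k4 cc (lpot J al be) K.

(** Together with the sign [sgn_ix], exchanging real and imaginary parts represents multiplication
    by -i. *)
Definition conj_ix (i : bool * bool) := (i.1, ~~ i.2).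
Definition sgn_ix (i : bool * bool) : R := if i.2 then -1 else 1.

Lemma op_lpot J al be z z1 z2 i x :
  op k4 cc (lpot J al be) z z1 z2 i x =
  k4 i * z2 i x + (cc i x * z1 i x + pot (lpot J 0 0) z i x) - al * z i x +
  sgn_ix i * be * z (conj_ix i) x.
Proof.
by rewrite /op /pot !big_bool2 /lpot /conj_ix /sgn_ix; case: i => -[] []/=; ring.
Qed.

Lemma lpot_test (p : R) J al be z z1 z2 i w w1 : 0 <= p -> bounded p J ->
  H2f z z1 z2 -> L2 w -> L2 w1 -> is_wderiv w w1 ->
  \int[mu]_x (op k4 cc (lpot J al be) z z1 z2 i x * w x) =
  - (k4 i * \int[mu]_x (z1 i x * w1 x)) +
  \int[mu]_x ((cc i x * z1 i x + pot (lpot J 0 0) z i x) * w x) -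
  al * \int[mu]_x (z i x * w x) + sgn_ix i * be * \int[mu]_x (z (conj_ix i) x * w x).
Proof.
move=> p0 bJ hz lw lw1 ww; have [lz lz1 lz2] := H2f_L2 hz.
have [_ _ _ _ w2] := hz i.
have b0 : bounded (p + 0) (lpot J 0 0) by apply: bounded_lpot => //; rewrite normr0 addr0.
rewrite addr0 in b0.
have [lp _] := pot_bound p0 b0 lz.
have [la _] := L2_adv mcc cc_le c00 (lz1 i).
have lq : L2 (fun x => cc i x * z1 i x + pot (lpot J 0 0) z i x) by apply: L2D.
have i1 := L1Z (k4 i) (L2M (lz2 i) lw).
have i2 := L2M lq lw.
have i3 := L1Z al (L2M (lz i) lw).
have i4 := L1Z (sgn_ix i * be) (L2M (lz (conj_ix i)) lw).
under eq_Rintegral do rewrite op_lpot.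
transitivity (\int[mu]_x (k4 i * (z2 i x * w x) +
    (cc i x * z1 i x + pot (lpot J 0 0) z i x) * w x - al * (z i x * w x) +
    sgn_ix i * be * (z (conj_ix i) x * w x))).
  by apply: eq_Rintegral => x _; ring.
rewrite (IntD (L1B (L1D i1 i2) i3) i4) (IntB (L1D i1 i2) i3) (IntD i1 i2).
rewrite !IntZ; [|exact: L2M..].
congr (_ + _ - _ + _); rewrite -mulrN; congr (_ * _).
by rewrite (wderiv_by_parts w2 ww).
Qed.

Lemma sum_mul_le (I : finType) (x y : I -> R) : (forall i, 0 <= x i) -> (forall i, 0 <= y i) ->
  \sum_i x i * y i <= (\sum_i x i) * \sum_i y i.
Proof.
move=> x0 y0; rewrite mulr_suml; apply: ler_sum => i _; rewrite ler_wpM2l//.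
by rewrite (bigD1 i)//= lerDl sumr_ge0.
Qed.

Lemma sqr_sum4 (F : bool * bool -> R) : (\sum_i F i) ^+ 2 <= 4 * \sum_i F i ^+ 2.
Proof.
rewrite !big_bool2; move: (F (true, true)) (F (true, false)) (F (false, true)) (F (false, false)).
move=> x y s t; rewrite -subr_ge0.
have -> : 4 * (x ^+ 2 + y ^+ 2 + (s ^+ 2 + t ^+ 2)) - (x + y + (s + t)) ^+ 2 =
  (x - y) ^+ 2 + (x - s) ^+ 2 + (x - t) ^+ 2 + (y - s) ^+ 2 + (y - t) ^+ 2 + (s - t) ^+ 2 by ring.
by rewrite !addr_ge0 ?sqr_ge0.
Qed.

(** The arithmetic of the energy estimate: n, a and H are the summed norms of the function, of its
    derivative and of the right-hand side, S and D the sums of the squared norms, q bounds the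
    lower-order terms. The two energy inequalities are added, Young's inequality absorbs c0 a n into
    k0 D, and 2 rho S makes up for a negative [al]. *)
Lemma far_scalar (k0 P rho al be a n S D q H : R) : 0 < k0 -> 0 <= P -> 0 <= rho ->
  - rho <= al -> 0 <= a -> 0 <= n -> 0 <= H -> n ^+ 2 <= 4 * S -> S <= n ^+ 2 ->
  a ^+ 2 <= 4 * D -> q <= c0 * a + P * n ->
  k0 * D + al * S <= (q + H) * n -> `|be| * S <= (q + H) * n ->
  8 * (4 * c0 ^+ 2 / k0 + 2 * P + 2 * rho) <= `|al| + `|be| ->
  (`|al| + `|be|) * n <= 16 * H.
Proof.
move=> k00 P0 rho0 ar a0 n0 H0 nS Sn aD qb e1 e2 hM.
set M := 4 * c0 ^+ 2 / k0 + 2 * P + 2 * rho in hM.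
have [->|nn] := eqVneq n 0; first by rewrite mulr0 mulr_ge0.
have npos : 0 < n by rewrite lt_neqAle eq_sym nn.
set s := `|al| + `|be| in hM *.
have S0 : 0 <= S by have := sqr_ge0 n; lra.
have alS : `|al| * S <= al * S + 2 * rho * S.
  rewrite -mulrDl ler_wpM2r//; case: (ger0P al) => h; first by rewrite lerDl mulr_ge0.
  by lra.
have qn : q * n <= (c0 * a + P * n) * n by rewrite ler_wpM2r// ltW.
have cn : 2 * (c0 * a * n) <= k0 * D + 4 * c0 ^+ 2 / k0 * n ^+ 2.
  have h1 : k0 * a ^+ 2 <= 4 * (k0 * D) by rewrite [leRHS]mulrCA ler_wpM2l// ltW.
  have h2 : 0 <= k0 * (a / 2 - 2 * (c0 / k0) * n) ^+ 2 by rewrite mulr_ge0 ?sqr_ge0// ltW.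
  have -> : 4 * c0 ^+ 2 / k0 * n ^+ 2 =
      k0 * (a / 2 - 2 * (c0 / k0) * n) ^+ 2 - k0 * a ^+ 2 / 4 + 2 * (c0 * a * n).
    by field; rewrite gt_eqF.
  by lra.
have sS : s * S <= M * n ^+ 2 + 2 * H * n.
  have rS : rho * S <= rho * n ^+ 2 by rewrite ler_wpM2l.
  have -> : M * n ^+ 2 + 2 * H * n = 4 * c0 ^+ 2 / k0 * n ^+ 2 + 2 * (P * n * n) +
     2 * (rho * n ^+ 2) + 2 * (H * n) by rewrite /M; ring.
  by rewrite /s mulrDl; lra.
have s0 : 0 <= s by rewrite addr_ge0.
have h3 : s * n ^+ 2 <= 4 * (s * S) by rewrite [leRHS]mulrCA ler_wpM2l.
have h4 : 8 * M * n ^+ 2 <= s * n ^+ 2 by rewrite ler_wpM2r// sqr_ge0.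
have h5 : s * n * n <= 16 * H * n by rewrite -[s * n * n]mulrA -expr2; lra.
by rewrite ler_pM2r in h5.
Qed.

(** The equation is paired with z and with i z, which isolates [al] and [be] respectively. The
    constant sees the Jacobian only through [p], hence serves all multipulses at once. *)
Lemma far_bound p (rho : R) : 0 <= p -> 0 <= rho -> exists2 C : R, 0 < C &
  forall J al be z z1 z2, bounded p J -> - rho <= al -> C <= `|al| + `|be| ->
  H2f z z1 z2 -> (`|al| + `|be|) * N z <= C * N (op k4 cc (lpot J al be) z z1 z2).
Proof.
move=> p0 r0; set n4 : R := #|{: bool * bool}|%:R.
have n40 : 0 <= n4 by [].
set M := 4 * c0 ^+ 2 / kmin d + 2 * (n4 * p) + 2 * rho.
have kp := kmin_gt0 d0.
have M0 : 0 <= M by rewrite !addr_ge0 ?mulr_ge0 ?invr_ge0 ?sqr_ge0 ?(ltW kp).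
(* [8 * M] is the threshold for the spectral parameter and 16 the constant in [far_scalar]; one
   number serves both purposes. *)
exists (8 * M + 16); first by lra.
move=> J al be z z1 z2 bJ ar sM hz; have [lz lz1 lz2] := H2f_L2 hz.
have b0 : bounded (p + 0) (lpot J 0 0) by apply: bounded_lpot => //; rewrite normr0 addr0.
have bP := bounded_lpot bJ (lexx (`|al| + `|be|)).
have pr0 : 0 <= p + (`|al| + `|be|) by rewrite !addr_ge0.
have lh := op_L2 k4 mcc cc_le c00 pr0 bP hz.
rewrite addr0 in b0.
have [lp bp] := pot_bound p0 b0 lz; rewrite -/n4 in bp.
pose q : vf := fun i x => cc i x * z1 i x + pot (lpot J 0 0) z i x.
have lq : L2f q by move=> i; apply: L2D => //; have [] := L2_adv mcc cc_le c00 (lz1 i).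
have Nq : N q <= c0 * N z1 + n4 * p * N z.
  apply: (le_trans (ND (h := pot (lpot J 0 0) z) _ lp)).
    by move=> i; have [] := L2_adv mcc cc_le c00 (lz1 i).
  apply: lerD => //; rewrite /N mulr_sumr; apply: ler_sum => i _.
  by have [] := L2_adv mcc cc_le c00 (lz1 i).
set h := op k4 cc (lpot J al be) z z1 z2 in lh *.
have T i j := lpot_test al be i p0 bJ hz (lz j) (lz1 j) (let: And5 _ _ _ w _ := hz j in w).
pose b (j k : bool * bool) := \int[mu]_x (z j x * z k x).
pose e (j k : bool * bool) := \int[mu]_x (z1 j x * z1 k x).
have bC j k : b j k = b k j by apply: eq_Rintegral => x _; rewrite mulrC.
have eC j k : e j k = e k j by apply: eq_Rintegral => x _; rewrite mulrC.
have bd j : b j j = nu (z j) ^+ 2 by rewrite nu_sqr; apply: eq_Rintegral => x _; rewrite expr2.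
have ed j : e j j = nu (z1 j) ^+ 2 by rewrite nu_sqr; apply: eq_Rintegral => x _; rewrite expr2.
pose X (y : vf) (i j : bool * bool) := \int[mu]_x (y i x * z j x).
have XN (y : vf) (tau : bool * bool -> bool * bool) : L2f y -> involutive tau ->
    \sum_i `|X y i (tau i)| <= N y * N z.
  move=> ly tK; apply: (@le_trans _ _ (\sum_i nu (y i) * nu (z (tau i)))).
    by apply: ler_sum => i _; exact: cauchy_schwarz.
  apply: (le_trans (sum_mul_le _ _)) => [i|i|]; rewrite ?nu_ge0//.
  by rewrite -/(N y) (reindex_inj (inv_inj tK))/=; under eq_bigr do rewrite tK.
have T' i j : X h i j = - (k4 i * e i j) + X q i j - al * b i j + sgn_ix i * be * b (conj_ix i) j.
  exact: T.
have idK : involutive (fun i : bool * bool => i) by [].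
have cK : involutive conj_ix by move=> [i j]; rewrite /conj_ix/= negbK.
apply: (@le_trans _ _ (16 * N h)); last by rewrite ler_wpM2r ?N_ge0//; lra.
have n0 := N_ge0 z; have a0 := N_ge0 z1; have H0 := N_ge0 h.
have kk i : kmin d <= k4 i by exact: kmin_le.
apply: (@far_scalar (kmin d) (n4 * p) rho al be (N z1) (N z) (\sum_i b i i) (\sum_i e i i) (N q)) => //.
- exact: mulr_ge0.
- by under eq_bigr do rewrite bd; exact: sqr_sum4.
- under eq_bigr do rewrite bd expr2; rewrite [leRHS]expr2; apply: sum_mul_le => i; exact: nu_ge0.
- by under eq_bigr do rewrite ed; exact: sqr_sum4.
(* Pairing each component with itself: the terms with [be] cancel between real and imaginary
   parts. *)
- have D : \sum_i k4 i * e i i + al * \sum_i b i i = \sum_i (X q i i - X h i i).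
    rewrite !big_bool2 !T' /sgn_ix /conj_ix/=.
    by rewrite (bC (true, false) (true, true)) (bC (false, false) (false, true)); ring.
  have kD : kmin d * (\sum_i e i i) <= \sum_i k4 i * e i i.
    by rewrite mulr_sumr; apply: ler_sum => i _; rewrite ler_wpM2r// ed sqr_ge0.
  apply: (@le_trans _ _ (\sum_i (X q i i - X h i i))); first by rewrite -D lerD2r.
  rewrite mulrDl; apply: le_trans (lerD (XN q _ lq idK) (XN h _ lh idK)).
  rewrite -big_split; apply: ler_sum => i _.
  by apply: (le_trans (ler_norm _)); exact: ler_normB.
(* Pairing each component with its conjugate one, with signs: diffusion and [al] cancel, and [be]
   remains. *)
- have D : be * \sum_i b i i = \sum_i sgn_ix i * (X h i (conj_ix i) - X q i (conj_ix i)).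
    rewrite !big_bool2 !T' /sgn_ix /conj_ix/=.
    rewrite (bC (true, false) (true, true)) (bC (false, false) (false, true)).
    by rewrite (eC (true, false) (true, true)) (eC (false, false) (false, true)) /k4 /kap4/=; ring.
  have S0 : 0 <= \sum_i b i i by apply: sumr_ge0 => i _; rewrite bd sqr_ge0.
  rewrite -[X in _ * X <= _]ger0_norm// -normrM D.
  apply: (le_trans (ler_norm_sum _ _ _)).
  rewrite addrC mulrDl; apply: le_trans (lerD (XN h _ lh cK) (XN q _ lq cK)).
  rewrite -big_split; apply: ler_sum => i _; rewrite normrM.
  have -> : `|sgn_ix i| = 1 by rewrite /sgn_ix; case: i.2; rewrite ?normrN normr1.
  by rewrite mul1r; exact: ler_normB.
- by rewrite -/M; lra.
Qed.

Lemma good_mono J al be K K' : K <= K' -> lgood J al be K -> lgood J al be K'.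
Proof.
move=> KK [s l]; split => // z z1 z2 hz; apply: (le_trans (l _ _ _ hz)).
by rewrite ler_wpM2r ?N_ge0.
Qed.

Let n4 : R := #|{: bool * bool}|%:R.

Lemma lgood_perturb p b r J J' al be al' be' K : 0 <= p -> bounded p J -> bounded p J' ->
  0 <= b -> bounded b (fun i k x => J' i k x - J i k x) -> 0 <= K ->
  `|al' - al| + `|be' - be| <= r -> n4 * (b + r) * K <= 2^-1 ->
  lgood J al be K -> lgood J' al' be' (2 * K).
Proof.
move=> p0 bJ bJ' b0 bJJ K0 hr hK G.
set s := `|al| + `|be|; set s' := `|al'| + `|be'|.
have s0 : 0 <= s by rewrite addr_ge0.
have s0' : 0 <= s' by rewrite addr_ge0.
have r0 : 0 <= r by apply: le_trans hr; rewrite addr_ge0.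
have up (q q' : R) J0 al0 be0 : q <= q' -> bounded q (lpot J0 al0 be0) -> bounded q' (lpot J0 al0 be0).
  move=> qq h i k; have [h1 h2] := h i k; split => //.
  by apply: aeS h2 => x /le_trans; exact.
apply: (good_perturb mcc cc_le c00 (p := p + s + s') (b := b + r) _ _ _ _ _ K0 hK G).
- by rewrite !addr_ge0.
- by apply: up (bounded_lpot bJ (lexx _)); rewrite lerDl.
- by apply: up (bounded_lpot bJ' (lexx _)); rewrite -/s' addrAC lerDl.
- by rewrite addr_ge0.
- rewrite (_ : (fun i k x => _) = lpot (fun i k x => J' i k x - J i k x) (al' - al) (be' - be)).
    exact: bounded_lpot bJJ hr.
  apply/funext => i; apply/funext => k; apply/funext => x; rewrite /lpot.
  case: (i.2 == k.2); case: (i.1 == k.1); rewrite ?subr0//; first by ring.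
  by case: i.2; ring.
Qed.

(** [far_bound] gives only the lower bound; solvability is inherited from [J]. For large |l| the
    inverse for [J] has norm at most C/|l|, whatever [K] was, so passing to [J'] is a small
    perturbation although J' - J may be as large as 2 p. *)
Lemma lgood_far p (rho : R) : 0 <= p -> 0 <= rho -> exists2 C : R, 0 < C &
  forall J J' al be K, bounded p J -> bounded p J' -> - rho <= al ->
  C <= `|al| + `|be| -> lgood J al be K -> exists2 K' : R, 0 <= K' & lgood J' al be K'.
Proof.
move=> p0 r0; have [C C0 HC] := far_bound p0 r0.
exists (C + 4 * (n4 * p * C)); first by rewrite ltr_wpDr// !mulr_ge0// ltW.
move=> J J' al be K bJ bJ' ar Cs [sP lP].
set s := `|al| + `|be| in Cs.
have s0 : 0 < s.
  by apply: lt_le_trans Cs; rewrite ltr_wpDr// !mulr_ge0// ltW.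
have Cs' : C <= s.
  by apply: le_trans Cs; rewrite lerDl !mulr_ge0// ltW.
have G : lgood J al be (C / s).
  split=> // z z1 z2 hz; have := HC _ _ _ _ _ _ bJ ar Cs' hz.
  by rewrite mulrAC ler_pdivlMr// mulrC.
exists (2 * (C / s)); first by rewrite mulr_ge0// divr_ge0// ltW.
apply: (@lgood_perturb p (2 * p) 0 J J' al be al be (C / s)) => //.
- exact: mulr_ge0.
- move=> i k; have [m1 b1] := bJ i k; have [m2 b2] := bJ' i k.
  split; first exact: measurable_funB.
  apply: aeS2 b1 b2 => x h1 h2; apply: (le_trans (ler_normB _ _)).
  by lra.
- by rewrite divr_ge0// ltW.
- by rewrite !subrr normr0 addr0.
- rewrite addr0 mulrA ler_pdivrMr//; have e : 0 <= n4 * p * C by rewrite !mulr_ge0// ltW.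
  have -> : n4 * (2 * p) * C = 2 * (n4 * p * C) by ring.
  by lra.
Qed.

(** Invertibility at a point persists nearby with twice the constant, and the rectangle is
    compact. *)
Lemma lgood_uniform p J (x0 x1 y0 y1 : R) : 0 <= p -> bounded p J ->
  (forall al be, x0 <= al <= x1 -> y0 <= be <= y1 -> exists2 K : R, 0 <= K & lgood J al be K) ->
  exists2 K : R, 0 <= K & forall al be, x0 <= al <= x1 -> y0 <= be <= y1 -> lgood J al be K.
Proof.
move=> p0 bJ H.
have cA : compact (`[x0, x1]%classic `*` `[y0, y1]%classic : set (R * R)).
  by apply: compact_setX; exact: segment_compact.
have /compact_near_coveringP nc := cA.
have [|K [Kr HK]] := nc R (+oo : set_system R) (fun K l => lgood J l.1 l.2 K) _.
  move=> [al be] /= [hal hbe]; rewrite !in_itv/= in hal hbe.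
  have [K K0 G] := H al be hal hbe.
  pose r : R := (2 * (n4 * K + 1))^-1 / 2.
  have nK : 0 <= n4 * K by exact: mulr_ge0.
  have r0 : 0 < r by rewrite divr_gt0// invr_gt0 mulr_gt0// ltr_wpDl.
  have b0 : bounded 0 (fun i k x => J i k x - J i k x).
    move=> i k; have [mJ _] := bJ i k; split; first exact: measurable_funB.
    by apply: ae_all => x; rewrite subrr normr0.
  exists ([set l : R * R | `|l.1 - al| < r /\ `|l.2 - be| < r], [set K' | 2 * K <= K']).
    split; last by exists (2 * K); split; [exact: num_real|move=> x /ltW].
    exists (ball al r, ball be r); first by split; exact: nbhsx_ballx.
    by move=> l [/= b1 b2]; rewrite /ball/= in b1 b2; split; rewrite distrC.
  move=> [l K'] [/= [l1 l2] KK]; apply: (good_mono KK).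
  apply: (@lgood_perturb p 0 (2 * r) J J al be l.1 l.2 K) => //; first by lra.
  rewrite add0r /r [2 * _]mulrC divfK// mulrAC ler_pdivrMr ?mulr_gt0 ?ltr_wpDl//.
  by rewrite mulKf// lerDl.
exists (`|K| + 1); first by rewrite addr_ge0.
have KK : K < `|K| + 1 by rewrite (le_lt_trans (ler_norm K))// ltrDl.
by move=> al be hal hbe; apply: (HK _ KK (al, be)); rewrite /=!in_itv.
Qed.

(** Half of the gap is given up so that the part of the half-plane with bounded |l| lies in a
    compact rectangle inside the resolvent set; beyond it [lgood_far] applies to every potential
    with the same bound. *)
Lemma stable_uniform p J (rho : R) : 0 <= p -> bounded p J -> 0 < rho ->
  (forall al be, - rho < al -> exists2 K : R, 0 <= K & lgood J al be K) ->
  exists (r K0 : R), [/\ 0 < r, 0 <= K0,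
    forall J' al be, bounded p J' -> - (rho / 2) <= al -> r <= `|al| + `|be| ->
      exists2 K' : R, 0 <= K' & lgood J' al be K' &
    forall al be, - (rho / 2) <= al -> `|al| + `|be| <= r -> lgood J al be K0].
Proof.
move=> p0 bJ rho0 H.
have [C C0 HC] := lgood_far p0 (ltW (divr_gt0 rho0 (ltr0Sn R 1))).
have [|K0 K00 HK0] := @lgood_uniform p J (- (rho / 2)) C (- C) C p0 bJ.
  by move=> al be /andP[h _] _; apply: H; lra.
exists C, K0; split => // [J' al be bJ' ar Cs|al be ar sC].
  have ar' : - rho < al by lra.
  have [K _ G] := H al be ar'.
  exact: HC bJ bJ' ar Cs G.
have a0 := normr_ge0 al; have b0 := normr_ge0 be.
have := ler_norm al; have := ler_norm be; have := ler_norm (- be); rewrite normrN.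
move=> h1 h2 h3; apply: HK0; first by rewrite ar/=; lra.
by apply/andP; split; lra.
Qed.

End ResolventEstimates.

(** * Bounds for periodic and localised profiles *)

Section Profiles.
Context {R : realType}.
Local Notation mu := (@lebesgue_measure R).
Implicit Types (f e v : R -> R) (T r : R).

Lemma ae_foralln_real (P : nat -> R -> Prop) : (forall n, {ae mu, forall x, P n x}) ->
  {ae mu, forall x, forall n, P n x}.
Proof. by move=> H; apply: ae_foralln; exact: H. Qed.

Lemma sup_ae f v : is_wderiv f v -> L2 f -> L2 v ->
  {ae mu, forall x, `|f x| <= 2 * (nu f + nu v)}.
Proof.
move=> fv lf lv; have [F [fF _ _ HF _]] := sobolev_rep fv lf lv.
have n1 := nu_ge0 f; have n2 := nu_ge0 v.
apply: aeS fF => x ->; rewrite -ler_sqr ?nnegrE ?mulr_ge0 ?addr_ge0//.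
rewrite -normrX ger0_norm ?sqr_ge0//; apply: (le_trans (HF x)).
have : 0 <= nu f * nu v by exact: mulr_ge0.
by have := sqr_ge0 (nu f); have := sqr_ge0 (nu v); lra.
Qed.

Lemma decay_ae f v (e : R) : is_wderiv f v -> L2 f -> L2 v -> 0 < e ->
  exists2 r : R, 0 < r & {ae mu, forall x, r <= `|x| -> `|f x| <= e}.
Proof.
move=> fv lf lv e0; have [F [fF _ _ _ HF]] := sobolev_rep fv lf lv.
have [r r0 Hr] := sobolev_decay lf lv HF e0.
by exists r => //; apply: aeS fF => x ->; exact: Hr.
Qed.

Lemma periodic_nat f T n x : periodic f T -> f (x + n%:R * T) = f x.
Proof. by move=> pf; rewrite mulr_natl periodicn. Qed.

Lemma periodic_natN f T n x : periodic f T -> f (x - n%:R * T) = f x.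
Proof. by move=> pf; rewrite -(periodic_nat n _ pf) subrK. Qed.

Lemma period_cover T x : 0 < T -> exists n : nat,
  0 <= x + n%:R * T <= T \/ 0 <= x - n%:R * T <= T.
Proof.
move=> T0; have tr y : 0 <= y -> exists n : nat, 0 <= y - n%:R * T <= T.
  move=> y0; exists (Num.truncn (y / T)).
  have yT : 0 <= y / T by rewrite divr_ge0// ltW.
  have /andP[h1 h2] := truncn_itv yT.
  rewrite ler_pdivlMr// in h1; rewrite ltr_pdivrMr// -natr1 mulrDl mul1r in h2.
  by lra.
case: (leP 0 x) => x0.
  by have [n H] := tr x x0; exists n; right.
have nx : 0 <= - x by rewrite oppr_ge0 ltW.
have [n /andP[h1 h2]] := tr _ nx; exists n.+1; left.
by rewrite -natr1 mulrDl mul1r; apply/andP; split; lra.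
Qed.

Lemma continuous_itv_bounded f T : 0 <= T -> continuous f ->
  exists2 B : R, 0 <= B & forall x, 0 <= x <= T -> `|f x| <= B.
Proof.
move=> T0 cf; have cn : {within `[0, T], continuous (fun x => `|f x|)}.
  apply: continuous_subspaceT => x; apply: (continuous_comp (cf x)).
  exact: norm_continuous.
have [c _ Hc] := EVT_max T0 cn.
by exists `|f c| => // x xT; apply: Hc; rewrite in_itv.
Qed.

Lemma continuous_periodic_bounded f T : 0 < T -> continuous f -> periodic f T ->
  exists2 B : R, 0 <= B & forall x, `|f x| <= B.
Proof.
move=> T0 cf pf; have [B B0 HB] := continuous_itv_bounded (ltW T0) cf.
exists B => // x; have [n [h|h]] := period_cover x T0.
  by rewrite -(periodic_nat n _ pf); exact: HB.
by rewrite -(periodic_natN n _ pf); exact: HB.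
Qed.

(** The continuous representative is bounded on one period. The identity with f, translated by all
    multiples of T, holds off one null set and carries the bound to the line by the periodicity of
    f. *)
Lemma periodic_ae_bounded f v T : 0 < T -> is_wderiv f v -> periodic f T ->
  exists2 B : R, 0 <= B & {ae mu, forall x, `|f x| <= B}.
Proof.
move=> T0 fv pf; have [F [fF cF _]] := wderiv_rep fv.
have [B B0 HB] := continuous_itv_bounded (ltW T0) cF; exists B => //.
have e1 := ae_foralln_real (fun n => ae_shift (n%:R * T) fF).
have e2 := ae_foralln_real (fun n => ae_shift (- (n%:R * T)) fF).
apply: aeS2 e1 e2 => x h1 h2; have [n [h|h]] := period_cover x T0.
  by rewrite -(periodic_nat n _ pf) h1; exact: HB.
by rewrite -(periodic_natN n _ pf) h2; exact: HB.
Qed.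

Lemma ae_periodic_nat e T n : {ae mu, forall x, e (x + T) = e x} ->
  {ae mu, forall x, e (x - n%:R * T) = e x}.
Proof.
move=> pe; elim: n => [|n IH]; first by apply: ae_all => x; rewrite mul0r subr0.
have h := ae_shift (- (n.+1%:R * T)) pe.
apply: aeS2 IH h => x <- <-; congr e.
by rewrite -natr1; ring.
Qed.

(** A translation by a multiple of T of at least 2 r moves the core |x| < r into the tail, so the
    norm of e is at most twice that of an arbitrarily small tail. *)
Lemma periodic_L2_eq0 e T : 0 < T -> L2 e -> {ae mu, forall x, e (x + T) = e x} ->
  {ae mu, forall x, e x = 0}.
Proof.
move=> T0 le pe; apply: nu_eq0 => //; apply/eqP; rewrite eq_le nu_ge0 andbT.
apply/ler_addgt0Pr => t t0; rewrite add0r.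
have t2 : 0 < t / 2 by rewrite divr_gt0.
have [r r0 Hr] := tail_cvg0 le t2.
have lt := L2_tail r le; have lq := L2B le lt.
have n1 : nu e <= nu (fun x => e x - tail r e x) + nu (tail r e).
  have -> : nu e = nu (fun x => (e x - tail r e x) + tail r e x).
    by congr nu; apply/funext => x; rewrite subrK.
  exact: nuD.
apply: (le_trans n1); have -> : t = t / 2 + t / 2 by rewrite -splitr.
apply: lerD; last exact: Hr.
pose n := (Num.truncn (2 * r / T)).+1.
have nT : 2 * r <= n%:R * T.
  rewrite -ler_pdivrMr// ltW//.
  have q : 0 <= 2 * r / T by rewrite divr_ge0 ?mulr_ge0// ltW.
  by have /andP[] := truncn_itv q.
rewrite -(nu_shift (- (n%:R * T)) lq); apply: le_trans (Hr r (lexx r)).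
rewrite -(nu_norm (tail r e)); apply: nu_le; last 1 first.
- apply: aeS (ae_periodic_nat n pe) => x ex; rewrite /tail ex.
  have [h|h] := boolP (r <= `|x - n%:R * T|).
    by rewrite mulr1 subrr normr0.
  have -> : r <= `|x|.
    rewrite -ltNge in h; have h1 := ler_distD 0 x (n%:R * T).
    have h2 := ler_normB (n%:R * T) x; have := ler_normB (x - n%:R * T) x.
    rewrite addrAC subrr add0r normrN => h3.
    by have := ler_norm (n%:R * T); lra.
  by rewrite mulr0 subr0 mulr1.
- exact: L2_mfun (L2_shift _ lq).
- exact: L2_norm.
Qed.

End Profiles.

(** * Trains of pulses *)

Section Jacobian.
Context {R : realType}.
Variables (m eps G : R) (g : R -> R).
Hypotheses (mg : measurable_fun [set: R] g) (gG : forall x, `|eps * g x| <= G).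
Local Notation mu := (@lebesgue_measure R).
Local Notation vf := (bool -> R -> R).
Implicit Types (w : vf) (B de : R) (i k : bool).

Definition pairf w : R -> R * R := fun x => (w false x, w true x).

Local Notation jacw w := (jac m eps g (pairf w)).

Definition jac_bd B := `|m| + G + 1 + 2 * B ^+ 2.

Lemma jac_bd_ge0 B : 0 <= jac_bd B.
Proof.
have := le_trans (normr_ge0 _) (gG 0); have := normr_ge0 m; have := sqr_ge0 B.
by rewrite /jac_bd; lra.
Qed.

Lemma jac_le B w i k x : (forall i, `|w i x| <= B) -> `|jacw w i k x| <= jac_bd B.
Proof.
move=> wB; have B0 := le_trans (normr_ge0 _) (wB true).
have G0 := le_trans (normr_ge0 _) (gG 0); have m0 := normr_ge0 m.
have P j l : `|w j x * w l x| <= B ^+ 2 by rewrite normrM expr2 ler_pM.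
have P2 : `|w true x ^+ 2| <= B ^+ 2 by rewrite expr2.
have P1 : `|2 * w false x * w true x| <= 2 * B ^+ 2.
  by rewrite -mulrA normrM ger0_norm// ler_wpM2l.
have B2 := sqr_ge0 B.
rewrite /jac /jac_bd; case: i; case: k => /=.
- by rewrite (le_trans (ler_normD _ _))// normrN; lra.
- by lra.
- by rewrite normrN; lra.
- rewrite (le_trans (ler_normB _ _))//; have := ler_normB (eps * g x) 1.
  by rewrite normr1; have := gG x; lra.
Qed.

Lemma jac_diff B de w y i k x : 0 <= B -> (forall i, `|w i x| <= B) -> (forall i, `|y i x| <= B) ->
  (forall i, `|w i x - y i x| <= de) -> `|jacw w i k x - jacw y i k x| <= 4 * B * de.
Proof.
move=> B0 wB yB wy; have de0 := le_trans (normr_ge0 _) (wy true).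
have Bd : 0 <= B * de by exact: mulr_ge0.
have P j (c : R) : `|c| <= B -> `|(w j x - y j x) * c| <= B * de.
  by move=> cB; rewrite normrM mulrC ler_pM.
have Q : `|2 * ((w false x - y false x) * w true x + (w true x - y true x) * y false x)| <= 4 * B * de.
  rewrite normrM ger0_norm// (_ : 4 * B * de = 2 * (B * de + B * de)); last by ring.
  rewrite ler_wpM2l// (le_trans (ler_normD _ _))// lerD//; exact: P.
have S : `|(w true x - y true x) * w true x + (w true x - y true x) * y true x| <= 4 * B * de.
  rewrite (le_trans (ler_normD _ _))//; have := P true _ (wB true); have := P true _ (yB true).
  by lra.
rewrite /jac; case: i; case: k => /=.
- by apply: le_trans Q; rewrite le_eqVlt; apply/orP; left; apply/eqP; congr (`|_|); ring.
- by apply: le_trans S; rewrite le_eqVlt; apply/orP; left; apply/eqP; congr (`|_|); ring.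
- by apply: le_trans Q; rewrite -normrN le_eqVlt; apply/orP; left; apply/eqP; congr (`|_|); ring.
- by apply: le_trans S; rewrite -normrN le_eqVlt; apply/orP; left; apply/eqP; congr (`|_|); ring.
Qed.

Lemma jac_bounded B w : (forall i, measurable_fun [set: R] (w i)) ->
  (forall i, {ae mu, forall x, `|w i x| <= B}) -> bounded (jac_bd B) (jacw w).
Proof.
move=> mw wB i k; split; last first.
  by apply: aeS2 (wB true) (wB false) => x h1 h2; apply: jac_le => -[].
have mc (r : R) : measurable_fun [set: R] (fun=> r) by exact: measurable_cst.
rewrite /jac; case: i; case: k => /=.
- by apply: measurable_funD => //; apply: measurable_funM => //; exact: measurable_funM.
- exact: measurable_funX.
- by apply: measurableT_comp => //; apply: measurable_funM => //; exact: measurable_funM.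
- apply: measurable_funB; last exact: measurable_funX.
  by apply: measurable_funB => //; exact: measurable_funM.
Qed.

End Jacobian.

Section PulseTrain.
Context {R : realType}.
Variables (T d m eps c0 G B0 : R) (f g : R -> R).
Hypotheses (T0 : 0 < T) (d0 : 0 < d).
Hypotheses (mf : measurable_fun [set: R] f) (mg : measurable_fun [set: R] g).
Hypotheses (fT : periodic f T) (gT : periodic g T).
Hypotheses (c00 : 0 <= c0) (fc0 : forall x, `|eps * f x| <= c0).
Hypotheses (gG : forall x, `|eps * g x| <= G).
Local Notation mu := (@lebesgue_measure R).
Local Notation vf := (bool -> R -> R).
Local Notation jacw w := (jac m eps g (pairf w)).
Local Notation lgood := (lgood d eps f).

Variables (v z z1 z2 : vf).
Hypotheses (mv : forall i, measurable_fun [set: R] (v i)) (vT : forall i, periodic (v i) T).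
Hypotheses (hz : H2f z z1 z2) (B00 : 0 <= B0).
Hypotheses (vB : forall i, {ae mu, forall x, `|v i x| <= B0}).
Hypotheses (zB : forall i, {ae mu, forall x, `|z i x| <= B0}).

Definition pulse_at (j n : nat) : vf := fun i x => z i (x - j%:R * n%:R * T).

Definition pulse_train (k n : nat) : vf := fun i x =>
  v i x + \sum_(1 <= j < k.+1) pulse_at j n i x.

Lemma trainS k n i x : pulse_train k.+1 n i x = pulse_train k n i x + pulse_at k.+1 n i x.
Proof. by rewrite /pulse_train big_nat_recr//= addrA. Qed.

Lemma periodicM (h : R -> R) j n x : periodic h T -> h (x - j%:R * n%:R * T) = h x.
Proof. by move=> hT; rewrite -natrM; exact: periodic_natN. Qed.

Lemma tz_H2 j n : H2f (pulse_at j n) (fun i x => z1 i (x - j%:R * n%:R * T))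
  (fun i x => z2 i (x - j%:R * n%:R * T)).
Proof. by move=> i; exact: (H2d_shift (- (j%:R * n%:R * T)) (hz i)). Qed.

Lemma tz_mfun j n i : measurable_fun [set: R] (pulse_at j n i).
Proof. by have [l _ _ _ _] := tz_H2 j n i; exact: L2_mfun. Qed.

Lemma tz_bound : {ae mu, forall x, forall j n i, `|pulse_at j n i x| <= B0}.
Proof.
have H i : {ae mu, forall x, forall j n, `|pulse_at j n i x| <= B0}.
  apply: ae_foralln_real => j; apply: ae_foralln_real => n.
  exact: (ae_shift (- (j%:R * n%:R * T)) (zB i)).
by apply: aeS2 (H true) (H false) => x h1 h2 j n [].
Qed.

Lemma tz_decay de : 0 < de -> exists2 r : R, 0 < r &
  {ae mu, forall x, forall j n i, r <= `|x - j%:R * n%:R * T| -> `|pulse_at j n i x| <= de}.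
Proof.
move=> de0.
have D i : exists2 r : R, 0 < r & {ae mu, forall x, r <= `|x| -> `|z i x| <= de}.
  by have [l l1 _ w _] := hz i; exact: (decay_ae w l l1).
have [r1 r10 H1] := D true; have [r2 r20 H2] := D false.
exists (Num.max r1 r2); first by rewrite lt_max r10.
have H i : {ae mu, forall x, forall j n, Num.max r1 r2 <= `|x - j%:R * n%:R * T| -> `|pulse_at j n i x| <= de}.
  apply: ae_foralln_real => j; apply: ae_foralln_real => n.
  have : {ae mu, forall x, Num.max r1 r2 <= `|x| -> `|z i x| <= de}.
    case: (i); [apply: aeS H1|apply: aeS H2] => x h hx; apply: h; apply: le_trans hx.
      by rewrite le_max lexx.
    by rewrite le_max lexx orbT.
  exact: ae_shift.
by apply: aeS2 (H true) (H false) => x h1 h2 j n [] hx; [exact: h1|exact: h2].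
Qed.

Lemma train_mfun k n i : measurable_fun [set: R] (pulse_train k n i).
Proof.
by apply: measurable_funD => //; apply: measurable_sum => j; exact: tz_mfun.
Qed.

Lemma train_bound : {ae mu, forall x, forall k n i, `|pulse_train k n i x| <= k.+1%:R * B0}.
Proof.
have vb : {ae mu, forall x, forall i, `|v i x| <= B0}.
  by apply: aeS2 (vB true) (vB false) => x h1 h2 [].
apply: aeS2 tz_bound vb => x h1 h2 k n i; elim: k => [|k IH].
  by rewrite /pulse_train big_geq// addr0 mul1r.
rewrite trainS -natr1 mulrDl mul1r (le_trans (ler_normD _ _))//.
exact: lerD.
Qed.

Lemma train_jac_bounded k n (B : R) : k.+1%:R * B0 <= B -> bounded (jac_bd m G B) (jacw (pulse_train k n)).
Proof.
move=> kB; apply: jac_bounded => // i; first exact: train_mfun.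
by apply: aeS train_bound => x h; exact: le_trans (h k n i) kB.
Qed.

(** With indices 0 0 this is the primary pulse; since v is periodic, the other indices give its
    translates by multiples of the period. *)
Definition one_pulse j n : vf := fun i x => v i x + pulse_at j n i x.

Lemma tu_jac_bounded j n (B : R) : 2 * B0 <= B -> bounded (jac_bd m G B) (jacw (one_pulse j n)).
Proof.
move=> kB; apply: jac_bounded => // i.
  by apply: measurable_funD => //; exact: tz_mfun.
apply: aeS2 (vB i) tz_bound => x h1 h2; rewrite /one_pulse (le_trans (ler_normD _ _))//.
by have := h2 j n i; lra.
Qed.

Lemma tu_good j n al be K : lgood (jacw (one_pulse 0 0)) al be K -> lgood (jacw (one_pulse j n)) al be K.
Proof.
move=> G0; have bJ := tu_jac_bounded 0 0 (lexx _).
set s := - (j%:R * n%:R * T).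
have cs i x : c4 eps f i (x + s) = c4 eps f i x.
  by rewrite /c4 /c2 /s; case: i.1 => //; rewrite periodicM.
have p0 : 0 <= jac_bd m G (2 * B0) + (`|al| + `|be|).
  by apply: addr_ge0; [exact: (jac_bd_ge0 m gG)|exact: addr_ge0].
have mcc i : measurable_fun [set: R] (c4 eps f i) := mc2 eps mf i.1.
have cc_le i x : `|c4 eps f i x| <= c0 := c2_le c00 fc0 i.1 x.
have := good_shift mcc cc_le c00 cs p0 (bounded_lpot bJ (lexx _)) G0.
congr (good _ _ _ _); apply/funext => i; apply/funext => k; apply/funext => x.
have E b : one_pulse 0 0 b (x + s) = one_pulse j n b x.
  by rewrite /one_pulse /pulse_at mul0r mul0r subr0 /s periodicM.
have gE : g (x + s) = g x by rewrite /s periodicM.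
by rewrite /lpot /jac /pairf/= !E gE.
Qed.

(* Two neighbouring groups of pulses are glued half way between them, where
   the profiles differ from each other only by tails. *)
Lemma train_good (k : nat) (r K0 : R) : 0 <= r -> 0 <= K0 -> exists (N0 : nat) (K : R), 0 <= K /\
  forall n al be, (N0 <= n)%N -> `|al| + `|be| <= r ->
  lgood (jacw (one_pulse 0 0)) al be K0 -> lgood (jacw (pulse_train k.+1 n)) al be K.
Proof.
move=> r0 K00; elim: k => [|k [N1 [K1 [K10 IH]]]].
  exists 0%N, K0; split=> [//|n al be _ _ G0]; have := tu_good 1 n G0.
  have -> : pulse_train 1 n = one_pulse 1 n; last by [].
  by apply/funext => i; apply/funext => x; rewrite /pulse_train big_nat1.
have [B BE] : exists B : R, B = k.+3%:R * B0 by exists (k.+3%:R * B0).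
have B_ge0 : 0 <= B by rewrite BE mulr_ge0.
pose p := jac_bd m G B + r.
have p0 : 0 <= p by rewrite addr_ge0//; exact: (jac_bd_ge0 m gG).
pose K := Num.max K0 K1.
have KK0 : K0 <= K by rewrite le_max lexx.
have KK1 : K1 <= K by rewrite le_max lexx orbT.
have Kge0 : 0 <= K := le_trans K00 KK0.
have mcc i : measurable_fun [set: R] (c4 eps f i) := mc2 eps mf i.1.
have cc_le i x : `|c4 eps f i x| <= c0 := c2_le c00 fc0 i.1 x.
have [de de0 [l l0 glue]] := good_glue_line (kap := kap4 d) (kmin_gt0 d0) (fun i => kmin_le d i.1)
  (fun i => kmax_ge d i.1) mcc cc_le c00 (kmax_ge0 d) p0 Kge0.
(* At most k+1 tails of size q meet the Lipschitz constant 4 B of the Jacobian; their total effect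
   stays below [de]. *)
pose q : R := de / (4 * (B + 1) * k.+2%:R).
have q0 : 0 < q by rewrite divr_gt0// !mulr_gt0// ltr_wpDl.
have qde : 4 * B * (k.+1%:R * q) <= de.
  rewrite /q !mulrA ler_pdivrMr ?mulr_gt0 ?ltr_wpDl//.
  have -> : 4 * B * k.+1%:R * de = de * (4 * B * k.+1%:R) by ring.
  rewrite ler_wpM2l ?(ltW de0)// ler_pM ?mulr_ge0 ?ler_nat//.
  by rewrite ler_wpM2l// lerDl.
have [rho rho0 dec] := tz_decay q0.
(* From this index on, half the distance between neighbours exceeds the decay radius plus the
   overlap l. *)
pose N2 := (Num.truncn (2 * (rho + l) / T)).+1.
have HN n : (N2 <= n)%N -> rho + l <= n%:R * T / 2.
  move=> N2n; have q1 : 0 <= 2 * (rho + l) / T by rewrite divr_ge0 ?mulr_ge0 ?addr_ge0 ?ltW.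
  have /andP[_ h] := truncn_itv q1; rewrite ltr_pdivrMr// in h.
  have h' : (Num.truncn (2 * (rho + l) / T)).+1%:R * T <= n%:R * T by rewrite ler_wpM2r ?ler_nat// ltW.
  by lra.
exists (maxn N1 N2), (4 * K + 1); split; first by rewrite addr_ge0 ?mulr_ge0.
move=> n al be; rewrite geq_max => /andP[n1 n2] abr G0.
have g1 := good_mono KK1 (IH n al be n1 abr G0).
have g2 := good_mono KK0 (tu_good k.+2 n G0).
have up J : bounded (jac_bd m G B) J -> bounded p (lpot J al be).
  by move=> bJ; exact: bounded_lpot.
have b1 : k.+3%:R * B0 <= B by rewrite BE.
have b2 : k.+2%:R * B0 <= B by rewrite BE ler_wpM2r ?ler_nat.
have b3 : 2 * B0 <= B by rewrite BE ler_wpM2r ?ler_nat.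
(* The midpoint between the last pulse of the old train and the new pulse k+2. *)
pose s : R := (k.+1%:R + 2^-1) * n%:R * T.
have nT := HN n n2; have nT0 : 0 <= n%:R * T by rewrite mulr_ge0// ltW.
have lp J J' (i j : bool * bool) x : `|J i.1 j.1 x - J' i.1 j.1 x| <= de ->
    `|lpot J al be i j x - lpot J' al be i j x| <= de.
  rewrite /lpot; case: (i.2 == j.2) => h; last by rewrite subrr normr0 ltW.
  by rewrite opprB addrA subrK.
apply: (glue _ _ _ s (up _ (train_jac_bounded n b1)) (up _ (train_jac_bounded n b2))
  (up _ (tu_jac_bounded k.+2 n b3)) g1 g2).
- move=> i j; have db : {ae mu, forall x, x <= s + l ->
      `|jacw (pulse_train k.+2 n) i.1 j.1 x - jacw (pulse_train k.+1 n) i.1 j.1 x| <= de}.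
    apply: aeS2 train_bound dec => x hb hd xs; apply: le_trans qde.
    have qq : 4 * B * q <= 4 * B * (k.+1%:R * q).
      by rewrite ler_wpM2l ?mulr_ge0// ler_peMl ?(ltW q0)// ler1n.
    apply: le_trans qq; apply: jac_diff => // b.
    + exact: le_trans (hb _ _ _) b1.
    + exact: le_trans (hb _ _ _) b2.
    + rewrite trainS addrAC subrr add0r; apply: hd.
      have e : k.+2%:R * n%:R * T = s + n%:R * T / 2 by rewrite /s -[k.+2%:R]natr1; field.
      by rewrite ler0_norm; lra.
  apply: aeS db => x h xs; exact: lp (h xs).
- move=> i j; have db : {ae mu, forall x, s - l <= x ->
      `|jacw (pulse_train k.+2 n) i.1 j.1 x - jacw (one_pulse k.+2 n) i.1 j.1 x| <= de}.
    have ub : {ae mu, forall x, forall b, `|one_pulse k.+2 n b x| <= B}.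
      have vb : {ae mu, forall x, forall i, `|v i x| <= B0}.
        by apply: aeS2 (vB true) (vB false) => x h1 h2 [].
      apply: aeS2 vb tz_bound => x h1 h2 b; apply: le_trans b3.
      rewrite /one_pulse (le_trans (ler_normD _ _))//.
      by have := h2 k.+2 n b; have := h1 b; lra.
    apply: aeS3 train_bound dec ub => x hb hd hu xs; apply: le_trans qde.
    apply: jac_diff => // b; first exact: le_trans (hb _ _ _) b1.
    have -> : pulse_train k.+2 n b x - one_pulse k.+2 n b x = \sum_(1 <= j0 < k.+2) pulse_at j0 n b x.
      by rewrite trainS /one_pulse /pulse_train; ring.
    apply: (le_trans (ler_norm_sum _ _ _)).
    have -> : k.+1%:R * q = \sum_(1 <= j0 < k.+2) q by rewrite sumr_const_nat subSS subn0 mulr_natl.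
    apply: ler_sum_nat => j0 /andP[_ jk]; apply: hd.
    have jn : j0%:R * n%:R * T <= k.+1%:R * n%:R * T.
      by rewrite -!mulrA ler_wpM2r// ler_nat.
    have e : k.+1%:R * n%:R * T = s - n%:R * T / 2 by rewrite /s; field.
    by rewrite ger0_norm; lra.
  apply: aeS db => x h xs; exact: lp (h xs).
Qed.

End PulseTrain.

(** * A maximum principle for the resolvent *)

Section GridMaximum.
Context {R : realType}.

(* Adding a small multiple of |.|^2, whose average over the four neighbours
   exceeds its value by 1, moves the maximum to the boundary. *)
Lemma grid_max (m : nat) (F : nat -> nat -> R) (c c1 Bd : R) : c < c1 -> 0 <= c ->
  (forall j k, (0 < j < m.*2)%N -> (0 < k < m.*2)%N ->
    F j k <= (F j.+1 k + F j.-1 k + F j k.+1 + F j k.-1) / 4 + c) ->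
  (forall j k, (j <= m.*2)%N -> (k <= m.*2)%N ->
    ~~ ((0 < j < m.*2)%N && (0 < k < m.*2)%N) -> F j k <= Bd) ->
  F m m <= Bd + c1 * (2 * m%:R ^+ 2).
Proof.
move=> cc1 c0 Fi Fb; pose q (j : nat) : R := (j%:R - m%:R) ^+ 2.
pose G (l : 'I_m.*2.+1 * 'I_m.*2.+1) : R := F l.1 l.2 + c1 * (q l.1 + q l.2).
pose o : 'I_m.*2.+1 := inord m.
have mm : (m < m.*2.+1)%N by rewrite ltnS -addnn leq_addr.
have oE : val o = m by rewrite /o /= inordK.
have c10 : 0 <= c1 := le_trans c0 (ltW cc1).
have [l _ Hl] := @arg_maxP _ _ _ (o, o) xpredT G isT.
have Go : F m m = G (o, o) by rewrite /G /= oE /q subrr expr0n/= addr0 mulr0 addr0.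
have qm j : (j <= m.*2)%N -> q j <= m%:R ^+ 2.
  move=> jm; rewrite /q -ler_sqrt ?sqr_ge0// !sqrtr_sqr (ger0_norm (ler0n _ m)).
  have : j%:R <= m%:R + m%:R :> R by rewrite -natrD addnn ler_nat.
  have : 0 <= j%:R :> R by [].
  by move=> h1 h2; rewrite ler_norml; apply/andP; split; lra.
have [/andP[hj hk]|hb] := boolP ((0 < l.1 < m.*2)%N && (0 < l.2 < m.*2)%N); last first.
  rewrite Go; apply: (le_trans (Hl (o, o) isT)); rewrite /G; apply: lerD.
    by apply: Fb => //; rewrite -ltnS; exact: ltn_ord.
  rewrite ler_wpM2l// mulr_natl mulr2n; apply: lerD; apply: qm; rewrite -ltnS; exact: ltn_ord.
exfalso; have /andP[j0 j1] := hj; have /andP[k0 k1] := hk.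
have nb j k (hj' : (j < m.*2.+1)%N) (hk' : (k < m.*2.+1)%N) :
    F j k + c1 * (q j + q k) <= F l.1 l.2 + c1 * (q l.1 + q l.2).
  by have := Hl (Ordinal hj', Ordinal hk') isT.
have lj := ltn_ord l.1; have lk := ltn_ord l.2.
have n1 := nb l.1.+1 l.2 (j1 : (l.1.+1 < m.*2.+1)%N) lk.
have n2 := nb l.1.-1 l.2 (leq_ltn_trans (leq_pred _) lj) lk.
have n3 := nb l.1 l.2.+1 lj (k1 : (l.2.+1 < m.*2.+1)%N).
have n4 := nb l.1 l.2.-1 lj (leq_ltn_trans (leq_pred _) lk).
have := Fi _ _ hj hk.
have qS j : q j.+1 = q j + 2 * (j%:R - m%:R) + 1 by rewrite /q -natr1; ring.
have qP j : (0 < j)%N -> q j.-1 = q j - 2 * (j%:R - m%:R) + 1.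
  by case: j => // j _; rewrite /= qS -natr1; ring.
rewrite !qS (qP _ j0) in n1 n2; rewrite !qS (qP _ k0) in n3 n4.
move: n1 n2 n3 n4.
set a1 := F l.1.+1 l.2; set a2 := F l.1.-1 l.2; set a3 := F l.1 l.2.+1; set a4 := F l.1 l.2.-1.
set b := F l.1 l.2; set x := l.1%:R - m%:R; set y := l.2%:R - m%:R.
have e1 : c1 * (q l.1 + 2 * x + 1 + q l.2) = c1 * (q l.1 + q l.2) + c1 * (2 * x) + c1 by ring.
have e2 : c1 * (q l.1 - 2 * x + 1 + q l.2) = c1 * (q l.1 + q l.2) - c1 * (2 * x) + c1 by ring.
have e3 : c1 * (q l.1 + (q l.2 + 2 * y + 1)) = c1 * (q l.1 + q l.2) + c1 * (2 * y) + c1 by ring.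
have e4 : c1 * (q l.1 + (q l.2 - 2 * y + 1)) = c1 * (q l.1 + q l.2) - c1 * (2 * y) + c1 by ring.
rewrite e1 e2 e3 e4; lra.
Qed.

End GridMaximum.

Section ResolventMaximum.
Context {R : realType}.
Variables (d eps c0 : R) (f : R -> R).
Hypotheses (d0 : 0 < d) (mf : measurable_fun [set: R] f).
Hypotheses (c00 : 0 <= c0) (fc0 : forall x, `|eps * f x| <= c0).
Local Notation mu := (@lebesgue_measure R).
Local Notation vf := (bool * bool -> R -> R).
Local Notation op4 J al be := (op (@kap4 R d) (c4 eps f) (lpot J al be)).
Local Notation lgood := (lgood d eps f).
Implicit Types (J : bool -> bool -> R -> R) (z h y : vf) (al be K p s : R).

(* Multiplication by the imaginary unit. *)
Definition rot z : vf := fun i x =>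
  if i.2 then z (i.1, false) x else - z (i.1, true) x.

(** A relation rather than an operator: it is stable under sums, real multiples and [rot], which
    gives complex linear algebra of resolvents without a linear choice of solutions. *)
Definition sol J al be z h := exists z1 z2, H2f z z1 z2 /\ aeq (op4 J al be z z1 z2) h.

Lemma sol_L2 J al be z h : sol J al be z h -> L2f z.
Proof. by move=> [z1 [z2 [/H2f_L2[]]]]. Qed.

Lemma solD J al be z h z' h' : sol J al be z h -> sol J al be z' h' ->
  sol J al be (fun i x => z i x + z' i x) (fun i x => h i x + h' i x).
Proof.
move=> [z1 [z2 [hz ez]]] [z1' [z2' [hz' ez']]].
exists (fun i x => z1 i x + z1' i x), (fun i x => z2 i x + z2' i x).
split=> i; first exact: H2dD.
by apply: aeS2 (ez i) (ez' i) => x <- <-; rewrite /op /pot !big_bool2; ring.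
Qed.

Lemma solZ J al be z h (c : R) : sol J al be z h ->
  sol J al be (fun i x => c * z i x) (fun i x => c * h i x).
Proof.
move=> [z1 [z2 [hz ez]]].
exists (fun i x => c * z1 i x), (fun i x => c * z2 i x).
split=> i; first exact: H2dZ.
by apply: aeS (ez i) => x <-; rewrite /op /pot !big_bool2; ring.
Qed.

Lemma sol_rot J al be z h : sol J al be z h -> sol J al be (rot z) (rot h).
Proof.
move=> [z1 [z2 [hz ez]]]; exists (rot z1), (rot z2); split.
  move=> [i []]; first exact: hz.
  have := H2dZ (-1) (hz (i, true)).
  by rewrite /rot/=; congr H2d; apply/funext => x; rewrite mulN1r.
move=> [i b]; apply: aeS (ez (i, ~~ b)) => x; rewrite {4}/rot.
by case: i; case: b => /= <-; rewrite !op_lpot /rot/sgn_ix/conj_ix/pot !big_bool2 /lpot/kap4/c4/=; ring.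
Qed.

Lemma sol_shift J al be al' be' z h : sol J al' be' z h ->
  sol J al be z (fun i x => h i x + (al' - al) * z i x + (be' - be) * rot z i x).
Proof.
move=> [z1 [z2 [hz ez]]]; exists z1, z2; split => // i.
apply: aeS (ez i) => x <-; rewrite !op_lpot /rot/sgn_ix/conj_ix.
by case: i => j [] /=; ring.
Qed.

Lemma sol_le p J al be K z h : 0 <= p -> bounded p J -> lgood J al be K -> L2f h ->
  sol J al be z h -> N z <= K * N h.
Proof.
move=> p0 bJ [_ lP] lh [z1 [z2 [hz ez]]]; apply: (le_trans (lP _ _ _ hz)).
rewrite (N_ae _ lh ez)//.
have pr0 : 0 <= p + (`|al| + `|be|) by rewrite !addr_ge0.
apply: (op_L2 _ _ _ c00 pr0 (bounded_lpot bJ (lexx _)) hz).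
  by move=> i; exact: mc2.
by move=> i x; exact: c2_le.
Qed.

(* With w ranging over the fourth roots of unity and a_j the average of
   w^j (L - l - s w)^-1 h, one has (L - l) a_j = s a_(j + 1) for 0 < j, and
   a_4 = a_0 : the average a_0 differs from (L - l)^-1 h by O(s^4). *)
Lemma four_point p J al be s K h z y0 y1 y2 y3 : 0 <= p -> bounded p J -> 0 <= s ->
  0 <= K -> lgood J al be K -> L2f h -> sol J al be z h ->
  sol J (al + s) be y0 h -> sol J al (be + s) y1 h ->
  sol J (al - s) be y2 h -> sol J al (be - s) y3 h ->
  [/\ N y0 <= K * N h, N y1 <= K * N h, N y2 <= K * N h & N y3 <= K * N h] ->
  N z <= (N y0 + N y2 + N y1 + N y3) / 4 + (s * K) ^+ 4 * (K * N h).
Proof.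
move=> p0 bJ s0 K0 G lh sz s0' s1' s2' s3' [b0 b1 b2 b3].
have t0 := sol_shift al be s0'; have t1 := sol_shift al be s1'.
have t2 := sol_shift al be s2'; have t3 := sol_shift al be s3'.
have l0 := sol_L2 t0; have l1 := sol_L2 t1; have l2 := sol_L2 t2; have l3 := sol_L2 t3.
have lz := sol_L2 sz.
pose a0 : vf := fun i x => 4^-1 * (y0 i x + y1 i x + (y2 i x + y3 i x)).
pose a1 : vf := fun i x => 4^-1 * (y0 i x + rot y1 i x + -1 * (y2 i x + rot y3 i x)).
pose a2 : vf := fun i x => 4^-1 * (y0 i x + -1 * y1 i x + (y2 i x + -1 * y3 i x)).
pose a3 : vf := fun i x => 4^-1 * (y0 i x + -1 * rot y1 i x + (-1 * y2 i x + rot y3 i x)).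
have e0 : sol J al be (fun i x => a0 i x + -1 * z i x) (fun i x => s * a1 i x).
  have := solD (solZ (4^-1) (solD (solD t0 t1) (solD t2 t3))) (solZ (-1) sz).
  congr sol; apply/funext => i; apply/funext => x.
  by rewrite /a1 /rot; case: i => j [] /=; field.
have e1 : sol J al be a1 (fun i x => s * a2 i x).
  have := solZ (4^-1) (solD (solD t0 (sol_rot t1)) (solZ (-1) (solD t2 (sol_rot t3)))).
  congr sol; apply/funext => i; apply/funext => x.
  by rewrite /a2 /rot; case: i => j [] /=; field.
have e2 : sol J al be a2 (fun i x => s * a3 i x).
  have := solZ (4^-1) (solD (solD t0 (solZ (-1) t1)) (solD t2 (solZ (-1) t3))).
  congr sol; apply/funext => i; apply/funext => x.
  by rewrite /a3 /rot; case: i => j [] /=; field.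
have e3 : sol J al be a3 (fun i x => s * a0 i x).
  have := solZ (4^-1) (solD (solD t0 (solZ (-1) (sol_rot t1))) (solD (solZ (-1) t2) (sol_rot t3))).
  congr sol; apply/funext => i; apply/funext => x.
  by rewrite /a0 /rot; case: i => j [] /=; field.
have la0 : L2f a0 by move=> i; apply: L2Z; apply: L2D; exact: L2D.
have [la1 la2 la3] : [/\ L2f a1, L2f a2 & L2f a3].
  by split; [exact: sol_L2 e1|exact: sol_L2 e2|exact: sol_L2 e3].
have le a a' : L2f a -> sol J al be a' (fun i x => s * a i x) -> N a' <= s * K * N a.
  move=> la sa; have lsa : L2f (fun i x => s * a i x) by move=> i; exact: L2Z.
  by have := sol_le p0 bJ G lsa sa; rewrite NZ// ger0_norm// mulrA [K * s]mulrC.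
have sK0 : 0 <= s * K by exact: mulr_ge0.
have Na0 : N a0 <= (N y0 + N y2 + N y1 + N y3) / 4.
  have l01 := L2fD l0 l1; have l23 := L2fD l2 l3.
  rewrite /a0 (NZ _ (L2fD l01 l23)) ger0_norm ?invr_ge0// mulrC ler_pM2r ?invr_gt0//.
  by have := ND l01 l23; have := ND l0 l1; have := ND l2 l3; lra.
have E : N (fun i x => a0 i x + -1 * z i x) <= (s * K) ^+ 4 * N a0.
  apply: (le_trans (le _ _ la1 e0)); rewrite exprS -[leRHS]mulrA ler_wpM2l//.
  apply: (le_trans (le _ _ la2 e1)); rewrite exprS -[leRHS]mulrA ler_wpM2l//.
  apply: (le_trans (le _ _ la3 e2)); rewrite exprS -[leRHS]mulrA ler_wpM2l//.
  exact: (le _ _ la0 e3).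
have Na0K : N a0 <= K * N h by lra.
have zE : N z <= N a0 + N (fun i x => a0 i x + -1 * z i x).
  have -> : N z = N (fun i x => a0 i x - (a0 i x + -1 * z i x)).
    by congr N; apply/funext => i; apply/funext => x; ring.
  exact: (NB la0 (sol_L2 e0)).
apply: (le_trans zE); apply: lerD => //; apply: (le_trans E).
by rewrite ler_wpM2l// exprn_ge0.
Qed.

(** The solutions of (L - l) y = h at the points of a grid with mesh s0/m have norms satisfying the
    hypotheses of [grid_max]. The conclusion features only the boundary constant K1; the interior
    constant K disappears as m grows. *)
Lemma interior_bound p J (l0 s0 K K1 : R) : 0 <= p -> bounded p J -> 0 < s0 -> 0 <= K -> 0 <= K1 ->
  (forall al be, `|al - l0| <= s0 -> `|be| <= s0 -> lgood J al be K) ->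
  (forall al be, `|al - l0| <= s0 -> `|be| <= s0 -> `|al - l0| = s0 \/ `|be| = s0 ->
    lgood J al be K1) ->
  forall z h, L2f h -> sol J l0 0 z h -> N z <= K1 * N h.
Proof.
move=> p0 bJ s00 K0 K10 HK HK1 z h lh sz; apply/ler_addgt0Pr => t t0.
have h0 := N_ge0 h.
pose A := 4 * ((s0 * K) ^+ 4 * (K * N h)).
have A0 : 0 <= A by do ?[apply: mulr_ge0 => //|apply: exprn_ge0 => //]; exact: ltW.
pose m := (Num.truncn (A / t)).+1.
have m0 : 0 < m%:R :> R by [].
have m1 : 1 <= m%:R :> R by rewrite ler1n.
have mA : A / m%:R <= t.
  rewrite ler_pdivrMr// mulrC -ler_pdivrMr// ltW//.
  by have /andP[] := truncn_itv (divr_ge0 A0 (ltW t0)).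
pose s := s0 / m%:R; have s_gt0 : 0 < s by exact: divr_gt0.
have sm : s * m%:R = s0 by rewrite divfK// gt_eqF.
pose pa (j : nat) := l0 + s * (j%:R - m%:R); pose pb (k : nat) := s * (k%:R - m%:R).
have inb j : (j <= m.*2)%N -> `|s * (j%:R - m%:R)| <= s0.
  move=> jm; rewrite normrM (ger0_norm (ltW s_gt0)) -sm ler_pM2l//.
  have h1 : j%:R <= m%:R + m%:R :> R by rewrite -natrD addnn ler_nat.
  have h2 : 0 <= j%:R :> R by [].
  by rewrite ler_norml; apply/andP; split; lra.
have pal j : pa j - l0 = s * (j%:R - m%:R) by rewrite /pa addrC addKr.
have gK j k : (j <= m.*2)%N -> (k <= m.*2)%N -> lgood J (pa j) (pb k) K.
  by move=> jm km; apply: HK; rewrite ?pal; exact: inb.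
have ex (l : nat * nat) : exists y : vf, (l.1 <= m.*2)%N -> (l.2 <= m.*2)%N ->
    sol J (pa l.1) (pb l.2) y h.
  have [jm|] := boolP ((l.1 <= m.*2)%N && (l.2 <= m.*2)%N); last first.
    by move=> nh; exists h => h1 h2; rewrite h1 h2 in nh.
  have /andP[hj hk] := jm; have [S _] := gK _ _ hj hk.
  by have [y [y1 [y2 hy]]] := S h lh; exists y => _ _; exists y1, y2.
have [Y HY] := choice ex.
have YK j k : (j <= m.*2)%N -> (k <= m.*2)%N -> N (Y (j, k)) <= K * N h.
  by move=> jm km; exact: (sol_le p0 bJ (gK _ _ jm km) lh (HY (j, k) jm km)).
have mm : (m <= m.*2)%N by rewrite -addnn leq_addr.
have zY : N z <= N (Y (m, m)).
  have lY := sol_L2 (HY (m, m) mm mm); have lz := sol_L2 sz.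
  have E : pa m = l0 /\ pb m = 0 by rewrite /pa /pb subrr mulr0 addr0.
  have sY := HY (m, m) mm mm; rewrite /= E.1 E.2 in sY.
  have sd := solD sz (solZ (-1) sY).
  have G0 := gK _ _ mm mm; rewrite E.1 E.2 in G0.
  have l00 : L2f (fun i x => h i x + -1 * h i x) by move=> i; apply: L2D => //; exact: L2Z.
  have := sol_le p0 bJ G0 l00 sd.
  have -> : N (fun i x => h i x + -1 * h i x) = 0.
    rewrite -(@N0 R (bool * bool)%type); congr N; apply/funext => i; apply/funext => x; ring.
  rewrite mulr0 => zY0.
  have -> : N z = N (fun i x => (z i x + -1 * Y (m, m) i x) + Y (m, m) i x).
    by congr N; apply/funext => i; apply/funext => x; ring.
  by apply: (le_trans (ND (sol_L2 sd) lY)); lra.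
apply: (le_trans zY).
pose c := (s * K) ^+ 4 * (K * N h).
have c_ge0 : 0 <= c by do ?[apply: mulr_ge0 => //|apply: exprn_ge0 => //]; exact: ltW.
(* The error c is of order m^-4, so c times 2 m^2 is at most t/2 by the choice of m; the strict
   surplus required by [grid_max] uses the other t/2. *)
pose c1 := c + t / (4 * m%:R ^+ 2).
have cc1 : c < c1 by rewrite ltrDl divr_gt0// mulr_gt0// exprn_gt0.
have := @grid_max R m (fun j k => N (Y (j, k))) c c1 (K1 * N h) cc1 c_ge0.
have ct : c1 * (2 * m%:R ^+ 2) <= t.
  have -> : c1 * (2 * m%:R ^+ 2) = A / m%:R / m%:R / 2 + t / 2.
    by rewrite /c1 /c /A /s; field; rewrite gt_eqF.
  have : A / m%:R / m%:R <= A / m%:R.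
    by rewrite ler_pdivrMr// ler_peMr// divr_ge0.
  by lra.
move=> gm; apply: (le_trans (gm _ _)); last by rewrite lerD2l.
- move=> j k /andP[j0 j1] /andP[k0 k1].
  have jS : pa j.+1 = pa j + s by rewrite /pa -natr1; ring.
  have jP : pa j.-1 = pa j - s by rewrite /pa -[in RHS](prednK j0) -natr1; ring.
  have kS : pb k.+1 = pb k + s by rewrite /pb -natr1; ring.
  have kP : pb k.-1 = pb k - s by rewrite /pb -[in RHS](prednK k0) -natr1; ring.
  have jm := ltnW j1; have km := ltnW k1.
  have jm' := leq_trans (leq_pred j) jm; have km' := leq_trans (leq_pred k) km.
  have y0 := HY (j.+1, k) j1 km; have y1 := HY (j, k.+1) jm k1.
  have y2 := HY (j.-1, k) jm' km; have y3 := HY (j, k.-1) jm km'.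
  rewrite /= jS in y0; rewrite /= kS in y1; rewrite /= jP in y2; rewrite /= kP in y3.
  by apply: (four_point p0 bJ (ltW s_gt0) K0 (gK _ _ jm km) lh (HY (j, k) jm km) y0 y1 y2 y3); split; exact: YK.
- move=> j k jm km hb; apply: (sol_le p0 bJ _ lh (HY (j, k) jm km)).
  have edge i : (i <= m.*2)%N -> ~~ (0 < i < m.*2)%N -> `|s * (i%:R - m%:R)| = s0.
    move=> im; rewrite negb_and -leqNgt leqn0 -leqNgt => /orP[/eqP ->|im'].
      by rewrite sub0r mulrN normrN sm ger0_norm// ltW.
    have -> : i = m.*2 by apply/eqP; rewrite eqn_leq im im'.
    by rewrite -addnn natrD addrK sm ger0_norm// ltW.
  apply: HK1; rewrite ?pal; [exact: inb|exact: inb|].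
  by move: hb; rewrite negb_and => /orP[hb|hb]; [left|right]; exact: edge.
Qed.

End ResolventMaximum.

(** * Nonlinear correction *)

Section NonlinearCorrection.
Context {R : realType}.
Variables (d m eps c0 G : R) (f g : R -> R).
Hypotheses (d0 : 0 < d) (mf : measurable_fun [set: R] f) (mg : measurable_fun [set: R] g).
Hypotheses (c00 : 0 <= c0) (fc0 : forall x, `|eps * f x| <= c0).
Hypotheses (gG : forall x, `|eps * g x| <= G).
Local Notation mu := (@lebesgue_measure R).
Local Notation vf := (bool -> R -> R).
Local Notation jacw w := (jac m eps g (pairf w)).
Local Notation op2 w := (op (kap2 d) (c2 eps f) (jacw w)).
Implicit Types (W c h : vf).

(** The reaction term w p^2 enters the first equation with a minus sign and the second with a plus
    sign. *)
Definition sg (i : bool) : R := if i then 1 else -1.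

(* The part of w p^2 that is at least quadratic in the increment c. *)
Definition quad W c (x : R) : R := c false x * c true x ^+ 2 +
  2 * W true x * c false x * c true x + W false x * c true x ^+ 2.

Lemma quad_diff (B M : R) W c c' x : 0 <= B -> 0 <= M <= 1 ->
  (forall i, `|W i x| <= B) -> (forall i, `|c i x| <= M) -> (forall i, `|c' i x| <= M) ->
  `|quad W c x - quad W c' x| <= (2 + 4 * B) * M * \sum_i `|c i x - c' i x|.
Proof.
move=> B0 /andP[M0 M1] wB cM cM'; rewrite big_bool/=.
have -> : quad W c x - quad W c' x =
  (c false x - c' false x) * (c true x ^+ 2 + 2 * W true x * c true x) +
  (c true x - c' true x) * (c' false x * (c true x + c' true x) + 2 * W true x * c' false x +
     W false x * (c true x + c' true x)).
  by rewrite /quad; ring.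
have P (r s u v : R) : `|r| <= u -> `|s| <= v -> `|r * s| <= u * v.
  by move=> h1 h2; rewrite normrM ler_pM.
have S : `|c true x + c' true x| <= 2 * M.
  by rewrite (le_trans (ler_normD _ _))//; have := cM true; have := cM' true; lra.
have W2 i : `|2 * W i x| <= 2 * B by rewrite normrM ger0_norm// ler_wpM2l.
have MM : M * M <= M by rewrite ler_piMr.
have BM : 0 <= B * M by exact: mulr_ge0.
have H1 : `|c true x ^+ 2 + 2 * W true x * c true x| <= (2 + 4 * B) * M.
  rewrite (le_trans (ler_normD _ _))//; have := P _ _ _ _ (cM true) (cM true).
  have := P _ _ _ _ (W2 true) (cM true); rewrite expr2; lra.
have H2 : `|c' false x * (c true x + c' true x) + 2 * W true x * c' false x +
     W false x * (c true x + c' true x)| <= (2 + 4 * B) * M.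
  rewrite (le_trans (ler_normD _ _))//.
  have := ler_normD (c' false x * (c true x + c' true x)) (2 * W true x * c' false x).
  have := P _ _ _ _ (cM' false) S; have := P _ _ _ _ (W2 true) (cM' false).
  by have := P _ _ _ _ (wB false) S; lra.
rewrite (le_trans (ler_normD _ _))// [leRHS]mulrDr addrC lerD//.
  by rewrite mulrC; apply: P => //; rewrite mulrC.
by rewrite mulrC; apply: P.
Qed.

Lemma quad_mfun W c : (forall i, measurable_fun [set: R] (W i)) ->
  (forall i, measurable_fun [set: R] (c i)) -> measurable_fun [set: R] (quad W c).
Proof.
move=> mW mc; have m2 : measurable_fun [set: R] (fun x => c true x ^+ 2) by exact: measurable_funX.
have mC : measurable_fun [set: R] (fun=> 2 : R) by exact: measurable_cst.
apply: measurable_funD; last by apply: measurable_funM.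
apply: measurable_funD; first by apply: measurable_funM.
by do 2![apply: measurable_funM => //]; exact: measurable_funM.
Qed.

(** The contraction acts on the source h, with c = S h and S a solution operator of the
    linearization: h = -sg (quad W (S h) + rho). The remainder [quad] is quadratic in c, so its
    Lipschitz constant on a small ball is proportional to the radius. [thr] and [E] depend on W only
    through B and K. *)
Lemma newton (B K : R) : 0 <= B -> 0 <= K -> exists (thr E : R), [/\ 0 < thr, 0 <= E &
  forall W (rho : R -> R), (forall i, measurable_fun [set: R] (W i)) ->
  (forall i, {ae mu, forall x, `|W i x| <= B}) -> good (kap2 d) (c2 eps f) (jacw W) K ->
  L2 rho -> nu rho <= thr -> exists c ca cb, [/\ H2f c ca cb,
    aeq (op2 W c ca cb) (fun i x => - (sg i * (quad W c x + rho x))),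
    [/\ N c <= E * nu rho, N ca <= E * nu rho & N cb <= E * nu rho] &
    forall i, {ae mu, forall x, `|c i x| <= E * nu rho}]].
Proof.
move=> B0 K0; pose p := jac_bd m G B.
have p0 : 0 <= p by exact: (jac_bd_ge0 m gG).
have [Ce Ce0 HCe] := elliptic (kmin_gt0 d0) (kmin_le d) (mc2 eps mf) (c2_le c00 fc0) c00 p0.
have [E0 E0E] : exists E0 : R, E0 = 2 * (K + Ce * (1 + K)) by eexists.
have [q qE] : exists q : R, q = 2 + 4 * B by eexists.
have q0 : 0 <= q by rewrite qE addr_ge0// mulr_ge0.
have E00 : 0 <= E0 by rewrite E0E mulr_ge0// addr_ge0// mulr_ge0// addr_ge0.
(* A single condition r D <= 1 yields both the contraction factor and sup norms of S h at most 1;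
   the threshold 1/(4 D) guarantees it for r = 4 nu rho. *)
pose D := 4 * q * E0 * K + E0 + 1.
have D0 : 0 < D.
  by rewrite ltr_wpDl// addr_ge0// !mulr_ge0.
exists (4 * D)^-1, (4 * (K + 2 * (Ce * (1 + K)) + E0)).
split; first by rewrite invr_gt0 mulr_gt0.
  by do ?[apply: mulr_ge0 => // | apply: addr_ge0 => //].
move=> W rho mW wB gW lr rthr.
have bJ : bounded p (jacw W) by exact: jac_bounded.
have [S [S1 [S2 HS]]] := good_solver gW; have [_ lP] := gW.
(* The residual occurs in both components, so the value at 0 has norm 2 nu rho, and [fixpoint] asks
   for twice that as radius. *)
set r := 4 * nu rho.
have r0 : 0 <= r by rewrite mulr_ge0// nu_ge0.
have rD : r * D <= 1.
  rewrite /r -ler_pdivlMr// mul1r; move: rthr; rewrite invfM => h.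
  by rewrite -ler_pdivlMl.
have NS h : L2f h -> N (op2 W (S h) (S1 h) (S2 h)) = N h.
  by move=> lh; have [hz ez] := HS _ lh; apply: N_ae => //; exact: (op_L2 _ (mc2 eps mf) (c2_le c00 fc0) c00 p0 bJ hz).
have bS h : L2f h -> [/\ N (S h) <= K * N h, N (S1 h) <= Ce * (1 + K) * N h &
    N (S2 h) <= Ce * (1 + K) * N h].
  move=> lh; have [hz ez] := HS _ lh; have := lP _ _ _ hz; rewrite NS// => h0.
  have [] := HCe _ _ _ _ bJ hz; rewrite NS// => h1 h2.
  have e : Ce * (N h + N (S h)) <= Ce * (1 + K) * N h.
    by rewrite -mulrA ler_wpM2l//; lra.
  by split => //; [exact: le_trans h1 e|exact: le_trans h2 e].
have supS h : L2f h -> {ae mu, forall x, forall i, `|S h i x| <= E0 * N h}.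
  move=> lh; have [hz _] := HS _ lh; have [b1 b2 _] := bS _ lh.
  have H i : {ae mu, forall x, `|S h i x| <= E0 * N h}.
    have [l l1 _ w _] := hz i; apply: aeS (sup_ae w l l1) => x h0; apply: (le_trans h0).
    rewrite E0E -mulrA ler_wpM2l// mulrDl; apply: lerD.
      by apply: le_trans b1; exact: nu_leN.
    by apply: le_trans b2; exact: nu_leN.
  by apply: aeS2 (H true) (H false) => x h1 h2 [].
have wBa : {ae mu, forall x, forall i, `|W i x| <= B}.
  by apply: aeS2 (wB true) (wB false) => x h1 h2 [].
have E0r : E0 * r <= 1.
  apply: le_trans rD; rewrite mulrC ler_wpM2l// /D.
  have : 0 <= 4 * q * E0 * K by rewrite !mulr_ge0.
  by lra.
have lS h : L2f h -> L2f (S h) by move=> /HS[/H2f_L2[]].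
have Qd h h' : L2f h -> L2f h' -> N h <= r -> N h' <= r ->
    L2 (fun x => quad W (S h) x - quad W (S h') x) /\
    2 * nu (fun x => quad W (S h) x - quad W (S h') x) <= 2^-1 * N (fun i x => h i x - h' i x).
  move=> lh lh' hr hr'.
  have [hz ez] := HS _ lh; have [hz' ez'] := HS _ lh'.
  have [_ dK] := good_diff (mc2 eps mf) (c2_le c00 fc0) c00 p0 bJ gW hz hz' lh lh' ez ez'.
  have lSd i : L2 (fun x => S h i x - S h' i x) by apply: L2B; exact: lS.
  have [lsum bsum] := L2_sum (fun i => L2_norm (lSd i)).
  have mq : measurable_fun [set: R] (fun x => quad W (S h) x - quad W (S h') x).
    by apply: measurable_funB; apply: quad_mfun => // i; apply: L2_mfun; exact: lS.
  have qb : {ae mu, forall x, `|quad W (S h) x - quad W (S h') x| <=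
      q * (E0 * r) * \sum_i `|S h i x - S h' i x|}.
    apply: aeS3 wBa (supS _ lh) (supS _ lh') => x h1 h2 h3.
    rewrite qE; apply: quad_diff => //; first by rewrite mulr_ge0.
      by move=> i; apply: (le_trans (h2 i)); rewrite ler_wpM2l.
    by move=> i; apply: (le_trans (h3 i)); rewrite ler_wpM2l.
  have qr0 : 0 <= q * (E0 * r) := mulr_ge0 q0 (mulr_ge0 E00 r0).
  have lq := L2Z (q * (E0 * r)) lsum; split; first exact: L2_le mq lq qb.
  have := nu_le mq lq qb; rewrite nuZ// (ger0_norm qr0) => h1.
  have h2 : nu (fun x => \sum_k `|S h k x - S h' k x|) <= K * N (fun i x => h i x - h' i x).
    apply: (le_trans bsum); apply: le_trans dK; apply: ler_sum => i _.
    by rewrite nu_norm.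
  set n := N (fun i x => h i x - h' i x) in h2 *; have n0 : 0 <= n by exact: N_ge0.
  apply: (@le_trans _ _ (2 * (q * (E0 * r) * (K * n)))).
    by rewrite ler_wpM2l//; apply: (le_trans h1); exact: ler_wpM2l.
  have -> : 2 * (q * (E0 * r) * (K * n)) = 2^-1 * (r * (4 * q * E0 * K) * n) by field.
  rewrite ler_wpM2l ?invr_ge0// ler_piMl//; apply: le_trans rD; rewrite ler_wpM2l// /D.
  by lra.
pose Phi h : vf := fun i x => - (sg i * (quad W (S h) x + rho x)).
have L0 : L2f ((fun _ _ => 0) : vf) by move=> i; exact: L20.
have N0r : N ((fun _ _ => 0) : vf) <= r by rewrite N0.
have S0 : {ae mu, forall x, forall i, S (fun _ _ => 0) i x = 0}.
  have [b1 _ _] := bS _ L0; rewrite N0 mulr0 in b1.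
  have H := N_eq0 (lS _ L0) (le_anti (introT andP (conj b1 (N_ge0 _)))).
  by apply: aeS2 (H true) (H false) => x h1 h2 [].
have Q0 : {ae mu, forall x, quad W (S (fun _ _ => 0)) x = 0}.
  by apply: aeS S0 => x h; rewrite /quad !h; ring.
have lQ h : L2f h -> N h <= r -> L2 (quad W (S h)).
  move=> lh hr; have [l _] := Qd _ _ lh L0 hr N0r.
  apply: (L2_ae l); first by apply: quad_mfun => // i; apply: L2_mfun; exact: lS.
  by apply: aeS Q0 => x ->; rewrite subr0.
have Nsg (F : R -> R) : L2 F -> N (fun i x => - (sg i * F x)) = 2 * nu F.
  move=> lF; rewrite /N big_bool/= /sg mulr_natl mulr2n; congr (_ + _).
    by rewrite -(nuN F); congr nu; apply/funext => x; rewrite mul1r.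
  by congr nu; apply/funext => x; rewrite mulN1r opprK.
have [| | |h [lh hr Hh]] := @fixpoint R bool Phi r.
- move=> h lh hr i; have lF := L2D (lQ _ lh hr) lr.
  by apply: L2N; exact: L2Z.
- move=> h h' lh lh' hr hr'; have [l b] := Qd _ _ lh lh' hr hr'.
  have -> : (fun i x => Phi h i x - Phi h' i x) =
      fun i x => - (sg i * (quad W (S h) x - quad W (S h') x)).
    by apply/funext => i; apply/funext => x; rewrite /Phi; ring.
  by rewrite Nsg.
- have lQ0 := lQ _ L0 N0r.
  rewrite /Phi Nsg; last exact: L2D.
  rewrite (nu_ae (L2D lQ0 lr) (L2_mfun lr)); first by rewrite /r; lra.
  by apply: aeS Q0 => x ->; rewrite add0r.
have [hz ez] := HS _ lh; have [b1 b2 b3] := bS _ lh.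
have n0 := nu_ge0 rho.
have CK0 : 0 <= Ce * (1 + K) by rewrite mulr_ge0// addr_ge0.
have up (k : R) : 0 <= k -> k <= K + 2 * (Ce * (1 + K)) + E0 ->
    k * N h <= 4 * (K + 2 * (Ce * (1 + K)) + E0) * nu rho.
  move=> k0 kk; apply: (@le_trans _ _ (k * r)); first by rewrite ler_wpM2l.
  rewrite /r mulrA [k * 4]mulrC ler_wpM2r// ler_wpM2l//.
exists (S h), (S1 h), (S2 h); split => //.
- by move=> i; apply: aeS2 (ez i) (Hh i) => x -> <-.
- split; [apply: (le_trans b1)|apply: (le_trans b2)|apply: (le_trans b3)]; apply: up => //; lra.
- move=> i; apply: aeS (supS _ lh) => x H; apply: (le_trans (H i)); apply: up => //; lra.
Qed.

End NonlinearCorrection.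

(** * Residual of a train *)

Section TrainResidual.
Context {R : realType}.
Variables (T d a m eps c0 G B0 : R) (f g : R -> R).
Hypotheses (T0 : 0 < T) (d0 : 0 < d).
Hypotheses (mf : measurable_fun [set: R] f) (mg : measurable_fun [set: R] g).
Hypotheses (fT : periodic f T) (gT : periodic g T).
Hypotheses (c00 : 0 <= c0) (fc0 : forall x, `|eps * f x| <= c0).
Hypotheses (gG : forall x, `|eps * g x| <= G).
Local Notation mu := (@lebesgue_measure R).
Local Notation vf := (bool -> R -> R).
Local Notation jacw w := (jac m eps g (pairf w)).

Variables (v v1 v2 z z1 z2 : vf).
Hypotheses (hv : forall i, H2locd (v i) (v1 i) (v2 i)) (vT : forall i, periodic (v i) T).
Hypotheses (hz : H2f z z1 z2) (B00 : 0 <= B0).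
Hypotheses (vB : forall i, {ae mu, forall x, `|v i x| <= B0}).
Hypotheses (zB : forall i, {ae mu, forall x, `|z i x| <= B0}).

Local Notation tz := (pulse_at T z).
Local Notation train := (pulse_train T v z).

Definition cubic (q : bool -> R) : R := q false * q true ^+ 2.

Definition lnc (i : bool) (x : R) : R := if i then - m else eps * g x - 1.

Definition lin (y ya yb : vf) : vf := fun i x =>
  kap2 d i * yb i x + c2 eps f i x * ya i x + lnc i x * y i x.

(** The left-hand side of the stationary system, with the derivatives as separate arguments and the
    nonlinearity split into linear, constant and cubic parts. *)
Definition res (y ya yb : vf) : vf := fun i x =>
  lin y ya yb i x + (if i then 0 else a) + sg i * cubic (y^~ x).

(** The mixed second difference of a polynomial retains only monomials that contain an increment q
    as well as an increment r. *)
Lemma cubic_mixed (B : R) (p q r : bool -> R) : (forall i, `|p i| <= B) ->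
  (forall i, `|q i| <= B) -> (forall i, `|r i| <= B) ->
  `|cubic (fun i => p i + q i + r i) - cubic (fun i => p i + q i) -
    (cubic (fun i => p i + r i) - cubic p)| <= 5 * B * (\sum_i `|q i|) * (\sum_i `|r i|).
Proof.
move=> pB qB rB; rewrite !big_bool/= /cubic.
set p0 := p false; set p1 := p true; set q0 := q false; set q1 := q true.
set r0 := r false; set r1 := r true.
have -> : (p0 + q0 + r0) * (p1 + q1 + r1) ^+ 2 - (p0 + q0) * (p1 + q1) ^+ 2 -
   ((p0 + r0) * (p1 + r1) ^+ 2 - p0 * p1 ^+ 2) =
   (q0 * r1) * (r1 + 2 * p1 + 2 * q1) + (r0 * q1) * (q1 + 2 * p1 + 2 * r1) + (q1 * r1) * (2 * p0) by ring.
have B0' := le_trans (normr_ge0 _) (pB true).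
have P (s t u : R) : `|s| <= B -> `|t| <= B -> `|u| <= B -> `|s + 2 * t + 2 * u| <= 5 * B.
  rewrite !ler_norml => /andP[? ?] /andP[? ?] /andP[? ?]; apply/andP; split; lra.
have H (s t u : R) : `|u| <= 5 * B -> `|s * t * u| <= 5 * B * (`|s| * `|t|).
  by move=> h; rewrite normrM normrM mulrC ler_wpM2r// mulr_ge0.
have h1 := H q0 r1 _ (P _ _ _ (rB true) (pB true) (qB true)).
have h2 := H r0 q1 _ (P _ _ _ (qB true) (pB true) (rB true)).
have h3 : `|q1 * r1 * (2 * p0)| <= 5 * B * (`|q1| * `|r1|).
  by apply: H; rewrite normrM ger0_norm//; have := pB false; rewrite -/p0; lra.
have h4 : 0 <= 5 * B * (`|q0| * `|r0|) by rewrite !mulr_ge0.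
rewrite (le_trans (ler_normD _ _))//; have := ler_normD (q0 * r1 * (r1 + 2 * p1 + 2 * q1)) (r0 * q1 * (q1 + 2 * p1 + 2 * r1)).
have -> : 5 * B * (`|q1| + `|q0|) * (`|r1| + `|r0|) =
  5 * B * (`|q1| * `|r1|) + 5 * B * (`|q0| * `|r1|) + 5 * B * (`|r0| * `|q1|) + 5 * B * (`|q0| * `|r0|) by ring.
by lra.
Qed.

Lemma cubic_diff (B : R) (p q : bool -> R) : (forall i, `|p i| <= B) -> (forall i, `|q i| <= B) ->
  `|cubic (fun i => p i + q i) - cubic p| <= 7 * B ^+ 2 * \sum_i `|q i|.
Proof.
move=> pB qB; rewrite big_bool/= /cubic.
set p0 := p false; set p1 := p true; set q0 := q false; set q1 := q true.
have -> : (p0 + q0) * (p1 + q1) ^+ 2 - p0 * p1 ^+ 2 =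
  q0 * ((p1 + q1) * (p1 + q1)) + q1 * (p0 * (2 * p1 + q1)) by ring.
have B0' := le_trans (normr_ge0 _) (pB true).
have h1 : `|p1 + q1| <= 2 * B.
  by rewrite (le_trans (ler_normD _ _))//; have := pB true; have := qB true; rewrite -/p1 -/q1; lra.
have h2 : `|2 * p1 + q1| <= 3 * B.
  rewrite (le_trans (ler_normD _ _))// normrM ger0_norm//.
  by have := pB true; have := qB true; rewrite -/p1 -/q1; lra.
have h3 : `|(p1 + q1) * (p1 + q1)| <= 2 * B * (2 * B) by rewrite normrM ler_pM.
have h4 : `|p0 * (2 * p1 + q1)| <= B * (3 * B) by rewrite normrM ler_pM//; exact: pB.
have h5 : `|q0 * ((p1 + q1) * (p1 + q1))| <= 7 * B ^+ 2 * `|q0|.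
  rewrite normrM mulrC ler_wpM2r//; apply: (le_trans h3).
  by have := sqr_ge0 B; rewrite expr2; lra.
have h6 : `|q1 * (p0 * (2 * p1 + q1))| <= 7 * B ^+ 2 * `|q1|.
  rewrite normrM mulrC ler_wpM2r//; apply: (le_trans h4).
  by have := sqr_ge0 B; rewrite expr2; lra.
by rewrite (le_trans (ler_normD _ _))// [leRHS]mulrDr; lra.
Qed.

Lemma cubic_mfun (y : vf) : (forall i, measurable_fun [set: R] (y i)) ->
  measurable_fun [set: R] (fun x => cubic (y^~ x)).
Proof. by move=> my; apply: measurable_funM => //; exact: measurable_funX. Qed.

Lemma lnc_mfun i : measurable_fun [set: R] (lnc i).
Proof.
rewrite /lnc; case: i; first exact: measurable_cst.
by apply: measurable_funB; [apply: measurable_funM|]; try exact: measurable_cst.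
Qed.

Lemma lnc_le i x : `|lnc i x| <= `|m| + G + 1.
Proof.
have := gG x; have := normr_ge0 m; have := normr_ge0 (eps * g x); rewrite /lnc.
case: i; first by rewrite normrN; lra.
by have := ler_normB (eps * g x) 1; rewrite normr1; lra.
Qed.

Lemma lin_L2 (y ya yb : vf) : H2f y ya yb -> L2f (lin y ya yb).
Proof.
move=> hy i; have [l la lb _ _] := hy i.
apply: L2D; first apply: L2D; first exact: L2Z.
  by have [] := L2_adv (mc2 eps mf) (c2_le c00 fc0) c00 la.
exact: (L2_mulbd (lnc_mfun i) (ae_all (lnc_le i)) l).
Qed.

Lemma linD (y ya yb w wa wb : vf) i x :
  lin (fun i x => y i x + w i x) (fun i x => ya i x + wa i x) (fun i x => yb i x + wb i x) i x =
  lin y ya yb i x + lin w wa wb i x.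
Proof. by rewrite /lin; ring. Qed.

Let mv i : measurable_fun [set: R] (v i).
Proof. by have [[]] := hv i. Qed.

Let mz i : measurable_fun [set: R] (z i).
Proof. by have [l _ _ _ _] := hz i; exact: L2_mfun. Qed.

Let lmfun (h : R -> R) : L2loc h -> measurable_fun [set: R] h.
Proof. by case. Qed.

(** Translating v by T changes nothing, so the translated derivatives are weak derivatives of the
    same function, and uniqueness applies. *)
Lemma wderiv_periodic i : {ae mu, forall x, v1 i (x + T) = v1 i x} /\
  {ae mu, forall x, v2 i (x + T) = v2 i x}.
Proof.
have [l l1 l2 w1 w2] := hv i.
have e1 : {ae mu, forall x, v1 i (x + T) = v1 i x}.
  have := wderiv_shift T w1; rewrite (_ : (fun x => v i (x + T)) = v i) => [ws|].
    exact: wderiv_uniq ws w1.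
  by apply/funext => x; exact: vT.
split => //; have ws := wderiv_shift T w2.
have m2 : measurable_fun [set: R] (fun x => v2 i (x + T)).
  by apply: (measurableT_comp (lmfun l2)); exact: measurable_funD.
exact: wderiv_uniq (wderiv_ae ws (lmfun l1) m2 e1 (ae_all (fun=> erefl))) w2.
Qed.

Hypothesis usol : forall i, {ae mu, forall x, res (fun i x => v i x + z i x)
  (fun i x => v1 i x + z1 i x) (fun i x => v2 i x + z2 i x) i x = 0}.

Let vzB : {ae mu, forall x, (forall i, `|v i x| <= B0) /\ (forall i, `|z i x| <= B0)}.
Proof.
have h1 : {ae mu, forall x, forall i, `|v i x| <= B0}.
  by apply: aeS2 (vB true) (vB false) => x h1 h2 [].
apply: aeS3 h1 (zB true) (zB false) => x h2 h3 h4; split => //; case => //.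
Qed.

(* The residual of the background is periodic, and square integrable because
   it is minus the contribution of the localised part. *)
Lemma background_solution i : {ae mu, forall x, res v v1 v2 i x = 0}.
Proof.
have [l l1 l2 _ _] := hv i.
have mres : measurable_fun [set: R] (res v v1 v2 i).
  apply: measurable_funD; first apply: measurable_funD.
  - apply: measurable_funD; first apply: measurable_funD.
    + by apply: measurable_funM; [exact: measurable_cst|exact: lmfun].
    + by apply: measurable_funM; [exact: mc2|exact: lmfun].
    + by apply: measurable_funM; [exact: lnc_mfun|exact: lmfun].
  - exact: measurable_cst.
  - by apply: measurable_funM; [exact: measurable_cst|exact: cubic_mfun].
pose D x := cubic (fun i => v i x + z i x) - cubic (v^~ x).
have lD : L2 D.
  have [lsum _] := L2_sum (fun i => L2_norm (let: And5 l _ _ _ _ := hz i in l)).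
  apply: (L2_le _ (L2Z (7 * B0 ^+ 2) lsum)).
    apply: measurable_funB; last exact: cubic_mfun.
    by apply: (@cubic_mfun (fun i x => v i x + z i x)) => j; exact: measurable_funD.
  by apply: aeS vzB => x [h1 h2]; exact: cubic_diff.
have lE : L2 (fun x => - (lin z z1 z2 i x + sg i * D x)).
  by apply: L2N; apply: L2D; [exact: lin_L2|exact: L2Z].
have e : {ae mu, forall x, - (lin z z1 z2 i x + sg i * D x) = res v v1 v2 i x}.
  apply: aeS (usol i) => x; rewrite /res linD /D => h.
  set s := cubic (fun i => v i x + z i x) in h *.
  by rewrite mulrBr; lra.
have lres := L2_ae lE mres e.
apply: (periodic_L2_eq0 T0 lres).
have [p1 p2] := wderiv_periodic i; apply: aeS2 p1 p2 => x h1 h2.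
rewrite /res /lin h1 h2 vT; congr (_ + _ + sg i * _).
  congr (_ + _ * _ + _ * _); first by rewrite /c2; case: (i); rewrite ?fT.
  by rewrite /lnc; case: (i); rewrite ?gT.
by rewrite /cubic !vT.
Qed.

Definition pulse_train1 (k n : nat) : vf := fun i x =>
  v1 i x + \sum_(1 <= j < k.+1) z1 i (x - j%:R * n%:R * T).
Definition pulse_train2 (k n : nat) : vf := fun i x =>
  v2 i x + \sum_(1 <= j < k.+1) z2 i (x - j%:R * n%:R * T).

Lemma train1S k n i x : pulse_train1 k.+1 n i x = pulse_train1 k n i x + z1 i (x - k.+1%:R * n%:R * T).
Proof. by rewrite /pulse_train1 big_nat_recr//= addrA. Qed.

Lemma train2S k n i x : pulse_train2 k.+1 n i x = pulse_train2 k n i x + z2 i (x - k.+1%:R * n%:R * T).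
Proof. by rewrite /pulse_train2 big_nat_recr//= addrA. Qed.

Lemma train_H2loc k n i : H2locd (train k n i) (pulse_train1 k n i) (pulse_train2 k n i).
Proof.
elim: k => [|k IH].
  by have := hv i; congr H2locd; apply/funext => x; rewrite /train /pulse_train1 /pulse_train2 big_geq// addr0.
have := H2locdD IH (H2d_loc (tz_H2 T hz k.+1 n i)).
by congr H2locd; apply/funext => x; rewrite ?trainS ?train1S ?train2S.
Qed.

(** The interaction of the pulses. Linear terms drop out of the residual of the train, since v and
    every v + z(. - jnT) are solutions; what remains is the failure of the cubic term to be
    additive. *)
Definition rho (k n : nat) (x : R) : R := cubic (train k n ^~ x) - cubic (v^~ x) -
  \sum_(1 <= j < k.+1) (cubic (fun i => v i x + tz j n i x) - cubic (v^~ x)).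

Lemma rho0 n x : rho 0 n x = 0.
Proof.
rewrite /rho big_geq// subr0 (_ : train 0 n ^~ x = v^~ x) ?subrr//.
by apply/funext => i; rewrite /train big_geq// addr0.
Qed.

Lemma rhoS k n x : rho k.+1 n x = rho k n x +
  (cubic (fun i => train k n i x + tz k.+1 n i x) - cubic (train k n ^~ x) -
   (cubic (fun i => v i x + tz k.+1 n i x) - cubic (v^~ x))).
Proof.
rewrite /rho big_nat_recr//= (_ : train k.+1 n ^~ x = fun i => train k n i x + tz k.+1 n i x).
  by ring.
by apply/funext => i; rewrite trainS.
Qed.

Lemma res_train k n i : {ae mu, forall x,
  res (train k n) (pulse_train1 k n) (pulse_train2 k n) i x = sg i * rho k n x}.
Proof.
have H : {ae mu, forall x, forall j, res (fun i x => v i x + z i x)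
  (fun i x => v1 i x + z1 i x) (fun i x => v2 i x + z2 i x) i (x - j%:R * n%:R * T) = 0}.
  by apply: ae_foralln_real => j; exact: (ae_shift (- (j%:R * n%:R * T)) (usol i)).
have P1 : {ae mu, forall x, forall j, v1 i (x - j%:R * n%:R * T) = v1 i x /\
    v2 i (x - j%:R * n%:R * T) = v2 i x}.
  apply: ae_foralln_real => j; have [p1 p2] := wderiv_periodic i.
  rewrite -natrM; apply: aeS2 (ae_periodic_nat (j * n) p1) (ae_periodic_nat (j * n) p2) => x.
  by rewrite natrM.
apply: aeS3 (background_solution i) H P1 => x hb hj hp.
elim: k => [|k IH].
  rewrite rho0 mulr0 -hb; rewrite /res /lin /train /pulse_train1 /pulse_train2 !big_geq// !addr0.
  by congr (_ + sg i * cubic _); apply/funext => j; rewrite big_geq// addr0.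
have E : res (train k.+1 n) (pulse_train1 k.+1 n) (pulse_train2 k.+1 n) i x =
    lin (train k n) (pulse_train1 k n) (pulse_train2 k n) i x +
    lin (tz k.+1 n) (fun i x => z1 i (x - k.+1%:R * n%:R * T)) (fun i x => z2 i (x - k.+1%:R * n%:R * T)) i x +
    (if i then 0 else a) + sg i * cubic (fun i => train k n i x + tz k.+1 n i x).
  rewrite -linD /res; congr (_ + _ + sg i * cubic _).
    by rewrite /lin trainS train1S train2S.
  by apply/funext => j; rewrite trainS.
have [e1 e2] := hp k.+1.
have hc : c2 eps f i (x - k.+1%:R * n%:R * T) = c2 eps f i x.
  by rewrite /c2; case: (i) => //; rewrite (periodicM _ _ _ fT).
have hl : lnc i (x - k.+1%:R * n%:R * T) = lnc i x.
  by rewrite /lnc; case: (i) => //; rewrite (periodicM _ _ _ gT).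
have hw : (fun j => v j (x - k.+1%:R * n%:R * T) + z j (x - k.+1%:R * n%:R * T)) =
    (fun j => v j x + tz k.+1 n j x).
  by apply/funext => j; rewrite (periodicM _ _ _ (vT _)).
have hu := hj k.+1; rewrite /res linD /lin e1 e2 (periodicM _ _ _ (vT _)) hc hl hw in hu.
rewrite E rhoS mulrDr -IH /res; move: hb hu; rewrite /res /lin /pulse_at.
set C1 := cubic _; set C2 := cubic _; set C3 := cubic _; set C4 := cubic _.
by rewrite !mulrBr; lra.
Qed.

Definition mass (k n : nat) (x : R) : R :=
  \sum_(1 <= j < k.+1) \sum_i `|tz j n i x|.

Lemma massS k n x : mass k.+1 n x = mass k n x + \sum_i `|tz k.+1 n i x|.
Proof. by rewrite /mass big_nat_recr. Qed.

Lemma mass_ge0 k n x : 0 <= mass k n x.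
Proof. by apply: sumr_ge0 => j _; apply: sumr_ge0. Qed.

Lemma mass_L2 k n : L2 (mass k n) /\ nu (mass k n) <= k%:R * N z.
Proof.
elim: k => [|k [l b]].
  rewrite (_ : mass 0 n = fun=> 0); first by split; [exact: L20|rewrite nu0 mul0r].
  by apply/funext => x; rewrite /mass big_geq.
have lt i : L2 (tz k.+1 n i) by have [] := tz_H2 T hz k.+1 n i.
have [l2 b2] := L2_sum (fun i => L2_norm (lt i)).
rewrite (_ : mass k.+1 n = fun x => mass k n x + \sum_i `|tz k.+1 n i x|); last first.
  by apply/funext => x; rewrite massS.
split; first exact: L2D.
apply: (le_trans (nuD l l2)); rewrite -natr1 mulrDl mul1r; apply: lerD => //.
apply: (le_trans b2); apply: ler_sum => i _; rewrite nu_norm.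
by have [lz _ _ _ _] := hz i; rewrite (nu_shift (- (k.+1%:R * n%:R * T)) lz).
Qed.

Lemma rho_mfun k n : measurable_fun [set: R] (rho k n).
Proof.
apply: measurable_funB; first apply: measurable_funB.
- by apply: cubic_mfun => i; have [[]] := train_H2loc k n i.
- exact: cubic_mfun.
- apply: measurable_sum => j; apply: measurable_funB; last exact: cubic_mfun.
  apply: (@cubic_mfun (fun i x => v i x + tz j n i x)) => i.
  by apply: measurable_funD => //; exact: tz_mfun hz _ _ _.
Qed.

(* At every point all pulses but at most one are small. *)
Lemma tz_mul (e r : R) n x : 0 <= e -> 2 * r <= n%:R * T ->
  (forall j i, r <= `|x - j%:R * n%:R * T| -> `|tz j n i x| <= e) ->
  forall l j, (l < j)%N -> (\sum_i `|tz l n i x|) * (\sum_i `|tz j n i x|) <=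
    2 * e * (\sum_i `|tz l n i x| + \sum_i `|tz j n i x|).
Proof.
move=> e0 rn H l j lj; set s := \sum_i `|tz l n i x|; set t := \sum_i `|tz j n i x|.
have s0 : 0 <= s by exact: sumr_ge0.
have t0 : 0 <= t by exact: sumr_ge0.
have B k : r <= `|x - k%:R * n%:R * T| -> \sum_i `|tz k n i x| <= 2 * e.
  by move=> hk; rewrite big_bool/=; have := H _ true hk; have := H _ false hk; lra.
have es : 0 <= 2 * e * s by rewrite !mulr_ge0.
have et : 0 <= 2 * e * t by rewrite !mulr_ge0.
have [hl|hl] := leP r `|x - l%:R * n%:R * T|.
  have : s * t <= 2 * e * t by rewrite ler_wpM2r//; exact: B.
  by rewrite mulrDr; lra.
suff hj : r <= `|x - j%:R * n%:R * T|.
  have : s * t <= s * (2 * e) by rewrite ler_wpM2l//; exact: B.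
  by rewrite mulrDr; lra.
have nT0 : 0 <= n%:R * T by rewrite mulr_ge0// ltW.
have h1 : (l.+1)%:R * (n%:R * T) <= j%:R * (n%:R * T) by rewrite ler_wpM2r// ler_nat.
rewrite -natr1 mulrDl mul1r in h1.
move: hl; rewrite -!mulrA ltr_norml => /andP[_ h2].
by rewrite ler0_norm; lra.
Qed.

(** Adding a pulse changes [rho] by a mixed difference, hence by at most 5 B times products of
    distinct pulses, which [tz_mul] makes small. Summing over the pulses, k^2 + (k + 1) <= (k + 1)^2
    closes the induction. *)
Lemma rho_le M (e r : R) n : 0 <= e -> 2 * r <= n%:R * T ->
  {ae mu, forall x, forall j n i, r <= `|x - j%:R * n%:R * T| -> `|tz j n i x| <= e} ->
  {ae mu, forall x, `|rho M n x| <= 10 * (M.+1%:R * B0) * e * M%:R ^+ 2 * mass M n x}.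
Proof.
move=> e0 rn dec; have [B BE] : exists B : R, B = M.+1%:R * B0 by eexists.
have Bge0 : 0 <= B by rewrite BE mulr_ge0.
rewrite -BE; apply: aeS3 dec vzB (tz_bound T zB) => x hd [hv0 _] ht.
have tm := tz_mul e0 rn (hd^~ n).
have mr k : \sum_(1 <= l < k.+1) ((\sum_i `|tz l n i x|) * (\sum_i `|tz k.+1 n i x|)) <=
    2 * e * (k.+1%:R * mass k.+1 n x).
  set s := \sum_i `|tz k.+1 n i x|.
  have s0 : 0 <= s by exact: sumr_ge0.
  apply: (@le_trans _ _ (\sum_(1 <= l < k.+1) (2 * e * ((\sum_i `|tz l n i x|) + s)))).
    by apply: ler_sum_nat => l /andP[_ lk]; exact: tm.
  rewrite -mulr_sumr ler_wpM2l ?mulr_ge0// big_split/= -/(mass k n x) massS -/s.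
  rewrite sumr_const_nat subSS subn0 -mulr_natl -natr1.
  have := mass_ge0 k n x; have : 0 <= k%:R * mass k n x by rewrite mulr_ge0 ?mass_ge0.
  by lra.
suff H k : (k <= M)%N -> `|rho k n x| <= 10 * B * e * k%:R ^+ 2 * mass k n x by exact: H.
elim: k => [_|k IH kM]; first by rewrite rho0 normr0 expr0n/= mulr0 mul0r.
have {}IH := IH (ltnW kM); rewrite rhoS (le_trans (ler_normD _ _))//.
pose q i := \sum_(1 <= j < k.+1) tz j n i x.
have qb i : `|q i| <= \sum_(1 <= j < k.+1) `|tz j n i x| by exact: ler_norm_sum.
have bB (l : nat) : (l <= M.+1)%N -> l%:R * B0 <= B.
  by move=> lM; rewrite BE ler_wpM2r// ler_nat.
have B0B : B0 <= B by rewrite -[B0]mul1r; exact: (bB 1%N).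
have q2 i : `|q i| <= B.
  apply: (le_trans (qb i)); apply: (@le_trans _ _ (\sum_(1 <= j < k.+1) B0)).
    by apply: ler_sum_nat => j _; exact: ht.
  by rewrite sumr_const_nat subSS subn0 -mulr_natl; apply: bB; rewrite (leq_trans (leqnSn k))// ltnW.
have Qm : \sum_i `|q i| <= mass k n x.
  by rewrite /mass exchange_big/=; apply: ler_sum => i _; exact: qb.
have := @cubic_mixed B (v^~ x) q (fun i => tz k.+1 n i x) _ q2 _.
rewrite (_ : cubic (fun i => v i x + q i + tz k.+1 n i x) = cubic (fun i => train k n i x + tz k.+1 n i x))//.
rewrite (_ : cubic (fun i => v i x + q i) = cubic (train k n ^~ x))//.
move=> /(_ (fun i => le_trans (hv0 i) B0B) (fun i => le_trans (ht _ _ i) B0B)) h1.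
set s := \sum_i `|tz k.+1 n i x| in h1 *.
have s0 : 0 <= s by exact: sumr_ge0.
have h2 : (\sum_i `|q i|) * s <= 2 * e * (k.+1%:R * mass k.+1 n x).
  by apply: le_trans (mr k); rewrite -mulr_suml -/(mass k n x) ler_wpM2r.
have mk := mass_ge0 k.+1 n x.
have h3 : mass k n x <= mass k.+1 n x by rewrite massS lerDl.
set c := 10 * B * e; have c_ge0 : 0 <= c by rewrite !mulr_ge0.
apply: (@le_trans _ _ (c * k%:R ^+ 2 * mass k.+1 n x + c * (k.+1%:R * mass k.+1 n x))).
  apply: lerD.
    by apply: (le_trans IH); rewrite ler_wpM2l// mulr_ge0.
  apply: (le_trans h1); rewrite -mulrA.
  apply: (@le_trans _ _ (5 * B * (2 * e * (k.+1%:R * mass k.+1 n x)))).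
    by rewrite ler_wpM2l// mulr_ge0.
  by rewrite /c le_eqVlt; apply/orP; left; apply/eqP; ring.
rewrite -mulrA -mulrDr -[leRHS]mulrA ler_wpM2l// -mulrDl ler_wpM2r// -natr1.
by have : 0 <= k%:R :> R by []; rewrite !expr2; nra.
Qed.

(** The L^2 norm of [mass] does not grow with n, so the pointwise factor e obtained from decay is
    all that has to be made small. *)
Lemma rho_small M (t : R) : 0 < t -> exists N0, forall n, (N0 <= n)%N ->
  L2 (rho M n) /\ nu (rho M n) <= t.
Proof.
move=> t0; pose C := 10 * (M.+1%:R * B0) * M%:R ^+ 2 * (M%:R * N z).
have C0 : 0 <= C by rewrite !mulr_ge0// N_ge0.
pose e := t / (C + 1); have e0 : 0 < e by rewrite divr_gt0// ltr_wpDl.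
have [r r0 dec] := tz_decay T hz e0.
exists (Num.truncn (2 * r / T)).+1 => n nn.
have rn : 2 * r <= n%:R * T.
  have q1 : 0 <= 2 * r / T by rewrite divr_ge0 ?mulr_ge0// ltW.
  have /andP[_ h] := truncn_itv q1; rewrite ltr_pdivrMr// in h.
  by apply: (le_trans (ltW h)); rewrite ler_wpM2r ?ler_nat// ltW.
have [lm bm] := mass_L2 M n.
have rb := rho_le M (ltW e0) rn dec.
set c := 10 * _ * e * _ in rb.
have c_ge0 : 0 <= c by have := ltW e0; rewrite /c; move: (e) => e' ?; rewrite !mulr_ge0.
have lc := L2Z c lm; split; first exact: L2_le (rho_mfun M n) lc rb.
apply: (le_trans (nu_le (rho_mfun M n) lc rb)); rewrite nuZ// (ger0_norm c_ge0).
apply: (@le_trans _ _ (c * (M%:R * N z))); first by rewrite ler_wpM2l.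
have -> : c * (M%:R * N z) = C * e by rewrite /c /C; ring.
by rewrite /e mulrA ler_pdivrMr ?ltr_wpDl// mulrC ler_wpM2l ?(ltW t0)// lerDl.
Qed.

End TrainResidual.

(** * Transfer of spectral properties *)

Section SpectralTransfer.
Context {R : realType}.
Variables (T d m eps c0 G B0 : R) (f g : R -> R).
Hypotheses (T0 : 0 < T) (d0 : 0 < d).
Hypotheses (mf : measurable_fun [set: R] f) (mg : measurable_fun [set: R] g).
Hypotheses (fT : periodic f T) (gT : periodic g T).
Hypotheses (c00 : 0 <= c0) (fc0 : forall x, `|eps * f x| <= c0).
Hypotheses (gG : forall x, `|eps * g x| <= G).
Local Notation mu := (@lebesgue_measure R).
Local Notation vf := (bool -> R -> R).
Local Notation jacw w := (jac m eps g (pairf w)).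
Local Notation lgood := (lgood d eps f).
Local Notation sol := (sol d eps f).
Local Notation vf4 := (bool * bool -> R -> R).

Variables (v z z1 z2 : vf).
Hypotheses (mv : forall i, measurable_fun [set: R] (v i)) (vT : forall i, periodic (v i) T).
Hypotheses (hz : H2f z z1 z2) (B00 : 0 <= B0).
Hypotheses (vB : forall i, {ae mu, forall x, `|v i x| <= B0}).
Hypotheses (zB : forall i, {ae mu, forall x, `|z i x| <= B0}).

Local Notation tz := (pulse_at T z).
Local Notation train := (pulse_train T v z).
Local Notation tu := (one_pulse T v z).
Local Notation J0 := (jacw (tu 0 0)).

(** [y n] stands for the exact multipulse. It enters through uniform closeness to the train, which
    makes its Jacobian a small perturbation of that of the train. *)
Variables (k : nat) (y : nat -> vf).
Hypothesis ymf : forall n i, measurable_fun [set: R] (y n i).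
Hypothesis y_close : forall e : R, 0 < e -> exists N0, forall n, (N0 <= n)%N ->
  {ae mu, forall x, forall i, `|y n i x - train k.+1 n i x| <= e}.

(** The summand 1 leaves room for the distance between [y n] and the train. *)
Let B : R := k.+2%:R * B0 + 1.
Let B_ge0 : 0 <= B. Proof. by rewrite addr_ge0// mulr_ge0. Qed.
Let p := jac_bd m G B.
Let p0 : 0 <= p. Proof. exact: (jac_bd_ge0 m gG). Qed.

Let B2 : 2 * B0 <= B.
Proof.
apply: (@le_trans _ _ (k.+2%:R * B0)); last by rewrite lerDl.
by rewrite ler_wpM2r// ler_nat.
Qed.

Lemma near_train_bound : exists N0, forall n, (N0 <= n)%N ->
  {ae mu, forall x, forall i, `|y n i x| <= B}.
Proof.
have [N0 H] := y_close ltr01; exists N0 => n /H hn.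
apply: aeS2 hn (train_bound T vB zB) => x h1 h2 i.
have -> : y n i x = train k.+1 n i x + (y n i x - train k.+1 n i x) by rewrite addrC subrK.
by apply: (le_trans (ler_normD _ _)); apply: lerD.
Qed.

Lemma near_train_jac : exists N0, forall n, (N0 <= n)%N -> bounded p (jacw (y n)).
Proof.
have [N0 H] := near_train_bound; exists N0 => n /H hn.
by apply: jac_bounded => // i; apply: aeS hn => x; exact.
Qed.

Lemma near_train_good (r K0 : R) : 0 <= r -> 0 <= K0 -> exists (N0 : nat) (K : R), 0 <= K /\
  forall n al be, (N0 <= n)%N -> `|al| + `|be| <= r ->
  lgood J0 al be K0 -> lgood (jacw (y n)) al be K.
Proof.
move=> r0 K00; have [N1 [K [Kge0 HK]]] := train_good m T0 d0 mf mg fT gT c00 fc0 gG mv vT hz B00 vB zB k r0 K00.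
have [N2 HJ] := near_train_jac; have [N3 HB] := near_train_bound.
pose q := #|{: bool * bool}|%:R * (4 * B) * K.
have q0 : 0 <= q by rewrite mulr_ge0// mulr_ge0// mulr_ge0.
have e0 : 0 < (2 * (q + 1))^-1 by rewrite invr_gt0 mulr_gt0// ltr_wpDl.
have [N4 Hc] := y_close e0; set e := (2 * (q + 1))^-1 in e0 Hc.
exists (maxn (maxn N1 N2) (maxn N3 N4)), (2 * K); split; first exact: mulr_ge0.
move=> n al be; rewrite !geq_max => /andP[/andP[n1 n2] /andP[n3 n4]] abr G0.
have bt : bounded p (jacw (train k.+1 n)).
  by apply: (train_jac_bounded T m mg gG mv hz vB zB); rewrite lerDl.
have b0 : 0 <= 4 * B * e by rewrite mulr_ge0 ?(ltW e0)// mulr_ge0.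
apply: (lgood_perturb mf c00 fc0 p0 bt (HJ n n2) b0 (r := 0) _ Kge0 _ _ (HK n al be n1 abr G0)).
- move=> i j; have [m1 _] := bt i j; have [m2 _] := HJ n n2 i j.
  split; first exact: measurable_funB.
  apply: aeS3 (HB n n3) (Hc n n4) (train_bound T vB zB) => x h1 h2 h3.
  apply: jac_diff => // b; apply: (le_trans (h3 _ _ _)); rewrite lerDl//.
- by rewrite !subrr normr0 addr0.
- rewrite addr0; have -> : #|{: bool * bool}|%:R * (4 * B * e) * K = q * e by rewrite /q; ring.
  rewrite /e invfM mulrCA ler_piMr ?invr_ge0//.
  by rewrite ler_pdivrMr ?ltr_wpDl// mul1r lerDl.
Qed.

Lemma near_train_stable (rho : R) : 0 < rho ->
  (forall al be, - rho < al -> exists2 K : R, 0 <= K & lgood J0 al be K) ->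
  exists N0, forall n, (N0 <= n)%N -> forall al be, - (rho / 2) <= al ->
    exists2 K : R, 0 <= K & lgood (jacw (y n)) al be K.
Proof.
move=> rho0 H.
have bJ : bounded p J0 := tu_jac_bounded T m mg gG mv hz vB zB 0 0 B2.
have [r [K0 [r0 K00 far near]]] := stable_uniform d0 mf c00 fc0 p0 bJ rho0 H.
have [N1 [K [Kge0 HK]]] := near_train_good (ltW r0) K00.
have [N2 HJ] := near_train_jac.
exists (maxn N1 N2) => n; rewrite geq_max => /andP[n1 n2] al be ar.
have [h|h] := leP r (`|al| + `|be|); first exact: far (HJ n n2) ar h.
by exists K => //; apply: HK (ltW h) _ => //; exact: near ar (ltW h).
Qed.

Lemma N_tail (psi : vf4) (e : R) : L2f psi -> 0 < e ->
  exists2 r : R, 0 < r & N (fun i => tail r (psi i)) <= e.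
Proof.
move=> lp e0; have e4 : 0 < e / 4 by rewrite divr_gt0.
have [r1 r10 H1] := tail_cvg0 (lp (true, true)) e4; have [r2 r20 H2] := tail_cvg0 (lp (true, false)) e4.
have [r3 r30 H3] := tail_cvg0 (lp (false, true)) e4; have [r4 r40 H4] := tail_cvg0 (lp (false, false)) e4.
exists (r1 + r2 + r3 + r4); first by rewrite !addr_gt0.
rewrite /N big_bool2.
have := H1 (r1 + r2 + r3 + r4); have := H2 (r1 + r2 + r3 + r4).
have := H3 (r1 + r2 + r3 + r4); have := H4 (r1 + r2 + r3 + r4) => h4 h3 h2 h1.
have {}h1 : nu (tail (r1 + r2 + r3 + r4) (psi (true, true))) <= e / 4 by apply: h1; lra.
have {}h2 : nu (tail (r1 + r2 + r3 + r4) (psi (true, false))) <= e / 4 by apply: h2; lra.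
have {}h3 : nu (tail (r1 + r2 + r3 + r4) (psi (false, true))) <= e / 4 by apply: h3; lra.
have {}h4 : nu (tail (r1 + r2 + r3 + r4) (psi (false, false))) <= e / 4 by apply: h4; lra.
by lra.
Qed.

Lemma sol_tu (l : R) (psi : vf4) n : sol J0 l 0 psi (fun _ _ => 0) ->
  sol (jacw (tu 1 n)) l 0 (fun i x => psi i (x - 1%:R * n%:R * T)) (fun _ _ => 0).
Proof.
move=> [psi1 [psi2 [hp ep]]]; set s := - (1%:R * n%:R * T).
exists (fun i x => psi1 i (x + s)), (fun i x => psi2 i (x + s)); split=> i.
  exact: (H2d_shift s (hp i)).
apply: aeS (ae_shift s (ep i)) => x e; rewrite -[RHS]e.
have E b : tu 0 0 b (x + s) = tu 1 n b x.
  by rewrite /one_pulse /pulse_at mul0r mul0r subr0 /s (periodicM _ _ _ (vT b)).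
have gE : g (x + s) = g x by rewrite /s (periodicM _ _ _ gT).
rewrite /op /pot; congr (_ + _ * _ + _).
  by rewrite /c4 /c2; case: i.1 => //; rewrite /s (periodicM _ _ _ fT).
by apply: eq_bigr => j _; rewrite /lpot /jac /pairf/= !E gE.
Qed.

(** Within distance rr of the first pulse all others are at distance at least n T - rr, beyond their
    decay radius for large n. *)
Lemma near_first_pulse (rr e : R) : 0 < rr -> 0 < e -> exists N0, forall n, (N0 <= n)%N ->
  {ae mu, forall x, `|x - 1%:R * n%:R * T| < rr ->
    forall i j, `|jacw (y n) i j x - jacw (tu 1 n) i j x| <= e}.
Proof.
move=> rr0 e0; pose q : R := e / (4 * (B + 1) * k.+2%:R).
have B1 : 0 < B + 1 by rewrite ltr_wpDl.
have q0 : 0 < q by rewrite divr_gt0// !mulr_gt0.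
have [r r0 dec] := tz_decay T hz q0.
have [N1 HB] := near_train_bound; have [N2 Hc] := y_close q0.
pose N3 := (Num.truncn ((rr + r) / T)).+1.
exists (maxn (maxn N1 N2) N3) => n; rewrite !geq_max => /andP[/andP[n1 n2] n3].
have nT : rr + r <= n%:R * T.
  have q1 : 0 <= (rr + r) / T by rewrite divr_ge0 ?addr_ge0// ltW.
  have /andP[_ h] := truncn_itv q1; rewrite ltr_pdivrMr// in h.
  by apply: (le_trans (ltW h)); rewrite ler_wpM2r ?ler_nat// ltW.
have nT0 : 0 <= n%:R * T by rewrite mulr_ge0// ltW.
have ub : {ae mu, forall x, forall b, `|tu 1 n b x| <= B}.
  have vb : {ae mu, forall x, forall i, `|v i x| <= B0}.
    by apply: aeS2 (vB true) (vB false) => x h1 h2 [].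
  apply: aeS2 vb (tz_bound T zB) => x h1 h2 b; apply: le_trans B2.
  rewrite /one_pulse (le_trans (ler_normD _ _))//.
  by have := h2 1%N n b; have := h1 b; lra.
have ubB : {ae mu, forall x, (forall b, `|tu 1 n b x| <= B) /\ (forall b, `|y n b x| <= B)}.
  by apply: aeS2 ub (HB n n1) => x.
apply: aeS3 ubB (Hc n n2) dec => x [hu hy] hc hd xr i j.
(* One share of [q] pays for the distance of [y n] to the train, the other k shares for the
   remaining pulses. *)
have D b : `|y n b x - tu 1 n b x| <= k.+1%:R * q.
  have -> : y n b x - tu 1 n b x = (y n b x - train k.+1 n b x) + \sum_(2 <= l < k.+2) tz l n b x.
    by rewrite /pulse_train big_ltn// /one_pulse; ring.
  rewrite -natr1 mulrDl mul1r addrC (le_trans (ler_normD _ _))//; apply: lerD => //.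
  apply: (le_trans (ler_norm_sum _ _ _)).
  have -> : k%:R * q = \sum_(2 <= l < k.+2) q by rewrite sumr_const_nat !subSS subn0 mulr_natl.
  apply: ler_sum_nat => l /andP[l2 _]; apply: hd.
  have h1 : 2 * (n%:R * T) <= l%:R * (n%:R * T) by rewrite ler_wpM2r// ler_nat.
  move: xr; rewrite mul1r ltr_norml => /andP[_ h2].
  by rewrite -mulrA ler0_norm; lra.
apply: (le_trans (jac_diff m eps g i j B_ge0 hy hu D)).
rewrite /q mulrA mulrA ler_pdivrMr ?mulr_gt0// mulrC -[e * _]mulrC.
rewrite [leRHS]mulrC ler_wpM2r ?(ltW e0)// ler_pM ?mulr_ge0// ?ler_nat//.
by rewrite ler_wpM2l// lerDl.
Qed.

(** With D the potential of the multipulse minus that of its first pulse, the translated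
    eigenfunction solves the multipulse equation at l with right-hand side D psi. This is small
    everywhere: D is small near the pulse, psi far from it. If the right half-plane contained no
    spectrum, [interior_bound] would give N psi <= K1 N (D psi) with K1 independent of n, which is
    impossible for large n. *)
Lemma near_train_unstable (l : R) (psi : vf4) : 0 < l ->
  (forall al be, 0 < al -> ~ (al = l /\ be = 0) -> exists2 K : R, 0 <= K & lgood J0 al be K) ->
  sol J0 l 0 psi (fun _ _ => 0) -> 0 < N psi ->
  exists N0, forall n, (N0 <= n)%N ->
    ~ (forall al be, 0 < al -> exists2 K : R, 0 <= K & lgood (jacw (y n)) al be K).
Proof.
(* Half-side l/2 keeps the closed square in the open right half-plane. *)
move=> l0 H spsi Npsi; pose s := l / 2; have s0 : 0 < s by rewrite divr_gt0.
have ls : l - s = s by rewrite /s; lra.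
have bJ : bounded p J0 := tu_jac_bounded T m mg gG mv hz vB zB 0 0 B2.
have U (x0 x1 y0 y1 : R) : 0 < x0 -> (forall al be, x0 <= al <= x1 -> y0 <= be <= y1 -> ~ (al = l /\ be = 0)) ->
    exists2 K : R, 0 <= K & forall al be, x0 <= al <= x1 -> y0 <= be <= y1 -> lgood J0 al be K.
  move=> x00 Hne; apply: (lgood_uniform mf c00 fc0 p0 bJ) => al be h1 h2.
  apply: H; last exact: Hne.
  by move/andP: h1 => [h1 _]; exact: lt_le_trans h1.
(* The four edges are treated as degenerate rectangles that avoid l, so compactness gives a bound on
   each. *)
have [Ka Ka0 HKa] : exists2 K : R, 0 <= K & forall al be, l + s <= al <= l + s -> - s <= be <= s -> lgood J0 al be K.
  by apply: U => [|al be /andP[h1 h2] _ []]; [exact: addr_gt0|lra].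
have [Kb Kb0 HKb] : exists2 K : R, 0 <= K & forall al be, l - s <= al <= l - s -> - s <= be <= s -> lgood J0 al be K.
  by apply: U => [|al be /andP[h1 h2] _ []]; [rewrite ls|lra].
have [Kc Kc0 HKc] : exists2 K : R, 0 <= K & forall al be, l - s <= al <= l + s -> s <= be <= s -> lgood J0 al be K.
  by apply: U => [|al be _ /andP[h1 h2] []]; [rewrite ls|lra].
have [Kd Kd0 HKd] : exists2 K : R, 0 <= K & forall al be, l - s <= al <= l + s -> - s <= be <= - s -> lgood J0 al be K.
  by apply: U => [|al be _ /andP[h1 h2] []]; [rewrite ls|lra].
pose K0 := Ka + Kb + (Kc + Kd).
have bd al be : `|al - l| <= s -> `|be| <= s -> `|al - l| = s \/ `|be| = s -> lgood J0 al be K0.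
  move=> h1 h2 h3.
  have ha : l - s <= al <= l + s by move: h1; rewrite ler_distl.
  have hb : - s <= be <= s by rewrite -ler_norml.
  case: h3 => h3.
    case: (ger0P (al - l)) h3 => _ h3.
      by apply: good_mono (HKa al be _ hb); [rewrite /K0; lra|apply/andP; split; lra].
    by apply: good_mono (HKb al be _ hb); [rewrite /K0; lra|apply/andP; split; lra].
  case: (ger0P be) h3 => _ h3.
    by apply: good_mono (HKc al be ha _); [rewrite /K0; lra|apply/andP; split; lra].
  by apply: good_mono (HKd al be ha _); [rewrite /K0; lra|apply/andP; split; lra].
have K00 : 0 <= K0 by rewrite !addr_ge0.
have [N1 [K1 [K10 HK1]]] := near_train_good (ltW (addr_gt0 (addr_gt0 l0 s0) s0)) K00.
have lpsi := sol_L2 spsi.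
set n4 : R := #|{: bool * bool}|%:R; have n40 : 0 <= n4 by [].
(* [A] and [e1] are calibrated so that, after multiplication by K1, the far part and the core part
   of D psi each contribute at most N psi / 4. *)
pose A := K1 * n4 + 1; have A0 : 0 < A by rewrite ltr_wpDl// mulr_ge0.
pose e1 := N psi / (4 * (2 * p + 1) * A).
have pp : 0 < 2 * p + 1 by rewrite ltr_wpDl// mulr_ge0.
have e10 : 0 < e1 by rewrite divr_gt0// !mulr_gt0.
have [rr rr0 tl] := N_tail lpsi e10.
have e20 : 0 < (4 * A)^-1 by rewrite invr_gt0 mulr_gt0.
have [N2 Hcore] := near_first_pulse rr0 e20; have [N3 HJ] := near_train_jac.
exists (maxn (maxn N1 N2) N3) => n; rewrite !geq_max => /andP[/andP[n1 n2] n3] Hn.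
have bn := HJ n n3.
have bt : bounded p (jacw (tu 1 n)) := tu_jac_bounded T m mg gG mv hz vB zB 1 n B2.
(* This bound on the full square may depend on n; it serves only as the interior constant of
   [interior_bound]. *)
have [Kn Kn0 HKn] : exists2 K : R, 0 <= K & forall al be, l - s <= al <= l + s -> - s <= be <= s ->
    lgood (jacw (y n)) al be K.
  apply: (lgood_uniform mf c00 fc0 p0 bn) => al be /andP[h1 _] _; apply: Hn.
  by apply: lt_le_trans h1; rewrite ls.
set psin : vf4 := fun i x => psi i (x - 1%:R * n%:R * T).
have lpn : L2f psin by move=> i; exact: (L2_shift _ (lpsi i)).
pose D (i j : bool * bool) x := lpot (jacw (y n)) l 0 i j x - lpot (jacw (tu 1 n)) l 0 i j x.
(* The indicator of the complement of the core of the first pulse; it splits D psi into a part with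
   small psi and a part with small D. *)
pose ch (x : R) : R := (rr <= `|x - 1%:R * n%:R * T|)%R%:R.
have DE i j x : D i j x = if i.2 == j.2 then jacw (y n) i.1 j.1 x - jacw (tu 1 n) i.1 j.1 x else 0.
  by rewrite /D /lpot; case: ifP => _; [ring|rewrite subrr].
have Dmf i j : measurable_fun [set: R] (D i j).
  rewrite (_ : D i j = fun x => if i.2 == j.2 then jacw (y n) i.1 j.1 x - jacw (tu 1 n) i.1 j.1 x else 0).
    case: (i.2 == j.2); last exact: measurable_cst.
    by have [m1 _] := bn i.1 j.1; have [m2 _] := bt i.1 j.1; exact: measurable_funB.
  by apply/funext => x; exact: DE.
have chmf : measurable_fun [set: R] ch.
  by apply: (measurableT_comp (mfun_ball rr)); exact: measurable_funB.
have bD : bounded (2 * p) D.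
  move=> i j; split; first exact: Dmf.
  have [_ h1] := bn i.1 j.1; have [_ h2] := bt i.1 j.1.
  apply: aeS2 h1 h2 => x q1 q2; rewrite DE; case: ifP => _; last by rewrite normr0 mulr_ge0.
  by apply: (le_trans (ler_normB _ _)); lra.
have bC : bounded (4 * A)^-1 (fun i j x => (1 - ch x) * D i j x).
  move=> i j; split; first by apply: measurable_funM => //; exact: measurable_funB.
  apply: aeS (Hcore n n2) => x hx; rewrite /ch.
  have [h|h] := leP rr `|x - 1%:R * n%:R * T|; first by rewrite subrr mul0r normr0 ltW.
  by rewrite subr0 mul1r DE; case: ifP => _; [exact: hx|rewrite normr0 ltW].
have E i x : pot D psin i x = pot D (fun i x => ch x * psin i x) i x +
    pot (fun i j x => (1 - ch x) * D i j x) psin i x.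
  by rewrite /pot -big_split/=; apply: eq_bigr => j _; ring.
have Etail i : (fun x => ch x * psin i x) = (fun x => tail rr (psi i) (x - 1%:R * n%:R * T)).
  by apply/funext => x; rewrite /tail mulrC.
have lt : L2f (fun i x => ch x * psin i x).
  by move=> i; rewrite Etail; apply: L2_shift; exact: L2_tail.
have Nt : N (fun i x => ch x * psin i x) <= e1.
  apply: le_trans tl; apply: ler_sum => i _; rewrite Etail.
  by rewrite (nu_shift (- (1%:R * n%:R * T)) (L2_tail rr (lpsi i))).
have Npn : N psin = N psi by apply: eq_bigr => i _; exact: (nu_shift _ (lpsi i)).
have [l1 b1] := pot_bound (mulr_ge0 (ler0n _ 2) p0) bD lt; rewrite -/n4 in b1.
have [l2 b2] := pot_bound (ltW e20) bC lpn; rewrite -/n4 Npn in b2.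
have lh : L2f (pot D psin).
  move=> i; rewrite (_ : pot D psin i = fun x => pot D (fun i x => ch x * psin i x) i x +
    pot (fun i j x => (1 - ch x) * D i j x) psin i x); first exact: L2D.
  by apply/funext => x; exact: E.
have sn : sol (jacw (y n)) l 0 psin (pot D psin).
  have [q1 [q2 [hq eq]]] := sol_tu n spsi; exists q1, q2; split => // i.
  apply: aeS (eq i) => x; rewrite /op -/psin => h0.
  have -> : pot D psin i x = pot (lpot (jacw (y n)) l 0) psin i x - pot (lpot (jacw (tu 1 n)) l 0) psin i x.
    by rewrite /pot -sumrB; apply: eq_bigr => j _; rewrite /D; ring.
  by lra.
have ab al be : `|al - l| <= s -> `|be| <= s -> (l - s <= al <= l + s) /\ (- s <= be <= s).
  by move=> h1 h2; split; [move: h1; rewrite ler_distl|rewrite -ler_norml].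
have := interior_bound mf c00 fc0 p0 bn s0 Kn0 K10 _ _ lh sn.
rewrite Npn => ib; have {ib} : N psi <= K1 * N (pot D psin).
  apply: ib => [al be h1 h2|al be h1 h2 h3].
    by have [h3 h4] := ab _ _ h1 h2; exact: HKn.
  apply: HK1 => //; last exact: bd.
  have h4 := ler_normD (al - l) l; rewrite subrK (ger0_norm (ltW l0)) in h4.
  by lra.
apply/negP; rewrite -ltNge.
have NE : N (pot D psin) <= n4 * (2 * p) * e1 + n4 * (4 * A)^-1 * N psi.
  have -> : N (pot D psin) = N (fun i x => pot D (fun i x => ch x * psin i x) i x +
      pot (fun i j x => (1 - ch x) * D i j x) psin i x).
    by congr N; apply/funext => i; apply/funext => x; exact: E.
  apply: (le_trans (ND l1 l2)); apply: lerD => //; apply: (le_trans b1).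
  by rewrite ler_wpM2l// !mulr_ge0.
apply: (le_lt_trans (ler_wpM2l K10 NE)).
have KA : K1 * n4 / A <= 1 by rewrite ler_pdivrMr// mul1r lerDl.
have KA0 : 0 <= K1 * n4 / A by rewrite divr_ge0 ?mulr_ge0// ltW.
have P1 : 2 * p / (2 * p + 1) <= 1 by rewrite ler_pdivrMr// mul1r lerDl.
have P10 : 0 <= 2 * p / (2 * p + 1) by rewrite divr_ge0 ?mulr_ge0// ltW.
have -> : K1 * (n4 * (2 * p) * e1 + n4 * (4 * A)^-1 * N psi) =
    (K1 * n4 / A) * ((2 * p / (2 * p + 1)) * N psi + N psi) / 4.
  by rewrite /e1; field; rewrite !gt_eqF.
have N0' := ltW Npsi.
have Q1 : (2 * p / (2 * p + 1)) * N psi <= N psi by rewrite ler_piMl.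
have Q0 : 0 <= (2 * p / (2 * p + 1)) * N psi by rewrite mulr_ge0.
have : (K1 * n4 / A) * ((2 * p / (2 * p + 1)) * N psi + N psi) <= (2 * p / (2 * p + 1)) * N psi + N psi.
  by rewrite ler_piMl// addr_ge0.
by lra.
Qed.

End SpectralTransfer.

(** * Cutoffs *)

Section Cutoffs.
Context {R : realType}.
Local Notation mu := (@lebesgue_measure R).
Implicit Types (h F : R -> R) (T K r s e : R).

Lemma derive_zero_ball h s r : (forall x, `|x - s| < r -> h x = 0) ->
  forall x, `|x - s| < r -> derive1 h x = 0.
Proof.
move=> H x xr; apply: derive1_val.
apply: (@is_derive_near _ (fun=> 0)).
have e0 : 0 < r - `|x - s| by rewrite subr_gt0.
near=> y; apply/esym/H.
have h1 : `|y - x| < r - `|x - s|.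
  by rewrite distrC; near: y; apply: (@nbhsx_ballx _ _ x _ e0).
have := ler_normD (y - x) (x - s); rewrite addrA subrK; lra.
Unshelve. all: by end_near. Qed.

Lemma derive_compl h x : smooth h -> derive1 (fun x => 1 - h x) x = - derive1 h x.
Proof.
move=> sh; apply: derive1_val.
have dB := is_deriveB (is_derive_cst (1 : R) x 1) (smooth_is_derive x sh).
by apply: (is_derive_eq dB); rewrite sub0r.
Qed.

Definition C2_cutoff K s r h := [/\ smooth h,
  forall x, [/\ `|h x| <= K, `|derive1 h x| <= K & `|derive1 (derive1 h) x| <= K] &
  forall x, `|x - s| < r -> h x = 0].

(** Near jnT, at distance less than nT/2 - 1, all other members of the partition vanish, so chi_j =
    1 there. For indices out of range, and for M = 1, the complement is set to 0, so that the bounds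
    hold for all n and j. *)
Lemma cutoff_complement T (M : nat) chi : 0 < T -> (0 < M)%N -> cutoff_family T M chi ->
  exists (n0 : nat) (K : R) (h : nat -> nat -> R -> R), [/\ 0 <= K,
    forall n j, C2_cutoff K (j%:R * n%:R * T) (n%:R * T / 2 - 1) (h n j),
    forall n j x, (n0 <= n)%N -> (1 <= j <= M)%N -> chi j n x = 1 - h n j x &
    forall n x, (n0 <= n)%N -> \sum_(1 <= j < M.+1) chi j n x = 1].
Proof.
move=> T0 M0 [chi1 chi2].
have zero (K s r : R) : 0 <= K -> C2_cutoff K s r (fun=> 0).
  move=> K0; have e1 : derive1 (fun=> 0 : R) = fun=> 0 :> R.
    by apply/funext => x; apply: derive1_val; exact: is_derive_cst.
  split=> [|x|//]; first exact: smooth_cst.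
  by rewrite !e1 normr0.
have [ME|M1] := eqVneq M 1%N.
  exists 0%N, 0, (fun _ _ _ => 0); split => //.
  - by move=> n j; exact: zero.
  - by move=> n j x _; rewrite ME andbC -eqn_leq => /eqP ->; rewrite subr0 chi1.
  - by move=> n x _; rewrite ME big_nat1 chi1.
have M2 : (2 <= M)%N by case: M M0 M1 {chi1 chi2} => [//|[]].
have [n0 [K chiK]] := chi2 M2.
pose ok n j := (n0 <= n)%N && (1 <= j <= M)%N.
pose h n j (x : R) : R := if ok n j then 1 - chi j n x else 0.
exists n0, (1 + `|K|), h; split.
- exact: addr_ge0.
- move=> n j; have [okj|nok] := boolP (ok n j); last first.
    rewrite (_ : h n j = fun=> 0); first by apply: zero; exact: addr_ge0.
    by apply/funext => x; rewrite /h (negbTE nok).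
  have -> : h n j = (fun x => 1 - chi j n x) by apply/funext => x; rewrite /h okj.
  have /andP[nn jM] := okj.
  have [sum1 /(_ j jM) [sc c01 cK _ _]] := chiK n nn.
  have KK := ler_norm K.
  have e1 : derive1 (fun x => 1 - chi j n x) = fun x => - derive1 (chi j n) x.
    by apply/funext => x; exact: derive_compl.
  have e2 x : derive1 (derive1 (fun x => 1 - chi j n x)) x = - derive1 (derive1 (chi j n)) x.
    rewrite e1; apply: derive1_val; apply: is_deriveN.
    by apply: smooth_is_derive; exact: smooth_derive.
  split=> [|x|x xs].
  + by apply: smoothB; [exact: smooth_cst|exact: sc].
  + rewrite e2 e1 !normrN; have [_ k1 k2] := cK x.
    have {}k2 : `|derive1 (derive1 (chi j n)) x| <= K by exact: k2.
    have /andP[q0 q1] := c01 x; split; [|lra|lra].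
    rewrite ger0_norm ?subr_ge0//.
    by have := normr_ge0 K; lra.
  + have <- := sum1 x; have /andP[j1 jM'] := jM.
    have jin : j \in index_iota 1 M.+1 by rewrite mem_index_iota j1 ltnS.
    rewrite (bigD1_seq j jin (iota_uniq _ _))/= addrAC subrr add0r.
    rewrite big_seq_cond big1// => i /andP[]; rewrite mem_index_iota ltnS => iM ij.
    have [_ /(_ i iM) [_ _ _ rgt lft]] := chiK n nn.
    have nT0 : 0 <= n%:R * T by rewrite mulr_ge0// ltW.
    move: xs; rewrite -mulrA ltr_norml => /andP[x1 x2].
    move: ij; rewrite neq_ltn => /orP[ij|ij].
      apply: rgt; first exact: leq_trans ij jM'.
      have : i.+1%:R * (n%:R * T) <= j%:R * (n%:R * T) by rewrite ler_wpM2r// ler_nat.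
      rewrite -natr1 -mulrA => h1.
      have -> : (i%:R + 1 / 2) * (n%:R * T) = (i%:R + 1) * (n%:R * T) - n%:R * T / 2 by field.
      by lra.
    apply: lft; first exact: leq_trans ij.
    have : j.+1%:R * (n%:R * T) <= i%:R * (n%:R * T) by rewrite ler_wpM2r// ler_nat.
    rewrite -natr1 -mulrA => h1.
    have -> : (i%:R - 1 / 2) * (n%:R * T) = i%:R * (n%:R * T) - n%:R * T / 2 by field.
    have e : (j%:R + 1) * (n%:R * T) = j%:R * (n%:R * T) + n%:R * T by ring.
    by lra.
- by move=> n j x nn jM; rewrite /h /ok nn jM subKr.
- by move=> n x nn; have [] := chiK n nn.
Qed.

Lemma cut_tail K s r h F : 0 <= K -> measurable_fun [set: R] h ->
  (forall x, `|h x| <= K) -> (forall x, `|x - s| < r -> h x = 0) -> L2 F ->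
  L2 (fun x => h x * F (x - s)) /\ nu (fun x => h x * F (x - s)) <= K * nu (tail r F).
Proof.
move=> K0 mh hK h0 lF; have ls := L2_shift (- s) lF.
have lh := L2_mulbd mh (ae_all hK) ls; split => //.
have lt := L2_tail r lF; have lts := L2_shift (- s) lt.
rewrite -(nu_shift (- s) lt) -[K]ger0_norm// -nuZ//.
rewrite -(nu_norm (fun x => K * _)); apply: nu_le; [exact: L2_mfun|exact/L2_norm/L2Z|].
apply: ae_all => x; rewrite /tail !normrM (ger0_norm K0).
have [hx|hx] := leP r `|x - s|; last by rewrite h0// normr0 mul0r !mulr_ge0.
by rewrite normr1 mulr1 ler_wpM2r.
Qed.

Definition small e F F1 F2 := [/\ nu F <= e, nu F1 <= e & nu F2 <= e].

(** All derivatives of h vanish on the ball as well, so only tails of F contribute; 4 = 1 + 2 + 1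
    counts the Leibniz terms of second order. *)
Lemma cut_H2 K s r h F F1 F2 e : 0 <= K -> C2_cutoff K s r h -> H2d F F1 F2 ->
  small e (tail r F) (tail r F1) (tail r F2) ->
  let y x := h x * F (x - s) in
  let y1 x := derive1 h x * F (x - s) + h x * F1 (x - s) in
  let y2 x := derive1 (derive1 h) x * F (x - s) + 2 * (derive1 h x * F1 (x - s)) + h x * F2 (x - s) in
  H2d y y1 y2 /\ small (4 * K * e) y y1 y2.
Proof.
move=> K0 [sh hK h0] hF [t0 t1 t2] y y1 y2.
have bnd : 0 <= K * e -> [/\ K * e <= 4 * K * e, K * e + K * e <= 4 * K * e &
    K * e + 2 * (K * e) + K * e <= 4 * K * e] by move=> Ke; split; lra.
split; first exact: (H2d_smoothM sh hK (H2d_shift (- s) hF)).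
have [lF lF1 lF2 _ _] := hF.
have h01 := derive_zero_ball h0; have h02 := derive_zero_ball h01.
have mh := smooth_mfun sh; have sh1 := smooth_derive sh; have mh1 := smooth_mfun sh1.
have mh2 := smooth_mfun (smooth_derive sh1).
have k0 x : `|h x| <= K by have [] := hK x.
have k1 x : `|derive1 h x| <= K by have [] := hK x.
have k2 x : `|derive1 (derive1 h) x| <= K by have [] := hK x.
have [a1 b1] := cut_tail K0 mh k0 h0 lF; have [a2 b2] := cut_tail K0 mh1 k1 h01 lF.
have [a3 b3] := cut_tail K0 mh k0 h0 lF1; have [a4 b4] := cut_tail K0 mh2 k2 h02 lF.
have [a5 b5] := cut_tail K0 mh1 k1 h01 lF1; have [a6 b6] := cut_tail K0 mh k0 h0 lF2.
have up (G : R -> R) q : nu (tail r G) <= e -> q <= K * nu (tail r G) -> q <= K * e.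
  by move=> h1 h2; apply: (le_trans h2); rewrite ler_wpM2l.
have {}b1 := up _ _ t0 b1; have {}b2 := up _ _ t0 b2; have {}b3 := up _ _ t1 b3.
have {}b4 := up _ _ t0 b4; have {}b5 := up _ _ t1 b5; have {}b6 := up _ _ t2 b6.
have [s1 s2 s3] := bnd (le_trans (nu_ge0 _) b1).
have b5' : nu (fun x => 2 * (derive1 h x * F1 (x - s))) <= 2 * (K * e).
  by rewrite (nuZ 2 a5) ger0_norm// ler_wpM2l.
split.
- exact: le_trans b1 s1.
- exact: le_trans (nuD a2 a3) (le_trans (lerD b2 b3) s2).
- apply: (le_trans (nuD (L2D a4 (L2Z 2 a5)) a6)); apply: le_trans s3.
  exact: lerD (le_trans (nuD a4 (L2Z 2 a5)) (lerD b4 b5')) b6.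
Qed.

Lemma smallD e e' F F1 F2 h h1 h2 : H2d F F1 F2 -> H2d h h1 h2 -> small e F F1 F2 -> small e' h h1 h2 ->
  small (e + e') (fun x => F x + h x) (fun x => F1 x + h1 x) (fun x => F2 x + h2 x).
Proof.
move=> [a0 a1 a2 _ _] [b0 b1 b2 _ _] [u0 u1 u2] [w0 w1 w2]; split.
- exact: le_trans (nuD a0 b0) (lerD u0 w0).
- exact: le_trans (nuD a1 b1) (lerD u1 w1).
- exact: le_trans (nuD a2 b2) (lerD u2 w2).
Qed.

Lemma H2d_sum (k : nat) (F F1 F2 : nat -> R -> R) : (forall j, H2d (F j) (F1 j) (F2 j)) ->
  H2d (fun x => \sum_(1 <= j < k.+1) F j x) (fun x => \sum_(1 <= j < k.+1) F1 j x)
      (fun x => \sum_(1 <= j < k.+1) F2 j x) /\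
  forall e, (forall j, small e (F j) (F1 j) (F2 j)) ->
    small (k%:R * e) (fun x => \sum_(1 <= j < k.+1) F j x) (fun x => \sum_(1 <= j < k.+1) F1 j x)
      (fun x => \sum_(1 <= j < k.+1) F2 j x).
Proof.
move=> H; have S (G : nat -> R -> R) l : (fun x => \sum_(1 <= j < l.+2) G j x) =
    (fun x => \sum_(1 <= j < l.+1) G j x + G l.+1 x).
  by apply/funext => x; rewrite big_nat_recr.
have Z (G : nat -> R -> R) : (fun x => \sum_(1 <= j < 1) G j x) = fun=> 0.
  by apply/funext => x; rewrite big_geq.
elim: k => [|k [IH IHe]].
  by rewrite !Z; split=> [|e _]; [exact: H2d0|rewrite /small mul0r nu0].
rewrite !S; split=> [|e He]; first exact: H2dD.
by rewrite -natr1 mulrDl mul1r; apply: smallD => //; exact: IHe.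
Qed.

Lemma small_tail F F1 F2 e : H2d F F1 F2 -> 0 < e -> exists2 r0, 0 < r0 &
  forall r, r0 <= r -> small e (tail r F) (tail r F1) (tail r F2).
Proof.
move=> [l0 l1 l2 _ _] e0; have [r1 r10 H1] := tail_cvg0 l0 e0.
have [r2 r20 H2] := tail_cvg0 l1 e0; have [r3 r30 H3] := tail_cvg0 l2 e0.
exists (r1 + r2 + r3); first by rewrite !addr_gt0.
by move=> r hr; split; [apply: H1|apply: H2|apply: H3]; lra.
Qed.

Lemma sqrt3_le (x y z : R) : 0 <= x -> 0 <= y -> 0 <= z ->
  Num.sqrt (x ^+ 2 + y ^+ 2 + z ^+ 2) <= x + y + z.
Proof.
move=> x0 y0 z0; rewrite -[leRHS]ger0_norm ?addr_ge0// -sqrtr_sqr ler_sqrt ?sqr_ge0//.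
have : 0 <= x * y by exact: mulr_ge0.
have : 0 <= x * z by exact: mulr_ge0.
have : 0 <= y * z by exact: mulr_ge0.
by rewrite !expr2; lra.
Qed.

Lemma enorm2_le (q : R * R) : enorm2 q <= `|q.1| + `|q.2|.
Proof.
have := sqrt3_le (normr_ge0 q.1) (normr_ge0 q.2) (lexx 0).
by rewrite /enorm2 !real_normK ?num_real// expr0n/= !addr0.
Qed.

(** [H2norm] is built from the chosen derivatives, which agree with the explicit ones almost
    everywhere; the factor 3 counts the orders of differentiation. *)
Lemma H2norm_small (b : R -> R * R) F1 F2 h1 h2 e e' : H2d (fst_fun b) F1 F2 -> H2d (snd_fun b) h1 h2 ->
  small e (fst_fun b) F1 F2 -> small e' (snd_fun b) h1 h2 ->
  H2v b /\ exists2 r : R, H2norm b = r%:E & 0 <= r <= 3 * (e + e').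
Proof.
move=> hF hh [s0 s1 s2] [t0 t1 t2].
have e3 : e + e' + (e + e') + (e + e') <= 3 * (e + e') by lra.
have nn (F G : R -> R) : L2 F -> L2 G -> nu (fun x => `|F x| + `|G x|) <= nu F + nu G.
  by move=> lF lG; rewrite -(nu_norm F) -(nu_norm G); apply: nuD; exact: L2_norm.
have [m0 _ _ _ _] := hF; have [m0' _ _ _ _] := hh.
have HF := H2d_H2 hF; have Hh := H2d_H2 hh.
split => //; have [l0 l1 l2 _ _] := H2dP HF; have [k0 k1 k2 _ _] := H2dP Hh.
have [_ _ _ w1 w2] := hF; have [_ _ a1 a2] := wderivE2 w1 w2.
have [_ _ _ w1' w2'] := hh; have [_ _ b1 b2] := wderivE2 w1' w2'.
have {}s1 : nu (wderiv (fst_fun b)) <= e by rewrite (nu_ae l1 _ a1)//; have [_ /L2_mfun] := hF.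
have {}s2 : nu (wderiv (wderiv (fst_fun b))) <= e by rewrite (nu_ae l2 _ a2)//; have [_ _ /L2_mfun] := hF.
have {}t1 : nu (wderiv (snd_fun b)) <= e' by rewrite (nu_ae k1 _ b1)//; have [_ /L2_mfun] := hh.
have {}t2 : nu (wderiv (wderiv (snd_fun b))) <= e' by rewrite (nu_ae k2 _ b2)//; have [_ _ /L2_mfun] := hh.
pose S x := `|fst_fun b x| + `|snd_fun b x| + (`|wderiv (fst_fun b) x| + `|wderiv (snd_fun b) x|) +
  (`|wderiv (wderiv (fst_fun b)) x| + `|wderiv (wderiv (snd_fun b)) x|).
have [L0 L1' L2'] : [/\ L2 (fun x => `|fst_fun b x| + `|snd_fun b x|),
    L2 (fun x => `|wderiv (fst_fun b) x| + `|wderiv (snd_fun b) x|) &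
    L2 (fun x => `|wderiv (wderiv (fst_fun b)) x| + `|wderiv (wderiv (snd_fun b)) x|)].
  by split; apply: L2D; exact: L2_norm.
have lS : L2 S by apply: L2D => //; exact: L2D.
have dE : H2density b = fun x => Num.sqrt (fst_fun b x ^+ 2 + snd_fun b x ^+ 2 +
    (wderiv (fst_fun b) x ^+ 2 + wderiv (snd_fun b) x ^+ 2) +
    (wderiv (wderiv (fst_fun b)) x ^+ 2 + wderiv (wderiv (snd_fun b)) x ^+ 2)).
  by apply/funext => x; rewrite /H2density /enorm2 !sqr_sqrtr ?addr_ge0 ?sqr_ge0.
have mD : measurable_fun [set: R] (H2density b).
  rewrite dE; apply: (measurableT_comp (continuous_measurable_fun (@sqrt_continuous R))).
  by apply: measurable_funD; [apply: measurable_funD; apply: measurable_funD|apply: measurable_funD];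
    apply: measurable_funX; exact: L2_mfun.
have DS : {ae mu, forall x, `|H2density b x| <= S x}.
  apply: ae_all => x; rewrite ger0_norm ?sqrtr_ge0//.
  apply: (le_trans (sqrt3_le _ _ _)); rewrite ?sqrtr_ge0//.
  by apply: lerD; [apply: lerD|]; exact: enorm2_le.
have lD := L2_le mD lS DS.
exists (nu (H2density b)); first exact: (LnormE lD).
rewrite nu_ge0/=; apply: (le_trans (nu_le mD lS DS)).
have n0 := le_trans (nn _ _ m0 m0') (lerD s0 t0).
have n1 := le_trans (nn _ _ l1 k1) (lerD s1 t1); have n2 := le_trans (nn _ _ l2 k2) (lerD s2 t2).
apply: le_trans e3; apply: (le_trans (nuD (L2D L0 L1') L2')).
exact: lerD (le_trans (nuD L0 L1') (lerD n0 n1)) n2.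
Qed.

End Cutoffs.

(** * Existence of multipulses *)

Section MultiPulse.
Context {R : realType}.
Variables (T d a m eps c0 G B0 : R) (f g : R -> R).
Hypotheses (T0 : 0 < T) (d0 : 0 < d).
Hypotheses (mf : measurable_fun [set: R] f) (mg : measurable_fun [set: R] g).
Hypotheses (fT : periodic f T) (gT : periodic g T).
Hypotheses (c00 : 0 <= c0) (fc0 : forall x, `|eps * f x| <= c0).
Hypotheses (gG : forall x, `|eps * g x| <= G).
Local Notation mu := (@lebesgue_measure R).
Local Notation vf := (bool -> R -> R).
Local Notation jacw w := (jac m eps g (pairf w)).
Local Notation lgood := (lgood d eps f).

Variables (v v1 v2 z z1 z2 : vf).
Hypotheses (hv : forall i, H2locd (v i) (v1 i) (v2 i)) (vT : forall i, periodic (v i) T).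
Hypotheses (hz : H2f z z1 z2) (B00 : 0 <= B0).
Hypotheses (vB : forall i, {ae mu, forall x, `|v i x| <= B0}).
Hypotheses (zB : forall i, {ae mu, forall x, `|z i x| <= B0}).

Local Notation tz := (pulse_at T z).
Local Notation train := (pulse_train T v z).
Local Notation train1 := (pulse_train1 T v1 z1).
Local Notation train2 := (pulse_train2 T v2 z2).
Local Notation tu := (one_pulse T v z).
Local Notation res := (res d a m eps f g).

Hypothesis usol : forall i, {ae mu, forall x, res (fun i x => v i x + z i x)
  (fun i x => v1 i x + z1 i x) (fun i x => v2 i x + z2 i x) i x = 0}.

(** The nonlinearity is a cubic polynomial, so its Taylor expansion is exact and [quad] is the whole
    remainder. *)
Lemma res_add (W Wa Wb c ca cb : vf) i x :
  res (fun i x => W i x + c i x) (fun i x => Wa i x + ca i x) (fun i x => Wb i x + cb i x) i x =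
  res W Wa Wb i x + op (kap2 d) (c2 eps f) (jacw W) c ca cb i x + sg i * quad W c x.
Proof.
rewrite /res /lin /op /pot /cubic /quad big_bool /lnc /sg /jac /pairf.
by case: i => /=; ring.
Qed.

Let mv i : measurable_fun [set: R] (v i).
Proof. by have [[]] := hv i. Qed.

Lemma multipulse_exists (k : nat) (K0 : R) : 0 <= K0 -> lgood (jacw (tu 0 0)) 0 0 K0 ->
  exists (N1 : nat) (c ca cb : nat -> vf),
  [/\ forall n, H2f (c n) (ca n) (cb n),
      forall n, (N1 <= n)%N -> forall i, {ae mu, forall x,
        res (fun i x => train k.+1 n i x + c n i x) (fun i x => train1 k.+1 n i x + ca n i x)
            (fun i x => train2 k.+1 n i x + cb n i x) i x = 0} &
      forall e : R, 0 < e -> exists N2, forall n, (N2 <= n)%N ->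
        (forall i, small e (c n i) (ca n i) (cb n i)) /\
        {ae mu, forall x, forall i, `|c n i x| <= e}].
Proof.
move=> K00 G0.
have [Na [K [Kge0 HK]]] := train_good m T0 d0 mf mg fT gT c00 fc0 gG mv vT hz B00 vB zB k (lexx 0) K00.
have BB : 0 <= k.+2%:R * B0 by rewrite mulr_ge0.
have [thr [E [thr0 E0 newt]]] := newton m d0 mf mg c00 fc0 gG BB Kge0.
have small_rho := rho_small T0 hv hz B00 vB zB k.+1.
have [Nb Hb] := small_rho thr thr0.
pose N1 := maxn Na Nb.
have ex n : exists t : vf * vf * vf, H2f t.1.1 t.1.2 t.2 /\ ((N1 <= n)%N ->
    [/\ aeq (op (kap2 d) (c2 eps f) (jacw (train k.+1 n)) t.1.1 t.1.2 t.2)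
          (fun i x => - (sg i * (quad (train k.+1 n) t.1.1 x + rho T v z k.+1 n x))),
      [/\ N t.1.1 <= E * nu (rho T v z k.+1 n), N t.1.2 <= E * nu (rho T v z k.+1 n) &
          N t.2 <= E * nu (rho T v z k.+1 n)] &
      forall i, {ae mu, forall x, `|t.1.1 i x| <= E * nu (rho T v z k.+1 n)}]).
  have [nn|nn] := boolP (N1 <= n)%N; last first.
    (* Below the threshold the correction defaults to 0, so that the sequence is defined and lies in
       H^2 for every n. *)
    exists ((fun _ _ => 0, fun _ _ => 0), fun _ _ => 0); split => //.
    by move=> i; exact: H2d0.
  move: nn; rewrite geq_max => /andP[na nb].
  have [lr rt] := Hb n nb.
  have gn : good (kap2 d) (c2 eps f) (jacw (train k.+1 n)) K.
    by apply: good_real; apply: (HK n 0 0 na _ G0); rewrite normr0 addr0.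
  have [||c [ca [cb [hc ec bc sc]]]] := newt (train k.+1 n) _ _ _ gn lr rt.
  - by move=> i; exact: (train_mfun T mv hz).
  - by move=> i; apply: aeS (train_bound T vB zB) => x; exact.
  - by exists ((c, ca), cb).
have [F HF] := choice ex.
exists N1, (fun n => (F n).1.1), (fun n => (F n).1.2), (fun n => (F n).2); split.
- by move=> n; have [] := HF n.
- move=> n nn i; have [_ /(_ nn) [ec _ _]] := HF n.
  have rt := res_train T0 mf mg fT gT c00 fc0 gG hv vT hz vB zB usol k.+1 n i.
  apply: aeS2 rt (ec i) => x h1 h2; rewrite res_add h1 h2; ring.
- move=> e e0; have e1 : 0 < e / (E + 1) by rewrite divr_gt0// ltr_wpDl.
  have [Nc Hc] := small_rho _ e1; exists (maxn N1 Nc) => n; rewrite geq_max => /andP[nn nc].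
  have [_ /(_ nn) [_ [n0 n1 n2] sc]] := HF n; have [_ rs] := Hc n nc.
  have Ee : E * nu (rho T v z k.+1 n) <= e.
    apply: (@le_trans _ _ (E * (e / (E + 1)))); first by rewrite ler_wpM2l.
    by rewrite mulrA ler_pdivrMr ?ltr_wpDl// mulrC ler_wpM2l ?(ltW e0)// lerDl.
  split=> [i|].
    by split; apply: le_trans Ee; [apply: le_trans n0|apply: le_trans n1|apply: le_trans n2]; exact: nu_leN.
  by apply: aeS2 (sc true) (sc false) => x h1 h2 [|]; exact: le_trans Ee.
Qed.

End MultiPulse.

(** * The corollary *)

Section Components.
Context {R : realType}.
Local Notation mu := (@lebesgue_measure R).

Definition cmp (u : R -> R * R) (i : bool) : R -> R := if i then snd_fun u else fst_fun u.

Lemma pairf_cmp u : pairf (cmp u) = u.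
Proof. by apply/funext => x; rewrite /pairf /cmp /fst_fun /snd_fun -surjective_pairing. Qed.

Lemma C1_continuous (h : R -> R) : C1 h -> continuous h.
Proof.
by move=> [dh _] x; apply: differentiable_continuous; apply/derivable1_diffP; exact: dh.
Qed.

Lemma C1_periodic_bounded T c (h : R -> R) : 0 < T -> C1 h -> periodic h T ->
  measurable_fun [set: R] h /\ exists2 B : R, 0 <= B & forall x, `|c * h x| <= B.
Proof.
move=> T0 /C1_continuous ch hT; split; first exact: continuous_measurable_fun.
have [B B0 hB] := continuous_periodic_bounded T0 ch hT.
exists (`|c| * B); first exact: mulr_ge0.
by move=> x; rewrite normrM ler_wpM2l.
Qed.

(** [solution] refers to the chosen weak derivatives; by uniqueness any explicit ones may take their
    place. *)
Lemma solutionP (d a m eps : R) (f g : R -> R) (u : R -> R * R) ua ub :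
  (forall i, H2locd (cmp u i) (ua i) (ub i)) ->
  solution d a m f g eps u <->
  forall i, {ae mu, forall x, res d a m eps f g (cmp u) ua ub i x = 0}.
Proof.
move=> hu; have [_ _ _ w1 w2] := hu false; have [_ _ _ w1' w2'] := hu true.
have [_ _ e1 e2] := wderivE2 w1 w2; have [_ _ e1' e2'] := wderivE2 w1' w2'.
have E x : wderiv (cmp u false) x = ua false x -> wderiv (wderiv (cmp u false)) x = ub false x ->
    wderiv (wderiv (cmp u true)) x = ub true x -> ua true x = ua true x ->
    A_op d f eps u x + N_op a m g eps u x = (res d a m eps f g (cmp u) ua ub false x,
      res d a m eps f g (cmp u) ua ub true x).
  move=> h1 h2 h3 _; rewrite /A_op /N_op; move: h1 h2 h3; rewrite /cmp => -> -> ->.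
  rewrite /N1 /N2 /res /lin /kap2 /c2 /lnc /sg /cubic /fst_fun /snd_fun.
  by apply/pair_equal_spec; split; rewrite /=; ring.
split=> [[_ su] i|H].
  have H : {ae mu, forall x, A_op d f eps u x + N_op a m g eps u x = 0} by exact: su.
  have e12 : {ae mu, forall x, wderiv (cmp u false) x = ua false x /\
      wderiv (wderiv (cmp u false)) x = ub false x}.
    by apply: aeS2 e1 e2 => x.
  apply: aeS3 e12 e2' H => x [h1 h2] h3; rewrite E// => -[h4 h5].
  by case: i.
split; first by split; [exact: H2locd_H2loc (hu false)|exact: H2locd_H2loc (hu true)].
have e12 : {ae mu, forall x, wderiv (cmp u false) x = ua false x /\
    wderiv (wderiv (cmp u false)) x = ub false x}.
  by apply: aeS2 e1 e2 => x.
have H2' : {ae mu, forall x, res d a m eps f g (cmp u) ua ub false x = 0 /\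
    res d a m eps f g (cmp u) ua ub true x = 0}.
  by apply: aeS2 (H false) (H true) => x.
by apply: aeS3 e12 e2' H2' => x [h1 h2] h3 [h4 h5]; rewrite E// h4 h5.
Qed.

Lemma H2norm_cvg0 (b : nat -> R -> R * R) : (forall e : R, 0 < e -> exists N0, forall n, (N0 <= n)%N ->
    exists2 r : R, H2norm (b n) = r%:E & 0 <= r <= e) ->
  H2norm (b n) @[n --> \oo] --> (0%R)%:E.
Proof.
move=> H; apply: cvg_EFin.
  by have [N0 H0] := H 1 ltr01; exists N0 => // n /= /H0[r -> _].
apply/cvgrPdist_le => e /H[N0 H0]; exists N0 => // n /= /H0[r].
by rewrite /comp => -> /andP[r0 re]; rewrite /= sub0r normrN ger0_norm.
Qed.

End Components.

Theorem corollary8p8 (R : realType) (T d a m : R) (f g : R -> R)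
  (M : nat) (chi : nat -> nat -> R -> R) (eps : R) (u : R -> R * R)
  (T_gt0 : 0 < T) (d_gt0 : 0 < d) (a_gt0 : 0 < a) (m_gt0 : 0 < m)
  (f_C1 : C1 f) (f_per : periodic f T) (f_odd : forall x, f (- x) = - f x)
  (g_C1 : C1 g) (g_per : periodic g T) (g_even : forall x, g (- x) = g x)
  (M_gt0 : (0 < M)%N) (chiP : cutoff_family T M chi)
  (eps_neq0 : eps != 0) (u_pulse : primary_pulse T d a m f g eps u) :
  exists (N : nat) (b : nat -> R -> R * R),
    (forall n, (N <= n)%N -> H2v (b n)) /\
    H2norm (b n) @[n --> \oo] --> (0%R)%:E /\
    forall n, (N <= n)%N ->
      let ut : R -> R * R := fun x =>
        b n x + \sum_(1 <= j < M.+1) chi j n x *: u (x - j%:R * n%:R * T) in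
      [/\ solution d a m f g eps ut,
          nondegenerate d a m f g eps ut,
          strongly_stable d a m f g eps u ->
            strongly_stable d a m f g eps ut &
          unstable d a m f g eps u -> unstable d a m f g eps ut].
Proof.
have [u0 [z0 [v0 [Psi [C [eps0 [eta [U [Z [V [lam0 [_ fam heps uU]]]]]]]]]]]] := u_pulse.
have [[_ _ eta0] [/(_ eps heps)[[hZ [VT hV] uZV] [usolv _ unond] _ uspec usimple] _]] := fam.
rewrite -uU in uZV usolv unond uspec usimple.
have [mf [c0 c00 fc0]] := C1_periodic_bounded eps T_gt0 f_C1 f_per.
have [mg [G _ gG]] := C1_periodic_bounded eps T_gt0 g_C1 g_per.
pose z := cmp (Z eps); pose v := cmp (V eps).
pose z1 i := wderiv (z i); pose z2 i := wderiv (wderiv (z i)).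
pose v1 i := wderiv (v i); pose v2 i := wderiv (wderiv (v i)).
have hz : H2f z z1 z2 by case; [exact: (H2dP hZ.2)|exact: (H2dP hZ.1)].
have hv i : H2locd (v i) (v1 i) (v2 i).
  by case: i; [exact: (H2locdP hV.2)|exact: (H2locdP hV.1)].
have vT i : periodic (v i) T.
  by move=> x; rewrite /v /cmp /fst_fun /snd_fun; case: i; rewrite VT.
have [B0 [B00 vB zB]] : exists B0 : R, [/\ 0 <= B0,
    forall i, {ae lebesgue_measure, forall x : R, `|v i x| <= B0} &
    forall i, {ae lebesgue_measure, forall x : R, `|z i x| <= B0}].
  have bv i : exists2 B : R, 0 <= B & {ae lebesgue_measure, forall x : R, `|v i x| <= B}.
    by have [_ _ _ w _] := hv i; exact: periodic_ae_bounded T_gt0 w (vT i).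
  have bz i : exists2 B : R, 0 <= B & {ae lebesgue_measure, forall x : R, `|z i x| <= B}.
    have [l l1 _ w _] := hz i; exists (2 * (nu (z i) + nu (z1 i))); last exact: sup_ae w l l1.
    by rewrite mulr_ge0// addr_ge0// nu_ge0.
  have [B1 B10 H1] := bv true; have [B2 B20 H2] := bv false.
  have [B3 B30 H3] := bz true; have [B4 B40 H4] := bz false.
  exists (B1 + B2 + B3 + B4); split; first by rewrite !addr_ge0.
    by case; [apply: aeS H1|apply: aeS H2] => x h; apply: (le_trans h); lra.
  by case; [apply: aeS H3|apply: aeS H4] => x h; apply: (le_trans h); lra.
have uE : cmp u = fun i x => v i x + z i x.
  apply/funext => i; apply/funext => x; rewrite /v /z /cmp addrC.
  by case: i; rewrite /fst_fun /snd_fun uZV.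
have hu i : H2locd (cmp u i) (fun x => v1 i x + z1 i x) (fun x => v2 i x + z2 i x).
  by rewrite uE; apply: H2locdD; [exact: hv|exact: H2d_loc (hz i)].
have usol := (solutionP d a m eps f g (ua := fun i x => v1 i x + z1 i x) (ub := fun i x => v2 i x + z2 i x) hu).1 usolv.
rewrite uE in usol.
have mv i : measurable_fun [set: R] (v i) by have [[]] := hv i.
pose J0 := jac m eps g (pairf (one_pulse T v z 0 0)).
have tuE : pairf (one_pulse T v z 0 0) = u.
  rewrite -[RHS]pairf_cmp uE; congr pairf; apply/funext => i; apply/funext => x.
  by rewrite /one_pulse /pulse_at !mul0r subr0.
have bJ0 := tu_jac_bounded T m mg gG mv hz vB zB 0 0 (lexx _).
have resu al be : resolvent_set (L_op d a m f g eps u) (al +i* be)%C <->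
    exists2 K : R, 0 <= K & lgood d eps f J0 al be K.
  rewrite -tuE; exact: (resolventP d a mf c00 fc0 al be (jac_bd_ge0 m gG _) bJ0).
have [K0 K00 G0] := (resu 0 0).1 unond.
case: M M_gt0 chiP => [//|k] M_gt0 chiP.
have [N1 [c [ca [cb [hc csol csmall]]]]] := multipulse_exists T_gt0 d_gt0 mf mg f_per g_per c00 fc0 gG
  hv vT hz B00 vB zB usol k K00 G0.
have [n0 [Kc [h [Kc0 hh chih chi1]]]] := cutoff_complement T_gt0 M_gt0 chiP.
pose y n : bool -> R -> R := fun i x => pulse_train T v z k.+1 n i x + c n i x.
have mc n i : measurable_fun [set: R] (c n i) by have [l _ _ _ _] := hc n i; exact: L2_mfun.
have ymf n i : measurable_fun [set: R] (y n i).
  by apply: measurable_funD => //; exact: train_mfun hz _ _ _.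
have yclose (e : R) : 0 < e -> exists N0, forall n, (N0 <= n)%N ->
    {ae lebesgue_measure, forall x : R, forall i, `|y n i x - pulse_train T v z k.+1 n i x| <= e}.
  move=> /csmall[N2 H2]; exists N2 => n /H2[_]; apply: aeS => x H i.
  by rewrite /y addrC addKr.
have [N2 HJ] := near_train_jac m mg gG vB zB ymf yclose.
have resy n al be : (N2 <= n)%N -> resolvent_set (L_op d a m f g eps (pairf (y n))) (al +i* be)%C <->
    exists2 K : R, 0 <= K & lgood d eps f (jac m eps g (pairf (y n))) al be K.
  by move=> nn; exact: (resolventP d a mf c00 fc0 al be (jac_bd_ge0 m gG _) (HJ n nn)).
have [N3 [K3 [K30 H3]]] := near_train_good m T_gt0 d_gt0 mf mg f_per g_per c00 fc0 gG mv vT hz B00 vB zB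
  ymf yclose (lexx 0) K00.
have [N4 H4] : exists N4, forall n, (N4 <= n)%N -> (N2 <= n)%N -> strongly_stable d a m f g eps u ->
    strongly_stable d a m f g eps (pairf (y n)).
  (* The threshold has to be fixed before stability of [u] is assumed, hence the classical case
     distinction; in the other case any index will do. *)
  have [[rho rho0 Hrho]|nst] := pselect (strongly_stable d a m f g eps u); last first.
    by exists 0%N => n _ _ st; case: (nst st).
  have Hs al be : - rho < al -> exists2 K : R, 0 <= K & lgood d eps f J0 al be K.
    move=> ar; apply/resu; apply: contrapT => /Hrho /=; lra.
  have [N4 H4] := near_train_stable T_gt0 d_gt0 mf mg f_per g_per c00 fc0 gG mv vT hz B00 vB zB
    ymf yclose rho0 Hs.
  exists N4 => n n4 n2 _; exists (rho / 2); first by rewrite divr_gt0.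
  move=> [al be] /= Hl; rewrite leNgt; apply/negP => ar; apply: Hl.
  by apply/(resy n al be n2); exact: H4 n n4 al be (ltW ar).
have [N5 H5] : exists N5, forall n, (N5 <= n)%N -> (N2 <= n)%N -> unstable d a m f g eps u ->
    unstable d a m f g eps (pairf (y n)).
  have [[lam slam lam_gt0]|nst] := pselect (unstable d a m f g eps u); last first.
    by exists 0%N => n _ _ st; case: (nst st).
  (* A positive real part excludes the half-plane Re <= -eta, so lam is the critical eigenvalue,
     which is real. *)
  have lamE : lam = (lam0 eps)%:C%C by case: (uspec lam slam) => [h1|//]; exfalso; lra.
  pose l := lam0 eps; have l0 : 0 < l by rewrite lamE in lam_gt0.
  have Hs al be : 0 < al -> ~ (al = l /\ be = 0) -> exists2 K : R, 0 <= K & lgood d eps f J0 al be K.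
    move=> a0 ne; apply/resu; apply: contrapT => /uspec[/=|[e1 e2]]; first by lra.
    by apply: ne.
  have [psi [hpsi npsi epsi _]] := usimple.
  have spsi : sol d eps f J0 l 0 (tovf psi) (fun _ _ => 0).
    exists (fun i => wderiv (tovf psi i)), (fun i => wderiv (wderiv (tovf psi i))).
    split; first exact: H2cP.
    move=> i; apply: aeS epsi => x e; rewrite /J0 tuE -(shift_opE d a m eps f g u l 0 psi i x).
    by rewrite (tovf_congr (y := fun=> 0) i e); case: i => -[] [].
  have lpsi := sol_L2 spsi.
  have Npsi : 0 < N (tovf psi).
    rewrite lt_neqAle N_ge0 andbT eq_sym; apply/eqP => N0; apply: npsi.
    have E := N_eq0 lpsi N0.
    have E1 : {ae lebesgue_measure, forall x : R, tovf psi (false, false) x = 0 /\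
        tovf psi (false, true) x = 0}.
      by apply: aeS2 (E (false, false)) (E (false, true)) => x.
    apply: aeS3 E1 (E (true, false)) (E (true, true)) => x [e1 e2] e3 e4.
    by apply: (@tovf_eq _ psi (fun=> 0)) => -[[] []]; rewrite ?e1 ?e2 ?e3 ?e4.
  have [N5 H5] := near_train_unstable T_gt0 d_gt0 mf mg f_per g_per c00 fc0 gG mv vT hz B00 vB zB
    ymf yclose l0 Hs spsi Npsi.
  exists N5 => n n5 n2 _; apply: contrapT => nun; apply: (H5 n n5) => al be a0.
  apply/(resy n al be n2); apply: contrapT => sp; apply: nun.
  by exists (al +i* be)%C.
(* The nonlinear correction together with the tails (1 - chi_j) z(. - jnT) that the partition of
   unity cuts away. *)
pose be n : bool -> R -> R := fun i x =>
  c n i x + \sum_(1 <= j < k.+2) h n j x * z i (x - j%:R * n%:R * T).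
have cH n j i (e : R) := cut_H2 (e := e) Kc0 (hh n j) (hz i).
pose y1 n i j x := derive1 (h n j) x * z i (x - j%:R * n%:R * T) + h n j x * z1 i (x - j%:R * n%:R * T).
pose y2 n i j x := derive1 (derive1 (h n j)) x * z i (x - j%:R * n%:R * T) +
  2 * (derive1 (h n j) x * z1 i (x - j%:R * n%:R * T)) + h n j x * z2 i (x - j%:R * n%:R * T).
have hy n i j : H2d (fun x => h n j x * z i (x - j%:R * n%:R * T)) (y1 n i j) (y2 n i j).
  have [sh hK _] := hh n j.
  exact: (H2d_smoothM sh hK (H2d_shift (- (j%:R * n%:R * T)) (hz i))).
have hS n i := H2d_sum k.+1 (hy n i).
have hbe n i : H2d (be n i) (fun x => ca n i x + \sum_(1 <= j < k.+2) y1 n i j x)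
    (fun x => cb n i x + \sum_(1 <= j < k.+2) y2 n i j x).
  by apply: H2dD; [exact: hc|have [] := hS n i].
exists (maxn (maxn (maxn n0 N1) (maxn N2 N3)) (maxn N4 N5)), (fun n => pairf (be n)); split; [|split].
- by move=> n _; split; [exact: H2d_H2 (hbe n false)|exact: H2d_H2 (hbe n true)].
(* The factor 6 in [q] is 3 for the orders of differentiation times 2 for the components; the
   bracket adds the correction and k+1 tails, each costing 4 Kc. *)
- apply: H2norm_cvg0 => e e0; pose q := 6 * (1 + k.+1%:R * (4 * Kc)).
  have q0 : 0 < q by rewrite mulr_gt0// ltr_wpDr// mulr_ge0// mulr_ge0.
  pose e1 := e / q; have e10 : 0 < e1 by rewrite divr_gt0.
  have [r1 r10 t1] := small_tail (hz true) e10; have [r2 r20 t2] := small_tail (hz false) e10.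
  have [Na Ha] := csmall e1 e10.
  (* The summand 1 makes up for the overlap of the partition, which reduces the cut radius to nT/2 -
     1. *)
  pose r := r1 + r2 + 1.
  exists (maxn Na (Num.truncn (2 * r / T)).+1) => n; rewrite geq_max => /andP[/Ha[cs _] nr].
  have rn : r <= n%:R * T / 2.
    have p1 : 0 <= 2 * r / T by rewrite divr_ge0 ?mulr_ge0 ?addr_ge0// ltW.
    have /andP[_ h1] := truncn_itv p1; rewrite ltr_pdivrMr// in h1.
    have h2 : (Num.truncn (2 * r / T)).+1%:R * T <= n%:R * T by rewrite ler_wpM2r ?ler_nat// ltW.
    rewrite ler_pdivlMr// mulrC; exact: le_trans (ltW h1) h2.
  have rn' : r1 + r2 <= n%:R * T / 2 - 1 by rewrite lerBrDr.
  have tl i : small e1 (tail (n%:R * T / 2 - 1) (z i)) (tail (n%:R * T / 2 - 1) (z1 i))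
      (tail (n%:R * T / 2 - 1) (z2 i)).
    have rr1 : r1 <= n%:R * T / 2 - 1 by apply: le_trans rn'; rewrite lerDl ltW.
    have rr2 : r2 <= n%:R * T / 2 - 1 by apply: le_trans rn'; rewrite lerDr ltW.
    by case: i; [exact: t1|exact: t2].
  have sb i : small (e1 + k.+1%:R * (4 * Kc * e1)) (be n i)
      (fun x => ca n i x + \sum_(1 <= j < k.+2) y1 n i j x)
      (fun x => cb n i x + \sum_(1 <= j < k.+2) y2 n i j x).
    have [hs Hs] := hS n i; apply: (smallD (hc n i) hs (cs i)); apply: Hs => j.
    by have [] := cH n j i e1 (tl i).
  have [_ [r' e' r'b]] := H2norm_small (b := pairf (be n)) (hbe n false) (hbe n true) (sb false) (sb true).
  exists r' => //; move: r'b => /andP[-> /le_trans]; apply.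
  have -> : 3 * (e1 + k.+1%:R * (4 * Kc * e1) + (e1 + k.+1%:R * (4 * Kc * e1))) = q * e1.
    by rewrite /q; ring.
  by rewrite /e1 mulrC divfK// gt_eqF.
- move=> n; rewrite !geq_max => /andP[/andP[/andP[nn0 nn1] /andP[nn2 nn3]] /andP[nn4 nn5]].
  set ut := fun x : R => _; rewrite /=.
  (* Since v is periodic and the chi_j sum to 1, the sum of the chi_j u(. - jnT) is v plus the
     localised parts chi_j z(. - jnT); adding back the tails in [be] restores the full train. *)
  have -> : ut = pairf (y n).
    have comp i x : be n i x + \sum_(1 <= j < k.+2) chi j n x * cmp u i (x - j%:R * n%:R * T) = y n i x.
      rewrite /be /y /pulse_train uE.
      have -> : \sum_(1 <= j < k.+2) chi j n x * (v i (x - j%:R * n%:R * T) + z i (x - j%:R * n%:R * T)) =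
          v i x + \sum_(1 <= j < k.+2) (pulse_at T z j n i x - h n j x * z i (x - j%:R * n%:R * T)).
        have vE : v i x = \sum_(1 <= j < k.+2) chi j n x * v i x.
          by rewrite -mulr_suml chi1// mul1r.
        rewrite [in RHS]vE -big_split/=.
        apply: eq_big_nat => j jk; rewrite (chih n j x nn0 jk) (periodicM _ _ _ (vT i)) /pulse_at; ring.
      by rewrite sumrB; ring.
    have fsum (F : nat -> R * R) : (\sum_(1 <= j < k.+2) F j).1 = \sum_(1 <= j < k.+2) (F j).1.
      exact: (big_morph fst (fun _ _ => erefl) erefl).
    have ssum (F : nat -> R * R) : (\sum_(1 <= j < k.+2) F j).2 = \sum_(1 <= j < k.+2) (F j).2.
      exact: (big_morph snd (fun _ _ => erefl) erefl).
    apply/funext => x; rewrite [LHS]surjective_pairing /ut /pairf -!comp/= fsum ssum.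
    by [].
  split.
  + have hyl i : H2locd (cmp (pairf (y n)) i) (fun x => pulse_train1 T v1 z1 k.+1 n i x + ca n i x)
        (fun x => pulse_train2 T v2 z2 k.+1 n i x + cb n i x).
      have := H2locdD (train_H2loc T hv hz k.+1 n i) (H2d_loc (hc n i)).
      by case: i.
    apply/(solutionP d a m eps f g hyl) => i.
    by apply: aeS (csol n nn1 i) => x <-; rewrite /res /lin; case: i.
  + apply/(resy n 0 0 nn2); exists K3; first exact: K30.
    by apply: (H3 n 0 0 nn3 _ G0); rewrite normr0 addr0.
  + exact: H4.
  + exact: H5.
Qed.
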